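(* Let $0<\alpha<2$, $\beta=\alpha/2$, let $n\in\{1,2\}$ be such that $n-1<\alpha\le n$, let $l,T>0$ and $\Omega=\{(x,y): 0<x<l,\ 0<y<T\}$. Let $u=u(x,y)$ be a regular solution in $\Omega$ of the equation $$u_{xx}(x,y)-D_{0y}^{\alpha}u(x,y)=0,$$ satisfying $$\lim_{y\to 0}D_{0y}^{\alpha-k}u(x,y)=\tau_k(x),\qquad 1\le k\le n,\quad 0<x<l,$$ and such that $u_x\in C([0,l]\times(0,T))$ and $u_x(0,y),\,u_x(l,y)\in L[0,T]$. Then $u$ fulfills the non-local conditions $$u(0,y)=2\sum_{k=1}^{n}\mathcal N_{0l}^{\beta-k+1,0,y}\tau_k(t)+2\mathcal R_{0y}^{\beta,l}u_x(l,s)-D_{0y}^{-\beta}u_x(0,s)+2\mathcal R_{0y}^{0,l}u(l,s),$$ $$u(l,y)=2\sum_{k=1}^{n}\mathcal N_{0l}^{\beta-k+1,l,y}\tau_k(t)-2\mathcal R_{0y}^{\beta,l}u_x(0,s)+D_{0y}^{-\beta}u_x(l,s)+2\mathcal R_{0y}^{0,l}u(0,s)$$ for $0<y<T$.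
   Context: Riemann-Liouville operator: for $\nu<0$, $D_{0y}^{\nu}g(y)=\frac{1}{\Gamma(-\nu)}\int_0^y\frac{g(s)\,ds}{(y-s)^{\nu+1}}$ ($y>0$); $D_{0y}^0g=g$; and for $\nu\geq 0$ recursively $D_{0y}^{\nu}g(y)=\frac{d}{dy}D_{0y}^{\nu-1}g(y)$. Applied to $u(x,y)$ it acts in the variable $y$. Regular solution: a function $u$ with $D_{0y}^{\alpha-k}u\in C(\overline\Omega)$ for $1\le k\le n$, $u_{xx},\,D_{0y}^{\alpha}u\in C(\Omega)$, satisfying the equation at all points of $\Omega$. Wright function: $\phi(\rho,\mu;z)=\sum_{k=0}^\infty\frac{z^k}{k!\,\Gamma(\rho k+\mu)}$ (with $1/\Gamma=0$ at the poles of $\Gamma$). Operators: for real $\theta,\delta$, for $x_1<x_2$ and $y>0$, $$\mathcal N_{x_1x_2}^{\theta,x,y}\nu(t)=\frac12\int_{x_1}^{x_2}\nu(t)\,y^{\theta-1}\phi(-\beta,\theta;-|x-t|y^{-\beta})\,dt,$$ $$\mathcal R_{0y}^{\delta,x}\mu(s)=\frac12\int_0^y\mu(s)(y-s)^{\delta-1}\phi(-\beta,\delta;-|x|(y-s)^{-\beta})\,ds.$$ The variables $t$ and $s$ written in the argument functions are the integration variables; the results are functions of $x,y$.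
   Formalization: The formal statement also requires u itself to be continuous in Ω as part of being a regular solution; without this the claim fails for α≠1, e.g. u=0 except u(x,y₀)=1 for all x at a single y₀. *)

(* Defs.v *)
From HB Require Import structures.
From mathcomp Require Import all_boot all_order all_algebra.
From mathcomp Require Import all_classical all_reals all_analysis.
Set Implicit Arguments.
Unset Strict Implicit.
Unset Printing Implicit Defensive.
Import Order.TTheory GRing.Theory Num.Theory.
Import numFieldNormedType.Exports.
Local Open Scope classical_set_scope.
Local Open Scope ring_scope.

(* Euler's integral; only used for x > 0. *)
Definition Gamma (R : realType) (x : R) : R :=
  \int[lebesgue_measure]_(t in `]0, +oo[%classic) (t `^ (x - 1) * expR (- t)).

(* 1 / Gamma on the whole line: Gamma is continued to x <= 0 through
   Gamma (x + 1) = x * Gamma x, shifting x by the least m with 0 < x + m;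
   the product vanishes exactly at the poles 0, -1, -2, ... *)
Definition rGamma (R : realType) (x : R) : R :=
  let m := if 0 < x then 0%N else (Num.truncn (- x)).+1 in
  (\prod_(i < m) (x + i%:R)) / Gamma (x + m%:R).

Definition Wright (R : realType) (rho mu z : R) : R :=
  limn (series (fun k : nat => z ^+ k / k`!%:R * rGamma (rho * k%:R + mu))).

(* The order nu - m of the innermost operator is meant to be <= 0: order 0 is
   the identity, negative order the fractional integral. *)
Fixpoint RL_iter (R : realType) (m : nat) (nu : R) (g : R -> R) : R -> R :=
  match m with
  | 0%N => if nu == 0 then g else fun y =>
      (Gamma (- nu))^-1 *
      \int[lebesgue_measure]_(s in `]0, y[%classic) (g s / (y - s) `^ (nu + 1))
  | m'.+1 => derive1 (RL_iter m' (nu - 1) g)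
  end.

(* Existence of the value at y of the operator above; integrals and derivatives
   are total functions in the library, so this has to be said separately. *)
Fixpoint RL_iter_ex (R : realType) (m : nat) (nu : R) (g : R -> R) (y : R) : Prop :=
  match m with
  | 0%N => nu = 0 \/
      lebesgue_measure.-integrable `]0, y[%classic
        (fun s => (g s / (y - s) `^ (nu + 1))%:E)
  | m'.+1 => (\forall z \near y, RL_iter_ex m' (nu - 1) g z) /\
      derivable (RL_iter m' (nu - 1) g) y 1
  end.

(* Number of derivatives: 0 for nu <= 0, the ceiling of nu for nu > 0. *)
Definition RL_nder (R : realType) (nu : R) : nat := `|Num.ceil (Num.max 0%R nu)|%N.

Definition RL (R : realType) (nu : R) (g : R -> R) (y : R) : R :=
  RL_iter (RL_nder nu) nu g y.

Definition RL_ex (R : realType) (nu : R) (g : R -> R) (y : R) : Prop :=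
  RL_iter_ex (RL_nder nu) nu g y.

Lemma RL_nder_le0 (R : realType) (nu : R) : nu <= 0 -> RL_nder nu = 0%N.
Proof. by move=> h; rewrite /RL_nder max_l// ceil0. Qed.

Lemma RL_nder_gt0 (R : realType) (nu : R) :
  0 < nu -> RL_nder nu = (RL_nder (nu - 1)).+1.
Proof.
move=> nu0; have [le1|gt1] := leP nu 1.
  rewrite (@RL_nder_le0 _ (nu - 1)) ?subr_le0// /RL_nder max_r ?ltW//.
  suff -> : Num.ceil nu = 1 by [].
  by apply/ceil_def; rewrite subrr nu0.
have h1 : 0 < nu - 1 by rewrite subr_gt0.
rewrite /RL_nder !max_r ?ltW//.
have -> : Num.ceil nu = Num.ceil (nu - 1) + 1.
  apply/ceil_def; rewrite addrK rmorphD /= -lerBlDr ceil_ge andbT.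
  have := ceilB1_lt (nu - 1).
  by rewrite rmorphB /= ltrD2r.
have : 0 <= Num.ceil (nu - 1) by rewrite -(ceil0 R); apply: le_ceil; exact: ltW.
by case: (Num.ceil (nu - 1)) => // k _; rewrite -[RHS]addn1.
Qed.

Lemma RL_lt0 (R : realType) (nu : R) (g : R -> R) (y : R) : nu < 0 ->
  RL nu g y = (Gamma (- nu))^-1 *
    \int[lebesgue_measure]_(s in `]0, y[%classic) (g s / (y - s) `^ (nu + 1)).
Proof. by move=> h; rewrite /RL RL_nder_le0 ?ltW//= lt_eqF. Qed.

Lemma RL0 (R : realType) (g : R -> R) : RL 0 g = g.
Proof. by apply/funext => y; rewrite /RL RL_nder_le0//= eqxx. Qed.

Lemma RL_gt0 (R : realType) (nu : R) (g : R -> R) :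
  0 < nu -> RL nu g = derive1 (RL (nu - 1) g).
Proof. by move=> h; rewrite {1}/RL RL_nder_gt0. Qed.

(* Derivative relative to A: one-sided at the end points of an interval A. *)
Definition derivable_in (R : realType) (A : set R) (f : R -> R) (x : R) : Prop :=
  cvg ((f t - f x) / (t - x) @[t --> within A x^']).

Definition derive_in (R : realType) (A : set R) (f : R -> R) (x : R) : R :=
  lim ((f t - f x) / (t - x) @[t --> within A x^']).

Definition Omega (R : realType) (l T : R) : set (R * R) := `]0, l[ `*` `]0, T[.

(* The partial derivative u_x on the strip [0, l] x (0, T). *)
Definition partial_x (R : realType) (l : R) (u : R -> R -> R) (x y : R) : R :=
  derive_in `[0, l]%classic (u^~ y) x.

Definition partial_xx (R : realType) (u : R -> R -> R) (x y : R) : R :=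
  derive1n 2 (u^~ y) x.

(* u is a function on [0, l] x (0, T); its values elsewhere play no role.  A
   function h given on [0, l] x (0, T) is in C of the closed rectangle when it
   is the restriction of a function continuous there.  Continuity of u itself
   in Omega is part of the notion: every other clause is insensitive to adding
   a constant to u on a single line y = y0 (unless alpha = 1). *)
Definition regular_solution (R : realType) (alpha : R) (n : nat) (l T : R)
    (u : R -> R -> R) : Prop :=
  [/\ {within Omega l T, continuous (fun p : R * R => u p.1 p.2)},
      forall k : nat, (1 <= k <= n)%N ->
        (forall x y, 0 <= x <= l -> 0 < y < T ->
          RL_ex (alpha - k%:R) (u x) y) /\
        exists w : R * R -> R,
          {within `[0, l] `*` `[0, T], continuous w} /\
          forall x y, 0 <= x <= l -> 0 < y < T ->
            RL (alpha - k%:R) (u x) y = w (x, y),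
      (forall x y, Omega l T (x, y) ->
         derivable (u^~ y) x 1 /\ derivable (derive1 (u^~ y)) x 1) /\
      {within Omega l T, continuous (fun p : R * R => partial_xx u p.1 p.2)},
      (forall x y, Omega l T (x, y) -> RL_ex alpha (u x) y) /\
      {within Omega l T, continuous (fun p : R * R => RL alpha (u p.1) p.2)} &
      forall x y, Omega l T (x, y) -> partial_xx u x y - RL alpha (u x) y = 0].

Definition Nop (R : realType) (beta x1 x2 theta x y : R) (f : R -> R) : R :=
  2^-1 * \int[lebesgue_measure]_(t in `]x1, x2[%classic)
    (f t * y `^ (theta - 1) * Wright (- beta) theta (- `|x - t| * y `^ (- beta))).

Definition Rop (R : realType) (beta delta x y : R) (f : R -> R) : R :=
  2^-1 * \int[lebesgue_measure]_(s in `]0, y[%classic)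
    (f s * (y - s) `^ (delta - 1) *
     Wright (- beta) delta (- `|x| * (y - s) `^ (- beta))).

(* Main.v *)
(* Fix an angle th with pi/2 < th < pi and beta th < pi/2.  The kernel K_d(x, y) is
   the inverse Laplace transform of p^(-d) exp(-x p^beta), written as a real
   Bromwich integral along the rays arg z = +- th.  Expanding exp(-x z^beta)
   identifies it with y^(d-1) phi(-beta, d; -x y^(-beta)), and Cauchy's formula
   along the rays gives its Laplace transform.

   For y in (0, Y), Y < T, the transform in y of the equation is
   U'' = p^alpha U - sum_k tau_k p^(k-1), up to O(p^3 exp(-(p-1) Y)).  Multiplying
   by exp(-p^beta x), or by exp(-p^beta (l - x)), integrating over (0, l) by
   Green's formula and dividing by p^beta gives the transform of each non-local
   condition up to such an error.  A function whose transform over (0, Y) is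
   O(exp(-p Z)) vanishes on (0, Z), so the conditions hold on (0, T).

   Since only fractional integrals of u are controlled near y = 0, the transform of
   u is obtained from that of v = I^a u through I^1 u = I^(1-a) v. *)

(* The two constraints on [th] make both exponentials decay along the rays: [exp(y z)] because
   [cos th < 0], and [exp(-x z^beta)] because [cos(beta th) > 0]; they are compatible since
   [beta < 1]. Complex integrals are handled through real and imaginary parts. Cauchy's formula is
   proved by rotating the ray: the Cauchy-Riemann equations make the integral of the imaginary part
   independent of the angle, and as the angle tends to 0 this imaginary part approaches a multiple
   of a Poisson kernel concentrating at [p]. The delicate limit is [y -> 0] in Green's formula,
   where in general [u(x, y)] has no bound uniform in [x]. What is uniform is a bound [C p] on the
   integrals of [exp(-p s) u(x, s)] over [(e, Y)], for all [e] and [x]: it comes from the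
   boundedness of [D^(alpha-n) u] on the closed rectangle, and it dominates the passage to the
   limit. *)
Require Import Defs.
From mathcomp Require Import all_boot all_order all_algebra.
From mathcomp Require Import all_classical all_reals all_analysis.
From mathcomp Require Import measurable_realfun ring lra.
Set Implicit Arguments.
Unset Strict Implicit.
Unset Printing Implicit Defensive.
Import Order.TTheory GRing.Theory Num.Theory.
Import numFieldNormedType.Exports.
Local Open Scope classical_set_scope.
Local Open Scope ring_scope.

(** * Lebesgue integration on the line *)

Section integration_tools.
Context {R : realType}.
Local Notation RR := (measurableTypeR R).
Implicit Types (f g : RR -> R) (D : set RR).
Local Notation mu := (@lebesgue_measure R).
Local Notation intg D f := (mu.-integrable D (EFin \o f)).

Lemma intg_measurable D f : intg D f -> measurable_fun D f.
Proof. by case/integrableP => /measurable_EFinP. Qed.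

Lemma intgZl D f k : measurable D -> intg D f -> intg D (fun x => k * f x).
Proof.
move=> mD fi; have := integrableZl mD k fi.
by apply: eq_integrable => // x _; rewrite /= EFinM.
Qed.

Lemma intgZr D f k : measurable D -> intg D f -> intg D (fun x => f x * k).
Proof.
move=> mD fi; have := intgZl k mD fi.
by apply: eq_integrable => // x _; rewrite /= mulrC.
Qed.

Lemma intgN D f : measurable D -> intg D f -> intg D (fun x => - f x).
Proof.
move=> mD fi; have := intgZl (-1) mD fi.
by apply: eq_integrable => // x _; rewrite /= mulN1r.
Qed.

Lemma intgD D f g : measurable D -> intg D f -> intg D g ->
  intg D (fun x => f x + g x).
Proof.
move=> mD fi gi; have := integrableD mD fi gi.
by apply: eq_integrable => // x _; rewrite /= EFinD.
Qed.

Lemma intgB D f g : measurable D -> intg D f -> intg D g ->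
  intg D (fun x => f x - g x).
Proof. by move=> mD fi gi; apply: intgD => //; exact: intgN. Qed.

Lemma intg_eq D f g : (forall x, D x -> f x = g x) -> measurable D ->
  intg D f -> intg D g.
Proof.
move=> fg mD; apply: eq_integrable => // x Dx.
by rewrite /= fg//; exact/set_mem.
Qed.

Lemma intg_le D f g : measurable D -> measurable_fun D f -> intg D g ->
  (forall x, D x -> `|f x| <= g x) -> intg D f.
Proof.
move=> mD mf ig fg; apply: le_integrable ig => //.
  exact/measurable_EFinP.
move=> x Dx /=; rewrite lee_fin (le_trans (fg _ Dx))//.
exact: ler_norm.
Qed.

Lemma norm_int_le D f g : measurable D -> intg D f -> intg D g ->
  (forall x, D x -> `|f x| <= g x) ->
  `|\int[mu]_(x in D) f x| <= \int[mu]_(x in D) g x.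
Proof.
move=> mD fi gi fg; rewrite (le_trans (le_normr_Rintegral _ _))//.
by apply: le_Rintegral => //; exact: integrable_norm.
Qed.

Lemma dominated_cvgR D (f_ : nat -> RR -> R) f g : measurable D ->
  (forall n, measurable_fun D (f_ n)) ->
  (forall x, D x -> f_ n x @[n --> \oo] --> f x) ->
  intg D g ->
  (forall n x, D x -> `|f_ n x| <= g x) ->
  intg D f /\ \int[mu]_(x in D) f_ n x @[n --> \oo] --> \int[mu]_(x in D) f x.
Proof.
move=> mD mf_ cf ig fg.
have mf : measurable_fun D f.
  by apply: (measurable_fun_cvg (h := f_)) => //.
have [] := @dominated_convergence _ _ _ mu _ mD (fun n => EFin \o f_ n) (EFin \o f)
  (EFin \o g).
- by move=> n; have h := mf_ n; apply/measurable_EFinP; exact: h.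
- exact/measurable_EFinP.
- by apply: aeW => x Dx; apply: cvg_EFin; [exact: nearW|exact: cf].
- by [].
- by apply: aeW => x n Dx /=; rewrite lee_fin fg.
move=> intf _ h; split=> //.
apply: fine_cvg; rewrite fineK; first exact: h.
exact: integrable_fin_num.
Qed.

(** A limit along a real parameter is tested on sequences. The hypotheses that hold only near [a]
    hold along such a sequence from some index [N] on, so the sequence is shifted by [N]. *)
Lemma dominated_cvg_filter D (a : R) (h : R -> RR -> R) f g : measurable D ->
  (\forall y \near a, measurable_fun D (h y)) ->
  (forall x, D x -> h y x @[y --> a] --> f x) ->
  intg D g ->
  (\forall y \near a, forall x, D x -> `|h y x| <= g x) ->
  \int[mu]_(x in D) h y x @[y --> a] --> \int[mu]_(x in D) f x.
Proof.
move=> mD mh ch ig hg; apply/(@cvg_nbhsP _ R^o) => w wa.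
have [N _ HN] : \forall n \near \oo, measurable_fun D (h (w n)) /\
    (forall x, D x -> `|h (w n) x| <= g x).
  by near=> n; split; near: n; [exact: wa _ mh|exact: wa _ hg].
have : \int[mu]_(x in D) h (w (n + N)%N) x @[n --> \oo]
    --> \int[mu]_(x in D) f x.
  apply: (dominated_cvgR (g := g) _ _ _ _ _).2 => //.
  - by move=> n; exact: (HN _ (leq_addl _ _)).1.
  - move=> x Dx; have := (@cvg_nbhsP _ R^o _ _ _).1 (ch x Dx) _ wa.
    by rewrite -(cvg_shiftn N).
  - by move=> n x Dx; exact: (HN _ (leq_addl _ _)).2.
by rewrite (cvg_shiftn N (fun n => \int[mu]_(x in D) h (w n) x)).
Unshelve. all: by end_near. Qed.

(** The integrals of the positive and negative parts are measurable in the parameter by Tonelli, and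
    [fine] of their difference is measurable even where the difference is infinite. *)
Lemma measurable_Rintegral_param d (T : measurableType d) (h : T * RR -> R) :
  measurable_fun setT h ->
  measurable_fun setT (fun x => \int[mu]_r h (x, r)).
Proof.
move=> mh; rewrite /Rintegral.
apply: (measurable_comp measurableT _ (fine_measurable measurableT)) => //.
have -> : (fun x => \int[mu]_r (h (x, r))%:E)%E =
  (fun x => \int[mu]_r ((EFin \o h)^\+ (x, r)) - \int[mu]_r ((EFin \o h)^\- (x, r)))%E.
  apply/funext => x; rewrite integralE; congr (_ - _)%E.
    by apply: eq_integral => r _; rewrite !funeposE.
  by apply: eq_integral => r _; rewrite !funenegE.
apply: emeasurable_funB.
  rewrite (_ : (fun x : T => _) = fubini_F mu ((EFin \o h)^\+)%E)//.
  apply: measurable_fun_fubini_tonelli_F.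
    by apply: measurable_funepos; exact/measurable_EFinP.
  by move=> x.
rewrite (_ : (fun x : T => _) = fubini_F mu ((EFin \o h)^\-)%E)//.
apply: measurable_fun_fubini_tonelli_F.
  by apply: measurable_funeneg; exact/measurable_EFinP.
by move=> x.
Qed.

Lemma FubiniR (h : RR * RR -> R) : measurable_fun setT h ->
  (forall x : RR, intg setT (fun y : RR => h (x, y))) ->
  intg setT (fun x => \int[mu]_y `|h (x, y)|) ->
  [/\ intg setT (fun x => \int[mu]_y h (x, y)),
      {ae mu, forall y, intg setT (fun x => h (x, y))},
      intg setT (fun y => \int[mu]_x h (x, y)) &
      \int[mu]_x \int[mu]_y h (x, y) = \int[mu]_y \int[mu]_x h (x, y)].
Proof.
move=> mh ih1 ih2.
have ih : (mu \x mu)%E.-integrable setT (EFin \o h).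
  apply/integrable12ltyP; first exact/measurable_EFinP.
  have := integrable_lty measurableT ih2.
  apply: le_lt_trans; apply: ge0_le_integral => //=.
  - by move=> x _; apply: integral_ge0.
  - apply: (measurable_fun_fubini_tonelli_F (m2 := mu) (abse \o (EFin \o h))).
      by apply: measurableT_comp => //; exact/measurable_EFinP.
    by move=> x; exact: abse_ge0.
  - by case/integrableP : ih2.
  - move=> x _; rewrite /Rintegral fineK//.
    by apply: integrable_fin_num => //; exact: (integrable_norm (ih1 x)).
have i1 x : (\int[mu]_y (h (x, y))%:E)%E = (\int[mu]_y h (x, y))%:E.
  rewrite /Rintegral fineK//; apply: (integrable_fin_num measurableT (ih1 x)).
have := @integral12_prod_meas1 _ _ _ _ _ mu mu _ ih.
have := @integral21_prod_meas1 _ _ _ _ _ mu mu _ ih.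
rewrite /fubini_F /fubini_G => e2 e1.
have ae2 := @ae_integrable2 _ _ _ _ _ mu mu _ ih.
have ifin := integrable_fin_num measurableT ih.
have iF := @integrable_fubini_F _ _ _ _ _ mu mu _ ih.
have iF1 : intg setT (fun x => \int[mu]_y h (x, y)).
  by apply: eq_integrable iF => // x _; rewrite /fubini_F /= i1.
split; [exact: iF1|exact: ae2| |].
- have ihs : (mu \x mu)%E.-integrable setT (EFin \o h \o ((fun p : RR * RR => (p.2, p.1)))).
    apply/integrable12ltyP.
      by apply/measurable_EFinP; apply: measurableT_comp => //; exact: measurable_swap.
    have /integrable21ltyP := ih.
    by apply; exact/measurable_EFinP.
  have iG := @integrable_fubini_F _ _ _ _ _ mu mu _ ihs.
  have mG : measurable_fun setT (fun y => \int[mu]_x h (x, y)).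
    apply: (measurable_Rintegral_param (h := h \o ((fun p : RR * RR => (p.2, p.1))))).
    by apply: measurableT_comp => //; exact: measurable_swap.
  apply: le_integrable iG => //=.
    exact/measurable_EFinP.
  move=> y _; rewrite /fubini_F /=.
  (* At the exceptional [y] whose inner integral is infinite, [Rintegral] takes the value 0, so the
     bound by the extended integral holds everywhere. *)
  rewrite /Rintegral; case: (\int[mu]_x (h (x, y))%:E)%E => [r||] //=;
    by rewrite normr0 leey.
- rewrite {1}/Rintegral; under eq_integral do rewrite -i1.
  rewrite e1 -e2 [RHS]/Rintegral; congr fine.
  apply: ae_eq_integral => //.
  + exact: (measurable_fubini_G ih).
  + apply/measurable_EFinP.
    apply: (measurable_Rintegral_param (h := h \o (fun p : RR * RR => (p.2, p.1)))).
    by apply: measurableT_comp => //; exact: measurable_swap.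
  + move: ae2; apply: filterS => y iy _.
    by rewrite /Rintegral fineK//; exact: (integrable_fin_num measurableT iy).
Qed.


(** Extended by 0 outside the rectangle, [h] is dominated by a product of integrable functions, from
    which the integrability hypotheses of [FubiniR] follow. *)
Lemma FubiniR_dom (D1 D2 : set RR) (h : RR * RR -> R) (g1 g2 : RR -> R) :
  measurable D1 -> measurable D2 ->
  measurable_fun (D1 `*` D2) h -> intg D1 g1 -> intg D2 g2 ->
  (forall x y, D1 x -> D2 y -> `|h (x, y)| <= g1 x * g2 y) ->
  [/\ forall x, D1 x -> intg D2 (fun y => h (x, y)),
     intg D1 (fun x => \int[mu]_(y in D2) h (x, y)),
     intg D2 (fun y => \int[mu]_(x in D1) h (x, y)) &
     \int[mu]_(x in D1) \int[mu]_(y in D2) h (x, y) =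
     \int[mu]_(y in D2) \int[mu]_(x in D1) h (x, y)].
Proof.
move=> mD1 mD2 mh ig1 ig2 hg.
have mDD : measurable (D1 `*` D2) by exact: measurableX.
pose H := h \_ (D1 `*` D2).
have mH : measurable_fun setT H by apply/(measurable_restrictT h mDD).
have HE x y : H (x, y) = if (x \in D1) && (y \in D2) then h (x, y) else 0.
  by rewrite /H patchE in_setX.
have mHx x : measurable_fun setT (fun y => H (x, y)).
  exact: (measurableT_comp mH (pair1_measurable x)).
have iG2 : intg setT ((g2 \_ D2)).
  by have := (integrable_mkcond _ mD2).1 ig2; rewrite restrict_EFin.
have iG1 : intg setT ((g1 \_ D1)).
  by have := (integrable_mkcond _ mD1).1 ig1; rewrite restrict_EFin.
have Hle x y : `|H (x, y)| <= `|(g1 \_ D1) x| * `|(g2 \_ D2) y|.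
  rewrite HE !patchE.
  case: ifPn => [/andP[xD yD]|_]; last by rewrite normr0 mulr_ge0.
  rewrite xD yD -normrM (le_trans _ (ler_norm _))// hg//; exact/set_mem.
have iHx x : intg setT (fun y => H (x, y)).
  apply: (@intg_le _ _ (fun y => `|(g1 \_ D1) x| * `|(g2 \_ D2) y|)) => //.
  by apply: intgZl => //; exact: (integrable_norm iG2).
have iH2 : intg setT (fun x => \int[mu]_y `|H (x, y)|).
  apply: (@intg_le _ _ (fun x => `|(g1 \_ D1) x| * \int[mu]_y `|(g2 \_ D2) y|)) => //.
  - apply: (measurable_Rintegral_param (h := fun p => `|H p|)).
    exact: measurableT_comp.
  - by apply: intgZr => //; exact: (integrable_norm iG1).
  move=> x _; rewrite ger0_norm; last by apply: Rintegral_ge0.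
  rewrite -RintegralZl//; last exact: (integrable_norm iG2).
  apply: le_Rintegral => //; first exact: (integrable_norm (iHx x)).
  by apply: intgZl => //; exact: (integrable_norm iG2).
have [iF _ iG eFG] := FubiniR mH iHx iH2.
have EF x : \int[mu]_y H (x, y) = ((fun x => \int[mu]_(y in D2) h (x, y)) \_ D1) x.
  rewrite patchE; case: ifPn => xD.
    rewrite [RHS]Rintegral_mkcond; apply: eq_Rintegral => y _.
    by rewrite HE xD patchE.
  under eq_Rintegral do rewrite HE (negbTE xD).
  by rewrite Rintegral_cst// mul0r.
have EG y : \int[mu]_x H (x, y) = ((fun y => \int[mu]_(x in D1) h (x, y)) \_ D2) y.
  rewrite patchE; case: ifPn => yD.
    rewrite [RHS]Rintegral_mkcond; apply: eq_Rintegral => x _.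
    by rewrite HE yD patchE andbT.
  under eq_Rintegral do rewrite HE (negbTE yD) andbF.
  by rewrite Rintegral_cst// mul0r.
split.
- move=> x xD; apply/(integrable_mkcond _ mD2); rewrite restrict_EFin.
  apply: eq_integrable (iHx x) => // y _ /=.
  by rewrite HE mem_set// patchE.
- apply/(integrable_mkcond _ mD1); rewrite restrict_EFin.
  by apply: eq_integrable iF => // x _ /=; rewrite EF.
- apply/(integrable_mkcond _ mD2); rewrite restrict_EFin.
  by apply: eq_integrable iG => // x _ /=; rewrite EG.
- rewrite [LHS]Rintegral_mkcond [RHS]Rintegral_mkcond.
  transitivity (\int[mu]_x \int[mu]_y H (x, y)).
    by apply: eq_Rintegral => x _; rewrite EF.
  by rewrite eFG; apply: eq_Rintegral => y _; rewrite EG.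
Qed.

(** Lebesgue measure is [|a|] times its push-forward under [x |-> a x + b]: by uniqueness it is
    enough to compare the two on half-open intervals, whose preimages are intervals for either sign
    of [a]. The formula then passes to nonnegative functions, and to [f] through its positive and
    negative parts. *)
Lemma integral_affine (a b : R) f : a != 0 -> intg setT f ->
  intg setT (fun x => f (a * x + b)) /\
  \int[mu]_x f (a * x + b) = `|a|^-1 * \int[mu]_x f x.
Proof.
move=> a0 fi; have mf := intg_measurable fi; pose phi (x : RR) : RR := a * x + b.
have mphi : measurable_fun setT phi.
  by apply: measurable_funD => //; exact: measurable_funM.
have na : 0 < `|a| by rewrite normr_gt0.
pose nu : {measure set (measurableTypeR R) -> \bar R} :=
  mscale (NngNum (ltW na)) (pushforward mu phi).
have nuE (A : set RR) : measurable A -> mu A = nu mphi A.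
  apply: lebesgue_measure_unique => X [[x y] _ <-] /=.
  rewrite /nu /mscale /= /pushforward.
  have [xy|yx] := ltP x y; last first.
    rewrite set_itv_ge ?bnd_simp -?leNgt//.
    by rewrite preimage_set0 !measure0 mule0.
  rewrite lebesgue_measure_itv/= lte_fin xy.
  have [a_gt|a_lt|a00] := ltgtP 0 a; last by rewrite a00 eqxx in a0.
    have -> : phi @^-1` `]x, y]%classic = `](x - b) / a, (y - b) / a]%classic.
      apply/seteqP; split=> z /=; rewrite !in_itv/= /phi;
      by rewrite ltr_pdivrMr// ler_pdivlMr// ltrBlDr lerBrDr (mulrC z).
    rewrite lebesgue_measure_itv/= lte_fin ltr_pM2r ?invr_gt0// ltrD2r xy.
    rewrite gtr0_norm// -!EFinB -EFinM; congr _%:E; field; exact: lt0r_neq0.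
  have -> : phi @^-1` `]x, y]%classic = `[(y - b) / a, (x - b) / a[%classic.
    apply/seteqP; split=> z /=; rewrite !in_itv/= /phi;
    by rewrite ltr_ndivlMr// ler_ndivrMr// ltrBlDr lerBrDr (mulrC z) andbC.
  rewrite lebesgue_measure_itv/= lte_fin ltr_nM2r ?invr_lt0// ltrD2r xy.
  rewrite ltr0_norm// -!EFinB -EFinM; congr _%:E; field; exact: ltr0_neq0.
have ge0E (g : RR -> \bar R) : measurable_fun setT g -> (forall x, 0 <= g x)%E ->
    (\int[mu]_x g x = `|a|%:E * \int[mu]_x g (phi x))%E.
  move=> mg g0; rewrite (eq_measure_integral (nu mphi)); last by move=> A mA _; exact: nuE.
  rewrite /nu ge0_integral_mscale//; congr (_ * _)%E.
  by rewrite ge0_integral_pushforward.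
have ige0 (g : RR -> \bar R) : measurable_fun setT g -> (forall x, 0 <= g x)%E ->
    (\int[mu]_x g (phi x) = `|a|^-1%:E * \int[mu]_x g x)%E.
  by move=> mg g0; rewrite (ge0E g)// muleA -EFinM mulVf ?mul1e// gt_eqF.
have mEf : measurable_fun setT (EFin \o f) by exact/measurable_EFinP.
have mfphi : measurable_fun setT (EFin \o (f \o phi)).
  by apply/measurable_EFinP; exact: measurableT_comp.
split.
  apply/integrableP; split => //; case/integrableP : fi => _ If.
  rewrite (ige0 (fun x => `|(EFin \o f) x|)%E)//; last exact: measurableT_comp.
  by rewrite lte_mul_pinfty// lee_fin invr_ge0.
rewrite /Rintegral.
have -> : (\int[mu]_x (f (a * x + b))%:E = `|a|^-1%:E * \int[mu]_x (f x)%:E)%E.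
  rewrite integralE [in RHS]integralE.
  have -> : (\int[mu]_x ((fun x => (f (a * x + b))%:E)^\+ x) =
      `|a|^-1%:E * \int[mu]_x (EFin \o f)^\+ x)%E.
    rewrite -ige0//; last exact: measurable_funepos.
    by apply: eq_integral => x _; rewrite !funeposE.
  have -> : (\int[mu]_x ((fun x => (f (a * x + b))%:E)^\- x) =
      `|a|^-1%:E * \int[mu]_x (EFin \o f)^\- x)%E.
    rewrite -ige0//; last exact: measurable_funeneg.
    by apply: eq_integral => x _; rewrite !funenegE.
  rewrite -muleBr// fin_num_adde_defr//.
  exact: integrable_pos_fin_num.
by rewrite fineM// (integrable_fin_num measurableT fi).
Qed.



Lemma Rint_affine (a b : R) f : a != 0 -> intg setT f ->
  \int[mu]_x f (a * x + b) = `|a|^-1 * \int[mu]_x f x.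
Proof. by move=> a0 fi; exact: (integral_affine b a0 fi).2. Qed.

Lemma intg_affine (a b : R) f : a != 0 -> intg setT f ->
  intg setT (fun x => f (a * x + b)).
Proof. by move=> a0 fi; exact: (integral_affine b a0 fi).1. Qed.

Lemma intg_restrict D f : measurable D -> intg D f <-> intg setT (f \_ D).
Proof. by move=> mD; have := integrable_mkcond (EFin \o f) mD; rewrite restrict_EFin. Qed.

Lemma intgS D (E : set RR) f : measurable D -> measurable E -> E `<=` D ->
  intg D f -> intg E f.
Proof. by move=> mD mE ED; exact: integrableS. Qed.

Lemma intg_continuous (a b : R) f : {within `[a, b], continuous (f : R -> R)} ->
  intg `[a, b] f.
Proof. by move=> cf; apply: continuous_compact_integrable => //; exact: segment_compact. Qed.

Lemma Rint_co (a b : R) f : intg `[a, b] f ->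
  \int[mu]_(x in `]a, b[) f x = \int[mu]_(x in `[a, b]) f x.
Proof.
move=> fi; rewrite Rintegral_itv_bndo_bndc; last first.
  by apply: intgS fi => //; apply: subset_itv_oo_cc.
rewrite Rintegral_itv_obnd_cbnd//.
by apply: intgS fi => //; apply: subset_itv; rewrite bnd_simp.
Qed.

Lemma FTC2_oo (f F : R -> R) (a b : R) : a < b ->
  {within `[a, b], continuous f} -> {within `[a, b], continuous F} ->
  (forall x, a < x < b -> is_derive x 1 F (f x)) ->
  \int[mu]_(x in `]a, b[) f x = F b - F a.
Proof.
move=> ab cf cF dF; rewrite Rint_co; last exact: intg_continuous.
rewrite /Rintegral (@continuous_FTC2 _ f F _ _ ab cf)//.
  have [_ cFa cFb] := (continuous_within_itvP _ ab).1 cF.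
  split=> // x; rewrite in_itv/= => xab.
  by have [] := dF x xab.
move=> x; rewrite in_itv/= => xab; rewrite derive1E.
by have := dF x xab => h; rewrite derive_val.
Qed.

Lemma FTC2_cc (f F : R -> R) (a b : R) : a < b ->
  (forall x, a <= x <= b -> {for x, continuous f}) ->
  (forall x, a <= x <= b -> is_derive x 1 F (f x)) ->
  \int[mu]_(x in `]a, b[) f x = F b - F a.
Proof.
move=> ab cf dF; apply: FTC2_oo => //.
- by apply: continuous_in_subspaceT => x /set_mem/=; rewrite in_itv => /cf.
- apply: continuous_in_subspaceT => x /set_mem/=; rewrite in_itv/= => /dF d.
  by apply: differentiable_continuous; apply/derivable1_diffP; case: d.
- by move=> x /andP[ax xb]; apply: dF; rewrite !ltW.
Qed.

Lemma measurable_patch D (E : set RR) f : measurable D -> measurable E ->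
  measurable_fun D f -> measurable_fun D (f \_ E).
Proof.
move=> mD mE mf; apply: (measurable_restrict _ mE mD).1.
by apply: measurable_funS mf => //; exact: subIsetl.
Qed.

Lemma cvg_invSn : (n.+1%:R : R)^-1 @[n --> \oo] --> (0 : R).
Proof. exact: cvg_harmonic. Qed.

(** The exhaustion of the half-line starts at []1, 2[], so that the left end is below the right end
    for every [n], [n = 0] included. *)
Let It (n : nat) : set RR := `](n.+1%:R : R)^-1, n.+2%:R[%classic.

Let mIt n : measurable (It n). Proof. exact: measurable_itv. Qed.

Let It_pos n x : It n x -> 0 < x.
Proof. by rewrite /It/= in_itv/= => /andP[+ _]; apply: lt_trans; rewrite invr_gt0. Qed.

Let It_lt n : (n.+1%:R : R)^-1 < n.+2%:R.
Proof.
rewrite (@le_lt_trans _ _ 1)// ?invf_le1// ?ler1n// ltr1n//.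
Qed.

Let It_near x : 0 < x -> \forall n \near \oo, It n x.
Proof.
move=> x0; near=> n; rewrite /It/= in_itv/=; apply/andP; split.
  near: n; have /cvgrPdist_lt := cvg_invSn; move=> /(_ _ x0).
  by apply: filterS => n; rewrite sub0r normrN ger0_norm// invr_ge0.
rewrite (@lt_trans _ _ n%:R)// ?ltr_nat//.
by near: n; exact: nbhs_infty_gtr.
Unshelve. all: by end_near. Qed.

Lemma cvg_exhaust f : intg `]0, +oo[ f ->
  \int[mu]_(x in `](n.+1%:R : R)^-1, n.+2%:R[) f x @[n --> \oo] -->
  \int[mu]_(x in `]0, +oo[) f x.
Proof.
move=> fi; have mf := intg_measurable fi.
have -> : (fun n => \int[mu]_(x in `](n.+1%:R : R)^-1, n.+2%:R[) f x) =
    (fun n => \int[mu]_(x in `]0, +oo[) (f \_ (It n)) x).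
  apply/funext => n; rewrite -Rintegral_mkcondr setIidr//.
  by move=> x /It_pos; rewrite /= in_itv/= andbT.
apply: (dominated_cvgR (g := fun x => `|f x|) _ _ _ _ _).2 => //.
- by move=> n; apply: measurable_patch.
- move=> x; rewrite /= in_itv/= andbT => x0.
  apply: cvg_near_cst; apply: filterS (It_near x0) => n Inx.
  by rewrite patchE mem_set.
- exact: integrable_norm.
- by move=> n x _; rewrite patchE; case: ifP => // _; rewrite normr0.
Qed.

Lemma improper_FTC (f F : R -> R) (A B : R) :
  (forall x : R, 0 < x -> {for x, continuous f}) ->
  (forall x : R, 0 < x -> is_derive x 1 F (f x)) ->
  F x @[x --> 0^'+] --> A -> F x @[x --> +oo] --> B ->
  intg `]0, +oo[ f ->
  \int[mu]_(x in `]0, +oo[) f x = B - A.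
Proof.
move=> cf dF FA FB fi.
have mf := intg_measurable fi.
have E n : \int[mu]_(x in `](n.+1%:R : R)^-1, n.+2%:R[) f x = F n.+2%:R - F (n.+1%:R)^-1.
  apply: FTC2_cc => //.
    by move=> x /andP[nx _]; apply: cf; rewrite (lt_le_trans _ nx)// invr_gt0.
  by move=> x /andP[nx _]; apply: dF; rewrite (lt_le_trans _ nx)// invr_gt0.
apply: (cvg_unique _ (cvg_exhaust fi)) => //.
rewrite /mkset (_ : (fun n => \int[mu]_(x in `](n.+1%:R : R)^-1, n.+2%:R[) f x) =
  (fun n => F n.+2%:R - F n.+1%:R^-1)); last exact/funext.
apply: cvgB.
  apply: (cvg_comp _ _ _ FB).
  apply/cvgryPge => M; near=> n; rewrite (@le_trans _ _ n%:R)// ?ler_nat//.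
    by near: n; exact: nbhs_infty_ger.
  by rewrite -addn2 leq_addr.
have /cvg_at_rightP := FA; apply; split; last exact: cvg_invSn.
by move=> n; rewrite invr_gt0.
Unshelve. all: by end_near. Qed.

(** Pointwise convergence may fail at one point: at the radius [r = p] in Cauchy's formula, and at
    the jump [s = t] in the uniqueness argument. *)
Lemma dominated_cvgR_unpoint D (f_ : nat -> RR -> R) g (p : R) : measurable D ->
  (forall n, measurable_fun D (f_ n)) ->
  (forall x, D x -> x != p -> f_ n x @[n --> \oo] --> (0 : R)) ->
  intg D g ->
  (forall n x, D x -> `|f_ n x| <= g x) ->
  \int[mu]_(x in D) f_ n x @[n --> \oo] --> (0 : R).
Proof.
move=> mD mf_ cf ig fg.
have [] := @dominated_convergence _ _ _ mu _ mD (fun n => EFin \o f_ n) (cst 0%E)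
  (EFin \o g).
- by move=> n; have h := mf_ n; apply/measurable_EFinP; exact: h.
- exact: measurable_cst.
- exists [set p]; split; [exact: measurable_set1|exact: lebesgue_measure_set1|].
  move=> x /=; apply: contra_notP => xp Dx; apply: cvg_EFin; first exact: nearW.
  by apply: cf => //; apply/eqP.
- by [].
- by apply: aeW => x n Dx /=; rewrite lee_fin fg.
move=> _ _; rewrite integral0 => h.
by apply: fine_cvg.
Qed.

(** Over the [n]-th interval of the exhaustion the integral is a difference of two values of [F],
    hence at most [2 M]; monotone convergence carries this bound to the whole half-line. *)
Lemma improper_FTC_intg (f F : R -> R) (M : R) :
  (forall x : R, 0 < x -> {for x, continuous f}) ->
  (forall x : R, 0 < x -> is_derive x 1 F (f x)) ->
  (forall x : R, 0 < x -> 0 <= f x) ->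
  (forall x : R, 0 < x -> `|F x| <= M) ->
  intg `]0, +oo[ f.
Proof.
move=> cf dF f0 FM.
have mf : measurable_fun (`]0, +oo[ : set RR) f.
  apply: open_continuous_measurable_fun; first exact: interval_open.
  by move=> x /set_mem; rewrite /= in_itv/= andbT; exact: cf.
apply/integrableP; split; first exact/measurable_EFinP.
pose g n := (EFin \o (f \_ (It n))).
have mg n : measurable_fun (`]0, +oo[ : set RR) (g n).
  apply/measurable_EFinP; exact: measurable_patch.
have gn n (x : RR) : (`]0, +oo[%classic : set RR) x -> (0 <= g n x)%E.
  rewrite /= in_itv/= andbT => x0; rewrite /g /= patchE lee_fin.
  by case: ifP => // _; exact: f0.
have gmono (x : RR) : (`]0, +oo[%classic : set RR) x -> {homo g^~ x : n m / (n <= m)%N >-> (n <= m)%E}.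
  rewrite /= in_itv/= andbT => x0 n m nm; rewrite /g /= !patchE lee_fin.
  case: ifPn => [xn|_]; last by case: ifP => // _; exact: f0.
  rewrite ifT// inE; move/set_mem : xn; rewrite /It/= !in_itv/= => /andP[nx xn].
  rewrite (lt_le_trans xn) ?ler_nat// andbT (le_lt_trans _ nx)//.
  by rewrite lef_pV2 ?posrE// ler_nat.
have cI := @cvg_monotone_convergence _ _ _ mu _ (measurable_itv `]0, +oo[) _ mg gn gmono.
have E n : \int[mu]_(x in `]0, +oo[) (f \_ (It n)) x = F n.+2%:R - F (n.+1%:R)^-1.
  rewrite -Rintegral_mkcondr setIidr; last by move=> x /It_pos; rewrite /= in_itv/= andbT.
  apply: FTC2_cc => //.
    by move=> x /andP[nx _]; apply: cf; rewrite (lt_le_trans _ nx)// invr_gt0.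
  by move=> x /andP[nx _]; apply: dF; rewrite (lt_le_trans _ nx)// invr_gt0.
have ig n : intg (`]0, +oo[ : set RR) (f \_ (It n)).
  apply/(intg_restrict _ (measurable_itv `]0, +oo[)).
  rewrite -patch_setI setIidr; last by move=> x /It_pos; rewrite /= in_itv/= andbT.
  apply/(intg_restrict _ (mIt n)).
  apply: (@intgS `[(n.+1%:R : R)^-1, n.+2%:R]) => //; first exact: subset_itv_oo_cc.
  apply: intg_continuous; apply: continuous_in_subspaceT => x /set_mem/=.
  by rewrite in_itv/= => /andP[nx _]; apply: cf; rewrite (lt_le_trans _ nx)// invr_gt0.
apply: (@le_lt_trans _ _ (M + M)%:E); last exact: ltry.
have -> : (\int[mu]_(x in `]0%R, +oo[) `|(EFin \o f) x| =
    \int[mu]_(x in `]0%R, +oo[) limn (g^~ x))%E.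
  apply: eq_integral => x /set_mem/=; rewrite in_itv/= andbT => x0.
  rewrite /= ger0_norm ?f0//; apply/esym/cvg_lim => //.
  apply: cvg_near_cst; apply: filterS (It_near x0) => n Inx.
  by rewrite /g /= patchE mem_set.
rewrite -(cvg_lim _ cI)//; apply: lime_le; first by apply/cvg_ex; eexists; exact: cI.
apply: nearW => n; rewrite -[leLHS]fineK; last exact: (integrable_fin_num _ (ig n)).
rewrite lee_fin [leLHS](E n); apply: (le_trans (ler_norm _)).
apply: (le_trans (ler_normB _ _)); apply: lerD; apply: FM => //.
Qed.

End integration_tools.

(** * Differentiation rules for explicit expressions *)

Section derivatives.
Context {R : realType}.
Implicit Types (f g : R -> R) (x a b : R).

Lemma deriv_cst x (c : R) : is_derive x 1 (fun=> c) 0.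
Proof. exact: is_derive_cst. Qed.

Lemma deriv_id x : is_derive x 1 (fun z : R => z) 1.
Proof. exact: is_derive_id. Qed.

Lemma deriv_add f g x a b : is_derive x 1 f a -> is_derive x 1 g b ->
  is_derive x 1 (fun z => f z + g z) (a + b).
Proof. exact: is_deriveD. Qed.

Lemma deriv_opp f x a : is_derive x 1 f a -> is_derive x 1 (fun z => - f z) (- a).
Proof. exact: is_deriveN. Qed.

Lemma deriv_sub f g x a b : is_derive x 1 f a -> is_derive x 1 g b ->
  is_derive x 1 (fun z => f z - g z) (a - b).
Proof. exact: is_deriveB. Qed.

Lemma deriv_mul f g x a b : is_derive x 1 f a -> is_derive x 1 g b ->
  is_derive x 1 (fun z => f z * g z) (f x * b + g x * a).
Proof. exact: is_deriveM. Qed.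

Lemma deriv_scale f x a (k : R) : is_derive x 1 f a -> is_derive x 1 (fun z => k * f z) (k * a).
Proof. exact: is_deriveZ. Qed.

Lemma deriv_inv f x a : f x != 0 -> is_derive x 1 f a ->
  is_derive x 1 (fun z => (f z)^-1) (- (f x ^- 2 * a)).
Proof.
by move=> h d; apply: is_derive_eq (is_deriveV h d) _; rewrite /GRing.scale/= mulNr.
Qed.

Lemma deriv_comp f g x a b : is_derive (f x) 1 g b -> is_derive x 1 f a ->
  is_derive x 1 (fun z => g (f z)) (b * a).
Proof. exact: is_derive1_comp. Qed.

Lemma deriv_expR f x a : is_derive x 1 f a -> is_derive x 1 (fun z => expR (f z)) (expR (f x) * a).
Proof. exact: deriv_comp. Qed.

Lemma deriv_sin f x a : is_derive x 1 f a -> is_derive x 1 (fun z => sin (f z)) (cos (f x) * a).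
Proof. exact: deriv_comp. Qed.

Lemma deriv_cos f x a : is_derive x 1 f a -> is_derive x 1 (fun z => cos (f z)) (- sin (f x) * a).
Proof. exact: deriv_comp. Qed.

Lemma deriv_powR f x a (p : R) : 0 < f x -> is_derive x 1 f a ->
  is_derive x 1 (fun z => f z `^ p) (p * f x `^ (p - 1) * a).
Proof. by move=> h; exact: (deriv_comp (g := fun z => z `^ p) (is_derive1_powR p h)). Qed.

End derivatives.

(** * Integrals of powers and exponentials *)

Section power_integrals.
Context {R : realType}.
Local Notation RR := (measurableTypeR R).
Local Notation mu := (@lebesgue_measure R).
Local Notation intg D f := (mu.-integrable D (EFin \o f)).
Implicit Types (f g : RR -> R) (D : set RR).

Lemma is_derive_cont (f : R -> R) (x d : R) : is_derive x 1 f d -> {for x, continuous f}.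
Proof. by move=> [h _]; apply: differentiable_continuous; exact/derivable1_diffP. Qed.

Lemma continuous_powR (a r : R) : 0 < r -> {for r, continuous (fun x : R => x `^ a)}.
Proof. by move=> r0; exact: is_derive_cont (is_derive1_powR a r0). Qed.

Lemma Rint_scale_pos f (c : R) : 0 < c -> intg `]0, +oo[ f ->
  intg `]0, +oo[ (fun r => f (c * r)) /\
  \int[mu]_(r in `]0, +oo[) f (c * r) = c^-1 * \int[mu]_(r in `]0, +oo[) f r.
Proof.
move=> c0 /(intg_restrict _ (measurable_itv _)) fi.
have E : (fun x : RR => (f \_ `]0, +oo[) (c * x + 0)) = (fun r => f (c * r)) \_ `]0, +oo[.
  apply/funext => x; rewrite !patchE addr0.
  by congr (if _ then _ else _); apply/idP/idP; rewrite !inE/= !in_itv/= !andbT pmulr_rgt0.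
have c1 : c != 0 by rewrite gt_eqF.
split.
  by apply/(intg_restrict _ (measurable_itv _)); rewrite -E; exact: intg_affine.
rewrite [LHS]Rintegral_mkcond [in RHS]Rintegral_mkcond -E Rint_affine//.
by rewrite gtr0_norm.
Qed.

Lemma Rint_reflect f (y : R) : intg `]0, y[ f ->
  intg `]0, y[ (fun s => f (y - s)) /\
  \int[mu]_(s in `]0, y[) f (y - s) = \int[mu]_(s in `]0, y[) f s.
Proof.
move=> /(intg_restrict _ (measurable_itv _)) fi.
have E : (fun x : RR => (f \_ `]0, y[) (-1 * x + y)) = (fun s => f (y - s)) \_ `]0, y[.
  apply/funext => x; rewrite !patchE mulN1r addrC.
  congr (if _ then _ else _); apply/idP/idP; rewrite !inE/= !in_itv/=; lra.
have c1 : -1 != 0 :> R by rewrite oppr_eq0 oner_eq0.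
split.
  by apply/(intg_restrict _ (measurable_itv _)); rewrite -E; exact: intg_affine.
rewrite [LHS]Rintegral_mkcond [in RHS]Rintegral_mkcond -E Rint_affine//.
by rewrite normrN normr1 invr1 mul1r.
Qed.

Lemma measurable_pos f : (forall x : R, 0 < x -> {for x, continuous (f : R -> R)}) ->
  measurable_fun (`]0, +oo[%classic : set RR) f.
Proof.
move=> cf; apply: open_continuous_measurable_fun; first exact: interval_open.
by move=> x /set_mem; rewrite /= in_itv/= andbT; exact: cf.
Qed.

Lemma intg_oo (a b : R) f : (forall x : R, a <= x <= b -> {for x, continuous (f : R -> R)}) ->
  intg `]a, b[ f.
Proof.
move=> cf; have H : intg `[a, b] f.
  apply: intg_continuous; apply: continuous_in_subspaceT => x /set_mem/=.
  by rewrite in_itv/=; exact: cf.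
by apply: intgS H => //; exact: subset_itv_oo_cc.
Qed.

(** A primitive is [(r / (1 + r))^a / a], which stays below [1 / a]. The integrand behaves like
    [r^(a-1)] at 0 and like [r^(-2)] at infinity, which makes it a convenient majorant. *)
Lemma intg_beta_prime (a : R) : 0 < a ->
  intg `]0, +oo[ (fun r => r `^ (a - 1) * (1 + r) `^ (- a - 1)).
Proof.
move=> a0.
pose F (r : R) : R := a^-1 * (r `^ a * (1 + r) `^ (- a)).
have cf (x : R) : 0 < x -> {for x, continuous (fun r : R => r `^ (a - 1) * (1 + r) `^ (- a - 1))}.
  move=> x0; apply: cvgM; first exact: continuous_powR.
  apply: (@continuous_comp R R R (fun r => 1 + r) (fun r => r `^ (- a - 1))).
    by apply: cvgD; [exact: cvg_cst|exact: cvg_id].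
  by apply: continuous_powR; rewrite ltr_wpDl.
apply: (@improper_FTC_intg _ _ F a^-1) => //.
- move=> x x0.
  have x1 : 0 < 1 + x by rewrite ltr_wpDl.
  apply: (is_derive_eq (deriv_scale a^-1 (deriv_mul (deriv_powR a x0 (deriv_id x)) (deriv_powR (f := fun r => 1 + r) (- a) x1 (deriv_add (deriv_cst x 1) (deriv_id x)))))).
  have -> : x `^ a = x * x `^ (a - 1) by rewrite mulr_powRB1// ltW.
  have -> : (1 + x) `^ (- a) = (1 + x) * (1 + x) `^ (- a - 1).
    by rewrite powRB ?(gt_eqF x1) ?implybT// powRr1 ?ltW// mulrCA divff ?mulr1// gt_eqF.
  by field; rewrite gt_eqF.
- by move=> x x0; rewrite mulr_ge0// powR_ge0.
- move=> x x0; have x1 : 0 < 1 + x by rewrite ltr_wpDl.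
  have ai0 : 0 <= a^-1 by rewrite invr_ge0 ltW.
  rewrite /F normrM (ger0_norm ai0) ler_piMr//.
  rewrite ger0_norm ?mulr_ge0 ?powR_ge0//.
  rewrite powRN ler_pdivrMr ?powR_gt0// mul1r.
  by rewrite ge0_ler_powR ?nnegrE ?(ltW a0) ?(ltW x0) ?(ltW x1)// lerDr.
Qed.

(** With [s = r^b] and [K = N / b] this is [ln v < v] at [v = c s / K], multiplied by [K]. The sharp
    maximum has a further factor [exp(-K)]. *)
Lemma powR_expR_le (N b c r : R) : 0 < N -> 0 < b -> 0 < c -> 0 < r ->
  r `^ N * expR (- (c * r `^ b)) <= (N / b / c) `^ (N / b).
Proof.
move=> N0 b0 c0 r0; set K := N / b; set s := r `^ b.
have K0 : 0 < K by rewrite divr_gt0.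
have s0 : 0 < s by rewrite powR_gt0.
have -> : r `^ N = s `^ K by rewrite /s -powRrM /K mulrCA divff ?mulr1 // gt_eqF.
have Kc : 0 < K / c by rewrite divr_gt0.
rewrite /powR !gt_eqF// -expRD ler_expR.
have := @ln_sublinear R (s * c / K) ltac:(by rewrite !mulr_gt0 ?invr_gt0).
have -> : s * c / K = s / (K / c) by field; rewrite !gt_eqF.
rewrite ln_div ?posrE// => h.
have := ltr_pM2l K0 => /(_ (ln s - ln (K / c)) (s / (K / c))); rewrite h => h2.
have h3 : K * (s / (K / c)) = c * s by field; rewrite !gt_eqF.
move: h2; rewrite h3; lra.
Qed.

Lemma intg_decay f (a C : R) : 0 < a ->
  measurable_fun (`]0, +oo[%classic : set RR) f ->
  (forall r : R, 0 < r -> `|f r| <= C * (r `^ (a - 1) * (1 + r) `^ (- a - 1))) ->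
  intg `]0, +oo[ f.
Proof.
move=> a0 mf fC; apply: intg_le mf (intgZl C (measurable_itv _) (intg_beta_prime a0)) _ => //.
by move=> x; rewrite /= in_itv/= andbT; exact: fC.
Qed.

Lemma intg_powR_expR (a b c : R) : 0 < a -> 0 < b -> 0 < c ->
  intg `]0, +oo[ (fun r => r `^ (a - 1) * expR (- (c * r `^ b))).
Proof.
move=> a0 b0 c0.
have a1 : 0 < a + 1 by rewrite addr_gt0.
set M := ((a + 1) / b / c) `^ ((a + 1) / b).
(* The constant covers both ranges: [1 + r <= 2] for [r <= 1], while for [r > 1] one has
   [1 + r <= 2 r], and [M] bounds [r^(a+1) exp(-c r^b)]. *)
apply: (@intg_decay _ a (2 `^ (a + 1) * (1 + M))) => //.
  apply: measurable_pos => x x0; apply: cvgM; first exact: continuous_powR.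
  apply: continuous_comp; last exact: continuous_expR.
  by apply: cvgN; apply: cvgM; [exact: cvg_cst|exact: continuous_powR].
move=> r r0.
have r1 : 0 < 1 + r by rewrite ltr_wpDl.
rewrite ger0_norm ?mulr_ge0 ?powR_ge0 ?expR_ge0// mulrCA ler_wpM2l ?powR_ge0//.
have -> : - a - 1 = - (a + 1) by rewrite opprD.
rewrite powRN ler_pdivlMr ?powR_gt0//.
have [rle|rgt] := lerP r 1.
  rewrite mulrC ler_pM ?powR_ge0 ?expR_ge0//.
    by rewrite ge0_ler_powR ?nnegrE ?(ltW a1) ?(ltW r1)// -[leRHS]/(1 + 1) lerD2l.
  rewrite (@le_trans _ _ 1)// ?expR_le1 ?oppr_le0 ?mulr_ge0 ?powR_ge0 ?(ltW c0)//.
  by rewrite lerDl powR_ge0.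
have : (1 + r) `^ (a + 1) <= 2 `^ (a + 1) * r `^ (a + 1).
  rewrite -powRM ?(ltW r0)//.
  rewrite ge0_ler_powR ?nnegrE ?(ltW a1) ?(ltW r1) ?mulr_ge0 ?(ltW r0)//.
  lra.
move=> h; rewrite mulrC (le_trans (ler_wpM2r (expR_ge0 _) h))// -mulrA ler_wpM2l ?powR_ge0//.
by rewrite (le_trans (powR_expR_le a1 b0 c0 r0))// -/M lerDr.
Qed.

Lemma intg_powR_expR1 (a c : R) : 0 < a -> 0 < c ->
  intg `]0, +oo[ (fun r => r `^ (a - 1) * expR (- (c * r))).
Proof.
move=> a0 c0; apply: intg_eq (intg_powR_expR a0 (@ltr01 R) c0) => //.
by move=> x; rewrite /= in_itv/= andbT => x0; rewrite powRr1// ltW.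
Qed.

Lemma Gamma_scale (a c : R) : 0 < a -> 0 < c ->
  \int[mu]_(r in `]0, +oo[) (r `^ (a - 1) * expR (- (c * r))) = Gamma a * c `^ (- a).
Proof.
move=> a0 c0.
have i1 := intg_powR_expR1 a0 (@ltr01 R).
have [i2 e2] := Rint_scale_pos c0 i1.
rewrite /Gamma mulrC.
have -> : \int[mu]_(t in `]0, +oo[) (t `^ (a - 1) * expR (- t)) = c *
   \int[mu]_(r in `]0, +oo[) ((c * r) `^ (a - 1) * expR (- (1 * (c * r)))).
  rewrite e2 mulVKf; last by rewrite gt_eqF.
  by under [RHS]eq_Rintegral do rewrite mul1r.
rewrite mulrA; have -> : c `^ (- a) * c = (c `^ (a - 1))^-1.
  by rewrite -powRN opprB (addrC 1) powRD ?(gt_eqF c0) ?implybT// powRr1// ltW.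
rewrite -RintegralZl//; apply: eq_Rintegral => x; rewrite inE/= in_itv/= andbT => x0.
rewrite powRM ?ltW// mul1r; field.
by rewrite gt_eqF// powR_gt0.
Qed.

End power_integrals.

(** * Cauchy's formula along rays *)

Section continuity.
Context {R : realType} {T : topologicalType}.
Implicit Types (f g : T -> R) (q : T).

Lemma cont_cst q (c : R) : {for q, continuous (fun=> c)}.
Proof. exact: cvg_cst. Qed.

Lemma cont_add f g q : {for q, continuous f} -> {for q, continuous g} ->
  {for q, continuous (fun z => f z + g z)}.
Proof. exact: cvgD. Qed.

Lemma cont_sub f g q : {for q, continuous f} -> {for q, continuous g} ->
  {for q, continuous (fun z => f z - g z)}.
Proof. exact: cvgB. Qed.

Lemma cont_opp f q : {for q, continuous f} -> {for q, continuous (fun z => - f z)}.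
Proof. exact: cvgN. Qed.

Lemma cont_mul f g q : {for q, continuous f} -> {for q, continuous g} ->
  {for q, continuous (fun z => f z * g z)}.
Proof. exact: cvgM. Qed.

Lemma cont_inv f q : f q != 0 -> {for q, continuous f} -> {for q, continuous (fun z => (f z)^-1)}.
Proof. by move=> h c; apply: cvgV. Qed.

Lemma cont_comp f (g : R -> R) q : {for f q, continuous g} -> {for q, continuous f} ->
  {for q, continuous (fun z => g (f z))}.
Proof. by move=> cg cf; apply: continuous_comp. Qed.

Lemma cont_sin f q : {for q, continuous f} -> {for q, continuous (fun z => sin (f z))}.
Proof. by apply: cont_comp; exact: continuous_sin. Qed.

Lemma cont_cos f q : {for q, continuous f} -> {for q, continuous (fun z => cos (f z))}.
Proof. by apply: cont_comp; exact: continuous_cos. Qed.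

Lemma cont_expR f q : {for q, continuous f} -> {for q, continuous (fun z => expR (f z))}.
Proof. by apply: cont_comp; exact: continuous_expR. Qed.

Lemma cont_powR f q (a : R) : 0 < f q -> {for q, continuous f} ->
  {for q, continuous (fun z => f z `^ a)}.
Proof. by move=> h; apply: (@cont_comp f (fun z => z `^ a)); exact: continuous_powR. Qed.

End continuity.

Section rectangle.
Context {R : realType}.

Lemma bounded_rect (h : R * R -> R) (a1 b1 a2 b2 : R) :
  {within `[a1, b1] `*` `[a2, b2], continuous h} ->
  exists M, forall r t, a1 <= r <= b1 -> a2 <= t <= b2 -> `|h (r, t)| <= M.
Proof.
move=> ch.
have K : compact (`[a1, b1]%classic `*` `[a2, b2]%classic : set (R * R)).
  by apply: compact_setX; exact: segment_compact.
have /compact_bounded := continuous_compact ch K.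
move=> [M [_ /(_ (M + 1))]]; rewrite ltrDl ltr01 => /(_ isT) hM.
exists (M + 1) => r t hr ht; apply: hM; by exists (r, t).
Qed.

Lemma cont_fst (q : R * R) : {for q, continuous (fun q : R * R => q.1)}.
Proof. exact: cvg_fst. Qed.

Lemma cont_snd (q : R * R) : {for q, continuous (fun q : R * R => q.2)}.
Proof. exact: cvg_snd. Qed.

Lemma continuous_pairl (t r : R) : {for r, continuous (fun r : R => (r, t))}.
Proof.
apply: (@cvg_pair _ _ _ (nbhs r) (nbhs r) (nbhs t) _ _ _ (fun r => r) (fun=> t)).
  exact: cvg_id.
exact: cvg_cst.
Qed.

End rectangle.

Section ray_defs.
Context {R : realType}.
Implicit Types b d x p r t : R.

(* Modulus and argument of z^(-d) exp(-x z^b) at z = r e^(i t). *)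
Definition ray_mod b d x r t : R := r `^ (- d) * expR (- (x * r `^ b * cos (b * t))).
Definition ray_arg b d x r t : R := - (d * t) - x * r `^ b * sin (b * t).
(* |p - r e^(i t)|^2 *)
Definition ray_den p r t : R := p ^+ 2 - 2 * p * r * cos t + r ^+ 2.
(* Imaginary and real part of e^(i t) z^(-d) exp(-x z^b) / (p - z). *)
Definition ray_im b d x p r t : R :=
  let B := ray_arg b d x r t in
  ray_mod b d x r t * (p * sin (t + B) - r * sin B) / ray_den p r t.
Definition ray_re b d x p r t : R :=
  let B := ray_arg b d x r t in
  ray_mod b d x r t * (p * cos (t + B) - r * cos B) / ray_den p r t.

(** The common value of the [t]-derivative of [ray_im] and of the [r]-derivative of [r * ray_re], in
    the form given by the quotient rule in [t]. *)
Definition ray_diff b d x p r t : R :=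
  let Y := x * b * r `^ b * sin (b * t) in
  let X := x * b * r `^ b * cos (b * t) in
  let B := ray_arg b d x r t in
  ray_mod b d x r t * (Y * (p * sin (t + B) - r * sin B)
    + (p * cos (t + B) * (1 - d - X) - r * cos B * (- d - X))) / ray_den p r t
  - ray_mod b d x r t * (p * sin (t + B) - r * sin B) * (2 * p * r * sin t)
    / ray_den p r t ^+ 2.

End ray_defs.

Section rotation.
Context {R : realType}.
Local Notation RR := (measurableTypeR R).
Local Notation mu := (@lebesgue_measure R).
Local Notation intg D f := (mu.-integrable D (EFin \o f)).

Lemma sin_abs_le (t : R) : `|sin t| <= `|t|.
Proof.
have H (s : R) : 0 < s -> `|sin s| <= s.
  move=> s0; have [|c _] := @MVT _ sin cos 0 s s0 (fun x _ => is_derive_sin x).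
    by apply: continuous_subspaceT; exact: continuous_sin.
  rewrite sin0 !subr0 => ->; rewrite normrM (gtr0_norm s0) ler_piMl ?(ltW s0)//.
  exact: cos_max.
have [t0|t0|<-] := ltgtP 0 t; last by rewrite sin0 normr0.
  by rewrite (gtr0_norm t0) H.
by rewrite -normrN -sinN (ltr0_norm t0) H// oppr_gt0.
Qed.

Lemma one_sub_cos_le (t : R) : `|cos t - 1| <= `|t|.
Proof.
have H (s : R) : 0 < s -> `|cos s - 1| <= s.
  move=> s0; have [|c _] := @MVT _ cos (fun x => - sin x) 0 s s0 (fun x _ => is_derive_cos x).
    by apply: continuous_subspaceT; exact: continuous_cos.
  rewrite cos0 !subr0 => ->; rewrite normrM (gtr0_norm s0) normrN ler_piMl ?(ltW s0)//.
  exact: sin_max.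
have [t0|t0|<-] := ltgtP 0 t; last by rewrite cos0 subrr normr0.
  by rewrite (gtr0_norm t0) H.
by rewrite -cosN (ltr0_norm t0) H// oppr_gt0.
Qed.

Lemma sin_lower (t : R) : 0 <= t <= 4^-1 -> 3 / 4 * t <= sin t.
Proof.
move=> /andP[]; rewrite le_eqVlt => /predU1P[<- _|t0 t1].
  by rewrite mulr0 sin0.
have [|c] := @MVT _ sin cos 0 t t0 (fun x _ => is_derive_sin x).
  by apply: continuous_subspaceT; exact: continuous_sin.
rewrite in_itv/= => /andP[c0 ct]; rewrite sin0 !subr0 => ->.
rewrite ler_wpM2r ?(ltW t0)//.
have := one_sub_cos_le c; rewrite (gtr0_norm c0) ler_norml => /andP[+ _].
lra.
Qed.

Lemma bounded_seg (f : R -> R) (a c : R) :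
  (forall x, a <= x <= c -> {for x, continuous f}) ->
  exists2 M, 0 < M & forall x, a <= x <= c -> `|f x| <= M.
Proof.
move=> cf; have /compact_bounded : compact (f @` `[a, c]%classic).
  apply: continuous_compact; last exact: segment_compact.
  apply: continuous_in_subspaceT => x /set_mem/=.
  by rewrite in_itv/=; exact: cf.
move=> [M [_ /(_ (`|M| + 1))]] h; exists (`|M| + 1); first by rewrite ltr_wpDl.
move=> x hx; apply: h; first by rewrite (le_lt_trans (ler_norm M))// ltrDl.
by exists x.
Qed.

Variables (b th : R).
Hypotheses (b0 : 0 < b) (b1 : b < 1) (th0 : 0 < th) (thpi : th < pi)
  (bth : b * th < pi / 2).
Variables (d x p : R).
Hypotheses (d1 : d < 1) (x0 : 0 < x) (p0 : 0 < p).

Local Notation bmod := (ray_mod b d x).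
Local Notation bph := (ray_arg b d x).
Local Notation den := (ray_den p).
Local Notation Qf := (ray_im b d x p).
Local Notation Pf := (ray_re b d x p).
Local Notation c' := (cos (b * th)).

Lemma ray_denE (r t : R) : den r t = (r - p * cos t) ^+ 2 + (p * sin t) ^+ 2.
Proof. by rewrite /ray_den exprMn sin2cos2; ring. Qed.

Lemma ray_denE_cos (r t : R) : den r t = (r - p) ^+ 2 + 2 * p * r * (1 - cos t).
Proof. by rewrite /ray_den; ring. Qed.

Lemma ray_den_ge (r t : R) : 0 < r -> (r - p) ^+ 2 <= den r t.
Proof.
move=> r0; have : 0 <= 2 * p * r * (1 - cos t).
  by rewrite mulr_ge0 ?subr_ge0 ?cos_le1// !mulr_ge0// ltW.
by rewrite ray_denE_cos lerDl.
Qed.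

Lemma ray_den_gt0 (r t : R) : 0 < t < pi -> 0 < den r t.
Proof.
move=> h; rewrite ray_denE ltr_wpDl ?sqr_ge0// exprn_gt0// mulr_gt0//.
exact: sin_gt0_pi.
Qed.

Lemma cos_bth_gt0 : 0 < c'.
Proof.
by apply: cos_gt0_pihalf; rewrite bth andbT (@lt_trans _ _ 0)// ?oppr_lt0 ?divr_gt0 ?pi_gt0// mulr_gt0.
Qed.

Lemma cos_bt_ge (t : R) : 0 <= t <= th -> c' <= cos (b * t).
Proof.
move=> /andP[t0 tt]; have pi0 := pi_gt0 R.
have h1 : 0 <= b * t by rewrite mulr_ge0// ltW.
have h2 : b * t <= b * th by rewrite ler_pM2l.
rewrite le_eqVlt; have [->|ne] := eqVneq (b * t) (b * th); first by rewrite eqxx.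
have h3 : b * th <= pi by apply: (le_trans (ltW bth)); lra.
have i1 : b * t \in `[0, pi] by rewrite in_itv/= h1 (le_trans h2).
have i2 : b * th \in `[0, pi] by rewrite in_itv/= (le_trans h1).
by rewrite ltr_cos// lt_neqAle ne h2 orbT.
Qed.

Lemma ray_mod_le (r t : R) : 0 < r -> 0 <= t <= th ->
  0 < bmod r t <= r `^ (- d) * expR (- (x * c' * r `^ b)).
Proof.
move=> r0 ht; rewrite /ray_mod mulr_gt0 ?powR_gt0 ?expR_gt0//=.
rewrite ler_wpM2l ?powR_ge0// ler_expR lerN2 -!mulrA ler_wpM2l ?(ltW x0)//.
by rewrite mulrC ler_wpM2l ?powR_ge0// cos_bt_ge.
Qed.

Local Notation dQ := (ray_diff b d x p).

Lemma is_derive_mul_b (r t : R) : is_derive t 1 (fun t : R => b * t) b.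
Proof. by apply: is_derive_eq (deriv_scale b (deriv_id t)) _; rewrite mulr1. Qed.

Lemma is_derive_ray_arg_t (r t : R) :
  is_derive t 1 (bph r) (- d - x * b * r `^ b * cos (b * t)).
Proof.
apply: is_derive_eq (deriv_sub (deriv_opp (deriv_scale d (deriv_id t))) (deriv_scale (x * r `^ b) (deriv_sin (is_derive_mul_b r t)))) _.
ring.
Qed.

Lemma is_derive_ray_mod_t (r t : R) :
  is_derive t 1 (bmod r) (bmod r t * (x * b * r `^ b * sin (b * t))).
Proof.
apply: is_derive_eq (deriv_scale (r `^ (- d)) (deriv_expR (deriv_opp (deriv_scale (x * r `^ b) (deriv_cos (is_derive_mul_b r t)))))) _.
rewrite /ray_mod; ring.
Qed.

Lemma is_derive_ray_den_t (r t : R) : is_derive t 1 (den r) (2 * p * r * sin t).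
Proof.
apply: is_derive_eq (deriv_add (deriv_sub (deriv_cst t (p ^+ 2)) (deriv_scale (2 * p * r) (deriv_cos (deriv_id t)))) (deriv_cst t (r ^+ 2))) _.
ring.
Qed.

Lemma is_derive_ray_im_t (r t : R) : den r t != 0 -> is_derive t 1 (Qf r) (dQ r t).
Proof.
move=> D0.
have dA2 := is_derive_ray_arg_t r t.
have dtB := deriv_add (deriv_id t) dA2.
have dn := is_derive_ray_den_t r t.
have dA := is_derive_ray_mod_t r t.
apply: is_derive_eq (deriv_mul (deriv_mul dA (deriv_sub (deriv_scale p (deriv_sin dtB)) (deriv_scale r (deriv_sin dA2)))) (deriv_inv D0 dn)) _.
rewrite /ray_diff; field.
exact: D0.
Qed.

Lemma is_derive_ray_arg_r (r t : R) : 0 < r ->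
  is_derive r 1 (bph^~ t) (- (x * b * r `^ (b - 1) * sin (b * t))).
Proof.
move=> r0.
apply: is_derive_eq (deriv_sub (deriv_cst r (- (d * t)))
  (deriv_mul (deriv_scale x (deriv_powR b r0 (deriv_id r))) (deriv_cst r (sin (b * t))))) _.
ring.
Qed.

Lemma is_derive_ray_mod_r (r t : R) : 0 < r ->
  is_derive r 1 (bmod^~ t) (bmod r t * (- d / r - x * b * r `^ (b - 1) * cos (b * t))).
Proof.
move=> r0.
apply: is_derive_eq (deriv_mul (deriv_powR (- d) r0 (deriv_id r))
  (deriv_expR (deriv_opp (deriv_mul (deriv_scale x (deriv_powR b r0 (deriv_id r))) (deriv_cst r (cos (b * t))))))) _.
have rN (a : R) : r `^ (a - 1) = r `^ a / r.
  by rewrite powRB ?(gt_eqF r0) ?implybT// powRr1 ?ltW.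
by rewrite /ray_mod !rN; field; rewrite gt_eqF.
Qed.

Lemma is_derive_ray_den_r (r t : R) : is_derive r 1 (den^~ t) (2 * r - 2 * p * cos t).
Proof.
have -> : den^~ t = (fun r => p ^+ 2 - 2 * p * cos t * r + r * r).
  by apply/funext => z; rewrite /ray_den; ring.
apply: is_derive_eq (deriv_add (deriv_sub (deriv_cst r (p ^+ 2)) (deriv_scale (2 * p * cos t) (deriv_id r))) (deriv_mul (deriv_id r) (deriv_id r))) _.
ring.
Qed.

(* Polar Cauchy-Riemann equation. *)
Lemma is_derive_ray_re_r (r t : R) : 0 < r -> den r t != 0 ->
  is_derive r 1 (fun r => r * Pf r t) (dQ r t).
Proof.
move=> r0 D0.
have dBr := is_derive_ray_arg_r t r0.
have dtB := deriv_add (deriv_cst r t) dBr.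
have dn := is_derive_ray_den_r r t.
have dA := is_derive_ray_mod_r t r0.
have h := deriv_mul (deriv_id r) (deriv_mul (deriv_mul dA (deriv_sub (deriv_scale p (deriv_cos dtB)) (deriv_mul (deriv_id r) (deriv_cos dBr)))) (deriv_inv (f := den^~ t) D0 dn)).
apply: (is_derive_eq h).
have rb : r `^ b = r * r `^ (b - 1) by rewrite mulr_powRB1// ltW.
(* With [B = bph r t] and [N = p e^(i(t+B)) - r e^(iB)], whose real and imaginary parts occur in
   [ray_re] and [ray_im], this is the real part of [N (p e^(-it) - r) = den e^(iB)]. The two
   derivatives differ by a multiple of this relation. *)
have key : den r t * cos (bph r t) =
    p * sin t * (p * sin (t + bph r t) - r * sin (bph r t))
    - (p * cos (t + bph r t) - r * cos (bph r t)) * (r - p * cos t).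
  rewrite sinD cosD /ray_den.
  have s2 : sin t * sin t = 1 - cos t * cos t by rewrite -!expr2 sin2cos2.
  set S := sin t in s2 *; set C := cos t in s2 *.
  set SB := sin _; set CB := cos _.
  transitivity (p ^+ 2 * CB * (C * C + S * S) - 2 * p * r * C * CB + r ^+ 2 * CB).
    by rewrite s2; ring.
  by ring.
rewrite /ray_diff rb.
move: key; set CB := cos (bph r t); set SB := sin (bph r t).
set CT := cos (t + bph r t); set ST := sin (t + bph r t) => key.
set De := den r t in D0 key *.
have r0' : r != 0 by rewrite gt_eqF.
apply/eqP; rewrite -subr_eq0; apply/eqP.
transitivity (2 * r * bmod r t / De ^+ 2 * (- (De * CB - (p * sin t * (p * ST - r * SB)
    - (p * CT - r * CB) * (r - p * cos t))))).
  by field; rewrite D0.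
by rewrite key subrr oppr0 mulr0.
Qed.

Lemma continuous_ray_diff (q : R * R) : 0 < q.1 -> den q.1 q.2 != 0 ->
  {for q, continuous (fun q : R * R => dQ q.1 q.2)}.
Proof.
move=> r0 D0.
have cr := @cont_fst R q; have ct := @cont_snd R q.
have crb : {for q, continuous (fun q : R * R => q.1 `^ b)} by exact: cont_powR.
have cbt : {for q, continuous (fun q : R * R => b * q.2)}.
  by apply: cont_mul => //; exact: cont_cst.
have cmod : {for q, continuous (fun q : R * R => bmod q.1 q.2)}.
  apply: cont_mul; first exact: cont_powR.
  by apply: cont_expR; apply: cont_opp; do 2 (apply: cont_mul; last by [|exact: cont_cos]); exact: cont_cst.
have carg : {for q, continuous (fun q : R * R => bph q.1 q.2)}.
  apply: cont_sub; first by apply: cont_opp; apply: cont_mul => //; exact: cont_cst.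
  by apply: cont_mul; [apply: cont_mul => //; exact: cont_cst|exact: cont_sin].
have cden : {for q, continuous (fun q : R * R => den q.1 q.2)}.
  apply: cont_add; last by apply: (@cont_mul _ _ (fun q : R * R => q.1) (fun q : R * R => q.1)).
  apply: cont_sub; first exact: cont_cst.
  by apply: cont_mul; [apply: cont_mul => //; exact: cont_cst|exact: cont_cos].
have ctB := cont_add ct carg.
have cN1 : {for q, continuous (fun q : R * R => p * sin (q.2 + bph q.1 q.2) - q.1 * sin (bph q.1 q.2))}.
  apply: cont_sub; first by apply: cont_mul; [exact: cont_cst|exact: cont_sin].
  by apply: cont_mul => //; exact: cont_sin.
have cX : {for q, continuous (fun q : R * R => x * b * q.1 `^ b * cos (b * q.2))}.
  by apply: cont_mul; [apply: cont_mul => //; exact: cont_cst|exact: cont_cos].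
have cY : {for q, continuous (fun q : R * R => x * b * q.1 `^ b * sin (b * q.2))}.
  by apply: cont_mul; [apply: cont_mul => //; exact: cont_cst|exact: cont_sin].
have cc1 := cont_mul (cont_mul (@cont_cst R _ q p) (cont_cos ctB)) (cont_sub (@cont_cst R _ q (1 - d)) cX).
have cc2 := cont_mul (cont_mul cr (cont_cos carg)) (cont_sub (@cont_cst R _ q (- d)) cX).
have c1 := cont_mul (cont_mul cmod (cont_add (cont_mul cY cN1) (cont_sub cc1 cc2))) (cont_inv (f := fun q : R * R => den q.1 q.2) D0 cden).
have c2 := cont_mul (cont_mul (cont_mul cmod cN1) (cont_mul (cont_mul (@cont_cst R _ q (2 * p)) cr) (cont_sin ct)))
  (cont_mul (cont_inv (f := fun q : R * R => den q.1 q.2) D0 cden) (cont_inv (f := fun q : R * R => den q.1 q.2) D0 cden)).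
apply: (eq_ind _ (fun F : R * R -> R => {for q, continuous F}) (cont_sub c1 c2)).
by apply/funext => z; rewrite /ray_diff -invfM -expr2.
Qed.

(** The derivative passes under the integral, [ray_diff] is then read as a derivative in [r], and
    integrating it leaves the end terms. These are the contributions of the two circular arcs
    between neighbouring rays. *)
Lemma is_derive_truncated_ray_integral (r1 r2 t : R) : 0 < r1 -> r1 < r2 -> 0 < t < th ->
  is_derive t 1 (fun t => \int[mu]_(r in `]r1, r2[) Qf r t) (r2 * Pf r2 t - r1 * Pf r1 t).
Proof.
move=> r10 r12 /andP[t0 tth].
(* For angles between [t / 2] and [th] the denominator has no zero, so [ray_diff] is bounded by
   compactness; this bound dominates the differentiation under the integral. *)
pose u := t / 2; pose v := th.
have uI s : u <= s <= v -> 0 < s < pi.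
  by rewrite /u /v => /andP[us sv]; rewrite (lt_le_trans _ us) ?divr_gt0// (le_lt_trans sv).
have [M HM] : exists M, forall r s, r1 <= r <= r2 -> u <= s <= v -> `|dQ r s| <= M.
  have [|M HM] := @bounded_rect R (fun q => dQ q.1 q.2) r1 r2 u v.
    apply: continuous_in_subspaceT => q /set_mem/= [].
    rewrite !in_itv/= => /andP[rq _] sq; apply: continuous_ray_diff.
      exact: lt_le_trans rq.
    by rewrite gt_eqF// ray_den_gt0// uI.
  by exists M => r s hr hs; exact: HM.
have dQs r s : r1 <= r <= r2 -> u <= s <= v -> is_derive s 1 (Qf r) (dQ r s).
  by move=> hr hs; apply: is_derive_ray_im_t; rewrite gt_eqF// ray_den_gt0// uI.
have dPr r s : r1 <= r <= r2 -> u <= s <= v -> is_derive r 1 (fun r => r * Pf r s) (dQ r s).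
  move=> /andP[hr _] hs; apply: is_derive_ray_re_r; first exact: lt_le_trans hr.
  by rewrite gt_eqF// ray_den_gt0// uI.
have cQr r s : r1 <= r <= r2 -> u <= s <= v -> {for r, continuous (Qf^~ s)}.
  move=> /andP[hr _] hs; have r0 : 0 < r by exact: lt_le_trans hr.
  have cBr := is_derive_cont (is_derive_ray_arg_r s r0).
  have cA := is_derive_cont (is_derive_ray_mod_r s r0).
  have cDn := is_derive_cont (is_derive_ray_den_r r s).
  have D0 : den r s != 0 by rewrite gt_eqF// ray_den_gt0// uI.
  exact: (cont_mul (cont_mul cA (cont_sub (cont_mul (@cont_cst R _ r p) (cont_sin (cont_add (@cont_cst R _ r s) cBr)))
    (cont_mul (f := id) (fun=> id) (cont_sin cBr)))) (cont_inv (f := den^~ s) D0 cDn)).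
have ut : u < t < v by rewrite /u /v tth andbT ltr_pdivrMr// ltr_pMr// ltr1n.
have uvt : (`]u, v[%classic : set R) t by rewrite /= in_itv/= ut.
have uv_ s : (`]u, v[%classic : set R) s -> u <= s <= v.
  by rewrite /= in_itv/= => /andP[us sv]; rewrite !ltW.
have rr_ (r : R) : (`]r1, r2[%classic : set R) r -> r1 <= r <= r2.
  by rewrite /= in_itv/= => /andP[us sv]; rewrite !ltW.
have iQ s : (`]u, v[%classic : set R) s -> intg `]r1, r2[ (Qf^~ s).
  by move=> /uv_ hs; apply: intg_oo => r hr; exact: cQr.
have p1 r s : (`]u, v[%classic : set R) s -> (`]r1, r2[%classic : set R) r ->
    partial1of2 (fun s r => Qf r s) s r = dQ r s.
  move=> /uv_ hs /rr_ hr; rewrite /partial1of2 derive1E.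
  by have h := dQs r s hr hs; rewrite derive_val.
have M0 : 0 <= M.
  apply: le_trans (normr_ge0 (dQ r1 t)) (HM r1 t _ (uv_ _ uvt)).
  by rewrite lexx ltW.
have dU := @derivable_under_integral R _ _ mu (fun s r => Qf r s) `]r1, r2[%classic
  (measurable_itv _) t u v uvt iQ.
have cU := @differentiation_under_integral R _ _ mu (fun s r => Qf r s) `]r1, r2[%classic
  (measurable_itv _) t u v uvt iQ.
have der s r : (`]u, v[%classic : set R) s -> (`]r1, r2[%classic : set R) r -> derivable (Qf r) s 1.
  by move=> /uv_ hs /rr_ hr; case: (dQs r s hr hs).
have iM : intg `]r1, r2[ (cst M).
  by apply: intg_oo => r hr; exact: cvg_cst.
have bd s r : (`]u, v[%classic : set R) s -> (`]r1, r2[%classic : set R) r ->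
    `|partial1of2 (fun s r => Qf r s) s r| <= cst M r.
  by move=> hs hr; rewrite p1//; apply: HM; [exact: rr_|exact: uv_].
apply: DeriveDef; first exact: (dU der (cst M) (fun=> M0) iM bd).
rewrite -derive1E (cU der (cst M) (fun=> M0) iM bd).
transitivity (\int[mu]_(r in `]r1, r2[) dQ r t).
  by apply: eq_Rintegral => r /set_mem hr; rewrite p1.
have ht : u <= t <= v by exact: uv_.
apply: (@FTC2_cc _ (dQ^~ t) (fun r => r * Pf r t)) => //.
  move=> r hr.
  have := @continuous_ray_diff (r, t) _ _.
  move=> h; apply: (@continuous_comp _ _ _ (fun r => (r, t)) (fun q => dQ q.1 q.2)).
    exact: continuous_pairl.
  apply: h => /=; first by case/andP : hr => h _; exact: lt_le_trans h.
  by rewrite gt_eqF// ray_den_gt0// uI.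
by move=> r hr; exact: dPr.
Qed.

Lemma cos_le_of (t1 t : R) : 0 <= t1 <= t -> t <= pi -> cos t <= cos t1.
Proof.
move=> /andP[t10 tt] tpi; have [->//|ne] := eqVneq t t1.
have i1 : t \in `[0, pi] by rewrite in_itv/=; lra.
have i2 : t1 \in `[0, pi] by rewrite in_itv/=; lra.
by apply/ltW; rewrite ltr_cos// lt_neqAle eq_sym ne.
Qed.

(** Since [(p + r)^2 = (r - p)^2 + 4 p r] and [1 - cos t1 <= 2], one gets
    [(1 - cos t1) (p + r)^2 <= 2 den], and one factor [p + r] is at least [p]. *)
Lemma ray_den_lower (t1 r t : R) : 0 < t1 <= t -> t <= pi -> 0 < r ->
  (p + r) / den r t <= 2 / ((1 - cos t1) * p).
Proof.
move=> /andP[t10 tt] tpi r0.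
have k1 : cos t1 < 1 by rewrite -[ltRHS](@cos0 R) ltr_cos ?in_itv/=; lra.
have k2 : cos t <= cos t1 by apply: cos_le_of => //; rewrite tt ltW.
have k3 := cos_geN1 t1.
have D1 : (1 - cos t1) * p * (p + r) <= 2 * den r t.
  rewrite ray_denE_cos.
  have e : (1 - cos t1) * p * (p + r) <= (1 - cos t1) * (p + r) ^+ 2.
    rewrite -mulrA ler_wpM2l ?subr_ge0 ?(ltW k1)// expr2 ler_wpM2r ?addr_ge0 ?ltW//.
    by rewrite ltrDl.
  apply: (le_trans e).
  have : (1 - cos t1) * (2 * p * r) <= (1 - cos t) * (2 * p * r).
    by rewrite ler_wpM2r ?lerB// !mulr_ge0 ?ltW.
  have : (1 - cos t1) * (r - p) ^+ 2 <= 2 * (r - p) ^+ 2.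
    by rewrite ler_wpM2r ?sqr_ge0//; lra.
  rewrite !expr2; lra.
have c1 : 0 < (1 - cos t1) * p by rewrite mulr_gt0// subr_gt0.
have D0 : 0 < den r t.
  rewrite -(pmulr_rgt0 _ (_ : 0 < 2))// (lt_le_trans _ D1)// mulr_gt0// addr_gt0//.
by rewrite ler_pdivrMr// mulrAC ler_pdivlMr// mulrC.
Qed.

Lemma lin_trig_le (u v r : R) : 0 < r -> `|u| <= 1 -> `|v| <= 1 ->
  `|p * u - r * v| <= p + r.
Proof.
move=> r0 hu hv; apply: (le_trans (ler_normB _ _)); rewrite !normrM.
by rewrite (gtr0_norm p0) (gtr0_norm r0) lerD// ler_piMr// ltW.
Qed.

Lemma ray_im_le (t1 r t : R) : 0 < t1 <= t -> t <= th -> 0 < r ->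
  `|Qf r t| <= 2 / ((1 - cos t1) * p) * (r `^ (- d) * expR (- (x * c' * r `^ b))) /\ `|Pf r t| <= 2 / ((1 - cos t1) * p) * (r `^ (- d) * expR (- (x * c' * r `^ b))).
Proof.
move=> /andP[t10 tt] tth r0.
have tpi : 0 < t < pi by rewrite (lt_le_trans t10 tt) (le_lt_trans tth thpi).
have D0 := ray_den_gt0 r tpi.
have tpi' : t <= pi by case/andP : tpi => _ /ltW.
have t0th : 0 <= t <= th by rewrite tth (ltW (lt_le_trans t10 tt)).
have /andP[m0 m1] := ray_mod_le r0 t0th.
have t1t : 0 < t1 <= t by rewrite t10.
have DL := ray_den_lower t1t tpi' r0.
have Di0 : 0 < (den r t)^-1 by rewrite invr_gt0.
rewrite /ray_im /ray_re; move: (bmod r t) m0 m1 => m m0 m1.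
rewrite !normrM !(gtr0_norm m0) !(gtr0_norm Di0).
have H (z : R) : `|z| <= p + r -> m * `|z| / den r t <=
    2 / ((1 - cos t1) * p) * (r `^ (- d) * expR (- (x * c' * r `^ b))).
  move=> hz; rewrite -mulrA mulrC ler_pM ?(ltW m0) ?mulr_ge0 ?(ltW Di0)//.
  by apply: le_trans DL; rewrite ler_wpM2r ?(ltW Di0).
split; apply: H; apply: lin_trig_le => //; [exact: sin_max|exact: sin_max|exact: cos_max|exact: cos_max].
Qed.

Lemma ray_envelope_intg : intg `]0, +oo[ (fun r => r `^ (- d) * expR (- (x * c' * r `^ b))).
Proof.
have := @intg_powR_expR R (1 - d) b (x * c') _ b0 (mulr_gt0 x0 cos_bth_gt0).
by rewrite subr_gt0 addrAC subrr add0r; apply.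
Qed.

Lemma continuous_ray_im (r t : R) : 0 < r -> 0 < t < pi -> {for r, continuous (Qf^~ t)}.
Proof.
move=> r0 ht; have cBr := is_derive_cont (is_derive_ray_arg_r t r0).
have cA := is_derive_cont (is_derive_ray_mod_r t r0).
have cDn := is_derive_cont (is_derive_ray_den_r r t).
have D0 : den r t != 0 by rewrite gt_eqF// ray_den_gt0.
exact: (cont_mul (cont_mul cA (cont_sub (cont_mul (@cont_cst R _ r p) (cont_sin (cont_add (@cont_cst R _ r t) cBr)))
    (cont_mul (f := id) (fun=> id) (cont_sin cBr)))) (cont_inv (f := den^~ t) D0 cDn)).
Qed.

Lemma ray_im_intg (t : R) : 0 < t <= th -> intg `]0, +oo[ (Qf^~ t).
Proof.
move=> /andP[t0 tth].
have mQ : measurable_fun (`]0, +oo[%classic : set RR) (Qf^~ t).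
  apply: measurable_pos => r r0; apply: continuous_ray_im => //.
  by rewrite t0 (le_lt_trans tth).
apply: intg_le mQ (intgZl (2 / ((1 - cos t) * p)) (measurable_itv _) ray_envelope_intg) _ => //.
move=> r; rewrite /= in_itv/= andbT => r0.
by apply: (ray_im_le _ tth r0).1; rewrite t0 lexx.
Qed.

(** Bounds, up to a constant, the contribution of the arc of radius [r]. It tends to 0 at infinity
    by the exponential, and at the origin because [d < 1]. *)
Let g (r : R) : R := r * (r `^ (- d) * expR (- (x * c' * r `^ b))).

Lemma cvg_g_infty : g n.+2%:R @[n --> \oo] --> (0 : R).
Proof.
have xc : 0 < x * c' by rewrite mulr_gt0// cos_bth_gt0.
have N0 : 0 < 2 - d by rewrite subr_gt0 (lt_trans d1)// ltr1n.
set M := ((2 - d) / b / (x * c')) `^ ((2 - d) / b).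
have M0 : 0 <= M by rewrite powR_ge0.
apply: (@squeeze_cvgr _ _ _ _ (cst 0) (fun n => M * (n.+1%:R)^-1)).
- apply: nearW => n; have r0 : 0 < n.+2%:R :> R by rewrite ltr0n.
  rewrite /g /cst !mulr_ge0 ?powR_ge0 ?expR_ge0 ?(ltW r0)//=.
  have := powR_expR_le N0 b0 xc r0; rewrite -/M => h.
  have -> : n.+2%:R * (n.+2%:R `^ (- d) * expR (- (x * c' * n.+2%:R `^ b))) =
    n.+2%:R `^ (2 - d) * expR (- (x * c' * n.+2%:R `^ b)) / n.+2%:R :> R.
    rewrite powRD ?(gt_eqF r0) ?implybT// -[2]/(2%:R) powR_mulrn ?(ltW r0)//.
    by field; rewrite gt_eqF.
  apply: ler_pM => //; rewrite ?mulr_ge0 ?powR_ge0 ?expR_ge0 ?invr_ge0 ?(ltW r0)//.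
  by rewrite lef_pV2 ?posrE// ler_nat.
- exact: cvg_cst.
- rewrite -(mulr0 M); apply: cvgM; first exact: cvg_cst.
  exact: cvg_invSn.
Qed.

Lemma cvg_g_zero : g (n.+1%:R^-1) @[n --> \oo] --> (0 : R).
Proof.
have d1' : 0 < 1 - d by rewrite subr_gt0.
apply: (@squeeze_cvgr _ _ _ _ (cst 0) (fun n : nat => (n.+1%:R^-1) `^ (1 - d))).
- apply: nearW => n; have r0 : 0 < n.+1%:R^-1 :> R by rewrite invr_gt0.
  rewrite /g /cst !mulr_ge0 ?powR_ge0 ?expR_ge0 ?(ltW r0)//=.
  have he : expR (- (x * c' * n.+1%:R^-1 `^ b)) <= 1.
    by rewrite expR_le1 oppr_le0 !mulr_ge0 ?powR_ge0 ?(ltW x0) ?(ltW cos_bth_gt0).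
  have hn : 0 <= n.+1%:R^-1 * n.+1%:R^-1 `^ (- d) by rewrite mulr_ge0 ?powR_ge0// ltW.
  by rewrite powRD ?(gt_eqF r0) ?implybT// powRr1 ?(ltW r0)// mulrA ler_piMr.
- exact: cvg_cst.
- have /cvg_at_rightP := powR_cvg0 d1'; apply; split; last exact: cvg_invSn.
  by move=> n; rewrite invr_gt0.
Qed.

(** Cut to [](n+1)^(-1), n+2[], the integral varies with the angle at a rate given by two arc terms.
    These are bounded by multiples of [g], uniformly for angles above [t1], and vanish as the cut is
    removed. *)
Lemma ray_integral_const (t1 t2 : R) : 0 < t1 < t2 -> t2 < th ->
  \int[mu]_(r in `]0, +oo[) Qf r t1 = \int[mu]_(r in `]0, +oo[) Qf r t2.
Proof.
move=> /andP[t10 t12] t2th.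
have t1th : t1 < th by exact: lt_trans t2th.
have i1 : intg `]0, +oo[ (Qf^~ t1) by apply: ray_im_intg; rewrite t10 ltW.
have i2 : intg `]0, +oo[ (Qf^~ t2).
  by apply: ray_im_intg; rewrite (ltW t2th) (lt_trans t10 t12).
have e1 := cvg_exhaust i1; have e2 := cvg_exhaust i2.
apply/esym/eqP; rewrite -subr_eq0; apply/eqP.
apply: (cvg_unique _ (cvgB e2 e1)) => //; rewrite /mkset.
set C := 2 / ((1 - cos t1) * p).
apply: norm_cvg0.
apply: (@squeeze_cvgr _ _ _ _ (cst 0)
  (fun n => C * (g n.+2%:R + g n.+1%:R^-1) * (t2 - t1))); last 2 first.
- exact: cvg_cst.
- have -> : (0 : R) = C * (0 + 0) * (t2 - t1) by rewrite addr0 mulr0 mul0r.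
  apply: cvgM; last exact: cvg_cst.
  apply: cvgM; first exact: cvg_cst.
  by apply: cvgD; [exact: cvg_g_infty|exact: cvg_g_zero].
apply: nearW => n; rewrite /cst normr_ge0/=.
have n1 : 0 < n.+1%:R^-1 :> R by rewrite invr_gt0.
have n12 : n.+1%:R^-1 < n.+2%:R :> R.
  by rewrite (@le_lt_trans _ _ 1)// ?invf_le1// ?ler1n// ltr1n.
have n2 : 0 < n.+2%:R :> R by exact: lt_trans n12.
pose F (t : R) : R := \int[mu]_(r in `](n.+1%:R : R)^-1, n.+2%:R[) Qf r t.
pose dF (t : R) : R := n.+2%:R * Pf n.+2%:R t - n.+1%:R^-1 * Pf n.+1%:R^-1 t.
have dFt (t : R) : 0 < t < th -> is_derive t 1 F (dF t).
  by move=> ht; exact: is_derive_truncated_ray_integral.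
have [||c] := @MVT _ F dF t1 t2 t12.
- move=> t; rewrite in_itv/= => /andP[ht1 ht2]; apply: dFt.
  by rewrite (lt_trans t10 ht1) (lt_trans ht2).
- apply: continuous_in_subspaceT => t /set_mem/=; rewrite in_itv/= => /andP[ht1 ht2].
  by apply: is_derive_cont (dFt t _); rewrite (lt_le_trans t10) ?(le_lt_trans ht2).
rewrite in_itv/= => /andP[c1 c2]; change (F t2 - F t1 = dF c * (t2 - t1) ->
  `|F t2 - F t1| <= C * (g n.+2%:R + g n.+1%:R^-1) * (t2 - t1)) => ->.
rewrite normrM [X in _ * X]gtr0_norm ?subr_gt0// ler_wpM2r ?subr_ge0 ?(ltW t12)//.
rewrite /dF (le_trans (ler_normB _ _))// mulrDr.
have H (r : R) : 0 < r -> `|r * Pf r c| <= C * g r.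
  move=> r0; rewrite normrM (gtr0_norm r0) /g mulrCA ler_wpM2l ?(ltW r0)//.
  by apply: (ray_im_le _ _ r0).2; rewrite ?t10 ltW// (lt_trans c2).
by apply: lerD; exact: H.
Qed.

(** The integrand is a Poisson kernel of the half-plane, centred at [p cos t] with height [p sin t].
    Its primitive is an arctangent, and the ends [p / 2] and [2 p] give arguments free of [p]. *)
Lemma integral_Poisson (t : R) : 0 < t < pi ->
  intg `]p / 2, 2 * p[ (fun r => p * sin t / den r t) /\
  \int[mu]_(r in `]p / 2, 2 * p[) (p * sin t / den r t) =
  atan ((2 - cos t) / sin t) - atan ((2^-1 - cos t) / sin t).
Proof.
move=> ht; have s0 := sin_gt0_pi ht.
have ps0 : 0 < p * sin t by rewrite mulr_gt0.
have cf (r : R) : {for r, continuous (fun r => p * sin t / den r t)}.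
  apply: cont_mul; first exact: cont_cst.
  apply: cont_inv; first by rewrite gt_eqF// ray_den_gt0.
  exact: is_derive_cont (is_derive_ray_den_r r t).
split; first by apply: intg_oo => r _; exact: cf.
pose F (r : R) : R := atan ((r - p * cos t) * (p * sin t)^-1).
have p2 : p / 2 < 2 * p by have := p0; lra.
have dF (r : R) : is_derive r 1 F (p * sin t / den r t).
  have dl := deriv_mul (deriv_sub (deriv_id r) (deriv_cst r (p * cos t))) (deriv_cst r (p * sin t)^-1).
  apply: (is_derive_eq (deriv_comp (is_derive1_atan _) dl)).
  rewrite ray_denE; set s := sin t in s0 ps0 *; set co := cos t.
  have h1 : (p * s) ^+ 2 + (r - p * co) ^+ 2 != 0.
    by rewrite gt_eqF// ltr_pwDl ?sqr_ge0 ?exprn_gt0.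
  field.
  by rewrite [X in X != 0]addrC h1 !gt_eqF.
apply: (etrans (FTC2_cc p2 (fun r _ => cf r) (fun r _ => dF r))).
by rewrite /F; congr (atan _ - atan _); field; rewrite !gt_eqF.
Qed.


(** The two arctangents tend to [pi / 2] and [- pi / 2]: for angles at most 1/4 the cosine is at
    least 3/4, so [2 - cos] and [cos - 1/2] stay above 1/4 while the sine tends to 0. *)
Lemma cvg_integral_Poisson (tn : nat -> R) : (forall n, 0 < tn n <= 4^-1) ->
  tn n @[n --> \oo] --> 0 ->
  \int[mu]_(r in `]p / 2, 2 * p[) (p * sin (tn n) / den r (tn n)) @[n --> \oo] --> (pi : R).
Proof.
move=> tn0 ctn; have pi2 := pi_ge2 R.
have tnpi n : 0 < tn n < pi by have := tn0 n; lra.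
under eq_fun do rewrite (integral_Poisson (tnpi _)).2.
have -> : (pi : R) = pi / 2 - (- (pi / 2)) by lra.
have cs n : 0 < sin (tn n) <= tn n.
  rewrite sin_gt0_pi//=; have /andP[t0 _] := tn0 n.
  by have := sin_abs_le (tn n); rewrite (gtr0_norm t0); apply: le_trans (ler_norm _).
have cc n : 3 / 4 <= cos (tn n) <= 1.
  rewrite cos_le1 andbT; have /andP[t0 t1] := tn0 n.
  have := one_sub_cos_le (tn n); rewrite (gtr0_norm t0) ler_norml => /andP[+ _].
  lra.
have cy : (4^-1 / sin (tn n)) @[n --> \oo] --> +oo.
  apply/cvgryPge => M.
  have M0 : 0 < `|M| + 1 by rewrite ltr_wpDl.
  have e0 : 0 < 4^-1 / (`|M| + 1) by rewrite divr_gt0.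
  have /cvgrPdist_lt/(_ _ e0) := ctn.
  apply: filterS => n; rewrite sub0r normrN => h.
  have /andP[s0 s1] := cs n.
  rewrite (le_trans (ler_norm M))// ler_pdivlMr//.
  have : sin (tn n) <= 4^-1 / (`|M| + 1).
    by rewrite (le_trans s1)// (le_trans (ler_norm _))// ltW.
  rewrite ler_pdivlMr// => h2; rewrite (le_trans _ h2)// mulrC ler_wpM2l ?(ltW s0)//.
  by rewrite lerDl.
have big (h : nat -> R) : (forall n, 4^-1 <= h n) -> atan (h n / sin (tn n)) @[n --> \oo] --> (pi / 2 : R).
  move=> hh; apply: (cvg_comp _ _ _ (@cvgy_atan R)).
  apply: (ger_cvgy _ cy); apply: nearW => n.
  by have /andP[s0 s1] := cs n; rewrite ler_wpM2r ?invr_ge0 ?(ltW s0).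
apply: cvgB.
  by apply: big => n; have := cc n; lra.
have -> : (fun n => atan ((2^-1 - cos (tn n)) / sin (tn n))) =
    (fun n => - atan ((cos (tn n) - 2^-1) / sin (tn n))).
  by apply/funext => n; rewrite -atanN -mulNr opprB.
by apply: cvgN; apply: big => n; have := cc n; lra.
Qed.

(** Near [r = p] and [t = 0] the function [z^(-d) exp(-x z^b)] differs from its value at [p] by
    [O(|r - p| + t)], and its imaginary part is [O(t)]. As [den] vanishes there to second order,
    this first-order gain is what keeps the difference with a multiple of the Poisson kernel
    bounded. *)
Lemma ray_lipschitz : exists2 L, 0 < L & forall r t : R, p / 2 <= r <= 2 * p -> 0 <= t <= th ->
  `|bmod r t * cos (bph r t) - p `^ (- d) * expR (- (x * p `^ b))| <= L * (`|r - p| + t) /\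
  `|bmod r t * sin (bph r t)| <= L * t.
Proof.
have rpos (r : R) : p / 2 <= r <= 2 * p -> 0 < r by have := p0; lra.
pose m (r : R) : R := r `^ (- d) * expR (- (x * r `^ b)).
pose dm (r : R) : R := r `^ (- d) * (expR (- (x * r `^ b)) * - (x * (b * r `^ (b - 1) * 1))) +
  expR (- (x * r `^ b)) * (- d * r `^ (- d - 1) * 1).
have dmE (r : R) : 0 < r -> is_derive r 1 m (dm r).
  move=> r0; exact: (deriv_mul (deriv_powR (- d) r0 (deriv_id r)) (deriv_expR (deriv_opp (deriv_scale x (deriv_powR b r0 (deriv_id r)))))).
have [M1 M10 HM1] : exists2 M, 0 < M & forall r, p / 2 <= r <= 2 * p -> `|dm r| <= M.
  apply: bounded_seg => r /rpos r0.
  have cb (a : R) := @continuous_powR R a r r0.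
  have ce := cont_expR (cont_opp (cont_mul (@cont_cst R _ r x) (cb b))).
  have k1 := cont_mul (cb (- d)) (cont_mul ce (cont_opp (cont_mul (@cont_cst R _ r x) (cont_mul (cont_mul (@cont_cst R _ r b) (cb (b - 1))) (@cont_cst R _ r 1))))).
  have k2 := cont_mul ce (cont_mul (cont_mul (@cont_cst R _ r (- d)) (cb (- d - 1))) (@cont_cst R _ r 1)).
  exact: (cont_add k1 k2).
have [H H0 HH] : exists2 M, 0 < M & forall r, p / 2 <= r <= 2 * p -> `|r `^ (- d)| <= M.
  by apply: bounded_seg => r /rpos r0; exact: continuous_powR.
have [N N0 HN] : exists2 M, 0 < M & forall r, p / 2 <= r <= 2 * p -> `|r `^ b| <= M.
  by apply: bounded_seg => r /rpos r0; exact: continuous_powR.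
pose B := `|d| + x * b * N.
have B0 : 0 < B by rewrite ltr_wpDl// !mulr_gt0.
have bm (r t : R) : p / 2 <= r <= 2 * p -> 0 <= t <= th -> 0 < bmod r t <= H.
  move=> hr ht; have r0 := rpos _ hr.
  have /andP[m0 m1] := ray_mod_le r0 ht; rewrite m0 (le_trans m1)//.
  apply: (@le_trans _ _ (r `^ (- d))); last by rewrite (le_trans _ (HH _ hr))// ler_norm.
  by rewrite ler_piMr ?powR_ge0// expR_le1 oppr_le0 !mulr_ge0 ?powR_ge0 ?(ltW x0) ?(ltW cos_bth_gt0).
have xbr (r : R) : p / 2 <= r <= 2 * p -> x * b * r `^ b <= x * b * N.
  move=> hr; rewrite ler_wpM2l ?mulr_ge0 ?(ltW x0) ?(ltW b0)//.
  by rewrite (le_trans _ (HN _ hr))// ler_norm.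
have xbr0 (r : R) : 0 <= x * b * r `^ b by rewrite !mulr_ge0 ?powR_ge0 ?(ltW x0) ?(ltW b0).
have bphB (r t : R) : p / 2 <= r <= 2 * p -> 0 <= t <= th -> `|bph r t| <= B * t.
  move=> hr /andP[ht _]; rewrite /ray_arg (le_trans (ler_normB _ _))// normrN normrM.
  rewrite (ger0_norm ht) /B mulrDl lerD2l normrM.
  rewrite ger0_norm ?mulr_ge0 ?powR_ge0 ?(ltW x0)//.
  apply: (@le_trans _ _ (x * r `^ b * (b * t))).
    rewrite ler_wpM2l ?mulr_ge0 ?powR_ge0 ?(ltW x0)// (le_trans (sin_abs_le _))//.
    by rewrite ger0_norm// mulr_ge0 ?(ltW b0).
  have -> : x * r `^ b * (b * t) = x * b * r `^ b * t by ring.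
  by rewrite ler_wpM2r// xbr.
have dph (r t : R) : p / 2 <= r <= 2 * p -> `|- d - x * b * r `^ b * cos (b * t)| <= B.
  move=> hr; rewrite (le_trans (ler_normB _ _))// normrN lerD2l normrM (ger0_norm (xbr0 r)).
  by rewrite (le_trans _ (xbr _ hr))// ler_piMr// cos_max.
have dmd (r t : R) : p / 2 <= r <= 2 * p -> `|x * b * r `^ b * sin (b * t)| <= B.
  move=> hr; rewrite normrM (ger0_norm (xbr0 r)) (@le_trans _ _ (x * b * r `^ b))//.
    by rewrite ler_piMr// sin_max.
  by rewrite (le_trans (xbr _ hr))// lerDr.
exists (M1 + H * B + H * B); first by rewrite !addr_gt0// mulr_gt0.
move=> r t hr ht; have r0 := rpos _ hr; have /andP[t0 tth] := ht.
split; last first.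
  rewrite normrM; have /andP[m0 mH] := bm _ _ hr ht; rewrite (gtr0_norm m0).
  apply: (@le_trans _ _ (H * (B * t))).
    by rewrite ler_pM ?(ltW m0)// (le_trans (sin_abs_le _))// bphB.
  by rewrite mulrA ler_wpM2r// lerDr addr_ge0 ?mulr_ge0 ?ltW.
have E0 (s : R) : bmod s 0 * cos (bph s 0) = m s.
  by rewrite /ray_mod /ray_arg !mulr0 sin0 cos0 mulr0 subr0 oppr0 cos0 !mulr1.
rewrite -/(m p) -(subrK (m r) (_ * _)) -addrA (le_trans (ler_normD _ _))//.
have hp : p / 2 <= p <= 2 * p by have := p0; lra.
have part1 : `|m r - m p| <= M1 * `|r - p|.
  have Hmvt (a e : R) : p / 2 <= a <= 2 * p -> p / 2 <= e <= 2 * p -> a < e ->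
      `|m e - m a| <= M1 * (e - a).
    move=> ha he ae; have [||c] := @MVT _ m dm a e ae.
    - move=> s; rewrite in_itv/= => hs; apply: dmE; have := rpos a ha; lra.
    - apply: continuous_in_subspaceT => s /set_mem/=; rewrite in_itv/= => hs.
      by apply: is_derive_cont (dmE s _); have := rpos a ha; lra.
    rewrite in_itv/= => hc ->; rewrite normrM [X in _ * X]gtr0_norm ?subr_gt0//.
    by rewrite ler_wpM2r ?subr_ge0 ?(ltW ae)// HM1//; lra.
  have [rp|pr|->] := ltgtP r p; last by rewrite !subrr normr0 mulr0.
    by rewrite distrC (distrC r) [X in _ * X]gtr0_norm ?subr_gt0// Hmvt.
  by rewrite [X in _ * X]gtr0_norm ?subr_gt0// Hmvt.
have part2 : `|bmod r t * cos (bph r t) - m r| <= (H * B + H * B) * t.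
  have [t00|tn0] := eqVneq t 0; first by rewrite t00 E0 subrr normr0 mulr0.
  have tp : 0 < t by rewrite lt_neqAle eq_sym tn0.
  have dF s := deriv_mul (is_derive_ray_mod_t r s) (deriv_cos (is_derive_ray_arg_t r s)).
  have [|c] := @MVT _ _ _ 0 t tp (fun s _ => dF s).
    by apply: continuous_in_subspaceT => s _; exact: is_derive_cont (dF s).
  rewrite in_itv/= => /andP[c0 ct]; rewrite E0 subr0 => ->.
  rewrite normrM [X in _ * X]gtr0_norm// ler_wpM2r//.
  have hc : 0 <= c <= th by rewrite (ltW c0) (ltW (lt_le_trans ct tth)).
  have /andP[m0 mH] := bm _ _ hr hc; move: (bmod r c) m0 mH => m' m0 mH.
  rewrite (le_trans (ler_normD _ _))// lerD// normrM.
    rewrite (gtr0_norm m0) ler_pM ?(ltW m0)// normrM normrN.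
    by rewrite -[leRHS]mul1r ler_pM// ?sin_max// dph.
  rewrite normrM (gtr0_norm m0) -[leRHS]mul1r ler_pM ?mulr_ge0 ?(ltW m0) ?cos_max//.
  by rewrite ler_pM ?(ltW m0)// dmd.
apply: (@le_trans _ _ ((H * B + H * B) * t + M1 * `|r - p|)); first exact: lerD.
have HB0 : 0 <= H * B by rewrite mulr_ge0 ?(ltW H0) ?(ltW B0).
have -> : (M1 + H * B + H * B) * (`|r - p| + t) =
  ((H * B + H * B) * t + M1 * `|r - p|) + ((H * B + H * B) * `|r - p| + M1 * t) by ring.
by rewrite lerDl addr_ge0// mulr_ge0// ?addr_ge0// ltW.
Qed.

(** The integral may be taken along angles [tn n] tending to 0. On []p / 2, 2 p[] the integrand is
    compared with [f0] times the Poisson kernel, of limiting mass [pi]; the difference tends to 0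
    for [r != p] and is dominated. *)
Lemma cauchy_formula_rays (t : R) : 0 < t < th ->
  \int[mu]_(r in `]0, +oo[) Qf r t = pi * (p `^ (- d) * expR (- (x * p `^ b))).
Proof.
move=> /andP[t0 tth]; set f0 := _ * expR _.
have [L L0 HL] := ray_lipschitz.
(* The cap 1/4 is the range in which [sin_lower] and [cvg_integral_Poisson] apply. *)
pose ts := Num.min t 4^-1.
have ts0 : 0 < ts by rewrite lt_min t0 /=.
have tst : ts <= t by rewrite ge_min lexx.
have ts4 : ts <= 4^-1 by rewrite ge_min lexx orbT.
pose tn (n : nat) := ts / n.+2%:R.
have tn0 n : 0 < tn n by rewrite divr_gt0.
have tnlt n : tn n < ts by rewrite ltr_pdivrMr// ltr_pMr// ltr1n.
have tn4 n : 0 < tn n <= 4^-1 by rewrite tn0 (le_trans (ltW (tnlt n))).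
have tnth n : tn n < th by rewrite (lt_trans (tnlt n))// (le_lt_trans tst).
have tnpi n : 0 < tn n < pi by rewrite tn0 (lt_trans (tnth n)).
have ctn : tn n @[n --> \oo] --> 0.
  rewrite -(mulr0 ts); apply: cvgM; first exact: cvg_cst.
  have := cvg_invSn (R := R); rewrite -(cvg_shiftn 1%N).
  by under eq_fun do rewrite addn1.
have f00 : 0 <= f0 by rewrite mulr_ge0 ?powR_ge0 ?expR_ge0.
pose J : set RR := `]p / 2, 2 * p[%classic.
have mJ : measurable J by exact: measurable_itv.
have JD : J `<=` `]0, +oo[%classic.
  by move=> r; rewrite /J/= !in_itv/= andbT => /andP[+ _]; apply: lt_trans; rewrite divr_gt0.
pose kap n (r : RR) : R := p * sin (tn n) / den r (tn n).
pose q n (r : RR) : R := Qf r (tn n) - f0 * (kap n \_ J) r.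
have iQ n : intg `]0, +oo[ (Qf^~ (tn n)) by apply: ray_im_intg; rewrite tn0 ltW.
have ikJ n : intg J (kap n) by exact: (integral_Poisson (tnpi n)).1.
have ik n : intg `]0, +oo[ (kap n \_ J).
  apply/(intg_restrict _ (measurable_itv `]0, +oo[)).
  by rewrite -patch_setI setIidr//; apply/(intg_restrict _ mJ).
have ek n : \int[mu]_(r in `]0, +oo[) q n r =
    \int[mu]_(r in `]0, +oo[) Qf r t - f0 * \int[mu]_(r in J) kap n r.
  rewrite RintegralB//; last by apply: intgZl.
  rewrite RintegralZl// -Rintegral_mkcondr setIidr//.
  by congr (_ - _); apply: ray_integral_const => //; rewrite tn0 (lt_le_trans (tnlt n)).
have cq : \int[mu]_(r in `]0, +oo[) q n r @[n --> \oo] --> (0 : R).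
  (* Write [s = p sin t] and [w = p cos t - r]. The three products [|r - p| s], [t s] and [t |w|] in
     the numerator are at most [den] times 1, [4 / (3 p)] and [4 / (3 p)]; the last two use
     [t <= 4 / (3 p) s]. *)
  pose C := L * (1 + 8 / (3 * p)).
  have C0 : 0 <= C by rewrite mulr_ge0 ?(ltW L0)// addr_ge0// divr_ge0// mulr_ge0 ?(ltW p0).
  pose E (r : R) : R := r `^ (- d) * expR (- (x * c' * r `^ b)).
  have E0 (r : R) : 0 <= E r by rewrite mulr_ge0 ?powR_ge0 ?expR_ge0.
  apply: (@dominated_cvgR_unpoint _ _ q (fun r => 9 / p * E r + ((cst C : RR -> R) \_ J) r) p) => //.
  - move=> n; apply: measurable_funB; first exact: (intg_measurable (iQ n)).
    by apply: measurable_funM => //; exact: (intg_measurable (ik n)).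
  - move=> r; rewrite /= in_itv/= andbT => r0 rp.
    have D0 : den r 0 != 0.
      by rewrite ray_denE_cos cos0 subrr mulr0 addr0 expf_neq0// subr_eq0.
    have a0 : bph r 0 = 0 by rewrite /ray_arg !mulr0 sin0 mulr0 subr0 oppr0.
    have Q0 : Qf r 0 = 0 by rewrite /ray_im a0 addr0 sin0 !mulr0 subr0 mulr0 mul0r.
    have cQ : Qf r (tn n) @[n --> \oo] --> (0 : R).
      rewrite -[in X in _ --> X]Q0.
      apply: (continuous_cvg _ _ ctn).
      exact: is_derive_cont (is_derive_ray_im_t D0).
    have ck : kap n r @[n --> \oo] --> (0 : R).
      have -> : (0 : R) = p * sin 0 / den r 0 by rewrite sin0 mulr0 mul0r.
      have cc : {for 0, continuous (fun t => p * sin t / den r t)}.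
        apply: (cont_mul (cont_mul (@cont_cst R _ (0 : R) p) (cont_sin (f := id) (fun=> id)))).
        exact: (cont_inv D0 (is_derive_cont (is_derive_ray_den_t r 0))).
      exact: (cvg_comp _ _ ctn cc).
    rewrite -[X in _ --> X](subr0 (0 : R)); apply: cvgB => //.
    rewrite -(mulr0 f0); apply: cvgM; first exact: cvg_cst.
    have [rJ|rJ] := boolP (r \in J).
      by under eq_fun do rewrite patchE rJ.
    by under eq_fun do rewrite patchE (negbTE rJ); exact: cvg_cst.
  - apply: intgD => //; first by apply: intgZl => //; exact: ray_envelope_intg.
    apply/(intg_restrict _ (measurable_itv `]0, +oo[)).
    rewrite -patch_setI setIidr//; apply/(intg_restrict _ mJ).
    by apply: intg_oo => r _; exact: cvg_cst.
  move=> n r; rewrite /= in_itv/= andbT => r0.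
  have /andP[t0n t4n] := tn4 n; have tthn := ltW (tnth n).
  have ht : 0 <= tn n <= th by rewrite (ltW t0n).
  have D0 := ray_den_gt0 r (tnpi n).
  have /andP[m0 mE] := ray_mod_le r0 ht.
  have sn := sin_gt0_pi (tnpi n).
  have ps0 : 0 < p * sin (tn n) by rewrite mulr_gt0.
  rewrite /q !patchE; case: ifPn => rJ; last first.
    rewrite mulr0 subr0 addr0 /ray_im.
    have lt := lin_trig_le r0 (sin_max (tn n + bph r (tn n))) (sin_max (bph r (tn n))).
    (* Outside []p / 2, 2 p[] one has [|r - p| >= (p + r) / 3]. *)
    have De : (p + r) ^+ 2 <= 9 * den r (tn n).
      apply: (@le_trans _ _ (9 * (r - p) ^+ 2)); last first.
        by rewrite ler_wpM2l// ray_den_ge.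
      move: rJ; rewrite notin_setE /J /= in_itv/= => /negP; rewrite negb_and -!leNgt.
      move=> /orP[h|h]; rewrite !expr2; have := p0; nra.
    have De2 : (p + r) / den r (tn n) <= 9 / p.
      have := p0; have pr0 : 0 < p + r by rewrite addr_gt0.
      rewrite ler_pdivrMr// mulrAC ler_pdivlMr// => _.
      rewrite (le_trans _ De)// expr2 ler_wpM2l ?(ltW pr0)// lerDl ltW//.
    move: (bmod r (tn n)) m0 mE => m m0 mE.
    rewrite !normrM (gtr0_norm m0) (gtr0_norm (_ : 0 < (den r (tn n))^-1)) ?invr_gt0//.
    rewrite -mulrA mulrC ler_pM ?(ltW m0) ?mulr_ge0 ?invr_ge0 ?(ltW D0)//.
    by rewrite (le_trans _ De2)// ler_wpM2r ?invr_ge0 ?(ltW D0).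
  have rJ' : p / 2 <= r <= 2 * p.
    by move: rJ; rewrite inE /J/= in_itv/= => /andP[h1 h2]; rewrite !ltW.
  have [H1 H2] := HL r (tn n) rJ' ht.
  have h9 : 0 <= 9 / p * E r by apply: (mulr_ge0 _ (E0 r)); rewrite divr_ge0// ltW.
  rewrite ler_wpDl// {h9} /cst.
  set F := bmod r (tn n) * cos _ in H1; set S := bmod r (tn n) * sin _ in H2.
  (* Expanding [sin (t + B)] isolates [p sin t], the numerator of the Poisson kernel, with
     coefficient [F - f0]; the rest carries the factor [S], itself of order [t]. *)
  have -> : Qf r (tn n) - f0 * kap n r =
     ((F - f0) * (p * sin (tn n)) + S * (p * cos (tn n) - r)) / den r (tn n).
    by rewrite /ray_im /kap /F /S sinD; field; rewrite gt_eqF.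
  rewrite normrM (gtr0_norm (_ : 0 < (den r (tn n))^-1)) ?invr_gt0// ler_pdivrMr//.
  clearbody F S; rewrite -/f0 in H1.
  rewrite (le_trans (ler_normD _ _))// (normrM (F - f0)) (normrM S) (gtr0_norm ps0).
  set s := p * sin (tn n) in ps0 *; set w := p * cos (tn n) - r.
  have DE : den r (tn n) = w ^+ 2 + s ^+ 2 by rewrite ray_denE -sqrrN opprB.
  have DE2 : `|r - p| * s <= den r (tn n).
    have g1 : `|r - p| ^+ 2 <= den r (tn n).
      by rewrite real_normK ?num_real// ray_den_ge.
    have g2 : s ^+ 2 <= den r (tn n) by rewrite DE lerDr sqr_ge0.
    have := sqr_ge0 (`|r - p| - s); move: g1 g2; rewrite !expr2; lra.
  have st : tn n <= 4 / (3 * p) * s.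
    have := sin_lower (_ : 0 <= tn n <= 4^-1); rewrite (ltW t0n) => /(_ t4n) h.
    have -> : 4 / (3 * p) * s = 4 / 3 * sin (tn n) by rewrite /s; field; rewrite gt_eqF.
    lra.
  have k0 : 0 <= 4 / (3 * p) by rewrite divr_ge0// mulr_ge0// ltW.
  have DE3 : tn n * s <= 4 / (3 * p) * den r (tn n).
    apply: (@le_trans _ _ (4 / (3 * p) * s * s)); first by rewrite ler_wpM2r ?(ltW ps0).
    by rewrite -mulrA ler_wpM2l// DE -expr2 lerDr sqr_ge0.
  have DE4 : tn n * `|w| <= 4 / (3 * p) * den r (tn n).
    apply: (@le_trans _ _ (4 / (3 * p) * s * `|w|)); first by rewrite ler_wpM2r.
    rewrite -mulrA ler_wpM2l// DE.
    have := sqr_ge0 (`|w| - s); have := sqr_ge0 w; rewrite -(real_normK (num_real w)) !expr2.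
    have := sqr_ge0 s; rewrite expr2; lra.
  apply: (@le_trans _ _ (L * (`|r - p| + tn n) * s + L * tn n * `|w|)).
    by rewrite lerD// ler_wpM2r ?(ltW ps0).
  have -> : C * den r (tn n) = L * (den r (tn n) + 4 / (3 * p) * den r (tn n)
      + 4 / (3 * p) * den r (tn n)).
    by rewrite /C; field; rewrite gt_eqF.
  have -> : L * (`|r - p| + tn n) * s + L * tn n * `|w| = L * (`|r - p| * s + tn n * s + tn n * `|w|).
    by ring.
  by rewrite ler_wpM2l ?(ltW L0)// !lerD.
have ck := cvg_integral_Poisson tn4 ctn.
move: cq; under eq_fun do rewrite ek.
move=> cq.
have c2 : \int[mu]_(r in `]0, +oo[) Qf r t - f0 * \int[mu]_(r in J) kap n r @[n --> \oo] -->
    \int[mu]_(r in `]0, +oo[) Qf r t - f0 * pi.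
  by apply: cvgB; [exact: cvg_cst|apply: cvgM; [exact: cvg_cst|exact: ck]].
apply/eqP; rewrite [_ * f0]mulrC -subr_eq0; apply/eqP.
exact: (cvg_unique _ c2 cq).
Qed.

End rotation.

(** * The kernel and its Laplace transform *)

Section Rint_linear.
Context {R : realType}.
Local Notation RR := (measurableTypeR R).
Local Notation mu := (@lebesgue_measure R).
Local Notation intg D f := (mu.-integrable D (EFin \o f)).
Implicit Types (D : set RR) (f g : RR -> R).

Lemma RintZl D f (k : R) : measurable D -> intg D f ->
  \int[mu]_(x in D) (k * f x) = k * \int[mu]_(x in D) f x.
Proof. exact: RintegralZl. Qed.

Lemma RintD D f g : measurable D -> intg D f -> intg D g ->
  \int[mu]_(x in D) (f x + g x) = \int[mu]_(x in D) f x + \int[mu]_(x in D) g x.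
Proof. exact: RintegralD. Qed.

Lemma RintB D f g : measurable D -> intg D f -> intg D g ->
  \int[mu]_(x in D) (f x - g x) = \int[mu]_(x in D) f x - \int[mu]_(x in D) g x.
Proof. exact: RintegralB. Qed.

Lemma eq_Rint D f g : (forall x, D x -> f x = g x) ->
  \int[mu]_(x in D) f x = \int[mu]_(x in D) g x.
Proof. by move=> fg; apply: eq_Rintegral => x /set_mem; exact: fg. Qed.

End Rint_linear.

Section kernel_defs.
Context {R : realType}.
Implicit Types b th d x y r : R.

(* Imaginary part of e^(i th) z^(-d) exp(y z - x z^b) at z = r e^(i th). *)
Definition ker_int b th d x y r : R :=
  expR (r * y * cos th) * ray_mod b d x r th *
  sin (r * y * sin th + th + ray_arg b d x r th).

(* Bromwich integral of exp(y z) z^(-d) exp(-x z^b) along the rays arg z = +- th. *)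
Definition ker b th d x y : R :=
  pi^-1 * \int[@lebesgue_measure R]_(r in `]0, +oo[) ker_int b th d x y r.

End kernel_defs.

Section kernel.
Context {R : realType}.
Local Notation RR := (measurableTypeR R).
Local Notation mu := (@lebesgue_measure R).
Local Notation intg D f := (mu.-integrable D (EFin \o f)).

Variables (b th : R).
Hypotheses (b0 : 0 < b) (b1 : b < 1) (pith : pi / 2 < th) (thpi : th < pi)
  (bth : b * th < pi / 2).

Local Notation c := (- cos th).
Local Notation c' := (cos (b * th)).
Local Notation KI := (ker_int b th).
Local Notation K := (ker b th).

Lemma th_gt0 : 0 < th.
Proof. by rewrite (lt_trans _ pith)// divr_gt0// pi_gt0. Qed.

Lemma ray_cos_gt0 : 0 < c.
Proof.
have -> : th = (th - pi / 2) + pi / 2 by rewrite subrK.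
rewrite cosDpihalf opprK; apply: sin_gt0_pihalf.
by rewrite subr_gt0 pith /= ltrBlDr; have := thpi; lra.
Qed.

Lemma ray_cosb_gt0 : 0 < c'.
Proof. exact: cos_bth_gt0 b0 th_gt0 bth. Qed.

Lemma ker_int_le (d x y r : R) : 0 <= x -> 0 < r ->
  `|KI d x y r| <= expR (- (c * y * r)) * (r `^ (- d) * expR (- (x * c' * r `^ b))).
Proof.
move=> x0 r0; rewrite /ker_int /ray_mod !normrM.
rewrite !(ger0_norm (expR_ge0 _)) (ger0_norm (powR_ge0 _ _)).
have -> : r * y * cos th = - (c * y * r) by ring.
have -> : x * r `^ b * cos (b * th) = x * cos (b * th) * r `^ b by ring.
by rewrite ler_piMr ?sin_max// !mulr_ge0 ?expR_ge0 ?powR_ge0.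
Qed.

Lemma measurable_ker_int (d : R) :
  measurable_fun setT (fun q : RR * RR * RR => KI d q.1.1 q.1.2 q.2).
Proof.
have mx : measurable_fun setT (fun q : RR * RR * RR => q.1.1 : R).
  exact: (measurableT_comp measurable_fst measurable_fst).
have my : measurable_fun setT (fun q : RR * RR * RR => q.1.2 : R).
  exact: (measurableT_comp measurable_snd measurable_fst).
have mr : measurable_fun setT (fun q : RR * RR * RR => q.2 : R).
  exact: measurable_snd.
have mp (a : R) : measurable_fun setT (fun q : RR * RR * RR => q.2 `^ a).
  exact: (measurableT_comp (measurable_powR a) mr).
have msin := @continuous_measurable_fun R _ (@continuous_sin R).
have mexp := @continuous_measurable_fun R _ (@continuous_expR R).
rewrite /ker_int /ray_mod /ray_arg; apply: measurable_funM.
  apply: measurable_funM.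
    apply: (measurableT_comp mexp); apply: measurable_funM => //.
    exact: measurable_funM.
  apply: measurable_funM => //; apply: (measurableT_comp mexp).
  apply: measurableT_comp => //; apply: measurable_funM => //; exact: measurable_funM.
apply: (measurableT_comp msin); apply: measurable_funD.
  apply: measurable_funD => //; apply: measurable_funM => //; exact: measurable_funM.
apply: measurable_funB => //; apply: measurable_funM => //; exact: measurable_funM.
Qed.

Lemma measurable_ker_int_r (d x y : R) :
  measurable_fun (`]0, +oo[%classic : set RR) (KI d x y).
Proof.
apply: measurable_funTS.
apply: (measurableT_comp (measurable_ker_int d) (_ : measurable_fun setT (fun r : RR => ((x, y) : RR * RR, r)))).
exact: measurable_pair1.
Qed.

Lemma measurable_ker (d : R) :
  measurable_fun setT (fun q : RR * RR => K d q.1 q.2).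
Proof.
apply: measurable_funM => //.
rewrite (_ : (fun q : RR * RR => _) = (fun q : RR * RR => \int[mu]_r
   ((fun z : RR * RR * RR => KI d z.1.1 z.1.2 z.2) \_ (snd @^-1` `]0, +oo[)) (q, r))).
  apply: measurable_Rintegral_param.
  have mS : measurable ((snd : RR * RR * RR -> RR) @^-1` `]0, +oo[).
    have := @measurable_snd _ _ (RR * RR)%type RR measurableT _ (measurable_itv `]0, +oo[).
    by rewrite setTI.
  apply: (measurable_restrictT _ mS).1.
  apply: measurable_funTS; exact: measurable_ker_int.
apply/funext => q; rewrite Rintegral_mkcond; apply: eq_Rintegral => r _.
by rewrite !patchE; congr (if _ then _ else _); rewrite !inE.
Qed.

Lemma intg_decay_x (d x : R) : d < 1 -> 0 < x ->
  intg `]0, +oo[ (fun r => r `^ (- d) * expR (- (x * c' * r `^ b))).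
Proof. move=> d1 x0; exact: (@ray_envelope_intg _ b th b0 th_gt0 bth d x d1 x0). Qed.

Lemma intg_decay_y (d k : R) : d < 1 -> 0 < k ->
  intg `]0, +oo[ (fun r => expR (- (k * r)) * r `^ (- d)).
Proof.
move=> d1 k0; have := @intg_powR_expR1 R (1 - d) k.
rewrite subr_gt0 addrAC subrr add0r => /(_ d1 k0).
by apply: intg_eq => // r _; rewrite mulrC.
Qed.

Lemma ker_int_intg (d x y : R) : d < 1 -> 0 <= x -> 0 < y -> intg `]0, +oo[ (KI d x y).
Proof.
move=> d1 x0 y0.
apply: intg_le (measurable_ker_int_r d x y) (intg_decay_y d1 (mulr_gt0 ray_cos_gt0 y0)) _ => //.
move=> r; rewrite /= in_itv/= andbT => r0.
rewrite (le_trans (ker_int_le _ _ x0 r0))// ler_wpM2l ?expR_ge0//.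
by rewrite ler_piMr ?powR_ge0// expR_le1 oppr_le0 !mulr_ge0 ?powR_ge0// ltW// ray_cosb_gt0.
Qed.

Lemma pi_neq0 : (pi : R) != 0. Proof. by rewrite gt_eqF// pi_gt0. Qed.

Lemma pi_inv_gt0 : 0 < (pi : R)^-1. Proof. by rewrite invr_gt0 pi_gt0. Qed.

Lemma ker_le (d x y : R) (g : RR -> R) : d < 1 -> 0 <= x -> 0 < y -> intg `]0, +oo[ g ->
  (forall r : R, 0 < r -> expR (- (c * y * r)) * (r `^ (- d) * expR (- (x * c' * r `^ b))) <= g r) ->
  `|K d x y| <= pi^-1 * \int[mu]_(r in `]0, +oo[) g r.
Proof.
move=> d1 x0 y0 gi hg; rewrite /ker normrM (gtr0_norm pi_inv_gt0) ler_wpM2l ?(ltW pi_inv_gt0)//.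
apply: norm_int_le => //; first exact: ker_int_intg.
move=> r; rewrite /= in_itv/= andbT => r0.
by rewrite (le_trans (ker_int_le _ _ x0 r0))// hg.
Qed.

(* Interpolates between decay in x and decay in y. *)
Lemma ker_bound_xy (d a : R) : 0 <= a -> 0 < 1 - d - b * a ->
  exists2 C, 0 <= C & forall x y : R, 0 < x -> 0 < y ->
   `|K d x y| <= C * (x `^ (- a) * y `^ (- (1 - d - b * a))).
Proof.
move=> a0 da; set e := 1 - d - b * a.
have d1 : d < 1.
  by have ba : 0 <= b * a by [rewrite mulr_ge0// ltW]; move: da ba; rewrite /e; lra.
(* [M] bounds [v^a exp(-c' v)], used with [v = x r^b]: the decay of [exp(-x c' r^b)] is traded for
   [x^(-a) r^(-b a)]. *)
pose M := (a / c') `^ a.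
exists (pi^-1 * (M * (Gamma e * c `^ (- e)))).
  rewrite mulr_ge0 ?(ltW pi_inv_gt0)// mulr_ge0 ?powR_ge0// mulr_ge0 ?powR_ge0//.
  by apply: Rintegral_ge0 => t _; rewrite mulr_ge0 ?powR_ge0 ?expR_ge0.
move=> x y x0 y0.
have cy0 : 0 < c * y by rewrite mulr_gt0// ray_cos_gt0.
have i0 := intg_powR_expR1 da cy0.
apply: (le_trans (ker_le (g := fun r => M * x `^ (- a) * (r `^ (e - 1) * expR (- (c * y * r)))) d1 (ltW x0) y0 _ _)).
- by apply: intgZl.
- move=> r r0.
  have h : expR (- (x * c' * r `^ b)) <= M * x `^ (- a) * r `^ (- (b * a)).
    have xr0 : 0 < x * r `^ b by rewrite mulr_gt0 ?powR_gt0.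
    have [a00|an0] := eqVneq a 0.
      rewrite /M a00 mulr0 !oppr0 !powRr0 !mulr1 expR_le1 oppr_le0.
      by rewrite !mulr_ge0 ?powR_ge0 ?(ltW x0) ?(ltW ray_cosb_gt0).
    have ap : 0 < a by rewrite lt_neqAle eq_sym an0.
    have := @powR_expR_le R a 1 c' _ ap ltr01 ray_cosb_gt0 xr0.
    rewrite powRr1 ?(ltW xr0)// divr1 -/M.
    have -> : c' * (x * r `^ b) = x * c' * r `^ b by ring.
    move=> h; have -> : M * x `^ (- a) * r `^ (- (b * a)) = M / (x * r `^ b) `^ a.
      by rewrite powRM ?(ltW x0) ?powR_ge0// -powRrM !powRN invfM mulrA.
    by rewrite ler_pdivlMr ?powR_gt0// mulrC.
  rewrite mulrC [leRHS]mulrA ler_wpM2r ?expR_ge0//.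
  have -> : e - 1 = - d + - (b * a) by rewrite /e; ring.
  rewrite powRD ?(gt_eqF r0) ?implybT//.
  rewrite [leRHS]mulrCA ler_wpM2l ?powR_ge0//.
rewrite RintegralZl// Gamma_scale// powRM ?(ltW y0) ?(ltW ray_cos_gt0)//.
rewrite le_eqVlt; apply/orP; left; apply/eqP; ring.
Qed.

(** The decay in [r] is taken from [exp(y z)] alone, which also covers [x = 0]; for parameters near
    [y], the exponential at [y / 2] is a common majorant. *)
Lemma continuous_ker_y (d x y : R) : d < 1 -> 0 <= x -> 0 < y ->
  {for y, continuous (fun y => K d x y)}.
Proof.
move=> d1 x0 y0; apply: cont_mul; first exact: cont_cst.
pose y1 := y / 2; have y10 : 0 < y1 by rewrite divr_gt0.
have cy : 0 < c * y1 by rewrite mulr_gt0// ray_cos_gt0.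
apply: (@dominated_cvg_filter R `]0, +oo[%classic y (fun y r => KI d x y r) _
  (fun r => expR (- (c * y1 * r)) * r `^ (- d))) => //.
- by near=> z; exact: measurable_ker_int_r.
- move=> r; rewrite /= in_itv/= andbT => r0.
  have cr : {for y, continuous (fun y : R => r * y)} by apply: (cont_mul (f := fun=> r) (g := id)); [exact: cont_cst|exact: (fun=> id)].
  have h1 := cont_mul (cont_expR (cont_mul cr (@cont_cst R _ y (cos th)))) (@cont_cst R _ y (ray_mod b d x r th)).
  have h2 := cont_sin (cont_add (cont_add (cont_mul cr (@cont_cst R _ y (sin th))) (@cont_cst R _ y th)) (@cont_cst R _ y (ray_arg b d x r th))).
  exact: (cont_mul h1 h2).
- exact: intg_decay_y.
- near=> z => r; rewrite /= in_itv/= andbT => r0.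
  have zy : y1 <= z.
    near: z; exists (y / 2); rewrite /= ?divr_gt0// => z /=.
    by rewrite ltr_norml /y1 => /andP[_]; lra.
  rewrite (le_trans (ker_int_le _ _ x0 r0))// ler_pM ?expR_ge0 ?mulr_ge0 ?powR_ge0 ?expR_ge0//.
    by rewrite ler_expR lerN2 ler_wpM2r ?(ltW r0)// ler_wpM2l// ltW// ray_cos_gt0.
  by rewrite ler_piMr ?powR_ge0// expR_le1 oppr_le0 !mulr_ge0 ?powR_ge0// ltW// ray_cosb_gt0.
Unshelve. all: by end_near. Qed.

(** The imaginary part of [e^(i phi) / (a - i q)], obtained from an explicit primitive. *)
Lemma integral_exp_sin (a q phi : R) : 0 < a ->
  \int[mu]_(y in `]0, +oo[) (expR (- (a * y)) * sin (q * y + phi)) =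
  (a * sin phi + q * cos phi) / (a ^+ 2 + q ^+ 2).
Proof.
move=> a0; set D := a ^+ 2 + q ^+ 2.
have D0 : 0 < D by rewrite ltr_pwDl ?sqr_ge0// exprn_gt0.
pose F (y : R) : R := - (expR (- (a * y)) * (a * sin (q * y + phi) + q * cos (q * y + phi))) / D.
have lin (y : R) := deriv_add (deriv_scale q (deriv_id y)) (deriv_cst y phi).
have dF (y : R) : is_derive y 1 F (expR (- (a * y)) * sin (q * y + phi)).
  have h1 := deriv_expR (deriv_opp (deriv_scale a (deriv_id y))).
  have h2 := deriv_add (deriv_scale a (deriv_sin (lin y))) (deriv_scale q (deriv_cos (lin y))).
  apply: (is_derive_eq (deriv_mul (deriv_opp (deriv_mul h1 h2)) (deriv_cst y D^-1))).
  by rewrite /D; field; rewrite gt_eqF.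
have cf (y : R) : {for y, continuous (fun y => expR (- (a * y)) * sin (q * y + phi))}.
  apply: cont_mul; first exact: is_derive_cont (deriv_expR (deriv_opp (deriv_scale a (deriv_id y)))).
  exact: is_derive_cont (deriv_sin (lin y)).
have iF : intg `]0, +oo[ (fun y => expR (- (a * y)) * sin (q * y + phi)).
  have := @intg_powR_expR1 R 1 a ltr01 a0 => h.
  apply: (intg_le (g := fun y => expR (- (a * y)))) => //.
  - by apply: measurable_pos => y _; exact: cf.
  - by apply: intg_eq h => // y _; rewrite subrr powRr0 mul1r.
  - by move=> y _; rewrite normrM ger0_norm ?expR_ge0// ler_piMr ?expR_ge0// sin_max.
rewrite (@improper_FTC R _ F (F 0) 0) //.
- by rewrite sub0r /F !mulr0 !add0r oppr0 expR0 mul1r mulNr opprK.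
- by apply: cvg_at_right_filter; exact: is_derive_cont (dF 0).
apply: norm_cvg0.
apply: (@squeeze_cvgr _ _ _ _ (cst 0) (fun y => expR (- (a * y)) * ((a + `|q|) / D))).
- apply: nearW => y; rewrite /cst normr_ge0/= /F normrM normrN normrM.
  rewrite (ger0_norm (expR_ge0 _)) (gtr0_norm (_ : 0 < D^-1)) ?invr_gt0//.
  rewrite -mulrA ler_wpM2l ?expR_ge0// ler_wpM2r ?invr_ge0 ?(ltW D0)//.
  rewrite (le_trans (ler_normD _ _))// !normrM (gtr0_norm a0) lerD//.
    by rewrite ler_piMr ?sin_max// ltW.
  by rewrite ler_piMr ?cos_max.
- exact: cvg_cst.
- rewrite -(mul0r ((a + `|q|) / D)); apply: cvgM; last exact: cvg_cst.
  apply: (cvg_comp (fun y : R => a * y) (fun y : R => expR (- y))); last exact: cvgr_expR.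
  by apply: gt0_cvgMry => //; exact: cvg_id.
Qed.


(** Integrating first in [y] turns [exp(-(p - z) y)] into [1 / (p - z)], so the integral over the
    ray becomes the one in Cauchy's formula. The exchange is dominated by
    [exp(-p y) r^(-d) exp(-x c' r^b)], which is integrable in [r] since [x > 0]. *)
Lemma ker_laplace (d x p : R) : d < 1 -> 0 < x -> 0 < p ->
  intg `]0, +oo[ (fun y => expR (- (p * y)) * K d x y) /\
  \int[mu]_(y in `]0, +oo[) (expR (- (p * y)) * K d x y) =
  p `^ (- d) * expR (- (x * p `^ b)).
Proof.
move=> d1 x0 p0.
pose h (q : RR * RR) : R := expR (- (p * q.1)) * KI d x q.1 q.2.
have mh : measurable_fun setT h.
  apply: measurable_funM.
    apply: (measurableT_comp (continuous_measurable_fun (@continuous_expR R))).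
    apply: measurableT_comp => //; apply: measurable_funM => //.
  have mpair : measurable_fun setT (fun q : RR * RR => ((x, q.1) : RR * RR, q.2)).
    apply/prod_measurable_funP; split => /=; last exact: measurable_snd.
    apply/prod_measurable_funP; split => /=; [exact: measurable_cst|exact: measurable_fst].
  exact: (measurableT_comp (measurable_ker_int d) mpair).
have ip : intg `]0, +oo[ (fun y => expR (- (p * y))).
  have := @intg_powR_expR1 R 1 p ltr01 p0.
  by apply: intg_eq => // y _; rewrite subrr powRr0 mul1r.
have [i1 i2 _ e] := @FubiniR_dom R `]0, +oo[%classic `]0, +oo[%classic h
  (fun y => expR (- (p * y))) (fun r => r `^ (- d) * expR (- (x * c' * r `^ b)))
  (measurable_itv _) (measurable_itv _) (measurable_funTS mh) ip (intg_decay_x d1 x0)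
  ltac:(by move=> y r; rewrite /= !in_itv/= !andbT => y0 r0;
    rewrite normrM ger0_norm ?expR_ge0// ler_wpM2l ?expR_ge0//;
    rewrite (le_trans (ker_int_le _ _ (ltW x0) r0))// ler_piMl ?mulr_ge0 ?powR_ge0 ?expR_ge0//;
    rewrite expR_le1 oppr_le0 !mulr_ge0 ?(ltW ray_cos_gt0) ?(ltW y0) ?(ltW r0)).
have pi0 := pi_neq0.
have E y : (`]0, +oo[%classic : set RR) y ->
    \int[mu]_(r in `]0, +oo[) h (y, r) = pi * (expR (- (p * y)) * K d x y).
  rewrite /= in_itv/= andbT => y0.
  transitivity (\int[mu]_(r in `]0, +oo[) (expR (- (p * y)) * KI d x y r)); first by [].
  have iK := ker_int_intg d1 (ltW x0) y0.
  rewrite (RintZl (expR (- (p * y))) (measurable_itv _) iK).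
  rewrite /ker; move: (Rintegral _ _ _) (expR _) => I e0.
  clear -pi0.
  rewrite (mulrCA e0).
  exact: (esym (mulVKf pi0 (e0 * I))).
have iK : intg `]0, +oo[ (fun y => expR (- (p * y)) * K d x y).
  apply: intg_eq (intgZl pi^-1 (measurable_itv _) i2); last exact: measurable_itv.
  move=> y y0; rewrite (E y y0) mulrA (mulVf pi0).
  exact: mul1r.
split; first exact: iK.
clear i1 i2.
apply: (mulfI pi0); rewrite -(RintZl pi (measurable_itv _) iK).
transitivity (\int[mu]_(x in `]0, +oo[) \int[mu]_(y in `]0, +oo[) h (x, y)).
  by apply: eq_Rint => y y0; rewrite (E y y0).
rewrite e; clear e.
(* [cauchy_formula_rays] applies to angles strictly below the one for which its constraints are
   assumed, so a slightly larger admissible angle is supplied. *)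
pose thM := Num.min ((th + pi) / 2) ((th + pi / 2 / b) / 2).
have thb : th < pi / 2 / b by rewrite ltr_pdivlMr// mulrC.
have t1 : th < thM by rewrite lt_min; apply/andP; split; have := thpi; lra.
have t2 : thM < pi by rewrite gt_min; apply/orP; left; have := thpi; lra.
have t3 : b * thM < pi / 2.
  rewrite -ltr_pdivlMl// mulrC gt_min; apply/orP; right; have := thb; lra.
have t0 := th_gt0.
rewrite -(@cauchy_formula_rays R b thM b0 (lt_trans t0 t1) t2 t3 d x p d1 x0 p0 th); last by rewrite t0.
apply: eq_Rintegral => r /set_mem; rewrite /= in_itv/= andbT => r0.
rewrite /h /ker_int.
have a0 : 0 < p - r * cos th.
  by have : 0 < r * c by [rewrite mulr_gt0// ray_cos_gt0]; have := p0; lra.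
pose m := ray_mod b d x r th; pose A := ray_arg b d x r th.
transitivity (\int[mu]_(y in `]0, +oo[) (m * (expR (- ((p - r * cos th) * y)) *
    sin (r * sin th * y + (th + A))))).
  apply: eq_Rint => y _; rewrite /= -/m -/A.
  have -> : - ((p - r * cos th) * y) = - (p * y) + r * y * cos th by ring.
  rewrite expRD; have -> : r * sin th * y + (th + A) = r * y * sin th + th + A by ring.
  ring.
rewrite RintegralZl//; last first.
  apply: (intg_le (g := fun y => expR (- ((p - r * cos th) * y)))) => //.
  - apply: measurable_pos => y _; apply: cont_mul.
      exact: is_derive_cont (deriv_expR (deriv_opp (deriv_scale (p - r * cos th) (deriv_id y)))).
    exact: is_derive_cont (deriv_sin (deriv_add (deriv_scale (r * sin th) (deriv_id y)) (deriv_cst y (th + A)))).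
  - have := @intg_powR_expR1 R 1 _ ltr01 a0.
    by apply: intg_eq => // y _; rewrite subrr powRr0 mul1r.
  - by move=> y _; rewrite normrM ger0_norm ?expR_ge0// ler_piMr ?expR_ge0// sin_max.
rewrite integral_exp_sin// /ray_im -/m -/A mulrA; congr (_ * _ / _).
  rewrite (_ : sin A = sin (th + A - th)); last by congr sin; ring.
  rewrite sinB; ring.
rewrite /ray_den exprMn -[X in _ + X](subrK (r ^+ 2)); rewrite sin2cos2; ring.
Qed.

(** The integrand of [ker] at [x = 0], [y = 1]; its integral divided by [pi] is Hankel's integral
    for [1 / Gamma(d)]. *)
Let G (d r : R) : R := expR (r * cos th) * r `^ (- d) * sin (r * sin th + (1 - d) * th).
Definition ker_const (d : R) : R := pi^-1 * \int[mu]_(r in `]0, +oo[) G d r.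

Lemma G_le (d r : R) : 0 < r -> `|G d r| <= expR (- (c * r)) * r `^ (- d).
Proof.
move=> r0; rewrite /G !normrM (ger0_norm (expR_ge0 _)) (ger0_norm (powR_ge0 _ _)).
have -> : - (c * r) = r * cos th by ring.
by rewrite ler_piMr ?sin_max// mulr_ge0 ?expR_ge0 ?powR_ge0.
Qed.

Lemma continuous_G (d r : R) : 0 < r -> {for r, continuous (G d)}.
Proof.
move=> r0; apply: cont_mul.
  apply: cont_mul; last exact: continuous_powR.
  exact: is_derive_cont (deriv_expR (deriv_mul (deriv_id r) (deriv_cst r (cos th)))).
exact: is_derive_cont (deriv_sin (deriv_add (deriv_mul (deriv_id r) (deriv_cst r (sin th))) (deriv_cst r ((1 - d) * th)))).
Qed.

Lemma G_intg (d : R) : d < 1 -> intg `]0, +oo[ (G d).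
Proof.
move=> d1; apply: intg_le (measurable_pos (@continuous_G d)) (intg_decay_y d1 ray_cos_gt0) _ => //.
by move=> r; rewrite /= in_itv/= andbT; exact: G_le.
Qed.

Lemma ker_int0E (d y r : R) : 0 < y -> 0 < r -> KI d 0 y r = y `^ d * G d (y * r).
Proof.
move=> y0 r0; rewrite /ker_int /ray_mod /ray_arg /G !mul0r oppr0 expR0 mulr1 addr0.
rewrite powRM ?(ltW r0) ?(ltW y0)// (powRN y) (mulrC y).
have -> : r * y * sin th + th + - (d * th) = r * y * sin th + (1 - d) * th by ring.
by field; rewrite gt_eqF// powR_gt0.
Qed.

Lemma ker0E (d y : R) : d < 1 -> 0 < y -> K d 0 y = ker_const d * y `^ (d - 1).
Proof.
move=> d1 y0; have [i e] := Rint_scale_pos y0 (G_intg d1).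
rewrite /ker /ker_const -mulrA; congr (_ * _).
transitivity (\int[mu]_(r in `]0, +oo[) (y `^ d * G d (y * r))).
  by apply: eq_Rintegral => r /set_mem; rewrite /= in_itv/= andbT => r0; exact: ker_int0E.
rewrite RintegralZl// e powRB ?(gt_eqF y0) ?implybT// powRr1 ?(ltW y0)//.
ring.
Qed.

(** Let [x] tend to 0 in the Laplace transform at [p = 1]: the right side [exp(-x)] tends to 1, and
    on the left [K d 0 y] is [ker_const d * y^(d-1)], whose transform is [ker_const d * Gamma d].
    The bound [ker_bound_xy] with [a = 0] is uniform in [x] and dominates. *)
Lemma ker_const_Gamma (d : R) : 0 < d < 1 -> ker_const d * Gamma d = 1.
Proof.
move=> /andP[d0 d1].
pose xn (n : nat) : R := n.+1%:R^-1.
have xn0 n : 0 < xn n by rewrite invr_gt0.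
have d1' : 0 < 1 - d - b * 0 by rewrite mulr0 subr0 subr_gt0.
have [C C0 HC] := ker_bound_xy (lexx 0) d1'.
have e1 n : \int[mu]_(y in `]0, +oo[) (expR (- (1 * y)) * K d (xn n) y) = expR (- xn n).
  by rewrite (ker_laplace d1 (xn0 n) ltr01).2 !powR1 mul1r mulr1.
have c1 : expR (- xn n) @[n --> \oo] --> (1 : R).
  rewrite -expR0 -oppr0; apply: continuous_cvg; first exact: continuous_expR.
  by apply: cvgN; exact: cvg_invSn.
have i1 := intg_powR_expR1 d0 (@ltr01 R).
have [] := @dominated_cvgR R `]0, +oo[%classic (fun n y => expR (- (1 * y)) * K d (xn n) y)
  (fun y => expR (- (1 * y)) * K d 0 y) (fun y => C * (y `^ (d - 1) * expR (- (1 * y)))) => //.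
- by move=> n; exact: intg_measurable (ker_laplace d1 (xn0 n) ltr01).1.
- move=> y; rewrite /= in_itv/= andbT => y0; apply: cvgM; first exact: cvg_cst.
  apply: cvgM; first exact: cvg_cst.
  have cy : 0 < c * y by rewrite mulr_gt0// ray_cos_gt0.
  apply: (@dominated_cvgR R `]0, +oo[%classic (fun n r => KI d (xn n) y r) (KI d 0 y)
    (fun r => expR (- (c * y * r)) * r `^ (- d)) _ _ _ _ _).2 => //.
  + by move=> n; exact: measurable_ker_int_r.
  + move=> r; rewrite /= in_itv/= andbT => r0.
    have cx : {for 0, continuous (fun x => KI d x y r)}.
      have xr := deriv_mul (deriv_id (0 : R)) (deriv_cst 0 (r `^ b)).
      have h1 := deriv_scale (r `^ (- d)) (deriv_expR (deriv_opp (deriv_mul xr (deriv_cst 0 c')))).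
      have h2 := deriv_sub (deriv_cst 0 (- (d * th))) (deriv_mul xr (deriv_cst 0 (sin (b * th)))).
      have h3 := deriv_sin (deriv_add (deriv_cst 0 (r * y * sin th + th)) h2).
      exact: is_derive_cont (deriv_mul (deriv_scale (expR (r * y * cos th)) h1) h3).
    exact: (cvg_comp _ _ (@cvg_invSn R) cx).
  + exact: intg_decay_y.
  + move=> n r; rewrite /= in_itv/= andbT => r0.
    rewrite (le_trans (ker_int_le _ _ (ltW (xn0 n)) r0))// ler_wpM2l ?expR_ge0//.
    by rewrite ler_piMr ?powR_ge0// expR_le1 oppr_le0 !mulr_ge0 ?powR_ge0 ?(ltW (xn0 n)) ?(ltW ray_cosb_gt0).
- by apply: intgZl.
- move=> n y; rewrite /= in_itv/= andbT => y0.
  rewrite normrM ger0_norm ?expR_ge0// mulrC [leRHS]mulrA ler_wpM2r ?expR_ge0//.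
  apply: (le_trans (HC _ _ (xn0 n) y0)).
  by rewrite mulr0 subr0 oppr0 powRr0 mul1r opprB.
move=> _; under eq_fun do rewrite e1.
move=> c2; have := cvg_unique _ c2 c1; rewrite /close => <- //.
rewrite (_ : Gamma d = \int[mu]_(r in `]0, +oo[) (r `^ (d - 1) * expR (- (1 * r)))); last first.
  by rewrite Gamma_scale// powR1 mulr1.
rewrite -RintegralZl//; apply: eq_Rintegral => y /set_mem; rewrite /= in_itv/= andbT => y0.
by rewrite ker0E//; ring.
Qed.

(** [F] is the imaginary part of [e^z z^(1-d)] along the ray; it vanishes at both ends, and its
    derivative is the sum of the two integrands. *)
Lemma ker_const_rec (d : R) : d <= 1 ->
  (1 - d) * ker_const d + ker_const (d - 1) = 0.
Proof.
move=> d1.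
pose F (r : R) : R := expR (r * cos th) * r `^ (1 - d) * sin (r * sin th + (1 - d) * th).
(* At [d = 1], outside the range of [G_intg], the integrand has the factor [1 - d = 0]. *)
have i1 : intg `]0, +oo[ (fun r => (1 - d) * G d r).
  move: d1; rewrite le_eqVlt => /predU1P[->|d1]; last by apply: intgZl => //; exact: G_intg.
  rewrite (_ : EFin \o _ = cst 0%E); first exact: integrable0.
  by apply/funext => r /=; rewrite subrr mul0r.
have d2 : d - 1 < 1 by lra.
have i2 := G_intg d2.
have dF (r : R) : 0 < r -> is_derive r 1 F ((1 - d) * G d r + G (d - 1) r).
  move=> r0.
  have lin := deriv_add (deriv_mul (deriv_id r) (deriv_cst r (sin th))) (deriv_cst r ((1 - d) * th)).
  apply: (is_derive_eq (deriv_mul (deriv_mul (deriv_expR (deriv_mul (deriv_id r) (deriv_cst r (cos th)))) (deriv_powR (1 - d) r0 (deriv_id r))) (deriv_sin lin))).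
  rewrite /G.
  have -> : 1 - d - 1 = - d by ring.
  have -> : - (d - 1) = 1 - d by ring.
  have -> : sin (r * sin th + (1 + (1 - d)) * th) =
    sin (r * sin th + (1 - d) * th) * cos th + cos (r * sin th + (1 - d) * th) * sin th.
    by rewrite -sinD; congr sin; ring.
  ring.
have I : \int[mu]_(r in `]0, +oo[) ((1 - d) * G d r + G (d - 1) r) = 0 - 0.
  have Fle (r : R) : 0 < r -> `|F r| <= expR (- (c * r)) * r `^ (1 - d).
    move=> r0; rewrite /F !normrM (ger0_norm (expR_ge0 _)) (ger0_norm (powR_ge0 _ _)).
    have -> : - (c * r) = r * cos th by ring.
    by rewrite ler_piMr ?sin_max// mulr_ge0 ?expR_ge0 ?powR_ge0.
  apply: (@improper_FTC R _ F 0 0) => //.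
  - move=> r r0; apply: cont_add; last exact: continuous_G.
    by apply: cont_mul; [exact: cont_cst|exact: continuous_G].
  - move: d1; rewrite le_eqVlt => /predU1P[d1|d1].
      apply: cvg_at_right_filter.
      have E0 : expR (0 * cos th) * 1 * sin (0 * sin th) = 0 :> R by rewrite !mul0r sin0 mulr0.
      rewrite /F d1; under eq_fun do rewrite subrr powRr0 mul0r addr0.
      have H : expR (x * cos th) * 1 * sin (x * sin th) @[x --> (0 : R)] -->
        expR (0 * cos th) * 1 * sin (0 * sin th) by exact: (is_derive_cont (deriv_mul (deriv_mul (deriv_expR (deriv_mul (deriv_id (0 : R)) (deriv_cst 0 (cos th)))) (deriv_cst 0 1))
        (deriv_sin (deriv_mul (deriv_id 0) (deriv_cst 0 (sin th)))))).
      by rewrite E0 in H.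
    apply: norm_cvg0.
    apply: (@squeeze_cvgr _ _ _ _ (cst 0) (fun r => r `^ (1 - d))).
    + near=> r; have r0 : 0 < r by near: r; do [exact: nbhs_right_gt|exact: nbhs_pinfty_gt].
      rewrite /cst normr_ge0/= (le_trans (Fle _ r0))// ler_piMl ?powR_ge0//.
      by rewrite expR_le1 oppr_le0 mulr_ge0 ?(ltW ray_cos_gt0) ?(ltW r0).
    + exact: cvg_cst.
    + by apply: powR_cvg0; rewrite subr_gt0.
  - have N0 : 0 < 2 - d by lra.
    set M := ((2 - d) / 1 / c) `^ ((2 - d) / 1).
    apply: norm_cvg0.
    apply: (@squeeze_cvgr _ _ _ _ (cst 0) (fun r => M * r^-1)).
    + near=> r; have r0 : 0 < r by near: r; do [exact: nbhs_right_gt|exact: nbhs_pinfty_gt].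
      rewrite /cst normr_ge0/= (le_trans (Fle _ r0))//.
      have := powR_expR_le N0 ltr01 ray_cos_gt0 r0; rewrite -/M powRr1 ?(ltW r0)// => h.
      rewrite ler_pdivlMr// (le_trans _ h)// le_eqVlt; apply/orP; left; apply/eqP.
      have -> : 2 - d = (1 - d) + 1 by ring.
      by rewrite (@powRD _ _ (1 - d) 1) ?(gt_eqF r0) ?implybT// powRr1 ?(ltW r0)//; ring.
    + exact: cvg_cst.
    + rewrite -(mulr0 M); apply: cvgM; first exact: cvg_cst.
      apply/(gtr0_cvgV0 _).2; [near=> r; near: r; exact: nbhs_pinfty_gt|exact: cvg_id].
  - by apply: intgD.
move: I; rewrite subr0 RintegralD//.
have -> : \int[mu]_(r in `]0, +oo[) ((1 - d) * G d r) = (1 - d) * \int[mu]_(r in `]0, +oo[) G d r.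
  move: d1; rewrite le_eqVlt => /predU1P[->|d1]; last by rewrite RintegralZl//; exact: G_intg.
  rewrite subrr mul0r (@eq_Rintegral _ _ _ mu _ (cst 0)); first by rewrite Rintegral_cst// mul0r.
  by move=> r _; rewrite mul0r.
by move=> I; rewrite /ker_const mulrCA -mulrDr I mulr0.
Unshelve. all: by end_near. Qed.

End kernel.

(** * Wright functions *)

Section rGamma.
Context {R : realType}.

Lemma rGamma_gt0 (x : R) : 0 < x -> rGamma x = (Gamma x)^-1.
Proof. by move=> x0; rewrite /rGamma x0 big_ord0 addr0 mul1r. Qed.

(** The least admissible shift for [x] exceeds the one for [x + 1] by exactly one, and the
    additional factor of the product is [x]. *)
Lemma rGamma_rec (x : R) : x <= 0 -> rGamma x = x * rGamma (x + 1).
Proof.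
move=> x0; rewrite /rGamma ltNge x0 /=.
have t0 : 0 <= - x by rewrite oppr_ge0.
have [x1|x1] := ltP 0 (x + 1).
  have -> : Num.truncn (- x) = 0%N.
    by apply: truncn_def; rewrite t0/=; move: x1; lra.
  by rewrite big_ord_recl !big_ord0 !addr0 mulr1 mul1r.
have x2 : 0 <= - (x + 1) by rewrite oppr_ge0.
have /andP[l1 l2] := truncn_itv x2.
have -> : Num.truncn (- x) = (Num.truncn (- (x + 1))).+1.
  apply: truncn_def; move: l1 l2; rewrite -!(natr1 _.+1) -!(natr1 (Num.truncn _)); lra.
set m := Num.truncn (- (x + 1)).
have e1 : x + m.+2%:R = x + 1 + m.+1%:R by rewrite -addrA nat1r.
have e2 : \prod_(i < m.+2) (x + i%:R) = x * \prod_(i < m.+1) (x + 1 + i%:R).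
  rewrite big_ord_recl addr0; congr (x * _).
  by apply: eq_bigr => i _; rewrite lift0 -addrA nat1r.
by rewrite e1 e2 mulrA.
Qed.

End rGamma.

Section sine_series.
Context {R : realType}.
Implicit Types s phi psi : R.

Local Notation S n phi psi s :=
  (\sum_(0 <= k < n) (- s) ^+ k / k`!%:R * sin (phi + k%:R * psi)).

Lemma is_derive_pow_fact (m : nat) (t : R) :
  is_derive t 1 (fun s : R => s ^+ m.+1 / m.+1`!%:R) (t ^+ m / m`!%:R).
Proof.
have h : is_derive t 1 (fun s : R => s ^+ m.+1) (m.+1%:R * t ^+ m).
  elim: m => [|m IH]; first by rewrite expr0 mulr1; exact: deriv_id.
  under [X in is_derive _ _ X]eq_fun do rewrite exprS.
  apply: (is_derive_eq (deriv_mul (deriv_id t) IH)).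
  by rewrite exprS -(natr1 m.+1); ring.
apply: (is_derive_eq (deriv_mul h (deriv_cst t (m.+1`!%:R^-1)))).
rewrite mulr0 add0r factS natrM; field.
by rewrite nat1r !pnatr_eq0 -!lt0n fact_gt0.
Qed.

(** The sum is a partial sum of the series of [Im (e^(i phi) exp(-s e^(i psi)))]. Differentiating
    the error in [s] lowers [n] by one and replaces [phi] by [phi + psi], up to sign, which gives an
    induction on [n] for all [phi] at once. *)
Lemma sine_partial_sum (n : nat) phi psi s : 0 <= s ->
  `|S n phi psi s - expR (- (s * cos psi)) * sin (phi - s * sin psi)| <= s ^+ n / n`!%:R * expR s.
Proof.
elim: n phi s => [|n IH] phi s s0.
  rewrite big_geq// sub0r normrN normrM ger0_norm ?expR_ge0// expr0 fact0 divr1 mul1r.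
  by rewrite (le_trans (ler_piMr (expR_ge0 _) (sin_max _)))// ler_expR -mulrN ler_piMr// lerNl.
pose D n phi s : R := S n phi psi s - expR (- (s * cos psi)) * sin (phi - s * sin psi).
pose U (s : R) : R := s ^+ n.+1 / n.+1`!%:R * expR s.
have mono := is_derive_pow_fact.
have dS (t : R) : is_derive t 1 (fun s => S n.+1 phi psi s) (- S n (phi + psi) psi t).
  have h (k : nat) : is_derive t 1 (fun s : R => (- s) ^+ k.+1 / k.+1`!%:R * sin (phi + k.+1%:R * psi))
      (- ((- t) ^+ k / k`!%:R * sin (phi + psi + k%:R * psi))).
    apply: (is_derive_eq (deriv_mul (deriv_comp (mono k (- t)) (deriv_opp (deriv_id t))) (deriv_cst t _))).
    rewrite mulr0 add0r -natr1 mulrDl mul1r (addrC (_ * psi)) addrA; ring.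
  have H : is_derive t 1 (fun s => \sum_(0 <= k < n) (- s) ^+ k.+1 / k.+1`!%:R * sin (phi + k.+1%:R * psi))
    (\sum_(0 <= k < n) - ((- t) ^+ k / k`!%:R * sin (phi + psi + k%:R * psi))).
    elim: (n) => [|m IHm].
      by under [X in is_derive _ _ X]eq_fun do rewrite big_geq//; rewrite big_geq//; exact: deriv_cst.
    under [X in is_derive _ _ X]eq_fun do rewrite big_nat_recr//=.
    by rewrite big_nat_recr//=; exact: deriv_add.
  under [X in is_derive _ _ X]eq_fun do rewrite big_nat_recl//= mul0r addr0.
  rewrite -sumrN -[X in is_derive _ _ _ X]add0r.
  apply: deriv_add H; rewrite (_ : (fun _ => _) = fun=> sin phi); first exact: deriv_cst.
  by apply/funext => x; rewrite expr0 fact0 divr1 mul1r.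
have dD1 (t : R) : is_derive t 1 (D n.+1 phi) (- D n (phi + psi) t).
  apply: (is_derive_eq (deriv_sub (dS t) (deriv_mul (deriv_expR (deriv_opp (deriv_mul (deriv_id t) (deriv_cst t (cos psi)))))
    (deriv_sin (deriv_sub (deriv_cst t phi) (deriv_mul (deriv_id t) (deriv_cst t (sin psi)))))))).
  have e1 : sin (phi + psi - t * sin psi) =
    sin (phi - t * sin psi) * cos psi + cos (phi - t * sin psi) * sin psi.
    by rewrite -sinD; congr sin; ring.
  rewrite /D e1; ring.
have dU (t : R) : is_derive t 1 U (t ^+ n / n`!%:R * expR t + t ^+ n.+1 / n.+1`!%:R * expR t).
  apply: (is_derive_eq (deriv_mul (mono n t) (deriv_expR (deriv_id t)))); ring.
have D0 : D n.+1 phi 0 = 0.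
  rewrite /D big_nat_recl//= big1_seq ?mul0r ?oppr0 ?expR0.
    by rewrite expr0 fact0 divr1 !mul1r !addr0 subrr.
  by move=> i _; rewrite exprS !mul0r.
have U0 : U 0 = 0 by rewrite /U exprS !mul0r.
(* With [e = 1] and [e = -1] this is the two-sided bound: [U - e D] vanishes at 0 and is
   nondecreasing, its derivative being nonnegative by the induction hypothesis. *)
have key (e : R) : `|e| = 1 -> 0 <= U s - e * D n.+1 phi s.
  move=> e1.
  have dG (t : R) := deriv_sub (dU t) (deriv_scale e (dD1 t)).
  rewrite -[leLHS](_ : U 0 - e * D n.+1 phi 0 = 0); last by rewrite D0 U0 mulr0 subr0.
  apply: (@ger0_derive1_ndecry R (fun t => U t - e * D n.+1 phi t) 0) => //.
  + move=> t; rewrite in_itv/= andbT => t0; rewrite derive1E (@derive_val _ _ _ _ _ _ _ (dG t)).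
    have : `|e * D n (phi + psi) t| <= t ^+ n / n`!%:R * expR t.
      by rewrite normrM e1 mul1r; apply: IH; exact: ltW.
    rewrite ler_norml => /andP[h1 h2].
    have : 0 <= t ^+ n.+1 / n.+1`!%:R * expR t.
      by rewrite mulr_ge0 ?expR_ge0// divr_ge0// exprn_ge0// ltW.
    by move: h1 h2; rewrite mulrN; lra.
  + apply: continuous_subspaceT => t; exact: (is_derive_cont (dG t)).
have k1 := key 1 (normr1 _).
have := key (- 1); rewrite normrN normr1 => /(_ erefl) k2.
rewrite ler_norml -/(D n.+1 phi s) -/(U s); apply/andP; split; move: k1 k2; lra.
Qed.

(** A bound independent of [n], which dominates all partial sums when the series is integrated term
    by term. *)
Lemma sine_partial_sum_le (n : nat) phi psi s : 0 <= s ->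
  `|S n phi psi s| <= expR s.
Proof.
move=> s0; rewrite (le_trans (ler_norm_sum _ _ _))//.
apply: (@le_trans _ _ (series (exp_coeff s) n)).
  rewrite /series/=; apply: ler_sum => k _; rewrite /exp_coeff /= !normrM normrX normrN (ger0_norm s0).
  by rewrite ger0_norm ?invr_ge0// ler_piMr ?sin_max// divr_ge0// exprn_ge0.
rewrite /expR; apply: nondecreasing_cvgn_le; last exact: is_cvg_series_exp_coeff.
by apply: nondecreasing_series => k _ _; exact: exp_coeff_ge0.
Qed.

Lemma sine_series_cvg phi psi s : 0 <= s ->
  S n phi psi s @[n --> \oo] --> expR (- (s * cos psi)) * sin (phi - s * sin psi).
Proof.
move=> s0; apply/subr_cvg0; apply: norm_cvg0.
apply: (@squeeze_cvgr _ _ _ _ (cst 0) (fun n => exp_coeff s n * expR s)).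
- by apply: nearW => n; rewrite normr_ge0/=; exact: sine_partial_sum.
- exact: cvg_cst.
- by rewrite -(mul0r (expR s)); apply: cvgM; [exact: cvg_exp_coeff|exact: cvg_cst].
Qed.

End sine_series.

Section Wright_kernel.
Context {R : realType}.
Local Notation RR := (measurableTypeR R).
Local Notation mu := (@lebesgue_measure R).
Local Notation intg D f := (mu.-integrable D (EFin \o f)).

Variables (b th : R).
Hypotheses (b0 : 0 < b) (b1 : b < 1) (pith : pi / 2 < th) (thpi : th < pi)
  (bth : b * th < pi / 2).

Local Notation K := (ker b th).
Local Notation C := (ker_const th).

(** Both sides satisfy [h(d) = d h(d + 1)] for [d <= 0] and agree on []0, 1[]; the induction is on
    an [n] with [-n < d]. *)
Lemma ker_const_rGamma (d : R) : d < 1 -> C d = rGamma d.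
Proof.
move=> d1; have [n] : exists n : nat, - n%:R < d.
  exists (Num.truncn `|d|).+1; have := truncnS_gt `|d|.
  by have := ler_norm (- d); rewrite normrN; lra.
elim: n d d1 => [|n IH] d d1.
  rewrite oppr0 => d0; rewrite rGamma_gt0//.
  have h := ker_const_Gamma b0 pith thpi bth (introT andP (conj d0 d1)).
  have g0 : Gamma d != 0 by apply: contra_eq_neq h => ->; rewrite mulr0 eq_sym oner_neq0.
  by apply: (mulIf g0); rewrite h mulVf.
move=> hn; have [d0|d0] := ltP 0 d; first by apply: IH; rewrite // (le_lt_trans _ d0)// oppr_le0.
have d1' : d + 1 <= 1 by rewrite -lerBrDr subrr.
have h := ker_const_rec pith thpi d1'.
have e : C d = d * C (d + 1) by move: h; rewrite addrK; lra.
(* At [d = 0] both sides vanish through the factor [d]; the induction hypothesis does not reach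
   [d + 1 = 1]. *)
rewrite rGamma_rec// e; move: d0; rewrite le_eqVlt => /predU1P[->|d0]; first by rewrite !mul0r.
congr (_ * _); apply: IH; first by rewrite -ltrBrDr subrr.
by move: hn; rewrite -natr1; lra.
Qed.

(** When [exp(-X z^b)] is expanded in its power series, the [k]-th term integrates to [(-X)^k / k!]
    times Hankel's integral of order [d - b k], which is the [k]-th term of the Wright series. *)
Lemma Wright_ker1 (d X : R) : d < 1 -> 0 < X -> Wright (- b) d (- X) = K d X 1.
Proof.
move=> d1 X0; rewrite /Wright.
have c0 := ray_cos_gt0 pith thpi; set c := - cos th in c0.
pose phi (r : R) : R := r * sin th + (1 - d) * th.
pose A (r : R) : R := expR (r * cos th) * r `^ (- d).
pose f (n : nat) (r : R) : R := A r *
  \sum_(0 <= k < n) (- (X * r `^ b)) ^+ k / k`!%:R * sin (phi r + k%:R * (b * th)).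
pose t (k : nat) (r : R) : R := (- X) ^+ k / k`!%:R *
  (expR (r * cos th) * r `^ (- (d - b * k%:R)) * sin (r * sin th + (1 - (d - b * k%:R)) * th)).
have dk k : d - b * k%:R < 1 by rewrite (le_lt_trans _ d1)// gerBl mulr_ge0// ltW.
have it k : intg `]0, +oo[ (t k) by apply: intgZl => //; exact: G_intg.
have fE n (r : R) : 0 < r -> f n r = \sum_(0 <= k < n) t k r.
  move=> r0; rewrite /f mulr_sumr; apply: eq_bigr => k _.
  have -> : (- (X * r `^ b)) ^+ k = (- X) ^+ k * r `^ (b * k%:R).
    by rewrite -mulNr exprMn powRrM powR_mulrn ?powR_ge0.
  rewrite /t; have -> : - (d - b * k%:R) = - d + b * k%:R by ring.
  rewrite (@powRD _ _ (- d)) ?(gt_eqF r0) ?implybT// /A /phi.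
  have -> : r * sin th + (1 + (- d + b * k%:R)) * th = r * sin th + (1 - d) * th + k%:R * (b * th) by ring.
  ring.
have If n : intg `]0, +oo[ (f n) /\ pi^-1 * \int[mu]_(r in `]0, +oo[) f n r =
    \sum_(0 <= k < n) ((- X) ^+ k / k`!%:R * rGamma (- b * k%:R + d)).
  suff [i e] : intg `]0, +oo[ (fun r => \sum_(0 <= k < n) t k r) /\
     pi^-1 * \int[mu]_(r in `]0, +oo[) (\sum_(0 <= k < n) t k r) =
    \sum_(0 <= k < n) ((- X) ^+ k / k`!%:R * rGamma (- b * k%:R + d)).
    split.
      by apply: intg_eq i => // r; rewrite /= in_itv/= andbT => r0; rewrite fE.
    by rewrite -e; congr (_ * _); apply: eq_Rint => r; rewrite /= in_itv/= andbT => r0; rewrite fE.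
  elim: n => [|n [IHi IHe]].
    rewrite (_ : (fun _ => _) = fun=> 0); last by apply/funext => r; rewrite big_geq.
    split; first exact: integrable0.
    by rewrite Rintegral_cst// mul0r mulr0 big_geq.
  rewrite (_ : (fun _ => _) = fun r => \sum_(0 <= k < n) t k r + t n r); last first.
    by apply/funext => r; rewrite big_nat_recr.
  split; first exact: intgD.
  rewrite RintD// mulrDr IHe big_nat_recr//=; congr (_ + _).
  rewrite mulNr addrC -ker_const_rGamma// /ker_const /t RintZl//; last exact: G_intg.
  by rewrite mulrCA.
(* Beyond [R0] one has [r^(b-1) <= c / (2 X)], hence [X r^b <= (c / 2) r]. This rests on [b < 1] and
   leaves half of the decay [exp(-c r)] to dominate the partial sums, whose sine factors are at most
   [exp(X r^b)]. *)
pose R0 : R := (2 * X / c) `^ (1 - b)^-1.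
have q0 : 0 < 2 * X / c by rewrite divr_gt0// mulr_gt0.
have R00 : 0 < R0 by rewrite powR_gt0.
have Xr (r : R) : 0 < r -> X * r `^ b <= X * R0 `^ b + c / 2 * r.
  move=> r0; have [rR|rR] := leP r R0.
    by rewrite -[leLHS]addr0 lerD// ?mulr_ge0 ?divr_ge0// ?(ltW c0) ?(ltW r0)// ler_wpM2l ?(ltW X0)// ge0_ler_powR// ?nnegrE// ?(ltW b0)// ltW.
  rewrite -[leLHS]add0r lerD ?mulr_ge0 ?powR_ge0 ?(ltW X0)//.
  have -> : r `^ b = r * r `^ (b - 1).
    by rewrite -{2}(powRr1 (ltW r0)) -powRD ?(gt_eqF r0) ?implybT// addrC subrK.
  have h : r `^ (b - 1) <= (2 * X / c)^-1.
    have -> : (2 * X / c)^-1 = R0 `^ (b - 1).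
      rewrite /R0 -powRrM (_ : (1 - b)^-1 * (b - 1) = -1) ?powR_inv1 ?(ltW q0)//.
      by field; rewrite subr_eq0 gt_eqF.
    have -> : b - 1 = - (1 - b) by ring.
    rewrite !powRN lef_pV2 ?posrE ?powR_gt0//.
    by rewrite ge0_ler_powR// ?nnegrE ?subr_ge0 ltW.
  rewrite mulrCA mulrC ler_wpM2r ?(ltW r0)//.
  rewrite (le_trans (ler_wpM2l (ltW X0) h))// le_eqVlt; apply/orP; left; apply/eqP.
  by field; rewrite !gt_eqF.
have c20 : 0 < c / 2 by rewrite divr_gt0.
have := @dominated_cvgR R `]0, +oo[%classic f (fun r => ker_int b th d X 1 r)
  (fun r => expR (X * R0 `^ b) * (expR (- (c / 2 * r)) * r `^ (- d))) (measurable_itv _).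
case.
- by move=> n; exact: intg_measurable (If n).1.
- move=> r; rewrite /= in_itv/= andbT => r0.
  have s0 : 0 <= X * r `^ b by rewrite mulr_ge0 ?powR_ge0// ltW.
  have -> : ker_int b th d X 1 r = A r *
    (expR (- (X * r `^ b * cos (b * th))) * sin (phi r - X * r `^ b * sin (b * th))).
    rewrite /ker_int /ray_mod /ray_arg /A mulr1 /phi.
    have -> : r * sin th + th + (- (d * th) - X * r `^ b * sin (b * th)) =
      r * sin th + (1 - d) * th - X * r `^ b * sin (b * th) by ring.
    ring.
  apply: cvgM; first exact: cvg_cst.
  exact: sine_series_cvg.
- by apply: intgZl => //; exact: intg_decay_y.
- move=> n r; rewrite /= in_itv/= andbT => r0.
  have s0 : 0 <= X * r `^ b by rewrite mulr_ge0 ?powR_ge0// ltW.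
  rewrite /f normrM ger0_norm ?mulr_ge0 ?expR_ge0 ?powR_ge0//.
  rewrite (le_trans (ler_wpM2l (mulr_ge0 (expR_ge0 _) (powR_ge0 _ _)) (sine_partial_sum_le _ _ _ s0)))//.
  rewrite /A mulrA -mulrA (mulrC (_ `^ _)) !mulrA ler_wpM2r ?powR_ge0// -!expRD ler_expR.
  have -> : r * cos th = - (c * r) by rewrite /c; ring.
  have := Xr _ r0; lra.
move=> _ /(cvgM (@cvg_cst _ pi^-1 _ \oo _)) h.
apply: cvg_lim => //; rewrite /ker.
rewrite (_ : series _ = fun n => pi^-1 * \int[mu]_(r in `]0, +oo[) f n r); first exact: h.
by apply/funext => n; rewrite (If n).2.
Qed.

(** By the substitution of [y r] for [r], the kernel depends on [x y^(-b)] alone, up to a power of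
    [y]. *)
Lemma ker_scale (d x y : R) : d < 1 -> 0 < x -> 0 < y ->
  K d x y = y `^ (d - 1) * K d (x * y `^ (- b)) 1.
Proof.
move=> d1 x0 y0.
have X0 : 0 < x * y `^ (- b) by rewrite mulr_gt0// powR_gt0.
have py : y `^ (d - 1) = y^-1 * y `^ d.
  by rewrite mulrC powRB ?(gt_eqF y0) ?implybT// powRr1// ltW.
have iK := ker_int_intg b0 pith thpi bth d1 (ltW X0) (@ltr01 R).
have [i e] := Rint_scale_pos y0 iK.
rewrite /ker (mulrCA _ pi^-1); congr (_ * _).
transitivity (\int[mu]_(r in `]0, +oo[) (y `^ d * ker_int b th d (x * y `^ (- b)) 1 (y * r))).
  apply: eq_Rint => r; rewrite /= in_itv/= andbT => r0.
  rewrite /ker_int /ray_mod /ray_arg !mulr1 !powRM ?(ltW r0) ?(ltW y0)//.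
  have -> : x * y `^ (- b) * (y `^ b * r `^ b) = x * r `^ b.
    by rewrite powRN; field; rewrite gt_eqF// powR_gt0.
  rewrite !(mulrC y r) (powRN y d); field.
  by rewrite gt_eqF// powR_gt0.
rewrite (RintZl _ (measurable_itv _) i) e py.
by rewrite (mulrA (y `^ d)) (mulrC (y `^ d)).
Qed.

Lemma Wright_ker (d x y : R) : d < 1 -> 0 < x -> 0 < y ->
  y `^ (d - 1) * Wright (- b) d (- x * y `^ (- b)) = K d x y.
Proof.
move=> d1 x0 y0; rewrite ker_scale// mulNr Wright_ker1//.
by rewrite mulr_gt0// powR_gt0.
Qed.

End Wright_kernel.

(** * Uniqueness for truncated Laplace transforms *)

Section Rint_more.
Context {R : realType}.
Local Notation RR := (measurableTypeR R).
Local Notation mu := (@lebesgue_measure R).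
Local Notation intg D f := (mu.-integrable D (EFin \o f)).
Implicit Types (f g K : RR -> R).

Lemma Rint_cat f (a c b : R) : a <= c -> c <= b -> intg `]a, b[ f ->
  \int[mu]_(x in `]a, b[) f x = \int[mu]_(x in `]a, c[) f x + \int[mu]_(x in `]c, b[) f x.
Proof.
move=> ac cb fi.
move: cb; rewrite le_eqVlt => /predU1P[->|cb].
  by rewrite set_itvoo0 // Rintegral_set0 addr0.
have := @Rintegral_itvB R f (BRight a) (BLeft b) c fi.
rewrite !bnd_simp => /(_ ac cb) <-.
rewrite -Rintegral_itv_bndo_bndc; first by rewrite addrC subrK.
by apply: intgS fi => //; apply: subset_itvl; rewrite bnd_simp ltW.
Qed.

Lemma eq_Rint_unpoint (D : set RR) f g (p : R) : measurable D ->
  measurable_fun D f -> measurable_fun D g -> (forall x, D x -> x != p -> f x = g x) ->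
  \int[mu]_(x in D) f x = \int[mu]_(x in D) g x.
Proof.
move=> mD mf mg fg; rewrite /Rintegral; congr fine; apply: ae_eq_integral => //.
- exact/measurable_EFinP.
- exact/measurable_EFinP.
exists [set p]; split; [exact: measurable_set1|exact: lebesgue_measure_set1|].
by move=> x /=; apply: contra_notP => xp Dx; rewrite /= fg//; apply/eqP.
Qed.

Lemma measurable_unpoint (D : set RR) f (p : R) : measurable D -> measurable_fun D f ->
  measurable_fun D (fun x => if x == p then 0 else f x).
Proof.
move=> mD mf; rewrite (_ : (fun _ => _) = f \_ (~` [set p])).
  by apply: measurable_patch => //; apply: measurableC; exact: measurable_set1.
apply/funext => x; rewrite patchE; case: eqVneq => [->|xp]; first by rewrite memNset//=; apply/not_notP.
by rewrite mem_set//=; apply/eqP.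
Qed.

(** Both integrands are reset to 0 at [p], which changes no integral. The exceptional point occurs
    when an endpoint of integration moves with the parameter. *)
Lemma dominated_cvg_filter_unpoint (D : set RR) (a p : R) (h : R -> RR -> R) f g : measurable D ->
  (\forall y \near a, measurable_fun D (h y)) ->
  (forall x, D x -> x != p -> h y x @[y --> a] --> f x) ->
  measurable_fun D f ->
  intg D g ->
  (\forall y \near a, forall x, D x -> `|h y x| <= g x) ->
  \int[mu]_(x in D) h y x @[y --> a] --> \int[mu]_(x in D) f x.
Proof.
move=> mD mh ch mf ig hg.
rewrite -(@eq_Rint_unpoint D (fun x => if x == p then 0 else f x) f p)//; last 2 first.
- exact: measurable_unpoint.
- by move=> x _ /negbTE ->.
have H := @dominated_cvg_filter R D a (fun y x => if x == p then 0 else h y x) (fun x => if x == p then 0 else f x) g mD.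
apply: cvg_trans (H _ _ ig _); last first.
- near=> y => x Dx; have hyx : `|h y x| <= g x by move: x Dx; near: y.
  by case: ifP => // _; rewrite (le_trans _ hyx)// normr0.
- move=> x Dx; have [xp|xp] := eqVneq x p; first exact: cvg_cst.
  exact: ch.
- by near=> y; apply: measurable_unpoint => //; near: y.
apply: near_eq_cvg; near=> y.
rewrite (@eq_Rint_unpoint D (fun x => if x == p then 0 else h y x) (h y) p)//; last 3 first.
- by apply: measurable_unpoint => //; near: y.
- by near: y.
- by move=> x _ /negbTE ->.
Unshelve. all: by end_near. Qed.

Lemma measurable_oo f (a b : R) : (forall x : R, a < x < b -> {for x, continuous (f : R -> R)}) ->
  measurable_fun (`]a, b[%classic : set RR) f.
Proof.
move=> cf; apply: open_continuous_measurable_fun; first exact: interval_open.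
by move=> x /set_mem; rewrite /= in_itv/=; exact: cf.
Qed.

Lemma is_derive_int f (T y : R) : intg `]0, T[ f -> 0 < y < T -> {for y, continuous (f : R -> R)} ->
  is_derive y 1 (fun y => \int[mu]_(s in `]0, y[) f s) (f y).
Proof.
move=> fi /andP[y0 yT] cf.
pose u := (y + T) / 2; have [yu uT] : y < u /\ u < T by rewrite /u; split; lra.
have iS (z : R) : z < T -> intg `]0, z] f.
  by move=> zT; apply: intgS fi => //; apply: subset_itvl; rewrite bnd_simp.
have [dF eF] := @continuous_FTC1 R f (BRight 0) y u yu (iS _ uT) y0 cf.
have h : is_derive y 1 (fun y => \int[mu]_(s in `]0, y]) f s) (f y).
  by rewrite -eF derive1E; apply/derivableP.
apply: near_eq_is_derive h; near=> z.
rewrite Rintegral_itv_bndo_bndc//.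
apply: (intgS _ _ _ (iS u uT)) => //; apply: subset_itvl; rewrite bnd_simp ltW//.
by near: z; exact: lt_nbhsl.
Unshelve. all: by end_near. Qed.

End Rint_more.

Section uniqueness.
Context {R : realType}.
Local Notation RR := (measurableTypeR R).
Local Notation mu := (@lebesgue_measure R).
Local Notation intg D f := (mu.-integrable D (EFin \o f)).
Implicit Types (f g K : RR -> R).

Lemma series_exp_le (x : R) n : 0 <= x -> series (exp_coeff x) n <= expR x.
Proof.
move=> x0; rewrite /expR; apply: nondecreasing_cvgn_le; last exact: is_cvg_series_exp_coeff.
by apply: nondecreasing_series => k _ _; exact: exp_coeff_ge0.
Qed.

Lemma cvg_eq (T : Type) (F : set_system T) (f : T -> R) (a c : R) : c = a ->
  f x @[x --> F] --> c -> f x @[x --> F] --> a.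
Proof. by move=> ->. Qed.

Lemma cvg_expR_nat (a : R) : 0 < a -> expR (- (n.+1%:R * a)) @[n --> \oo] --> (0 : R).
Proof.
move=> a0.
have nn : (n.+1%:R : R) @[n --> \oo] --> +oo by rewrite (cvg_shiftS (fun n => n%:R : R)); exact: cvgr_idn.
apply: (cvg_comp (fun n : nat => n.+1%:R : R) (fun y : R => expR (- (y * a))) nn).
apply: (cvg_comp (fun y : R => y * a) (fun y : R => expR (- y))); last exact: cvgr_expR.
by apply: gt0_cvgMly => //; exact: cvg_id.
Qed.

Lemma cvg_expR_expR_nat (a : R) : 0 < a -> expR (- expR (n.+1%:R * a)) @[n --> \oo] --> (0 : R).
Proof.
move=> a0; apply: (@squeeze_cvgr _ _ _ _ (fun=> 0) (fun n : nat => expR (- (n.+1%:R * a)))).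
- apply: nearW => n; apply/andP; split; first exact: expR_ge0.
  rewrite ler_expR lerN2; have := expR_ge1Dx (n.+1%:R * a); lra.
- exact: cvg_cst.
- exact: cvg_expR_nat.
Qed.

Lemma measurable_expR_lin (D : set RR) (a b : R) : measurable D ->
  measurable_fun D (fun s : RR => expR (a * s + b)).
Proof.
move=> mD; apply: measurable_funTS; apply: continuous_measurable_fun => s.
exact: (is_derive_cont (deriv_expR (deriv_add (deriv_scale a (deriv_id s)) (deriv_cst s b)))).
Qed.

Lemma intgM_bounded (D : set RR) f g (M : R) : measurable D -> intg D f -> measurable_fun D g ->
  (forall s, D s -> `|g s| <= M) -> intg D (fun s => g s * f s).
Proof.
move=> mD fi mg gM.
apply: (intg_le (g := fun s => M * `|f s|)) => //.
- by apply: measurable_funM => //; exact: intg_measurable fi.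
- by apply: intgZl => //; exact: (integrable_norm fi).
- by move=> s Ds; rewrite normrM ler_wpM2r// gM.
Qed.

(* The transforms at multiples of n combine into the integral of f against
   1 - exp(-exp(n(t-s))), which approaches the indicator of s < t. *)
Lemma laplace_decay_Rint_eq0 f (Y Z C t : R) : 0 < t -> t < Z -> Z <= Y -> 0 <= C -> intg `]0, Y[ f ->
  (forall n : nat, (0 < n)%N ->
    `|\int[mu]_(s in `]0, Y[) (expR (- (n%:R * s)) * f s)| <= C * expR (- (n%:R * Z))) ->
  \int[mu]_(s in `]0, t[) f s = 0.
Proof.
move=> t0 tZ ZY C0 fi hL.
have mD : measurable (`]0, Y[%classic : set RR) by exact: measurable_itv.
pose z (n : nat) (s : R) : R := expR (n%:R * (t - s)).
have mz n : measurable_fun (`]0, Y[%classic : set RR) (z n).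
  rewrite (_ : z n = fun s => expR (- n%:R * s + n%:R * t)); first exact: measurable_expR_lin.
  by apply/funext => s; rewrite /z; congr expR; ring.
have zle n s : (`]0, Y[%classic : set RR) s -> z n s <= expR (n%:R * t).
  rewrite /= in_itv/= => /andP[s0 _]; rewrite /z ler_expR ler_wpM2l// gerBl ltW//.
have mexp : measurable_fun setT (expR : R -> R).
  exact: continuous_measurable_fun (@continuous_expR R).
have ie n : intg `]0, Y[ (fun s => expR (- z n s) * f s).
  apply: (@intgM_bounded _ _ _ 1) => //.
    by apply: (measurableT_comp mexp); exact: measurableT_comp.
  by move=> s _; rewrite ger0_norm ?expR_ge0// expR_le1 oppr_le0 expR_ge0.
have iL (k : R) : 0 <= k -> intg `]0, Y[ (fun s => expR (- (k * s)) * f s).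
  move=> k0; apply: (@intgM_bounded _ _ _ 1) => //.
    have := @measurable_expR_lin `]0, Y[%classic (- k) 0 mD.
    by rewrite (_ : (fun s : RR => expR (- k * s + 0)) = fun s => expR (- (k * s)))//; apply/funext => s; rewrite addr0 mulNr.
  move=> s; rewrite /= in_itv/= => /andP[s0 _].
  by rewrite ger0_norm ?expR_ge0// expR_le1 oppr_le0 mulr_ge0// ltW.
pose q (n : nat) : R := expR (- (n%:R * (Z - t))).
(* When [exp(-z)] is expanded in powers of [z], the term of order [k >= 1] is, up to sign,
   [exp(k n t) / k!] times the transform at [k n]. The hypothesis bounds it by
   [C exp(-k n (Z - t)) / k!], so these terms add up to at most [C * expR 1 * q n]. *)
have key (n : nat) : (0 < n)%N ->
    `|\int[mu]_(s in `]0, Y[) (expR (- z n s) * f s) - \int[mu]_(s in `]0, Y[) f s| <=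
    C * expR 1 * q n.
  move=> n0.
  pose P (N : nat) (s : R) : R := series (exp_coeff (- z n s)) N * f s.
  pose T (k : nat) (s : R) : R := (- 1) ^+ k / k`!%:R * expR (k%:R * n%:R * t) * (expR (- ((k * n)%:R * s)) * f s).
  have PE N s : P N s = \sum_(0 <= k < N) T k s.
    rewrite /P /series/= mulr_suml; apply: eq_bigr => k _.
    have ez : (- z n s) ^+ k = (-1) ^+ k * (expR (k%:R * n%:R * t) * expR (- (k%:R * n%:R * s))).
      by rewrite -(mulN1r (z n s)) exprMn /z -expRM_natl -expRD; congr (_ * expR _); ring.
    by rewrite /T /exp_coeff/= ez natrM; ring.
  have iT k : intg `]0, Y[ (T k) by apply: intgZl => //; exact: iL.
  have Psum N : intg `]0, Y[ (fun s => \sum_(0 <= k < N) T k s) /\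
     \int[mu]_(s in `]0, Y[) (\sum_(0 <= k < N) T k s) = \sum_(0 <= k < N) \int[mu]_(s in `]0, Y[) T k s.
    elim: N => [|N [IHi IHe]].
      rewrite (_ : (fun _ => _) = fun=> 0); last by apply/funext => s; rewrite big_geq.
      by split; [exact: integrable0|rewrite Rintegral_cst// mul0r big_geq].
    rewrite (_ : (fun _ => _) = fun s => \sum_(0 <= k < N) T k s + T N s); last first.
      by apply/funext => s; rewrite big_nat_recr.
    by split; [exact: intgD|rewrite RintD// IHe big_nat_recr].
  have T0 : \int[mu]_(s in `]0, Y[) T 0%N s = \int[mu]_(s in `]0, Y[) f s.
    apply: eq_Rint => s _; rewrite /T expr0 fact0 divr1 !mul0r oppr0 expR0; ring.
  have Tk (k : nat) : `|\int[mu]_(s in `]0, Y[) T k.+1 s| <= exp_coeff 1 k.+1 * (C * q n).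
    rewrite /T RintZl//; last exact: iL.
    rewrite !normrM normrX normrN1 expr1n mul1r (ger0_norm (expR_ge0 _)) ger0_norm ?invr_ge0//.
    rewrite /exp_coeff/= expr1n mul1r -mulrA ler_wpM2l ?invr_ge0//.
    have kn : (0 < k.+1 * n)%N by rewrite muln_gt0.
    rewrite (le_trans (ler_wpM2l (expR_ge0 _) (hL _ kn)))// mulrCA ler_wpM2l// -expRD ler_expR natrM.
    have h : n%:R * (Z - t) <= k.+1%:R * (n%:R * (Z - t)).
      by rewrite ler_peMl ?ler1n// mulr_ge0// subr_ge0 ltW.
    by move: h; lra.
  have PN (N : nat) : `|\int[mu]_(s in `]0, Y[) P N.+1 s - \int[mu]_(s in `]0, Y[) f s| <= C * expR 1 * q n.
    rewrite (_ : \int[mu]_(s in `]0, Y[) P N.+1 s = \sum_(0 <= k < N.+1) \int[mu]_(s in `]0, Y[) T k s); last first.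
      by rewrite -(Psum N.+1).2; apply: eq_Rint => s _; exact: PE.
    rewrite big_nat_recl//= T0 addrAC subrr add0r.
    rewrite (le_trans (ler_norm_sum _ _ _))//.
    rewrite (le_trans (ler_sum _ (fun k _ => Tk k)))// -mulr_suml mulrAC mulrC.
    rewrite ler_wpM2l ?mulr_ge0 ?expR_ge0//.
    rewrite (le_trans _ (@series_exp_le 1 N.+1 ler01))// /series/= big_nat_recl//=.
    by rewrite lerDr exp_coeff_ge0.
  have [_ cP] := @dominated_cvgR R `]0, Y[%classic P (fun s => expR (- z n s) * f s)
    (fun s => expR (expR (n%:R * t)) * `|f s|) mD
    ltac:(move=> N; rewrite (_ : P N = fun s => \sum_(0 <= k < N) T k s); [exact: intg_measurable (Psum N).1|by apply/funext => s; exact: PE])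
    ltac:(move=> s _; apply: cvgM; [exact: is_cvg_series_exp_coeff|exact: cvg_cst])
    ltac:(by apply: intgZl => //; exact: (integrable_norm fi))
    ltac:(move=> N s Ds; rewrite normrM ler_wpM2r//;
      rewrite (le_trans (ler_norm_sum _ _ _))//;
      rewrite -(_ : series (exp_coeff (z n s)) N = \sum_(0 <= i < N) `|exp_coeff (- z n s) i|);
      [by rewrite (le_trans (series_exp_le _ (expR_ge0 _)))// ler_expR; exact: zle
      |by rewrite /series/=; apply: eq_bigr => k _; rewrite /exp_coeff/= normrM normrX normrN
         (ger0_norm (expR_ge0 _)) ger0_norm ?invr_ge0]).
  have c2 : `|\int[mu]_(s in `]0, Y[) P N.+1 s - \int[mu]_(s in `]0, Y[) f s| @[N --> \oo] -->
     `|\int[mu]_(s in `]0, Y[) (expR (- z n s) * f s) - \int[mu]_(s in `]0, Y[) f s|.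
    apply: cvg_norm; apply: cvgB; last exact: cvg_cst.
    by rewrite (cvg_shiftS (fun N => \int[mu]_(s in `]0, Y[) P N s)).
  rewrite -(cvg_lim _ c2)//; apply: limr_le; first by apply/cvg_ex; exists (`|\int[mu]_(s in `]0, Y[) (expR (- z n s) * f s) - \int[mu]_(s in `]0, Y[) f s|).
  by apply: nearW => N; exact: PN.
pose I0 := \int[mu]_(s in `]0, Y[) f s.
pose It := \int[mu]_(s in `]0, t[) f s.
(* [1 - exp(-z)] minus the indicator of [s < t] tends to 0 except at [s = t]. The index [n + 1]
   keeps the transform parameter positive, as [key] demands. *)
pose h (n : nat) (s : R) : R := f s - expR (- z n.+1 s) * f s - (f \_ `]-oo, t[) s.
have tY : t < Y := lt_le_trans tZ ZY.
have eI : It = \int[mu]_(s in `]0, Y[) (f \_ `]-oo, t[) s.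
  rewrite -Rintegral_mkcondr; congr (Rintegral _ _ _); apply/seteqP; split => x /=; rewrite !in_itv/=.
    by move=> /andP[-> xt]; rewrite xt (lt_trans xt tY).
  by move=> [/andP[-> _] ->].
have ip : intg `]0, Y[ (f \_ `]-oo, t[).
  apply: (intg_le (g := fun s => `|f s|)) => //.
  - by apply: measurable_patch => //; exact: intg_measurable fi.
  - exact: (integrable_norm fi).
  - by move=> s _; rewrite patchE; case: ifP => // _; rewrite normr0.
have ih n : intg `]0, Y[ (h n) by apply: intgB => //; exact: intgB.
have c1 : \int[mu]_(s in `]0, Y[) h n s @[n --> \oo] --> (0 : R).
  apply: (@dominated_cvgR_unpoint R _ _ (fun s => 2 * `|f s|) t) => //.
  - by move=> n; exact: intg_measurable (ih n).
  - move=> s Ds st.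
    have pE : (f \_ `]-oo, t[) s = if s < t then f s else 0.
      rewrite patchE; congr (if _ then _ else _).
      by apply/idP/idP; rewrite inE/= in_itv.
    rewrite /h; under eq_fun do rewrite pE.
    case: ifPn => ts.
      rewrite (_ : 0 = f s - 0 * f s - f s); last by ring.
      apply: cvgB; last exact: cvg_cst.
      apply: cvgB; first exact: cvg_cst.
      apply: cvgM; last exact: cvg_cst.
      by apply: cvg_expR_expR_nat; rewrite subr_gt0.
    have {}ts : t < s by rewrite lt_neqAle eq_sym st leNgt.
    apply: (@cvg_eq _ _ _ _ (f s - 1 * f s - 0)); first by ring.
    apply: cvgB; last exact: cvg_cst.
    apply: cvgB; first exact: cvg_cst.
    apply: cvgM; last exact: cvg_cst.
    rewrite -expR0 -oppr0; apply: continuous_cvg; first exact: continuous_expR.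
    apply: cvgN.
    rewrite /z (_ : (fun n => _) = fun n : nat => expR (- (n.+1%:R * (s - t)))); last first.
      by apply/funext => n; congr expR; ring.
    by apply: cvg_expR_nat; rewrite subr_gt0.
  - by apply: intgZl => //; exact: (integrable_norm fi).
  - move=> n s _; rewrite /h mulr_natl mulr2n (le_trans (ler_normB _ _))// lerD//.
      rewrite -{1}(mul1r (f s)) -mulrBl normrM ler_piMl// ger0_norm.
        by rewrite gerBl expR_ge0.
      by rewrite subr_ge0 expR_le1 oppr_le0 expR_ge0.
    by rewrite patchE; case: ifP => // _; rewrite normr0.
have c2 : \int[mu]_(s in `]0, Y[) h n s @[n --> \oo] --> - It.
  rewrite (_ : (fun n => _) = fun n => (I0 - \int[mu]_(s in `]0, Y[) (expR (- z n.+1 s) * f s)) - It); last first.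
    apply/funext => n; rewrite RintB//; last exact: intgB.
    by rewrite RintB// -eI.
  apply: (@cvg_eq _ _ _ _ (0 - It)); first by rewrite add0r.
  apply: cvgB; last exact: cvg_cst.
  apply: norm_cvg0.
  apply: (@squeeze_cvgr _ _ _ _ (cst 0) (fun n => C * expR 1 * q n.+1)).
  - by apply: nearW => n; rewrite normr_ge0 distrC/=; exact: key.
  - exact: cvg_cst.
  - rewrite -(mulr0 (C * expR 1)); apply: cvgM; first exact: cvg_cst.
    by apply: cvg_expR_nat; rewrite subr_gt0.
have e : - It = 0 by rewrite -(cvg_lim _ c2)// (cvg_lim _ c1).
by rewrite -/It -[It]opprK e oppr0.
Qed.

(** The primitive of [f] vanishes on all of []0, Z[], and its derivative at [t] is [f t]. *)
Lemma laplace_decay_eq0 f (Y Z C t : R) : 0 < t -> t < Z -> Z <= Y -> 0 <= C -> intg `]0, Y[ f ->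
  (forall n : nat, (0 < n)%N ->
    `|\int[mu]_(s in `]0, Y[) (expR (- (n%:R * s)) * f s)| <= C * expR (- (n%:R * Z))) ->
  {for t, continuous (f : R -> R)} -> f t = 0.
Proof.
move=> t0 tZ ZY C0 fi hL cf.
have tY : t < Y := lt_le_trans tZ ZY.
have d1 := is_derive_int fi (introT andP (conj t0 tY)) cf.
have d0 : is_derive t 1 (fun y => \int[mu]_(s in `]0, y[) f s) 0.
  apply: near_eq_is_derive (deriv_cst t (0 : R)); near=> y.
  by rewrite (@laplace_decay_Rint_eq0 f Y Z C y)//; near: y; [exact: lt_nbhsr|exact: lt_nbhsl].
by rewrite -(@derive_val _ _ _ _ _ _ _ d1) (@derive_val _ _ _ _ _ _ _ d0).
Unshelve. all: by end_near. Qed.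

End uniqueness.

(** * Convolution and fractional integrals *)

Section convolution.
Context {R : realType}.
Local Notation RR := (measurableTypeR R).
Local Notation mu := (@lebesgue_measure R).
Local Notation intg D f := (mu.-integrable D (EFin \o f)).
Implicit Types (f g K : RR -> R).

Definition conv f K (y : R) : R := \int[mu]_(s in `]0, y[) (f s * K (y - s)).

Definition lap (Y : R) f (p : R) : R := \int[mu]_(s in `]0, Y[) (expR (- (p * s)) * f s).

Definition Lap f (p : R) : R := \int[mu]_(s in `]0, +oo[) (expR (- (p * s)) * f s).

(** Absolute convergence of the transform at [p = 1], hence at every [p >= 1]; the spare factor
    [exp(-(p - 1) z)] produces the exponentially small truncation errors. *)
Definition kernel_class K := intg `]0, +oo[ (fun z => expR (- z) * K z).

Lemma kernel_class_exp K (p : R) : 1 <= p -> kernel_class K ->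
  intg `]0, +oo[ (fun z => expR (- (p * z)) * K z).
Proof.
move=> p1 iK.
have := @intgM_bounded R `]0, +oo[%classic _ (fun z => expR (- (p - 1) * z + 0)) 1 (measurable_itv _) iK
  (measurable_expR_lin _ _ (measurable_itv _)).
have h : forall s, (`]0, +oo[%classic : set RR) s -> `|expR (- (p - 1) * s + 0)| <= 1.
  move=> s; rewrite /= in_itv/= andbT => s0; rewrite ger0_norm ?expR_ge0// addr0.
  by rewrite expR_le1 mulNr oppr_le0 mulr_ge0 ?subr_ge0// ltW.
move=> /(_ h); apply: intg_eq => // s _.
by rewrite mulrA -expRD; congr (expR _ * _); ring.
Qed.

Lemma patch_itvE f (i : interval R) (s : R) :
  (f \_ ([set` i] : set RR)) s = if s \in i then f s else 0.
Proof.
rewrite patchE; congr (if _ then _ else _).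
by apply/idP/idP; rewrite inE.
Qed.

Lemma indic_itvE (i : interval R) (s : R) :
  \1_([set` i] : set RR) s = (s \in i)%:R :> R.
Proof.
rewrite indicE; congr (nat_of_bool _)%:R.
by apply/idP/idP; rewrite inE.
Qed.

(** The product formula is exact on the full quadrant; the cut at [Y] drops, for each [s < Y], the
    values [z >= Y - s] of the kernel variable. There [exp(-p z)] is at most
    [exp(-(p-1)(Y-s)) exp(-z)], and the factor [exp(-p s)] supplies the missing [exp(-(p-1) s)]. *)
Lemma conv_laplace f K (Y p : R) : 0 < Y -> 1 <= p -> intg `]0, Y[ f -> kernel_class K ->
  (forall y, 0 < y < Y -> intg `]0, y[ (fun s => f s * K (y - s))) ->
  intg `]0, Y[ (conv f K) /\
  `|lap Y (conv f K) p - Lap K p * lap Y f p| <=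
    expR (- ((p - 1) * Y)) * ((\int[mu]_(s in `]0, Y[) `|f s|) * (\int[mu]_(z in `]0, +oo[) `|expR (- z) * K z|)).
Proof.
move=> Y0 p1 fi iK ifK.
have p0 : 0 <= p by rewrite (le_trans ler01).
have ik := kernel_class_exp p1 iK.
have mI (a b : itv_bound R) : measurable ([set` Interval a b] : set RR) by exact: measurable_itv.
pose k := (fun z : RR => expR (- (p * z)) * K z) \_ `]0, +oo[.
have ikT : intg setT k by apply/(intg_restrict _ (mI _ _)).
have eb (s : R) : 0 < s -> expR (- (p * s)) <= 1 by move=> s0; rewrite expR_le1 oppr_le0 mulr_ge0// ltW.
have ief : intg `]0, Y[ (fun s => expR (- (p * s)) * f s).
  have := @intgM_bounded R `]0, Y[%classic _ (fun z => expR (- p * z + 0)) 1 (measurable_itv _) fi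
    (measurable_expR_lin _ _ (measurable_itv _)).
  have h s : (`]0, Y[%classic : set RR) s -> `|expR (- p * s + 0)| <= 1.
    rewrite /= in_itv/= => /andP[s0 _]; rewrite ger0_norm ?expR_ge0// addr0 mulNr; exact: eb.
  by move=> /(_ h); apply: intg_eq => // s _; rewrite addr0 mulNr.
pose F := (fun s : RR => expR (- (p * s)) * f s) \_ `]0, Y[.
have iF : intg setT F by apply/(intg_restrict _ (mI _ _)).
(* The double integrand in [s = q.1] and [y = q.2], with both factors extended by 0 and the
   indicator cutting at [y < Y]. The form [1 * y + - s] fits the affine change of variables. *)
pose h (q : RR * RR) : R := F q.1 * (k (1 * q.2 + - q.1) * \1_(`]-oo, Y[%classic : set RR) q.2).
have mF := intg_measurable iF; have mk := intg_measurable ikT.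
have mh : measurable_fun setT h.
  apply: measurable_funM; first exact: (measurableT_comp mF measurable_fst).
  apply: measurable_funM.
    apply: (measurableT_comp mk); apply: measurable_funD; last exact: measurableT_comp.
    exact: measurable_funM.
  apply: (measurableT_comp _ measurable_snd).
  by apply: measurable_indic; exact: mI.
have ind_le (y : RR) : `|\1_(`]-oo, Y[%classic : set RR) y : R| <= 1.
  by rewrite indicE; case: (_ \in _); rewrite ?normr1 ?normr0.
have itr (s : R) : intg setT (fun y => k (1 * y + - s) * \1_(`]-oo, Y[%classic : set RR) y).
  have := @intgM_bounded R setT _ (\1_(`]-oo, Y[%classic : set RR)) 1 measurableT
    (intg_affine (- s) (oner_neq0 _) ikT) (measurable_indic (mI _ _)) (fun y _ => ind_le y).
  by apply: intg_eq => // y _; rewrite mulrC.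
pose Nk := \int[mu]_y `|k y|.
have shift (g : RR -> R) (s : R) : intg setT g ->
    intg setT (fun y => g (1 * y + - s)) /\ \int[mu]_y g (1 * y + - s) = \int[mu]_y g y.
  move=> ig; have [i e] := integral_affine (- s) (oner_neq0 R) ig.
  by split=> //; rewrite e normr1 invr1 mul1r.
have ikn := integrable_norm ikT : intg setT (fun y => `|k y|).
have hle s : \int[mu]_y `|h (s, y)| <= `|F s| * Nk.
  have [j1 j2] := shift _ s ikn; rewrite /Nk -j2 -(RintZl _ measurableT j1).
  apply: le_Rintegral => //.
  - exact: (integrable_norm (intgZl (F s) measurableT (itr s))).
  - exact: (intgZl _ measurableT j1).
  - by move=> y _; rewrite /h/= normrM ler_wpM2l// normrM ler_piMr.
have h1 s : intg setT (fun y => h (s, y)) by exact: (intgZl (F s) measurableT (itr s)).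
have h2 : intg setT (fun s => \int[mu]_y `|h (s, y)|).
  apply: (intg_le (g := fun s => `|F s| * Nk)) => //.
  - by apply: (measurable_Rintegral_param (h := fun q => `|h q|)); exact: measurableT_comp.
  - by apply: intgZr => //; exact: (integrable_norm iF).
  - by move=> s _; rewrite ger0_norm; [exact: hle|exact: Rintegral_ge0].
have innery (y : R) : \int[mu]_s h (s, y) = ((fun y => expR (- (p * y)) * conv f K y) \_ `]0, Y[) y.
  rewrite patch_itvE in_itv/=; case: ifPn => [yY|ny].
    rewrite /conv -(RintZl _ (mI _ _) (ifK y yY)) Rintegral_mkcond; apply: eq_Rint => s _.
    rewrite patch_itvE /h /F /k !patch_itvE !in_itv/= !andbT mul1r.
    have /andP[y0 yY'] := yY.
    rewrite indic_itvE in_itv/= yY' mulr1.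
    have -> : (0 < y - s) = (s < y) by rewrite subr_gt0.
    case: (ltP 0 s) => s0 /=; last by rewrite mul0r.
    case: (ltP s y) => sy; last by rewrite mulr0.
    rewrite (lt_trans sy yY').
    have -> : - (p * y) = - (p * s) + - (p * (y - s)) by ring.
    by rewrite expRD; ring.
  rewrite (@eq_Rint R setT _ (fun=> 0)); first by rewrite Rintegral_cst// mul0r.
  move=> s _; rewrite /h /F /k !patch_itvE !in_itv/= mul1r andbT.
  case: ifPn => [/andP[s0 sY]|_]; last by rewrite mul0r.
  rewrite indic_itvE in_itv/=; have [yY|yY] := ltP y Y; last by rewrite !mulr0.
  rewrite subr_gt0; case: (ltP s y) => sy; last by rewrite !(mul0r, mulr0).
  by case/negP: ny; rewrite yY (lt_trans s0 sy).
have [i1 _ i2 sw] := FubiniR mh h1 h2.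
have e1 : lap Y (conv f K) p = \int[mu]_s \int[mu]_y h (s, y).
  rewrite sw /lap Rintegral_mkcond; apply: eq_Rint => y _.
  by rewrite innery.
clear sw.
have ice : intg `]0, Y[ (fun y => expR (- (p * y)) * conv f K y).
  apply/(intg_restrict _ (mI _ _)).
  rewrite (_ : _ \_ _ = fun y => \int[mu]_s h (s, y)); first exact: i2.
  by apply/funext => y; rewrite innery.
split.
  have := @intgM_bounded R `]0, Y[%classic _ (fun z => expR (p * z + 0)) (expR (p * Y)) (mI _ _) ice
    (measurable_expR_lin _ _ (mI _ _)).
  have hb s : (`]0, Y[%classic : set RR) s -> `|expR (p * s + 0)| <= expR (p * Y).
    rewrite /= in_itv/= => /andP[s0 sY]; rewrite ger0_norm ?expR_ge0// addr0 ler_expR.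
    by rewrite ler_wpM2l// ltW.
  move=> /(_ hb); apply: intg_eq => // s _.
  by rewrite mulrA -expRD addr0 subrr expR0 mul1r.
have e2 : Lap K p * lap Y f p = \int[mu]_s (F s * Lap K p).
  rewrite /lap Rintegral_mkcond -/F -RintZl//; apply: eq_Rint => s _; exact: mulrC.
have iF2 : intg setT (fun s => F s * Lap K p) by apply: intgZr.
rewrite e1 e2 -RintB//.
set N1 := \int[mu]_(z in `]0, +oo[) `|expR (- z) * K z|.
set E := expR (- ((p - 1) * Y)).
pose k1 := (fun z : RR => expR (- z) * K z) \_ `]0, +oo[.
have ik1 : intg setT k1 by apply/(intg_restrict _ (mI _ _)).
have ik1n := integrable_norm ik1 : intg setT (fun y => `|k1 y|).
have N1E : N1 = \int[mu]_y `|k1 y|.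
  rewrite /N1 Rintegral_mkcond; apply: eq_Rint => y _.
  by rewrite /k1 !patch_itvE; case: ifP => // _; rewrite normr0.
have ifn : intg `]0, Y[ (fun s => `|f s|) by exact: (integrable_norm fi).
rewrite [X in _ <= X]mulrA [X in X * _]mulrC -mulrA [X in _ <= X]mulrC -(RintZl _ (mI _ _) ifn) [X in _ <= X]Rintegral_mkcond.
apply: norm_int_le => //.
- exact: intgB.
- by apply/(intg_restrict _ (mI _ _)); exact: intgZl.
move=> s _; rewrite patch_itvE in_itv/= /F.
rewrite [X in `|X - _|](_ : _ = F s * \int[mu]_y (k (1 * y + - s) * \1_(`]-oo, Y[%classic : set RR) y)); last first.
  by rewrite -RintZl//; exact: itr.
rewrite /F patch_itvE in_itv/=; case: ifPn => [/andP[s0 sY]|_]; last first.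
  by rewrite !mul0r subr0 normr0.
have [j1 j2] := shift _ s ikT.
have LK : Lap K p = \int[mu]_y k (1 * y + - s).
  by rewrite j2 /Lap Rintegral_mkcond.
rewrite -mulrBr LK -(RintB measurableT (itr s) j1).
have [l1 l2] := shift _ s ik1n.
have A : `|\int[mu]_y (k (1 * y + - s) * \1_(`]-oo, Y[%classic : set RR) y - k (1 * y + - s))| <=
    expR (- ((p - 1) * (Y - s))) * N1.
  rewrite N1E -l2 -(RintZl _ measurableT l1); apply: norm_int_le => //.
  - by apply: intgB => //; exact: itr.
  - exact: (intgZl _ measurableT l1).
  move=> y _; rewrite mul1r indic_itvE in_itv/=; have [yY|yY] := ltP y Y.
    by rewrite mulr1 subrr normr0 mulr_ge0 ?expR_ge0.
  rewrite mulr0 sub0r normrN /k /k1 !patch_itvE in_itv/= andbT.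
  case: ifP => // ys; last by rewrite normr0 mulr0.
  rewrite !normrM !(ger0_norm (expR_ge0 _)) mulrA ler_wpM2r// -expRD ler_expR.
  have : (p - 1) * (Y - s) <= (p - 1) * (y - s) by rewrite ler_wpM2l ?subr_ge0// lerB.
  by clear; lra.
rewrite normrM (le_trans (ler_wpM2l (normr_ge0 _) A))// normrM (ger0_norm (expR_ge0 _)).
have -> : expR (- (p * s)) * `|f s| * (expR (- ((p - 1) * (Y - s))) * N1) =
   (expR (- (p * s)) * expR (- ((p - 1) * (Y - s)))) * (N1 * `|f s|) by ring.
rewrite [X in _ <= X](_ : _ = E * (N1 * `|f s|)); last by ring.
rewrite ler_wpM2r//.
  by rewrite mulr_ge0// N1E Rintegral_ge0.
rewrite /E -expRD ler_expR; move: s0 p1; clear; lra.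
Qed.

Lemma kernel_intg K (y : R) : kernel_class K -> intg `]0, y[ K.
Proof.
move=> iK.
have mI : measurable (`]0, y[%classic : set RR) by exact: measurable_itv.
have i1 : intg `]0, y[ (fun z => expR (- z) * K z).
  apply: intgS iK => //.
  by apply: subset_itvl; rewrite bnd_simp.
have := @intgM_bounded R `]0, y[%classic _ (fun z => expR (1 * z + 0)) (expR y) mI i1
    (measurable_expR_lin _ _ mI).
have hb s : (`]0, y[%classic : set RR) s -> `|expR (1 * s + 0)| <= expR y.
  rewrite /= in_itv/= => /andP[s0 sY]; rewrite ger0_norm ?expR_ge0// addr0 ler_expR mul1r.
  exact: ltW.
move=> /(_ hb); apply: intg_eq => // s _.
by rewrite mulrA -expRD addr0 mul1r subrr expR0 mul1r.
Qed.

Lemma continuous_reflect f (y s : R) : {for (y - s), continuous (f : R -> R)} ->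
  {for s, continuous (fun s : R => f (y - s))}.
Proof.
move=> cf; apply: (cont_comp (g := f) (f := fun s => y - s)) => //.
exact: is_derive_cont (deriv_sub (deriv_cst s y) (deriv_id s)).
Qed.

Lemma continuous_shift f (y s : R) : {for (y - s), continuous (f : R -> R)} ->
  {for y, continuous (fun y : R => f (y - s))}.
Proof.
move=> cf; apply: (cont_comp (g := f) (f := fun y => y - s)) => //.
exact: is_derive_cont (deriv_sub (deriv_id y) (deriv_cst y s)).
Qed.

(** The possible singularities, of [f] at [s = 0] and of [K (y - s)] at [s = y], are separated at
    [y / 2]: on each half one factor is bounded and the other integrable. *)
Lemma conv_integrand f K (y : R) : 0 < y -> (forall s : R, 0 < s <= y -> {for s, continuous (f : R -> R)}) ->
  (forall s : R, 0 < s -> {for s, continuous (K : R -> R)}) -> intg `]0, y[ f -> kernel_class K ->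
  intg `]0, y[ (fun s => f s * K (y - s)).
Proof.
move=> y0 cf cK fi iK.
have y2 : 0 < y / 2 by rewrite divr_gt0.
have [M1 M10 HM1] := @bounded_seg R K (y / 2) y (fun s h => cK s (lt_le_trans y2 (andP h).1)).
have [M2 M20 HM2] := @bounded_seg R f (y / 2) y (fun s h => cf s (introT andP (conj (lt_le_trans y2 (andP h).1) (andP h).2))).
have iKr := (Rint_reflect (kernel_intg y iK)).1.
apply: (intg_le (g := fun s => M1 * `|f s| + M2 * `|K (y - s)|)) => //.
- apply: measurable_oo => s /andP[s0 sy]; apply: cont_mul; first by apply: cf; rewrite s0 ltW.
  by apply: continuous_reflect; apply: cK; rewrite subr_gt0.
- by apply: intgD => //; apply: intgZl => //; [exact: (integrable_norm fi)|exact: (integrable_norm iKr)].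
move=> s; rewrite /= in_itv/= => /andP[s0 sy]; rewrite normrM.
have [h|h] := leP s (y / 2).
  rewrite (le_trans (ler_wpM2l (normr_ge0 (f s)) (HM1 (y - s) _)))//.
    by apply/andP; split; lra.
  by rewrite mulrC lerDl mulr_ge0// ltW.
rewrite (le_trans (ler_wpM2r (normr_ge0 (K (y - s))) (HM2 s _)))//.
  by apply/andP; split; exact: ltW.
by rewrite lerDr mulr_ge0// ltW.
Qed.

(** For [s < y / 2] and [y] near [y0] the argument [y - s] stays in a compact part of []0, T[], so
    only [f] can be singular and a multiple of [|f|] dominates. *)
Lemma half_conv_continuous f g (T y0 : R) : 0 < y0 < T -> intg `]0, y0[ f ->
  (forall s : R, 0 < s < T -> {for s, continuous (g : R -> R)}) ->
  {for y0, continuous (fun y : R => \int[mu]_(s in `]0, (y / 2)[) (f s * g (y - s)))}.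
Proof.
move=> /andP[y00 y0T] fi cg.
have mI : measurable (`]0, y0[%classic : set RR) by exact: measurable_itv.
(* For [y < y1] one has [y < T] and [y / 2 < y0]; all the integrals can then be written over []0,
   y0[], with a jump of the integrand at [s = y / 2]. *)
pose y1 := Num.min ((y0 + T) / 2) (3 / 2 * y0).
have y01 : y0 < y1 by rewrite /y1 lt_min; apply/andP; split; lra.
have y1T : y1 < T by rewrite /y1 gt_min; apply/orP; left; lra.
have y1y : y1 <= 3 / 2 * y0 by rewrite /y1 ge_min lexx orbT.
have y04 : 0 < y0 / 4 by rewrite divr_gt0.
have [M M0 HM] := @bounded_seg R g (y0 / 4) y1 (fun s h => cg s (introT andP (conj (lt_le_trans y04 (andP h).1) (le_lt_trans (andP h).2 y1T)))).
pose h (y : R) (s : R) : R := if s < y / 2 then f s * g (y - s) else 0.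
have hE (y : R) : y0 / 2 < y < y1 -> \int[mu]_(s in `]0, (y / 2)[) (f s * g (y - s)) = \int[mu]_(s in `]0, y0[) h y s.
  move=> /andP[ya yb].
  rewrite Rintegral_mkcond [RHS]Rintegral_mkcond; apply: eq_Rint => s _.
  rewrite !patch_itvE !in_itv/= /h.
  case: (ltP s (y / 2)) => sy; last by rewrite andbF if_same.
  by rewrite andbT (_ : s < y0 = true) ?andbT//; lra.
have near1 : \forall y \near y0, y0 / 2 < y < y1.
  near=> y; apply/andP; split; near: y; last exact: lt_nbhsl.
  by apply: lt_nbhsr; lra.
have mh (y : R) : y0 / 2 < y < y1 -> measurable_fun (`]0, y0[%classic : set RR) (h y).
  move=> /andP[ya yb].
  rewrite (_ : h y = (fun s => f s * g (y - s)) \_ `]-oo, (y / 2)[); last first.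
    by apply/funext => s; rewrite patch_itvE in_itv.
  have mJ : measurable (`]-oo, (y / 2)[%classic : set RR) by exact: measurable_itv.
  apply: (measurable_restrict _ mJ mI).1.
  apply: measurable_funM.
    apply: measurable_funS (intg_measurable fi) => //; exact: subIsetl.
  have mK : measurable_fun (`]0, (y / 2)[%classic : set RR) (fun s => g (y - s)).
    apply: measurable_oo => s /andP[s0 sy]; apply: continuous_reflect; apply: cg.
    by apply/andP; split; lra.
  apply: measurable_funS mK; first exact: measurable_itv.
  by move=> s [/=]; rewrite !in_itv/= => /andP[-> _] ->.
have H : \int[mu]_(s in `]0, y0[) h y s @[y --> y0] --> \int[mu]_(s in `]0, y0[) h y0 s.
  apply: (@dominated_cvg_filter_unpoint R _ _ (y0 / 2) _ _ (fun s => M * `|f s|)) => //.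
  - by near=> y; apply: mh; near: y.
  - move=> s; rewrite /= in_itv/= => /andP[s0 sy0] sy; rewrite /h.
    case: (ltP s (y0 / 2)) => hs.
      apply: (cvg_trans (G := (f s * g (y - s)) @[y --> y0])).
        apply: near_eq_cvg; near=> y; rewrite (_ : s < y / 2)//.
        by rewrite ltr_pdivlMr//; near: y; apply: lt_nbhsr; lra.
      have Hc : {for y0, continuous (fun y => f s * g (y - s))}.
        apply: cont_mul; first exact: cont_cst.
        apply: continuous_shift; apply: cg; apply/andP; split; lra.
      exact: Hc.
    have {}hs : y0 / 2 < s by rewrite lt_neqAle eq_sym sy.
    have Hc : (fun=> 0 : R) @ nbhs y0 --> (0 : R) by exact: cvg_cst.
    apply: cvg_trans Hc; apply: near_eq_cvg; near=> y; rewrite (_ : s < y / 2 = false)//.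
    apply/negbTE; rewrite -leNgt ltW// ltr_pdivrMr//; near: y; apply: lt_nbhsl; lra.
  - by apply: mh; apply/andP; split; lra.
  - by apply: intgZl => //; exact: (integrable_norm fi).
  - near=> y => s; rewrite /= in_itv/= => /andP[s0 sy0]; rewrite /h.
    have /andP[ya yb] : y0 / 2 < y < y1 by near: y.
    case: ifPn => hs; last by rewrite normr0 mulr_ge0// ltW.
    rewrite normrM mulrC ler_wpM2r// HM//; apply/andP; split; lra.
suff: \int[mu]_(s in `]0, (y / 2)[) (f s * g (y - s)) @[y --> y0] -->
    \int[mu]_(s in `]0, (y0 / 2)[) (f s * g (y0 - s)) by [].
rewrite hE; last by apply/andP; split; lra.
apply: cvg_trans H; apply: near_eq_cvg; near=> y; rewrite hE//; near: y; exact: near1.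
Unshelve. all: by end_near. Qed.

(** Cutting at [y / 2] and reflecting the upper half moves the singularity of [K] to the fixed end
    [s = 0]; [half_conv_continuous] then applies to both pieces, with [f] and [K] exchanged in the
    second. *)
Lemma conv_continuous f K (T y0 : R) : 0 < y0 < T ->
  (forall s : R, 0 < s < T -> {for s, continuous (f : R -> R)}) ->
  (forall s : R, 0 < s -> {for s, continuous (K : R -> R)}) ->
  (forall Y : R, Y < T -> intg `]0, Y[ f) -> kernel_class K ->
  {for y0, continuous (conv f K)}.
Proof.
move=> y0T cf cK fi iK; have /andP[y00 yT] := y0T.
have E (y : R) : 0 < y < T -> conv f K y =
    \int[mu]_(s in `]0, (y / 2)[) (f s * K (y - s)) + \int[mu]_(s in `]0, (y / 2)[) (K s * f (y - s)).
  move=> /andP[y1 y2].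
  have ic : intg `]0, y[ (fun s => f s * K (y - s)).
    apply: conv_integrand => //; last exact: fi.
    by move=> s /andP[s0 sy]; apply: cf; rewrite s0 (le_lt_trans sy).
  rewrite /conv (@Rint_cat _ _ 0 (y / 2) y)//; [|lra|lra]; congr (_ + _).
  have mI : measurable (`]0, y[%classic : set RR) by exact: measurable_itv.
  have mJ : measurable (`](y / 2), +oo[%classic : set RR) by exact: measurable_itv.
  pose F := (fun s : RR => f s * K (y - s)) \_ `](y / 2), +oo[.
  have iF : intg `]0, y[ F.
    apply: (intg_le (g := fun s => `|f s * K (y - s)|)) => //.
    - apply: measurable_patch => //; exact: intg_measurable ic.
    - exact: (integrable_norm ic).
    - by move=> s _; rewrite /F patch_itvE; case: ifP => // _; rewrite normr0.
  transitivity (\int[mu]_(s in `]0, y[) F s).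
    rewrite Rintegral_mkcond [RHS]Rintegral_mkcond; apply: eq_Rint => s _.
    rewrite /F !patch_itvE !in_itv/= andbT.
    case: (ltP (y / 2) s) => sy /=; last by rewrite if_same.
    by rewrite (_ : 0 < s)//; lra.
  rewrite -(Rint_reflect iF).2.
  rewrite Rintegral_mkcond [RHS]Rintegral_mkcond; apply: eq_Rint => s _.
  rewrite /F !patch_itvE !in_itv/= andbT.
  have -> : (y / 2 < y - s) = (s < y / 2) by apply/idP/idP; lra.
  case: (ltP s (y / 2)) => sy /=; last by rewrite andbF if_same.
  rewrite andbT (_ : s < y = true) ?andbT; last by lra.
  by case: ifP => // _; rewrite mulrC; congr (K _ * _); ring.
have -> : {for y0, continuous (conv f K)} = (conv f K y @[y --> y0] --> conv f K y0) by [].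
rewrite E//.
have H : {for y0, continuous (fun y : R => \int[mu]_(s in `]0, (y / 2)[) (f s * K (y - s)) + \int[mu]_(s in `]0, (y / 2)[) (K s * f (y - s)))}.
  apply: cont_add.
    by apply: (@half_conv_continuous _ _ T) => //; [exact: fi|move=> s /andP[s0 _]; exact: cK].
  by apply: (@half_conv_continuous _ _ T) => //; exact: kernel_intg.
apply: cvg_trans H; apply: near_eq_cvg; near=> y; rewrite E//; apply/andP; split; near: y.
- exact: lt_nbhsr.
- exact: lt_nbhsl.
Unshelve. all: by end_near. Qed.

End convolution.

(** * Measurability and parameter integrals in the plane *)

Section measurable_plane.
Context {R : realType}.
Local Notation RR := (measurableTypeR R).
Local Notation mu := (@lebesgue_measure R).
Local Notation intg D f := (mu.-integrable D (EFin \o f)).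

(** An open set of the plane is the countable union of the rational open rectangles it contains,
    which puts it in the product sigma-algebra. *)
Lemma open_plane_measurable (O : set (R * R)) : open O -> measurable (O : set (RR * RR)).
Proof.
move=> oO.
pose rect (q : (rat * rat) * (rat * rat)) : set (RR * RR) :=
  `](ratr q.1.1 : R), (ratr q.1.2 : R)[%classic `*` `](ratr q.2.1 : R), (ratr q.2.2 : R)[%classic.
pose F q := if `[< rect q `<=` O >] then rect q else set0.
have -> : O = \bigcup_q F q.
  apply/seteqP; split => [x Ox|x [q _]]; last by rewrite /F; case: asboolP => // h; exact: h.
  have [[A B] /= [/nbhs_ballP[e1 /= e10 He1] /nbhs_ballP[e2 /= e20 He2]] AB] : nbhs x O by exact: open_nbhs_nbhs.
  have [q1 +] := @rat_in_itvoo R (x.1 - e1) x.1 ltac:(lra).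
  have [q2 +] := @rat_in_itvoo R x.1 (x.1 + e1) ltac:(lra).
  have [q3 +] := @rat_in_itvoo R (x.2 - e2) x.2 ltac:(lra).
  have [q4 +] := @rat_in_itvoo R x.2 (x.2 + e2) ltac:(lra).
  rewrite !in_itv/= => /andP[h41 h42] /andP[h31 h32] /andP[h21 h22] /andP[h11 h12].
  exists ((q1, q2), (q3, q4)) => //; rewrite /F; case: asboolP => [_|].
    by rewrite /rect; split; rewrite /= in_itv/=; apply/andP; split.
  case=> z []; rewrite /= !in_itv/= => /andP[z1 z2] /andP[z3 z4].
  apply: AB; split; rewrite /=; [apply: He1|apply: He2]; rewrite /ball/= ltr_norml; move: h11 h12 h21 h22 h31 h32 h41 h42 z1 z2 z3 z4; clear; by move=> *; apply/andP; split; lra.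
apply: countable_bigcupT_measurable => [|q]; first exact: countableP.
by rewrite /F; case: ifP => // _; apply: measurableX; exact: measurable_itv.
Qed.

Lemma continuous_plane_measurable (D : set (R * R)) (h : R * R -> R) : open D ->
  (forall q, D q -> {for q, continuous h}) -> measurable_fun (D : set (RR * RR)) (h : RR * RR -> R).
Proof.
move=> oD ch mD; apply: (measurability _ (RGenOpens.measurableE R)) => //.
move=> _ [_ [a [b ->] <-]]; apply: open_plane_measurable.
rewrite openE => q [Dq hq]; apply: filterI; first exact: open_nbhs_nbhs.
by apply: ch => //; apply: open_nbhs_nbhs; split => //; exact: interval_open.
Qed.

Lemma open_rect (a b c d : R) : open (`]a, b[%classic `*` `]c, d[%classic : set (R * R)).
Proof.
rewrite openE => q [q1 q2].
exists (`]a, b[%classic, `]c, d[%classic) => //=.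
by split; apply: open_nbhs_nbhs; split => //; exact: interval_open.
Qed.

Lemma rect_measurable (a b c d : R) (h : R * R -> R) :
  (forall x y, a < x < b -> c < y < d -> {for (x, y), continuous h}) ->
  measurable_fun (`]a, b[%classic `*` `]c, d[%classic : set (RR * RR)) (h : RR * RR -> R).
Proof.
move=> ch; apply: continuous_plane_measurable; first exact: open_rect.
by move=> [x y] []; rewrite /= !in_itv/=; exact: ch.
Qed.

Lemma within_interior (T U : topologicalType) (A : set T) (h : T -> U) (x : T) :
  {within A, continuous h} -> (A^° x) -> {for x, continuous h}.
Proof.
move=> ch Ax.
have := ch x; rewrite /continuous_at /= /prop_for => H.
by move: H; rewrite -(nbhs_subspace_interior Ax).
Qed.

Lemma continuous_Rint_param (h : R -> R -> R) (c d x0 M : R) :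
  (forall s : R, c < s < d -> {for x0, continuous (h^~ s)}) ->
  (\forall x \near x0, measurable_fun (`]c, d[%classic : set RR) (h x)) ->
  (\forall x \near x0, forall s : R, c < s < d -> `|h x s| <= M) ->
  {for x0, continuous (fun x => \int[mu]_(s in `]c, d[) h x s)}.
Proof.
move=> ch mh bh.
apply: (@dominated_cvg_filter R `]c, d[%classic x0 h (h x0) (cst M)) => //.
- have := @intg_oo R c d (cst M); apply => s _; exact: cont_cst.
Qed.

End measurable_plane.

(** * Kernels of fractional integration *)

Section power_kernel.
Context {R : realType}.
Local Notation RR := (measurableTypeR R).
Local Notation mu := (@lebesgue_measure R).
Local Notation intg D f := (mu.-integrable D (EFin \o f)).

Definition power_ker (a z : R) : R := (Gamma a)^-1 * z `^ (a - 1).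

(** Read off from [ker_const a * Gamma a = 1]; the values [1 / 2] and [3 pi / 4] are one admissible
    choice of [b] and [th]. *)
Lemma Gamma_neq0 (a : R) : 0 < a < 1 -> Gamma a != 0.
Proof.
move=> a01.
have p0 := pi_gt0 R.
have h1 : pi / 2 < 3 / 4 * pi :> R by lra.
have h2 : 3 / 4 * pi < pi :> R by lra.
have h3 : 1 / 2 * (3 / 4 * pi) < pi / 2 :> R by lra.
have h0 : 0 < 1 / 2 :> R by lra.
have h := ker_const_Gamma h0 h1 h2 h3 a01.
by apply: contra_eq_neq h => ->; rewrite mulr0 eq_sym oner_neq0.
Qed.

Lemma power_ker_continuous (a s : R) : 0 < s -> {for s, continuous (power_ker a)}.
Proof. by move=> s0; apply: cont_mul; [exact: cont_cst|exact: continuous_powR]. Qed.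

Lemma kernel_class_power_ker (a : R) : 0 < a -> kernel_class (power_ker a).
Proof.
move=> a0; have := intgZl (Gamma a)^-1 (measurable_itv _) (intg_powR_expR1 a0 (@ltr01 R)).
by apply: intg_eq => // z _; rewrite /power_ker mul1r; ring.
Qed.

Lemma Lap_power_ker (a p : R) : 0 < a < 1 -> 0 < p -> Lap (power_ker a) p = p `^ (- a).
Proof.
move=> a01 p0; have /andP[a0 _] := a01.
transitivity (\int[mu]_(z in `]0, +oo[) ((Gamma a)^-1 * (z `^ (a - 1) * expR (- (p * z))))).
  by apply: eq_Rint => z _; rewrite /power_ker; ring.
rewrite (RintZl _ (measurable_itv _) (intg_powR_expR1 a0 p0)) Gamma_scale//.
by rewrite mulrA mulVf ?mul1r// Gamma_neq0.
Qed.

Lemma kernel_class_one : kernel_class (fun=> 1 : R).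
Proof.
have := intg_powR_expR1 (@ltr01 R) (@ltr01 R).
by apply: intg_eq => // z _; rewrite subrr powRr0 !mul1r mulr1.
Qed.

Lemma Lap_one (p : R) : 0 < p -> Lap (fun=> 1) p = p^-1.
Proof.
move=> p0.
have iK := intg_powR_expR1 (@ltr01 R) p0.
have ie : intg `]0, +oo[ (fun z => expR (- (p * z))).
  by apply: intg_eq iK => // z _; rewrite subrr powRr0 mul1r.
have d (z : R) : is_derive z 1 (fun z : R => - p^-1 * expR (- (p * z))) (expR (- (p * z))).
  apply: (is_derive_eq (deriv_scale (- p^-1) (deriv_expR (deriv_opp (deriv_scale p (deriv_id z)))))).
  by field; rewrite gt_eqF.
transitivity (\int[mu]_(z in `]0, +oo[) expR (- (p * z))).
  by apply: eq_Rint => z _; rewrite mulr1.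
rewrite (@improper_FTC R _ (fun z : R => - p^-1 * expR (- (p * z))) (- p^-1 * expR (- (p * 0))) 0) //.
- by rewrite mulr0 oppr0 expR0 mulr1 sub0r opprK.
- move=> z _; exact: (is_derive_cont (deriv_expR (deriv_opp (deriv_scale p (deriv_id z))))).
- by apply: cvg_at_right_filter; exact: is_derive_cont (d 0).
- apply: (@cvg_eq _ _ _ _ _ (- p^-1 * 0)); first by rewrite mulr0.
  apply: cvgM; first exact: cvg_cst.
  apply: (cvg_comp (fun y : R => p * y) (fun y : R => expR (- y))); last exact: cvgr_expR.
  by apply: gt0_cvgMry => //; exact: cvg_id.
Qed.

End power_kernel.

(** * Semigroup law and integration by parts for transforms *)

Section fractional.
Context {R : realType}.
Local Notation RR := (measurableTypeR R).
Local Notation mu := (@lebesgue_measure R).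
Local Notation intg D f := (mu.-integrable D (EFin \o f)).
Implicit Types (g v : R -> R).

Lemma powR_ge1 (p c : R) : 1 <= p -> 0 <= c -> 1 <= p `^ c.
Proof. by move=> p1 c0; rewrite -(powRr0 p) ler_powR. Qed.

Lemma conv1 g : conv g (fun=> 1) = fun y : R => \int[mu]_(s in `]0, y[) g s.
Proof. by apply/funext => y; apply: eq_Rint => s _; rewrite mulr1. Qed.

(* Semigroup law: the fractional integral of order 1-a of the fractional
   integral of order a is the primitive. *)
Lemma conv_power_ker_semigroup (a T t : R) g v : 0 < a < 1 -> 0 < t < T ->
  (forall s : R, 0 < s < T -> {for s, continuous g}) ->
  (forall Y : R, Y < T -> intg `]0, Y[ g) ->
  (forall s : R, 0 < s < T -> {for s, continuous v}) ->
  (forall Y : R, Y < T -> intg `]0, Y[ v) ->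
  (forall y, 0 < y < T -> v y = conv g (power_ker a) y) ->
  \int[mu]_(s in `]0, t[) g s = conv v (power_ker (1 - a)) t.
Proof.
move=> a01 tT cg ig cv iv vE; have /andP[a0 a1] := a01; have /andP[t0 tT'] := tT.
have b01 : 0 < 1 - a < 1 by apply/andP; split; lra.
have b0 : 0 < 1 - a by lra.
pose Y := (t + T) / 2; have [tY YT] : t < Y /\ Y < T by rewrite /Y; split; lra.
have Y0 : 0 < Y by lra.
pose U (y : R) : R := conv g (fun=> 1) y.
pose W (y : R) : R := conv v (power_ker (1 - a)) y.
have c1 (s : R) : 0 < s -> {for s, continuous (fun=> 1 : R)} by move=> _; exact: cont_cst.
have ci f (K : R -> R) : (forall s : R, 0 < s < T -> {for s, continuous f}) -> (forall Y : R, Y < T -> intg `]0, Y[ f) ->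
    (forall s : R, 0 < s -> {for s, continuous K}) -> kernel_class K ->
    forall y, 0 < y < Y -> intg `]0, y[ (fun s => f s * K (y - s)).
  move=> cf jf cK iK y /andP[y0 yY]; apply: conv_integrand => //.
    by move=> s /andP[s0 sy]; apply: cf; rewrite s0/=; lra.
  by apply: jf; lra.
have cU : {for t, continuous U} by apply: (@conv_continuous _ _ _ T) => //; exact: kernel_class_one.
have cW : {for t, continuous W}.
  apply: (@conv_continuous _ _ _ T) => //; last exact: kernel_class_power_ker.
  by move=> s; exact: power_ker_continuous.
suff : U t - W t = 0 by rewrite /U conv1 => /eqP; rewrite subr_eq0 => /eqP.
pose CC (f K : R -> R) : R := (\int[mu]_(s in `]0, Y[) `|f s|) * (\int[mu]_(z in `]0, +oo[) `|expR (- z) * K z|).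
have cc (f K : R -> R) : (forall s : R, 0 < s < T -> {for s, continuous f}) ->
    (forall Y : R, Y < T -> intg `]0, Y[ f) ->
    (forall s : R, 0 < s -> {for s, continuous K}) -> kernel_class K ->
    forall p : R, 1 <= p -> intg `]0, Y[ (conv f K) /\
     `|lap Y (conv f K) p - Lap K p * lap Y f p| <= expR (- ((p - 1) * Y)) * CC f K.
  move=> cf jf cK iK p p1; exact: (conv_laplace Y0 p1 (jf _ YT) iK (ci _ _ cf jf cK iK)).
have q1 := cc _ _ cg ig c1 (@kernel_class_one R).
have q2 := cc _ _ cv iv (@power_ker_continuous R _) (kernel_class_power_ker b0).
have q3 := cc _ _ cg ig (@power_ker_continuous R _) (kernel_class_power_ker a0).
move: q1 q2 q3; move E1 : (CC g _) => C1; move E2 : (CC v _) => C2; move E3 : (CC g _) => C3 q1 q2 q3.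
have C0 (f h : RR -> R) (D : set RR): 0 <= (\int[mu]_(s in `]0, Y[) `|f s|) * (\int[mu]_(z in D) `|h z|).
  by rewrite mulr_ge0// Rintegral_ge0.
have [C10 C20 C30] : [/\ 0 <= C1, 0 <= C2 & 0 <= C3] by split; rewrite -?E1 -?E2 -?E3; exact: C0.
clear E1 E2 E3.
have iU := (q1 _ (lexx 1)).1; have iW := (q2 _ (lexx 1)).1.
apply: (@laplace_decay_eq0 R (fun y => U y - W y) Y Y (expR Y * (C1 + C2 + C3)) t) => //.
- by rewrite mulr_ge0 ?expR_ge0// !addr_ge0.
- exact: intgB.
- move=> n n0; set p : R := n%:R.
  have p1 : 1 <= p by rewrite ler1n.
  have p0 : 0 < p by rewrite (lt_le_trans ltr01).
  have [_ e1] := q1 p p1; have [_ e2] := q2 p p1; have [_ e3] := q3 p p1.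
  have mY : measurable (`]0, Y[%classic : set RR) by exact: measurable_itv.
  have ie (f : RR -> R) : intg `]0, Y[ f -> intg `]0, Y[ (fun s => expR (- (p * s)) * f s).
    move=> jf; have := @intgM_bounded R `]0, Y[%classic _ (fun z => expR (- p * z + 0)) 1 mY jf
      (measurable_expR_lin _ _ mY).
    have h s : (`]0, Y[%classic : set RR) s -> `|expR (- p * s + 0)| <= 1.
      rewrite /= in_itv/= => /andP[s0 _]; rewrite ger0_norm ?expR_ge0// addr0 mulNr.
      by rewrite expR_le1 oppr_le0 mulr_ge0// ltW.
    by move=> /(_ h); apply: intg_eq => // s _; rewrite addr0 mulNr.
  have -> : \int[mu]_(s in `]0, Y[) (expR (- (p * s)) * (U s - W s)) = lap Y U p - lap Y W p.
    rewrite /lap -(RintB mY (ie _ iU) (ie _ iW)); apply: eq_Rint => s _; exact: mulrBr.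
  have ev : lap Y (conv g (power_ker a)) p = lap Y v p.
    apply: eq_Rint => s; rewrite /= in_itv/= => /andP[s0 sY]; by rewrite vE// s0 (lt_trans sY YT).
  rewrite ev in e3; rewrite (Lap_power_ker a01 p0) in e3; rewrite (Lap_power_ker b01 p0) in e2; rewrite (Lap_one p0) in e1.
  move: e1 e2 e3; rewrite -/U -/W; move: (lap Y U p) (lap Y W p) (lap Y g p) (lap Y v p) => lU lW lg lv e1 e2 e3.
  set Ex := expR (- ((p - 1) * Y)) in e1 e2 e3.
  have -> : expR Y * (C1 + C2 + C3) * expR (- (p * Y)) = Ex * C1 + Ex * C2 + Ex * C3.
    have -> : Ex = expR Y * expR (- (p * Y)) by rewrite /Ex -expRD; congr expR; ring.
    ring.
  (* The main terms cancel because [p^(-1) = p^(-(1-a)) p^(-a)]: both transforms are [p^(-1) lg] up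
     to truncation errors. *)
  have -> : lU - lW = (lU - p^-1 * lg) - (lW - p `^ (- (1 - a)) * lv) - p `^ (- (1 - a)) * (lv - p `^ (- a) * lg).
    have -> : p^-1 = p `^ (- (1 - a)) * p `^ (- a).
      rewrite -powRD ?(gt_eqF p0) ?implybT//.
      by have -> : - (1 - a) + - a = -1 by [ring]; rewrite powR_inv1// ltW.
    ring.
  rewrite (le_trans (ler_normB _ _))// lerD//.
    by rewrite (le_trans (ler_normB _ _))// lerD.
  rewrite normrM (ger0_norm (powR_ge0 _ _)) (le_trans _ e3)// ler_piMl// powRN.
  by rewrite invf_le1 ?powR_gt0// powR_ge1// ltW.
- by apply: cont_sub.
Qed.

(** Near 0 the function [g] is only integrable, so the integration by parts starts at some [e > 0],
    where the primitive [U] is differentiable. *)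
Lemma lap_by_parts (T e Y p : R) g : 0 < e -> e < Y -> Y < T ->
  (forall s : R, 0 < s < T -> {for s, continuous g}) ->
  (forall Y : R, Y < T -> intg `]0, Y[ g) ->
  let U := fun y : R => \int[mu]_(s in `]0, y[) g s in
  \int[mu]_(s in `]e, Y[) (expR (- (p * s)) * g s) =
  expR (- (p * Y)) * U Y - expR (- (p * e)) * U e +
   p * \int[mu]_(s in `]e, Y[) (expR (- (p * s)) * U s).
Proof.
move=> e0 eY YT cg ig U.
pose Y1 := (Y + T) / 2; have [YY1 Y1T] : Y < Y1 /\ Y1 < T by rewrite /Y1; split; lra.
have dU (s : R) : e <= s <= Y -> is_derive s 1 U (g s).
  move=> /andP[es sY]; apply: (@is_derive_int R g Y1); first exact: ig.
    by apply/andP; split; lra.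
  by apply: cg; apply/andP; split; lra.
have dE (s : R) := deriv_expR (deriv_opp (deriv_scale p (deriv_id s))).
have dF (s : R) (h : e <= s <= Y) := deriv_mul (dE s) (dU s h).
have cEU (s : R) (h : e <= s <= Y) := is_derive_cont (dF s h).
have cEg (s : R) : e <= s <= Y -> {for s, continuous (fun s => expR (- (p * s)) * g s)}.
  move=> h; apply: cont_mul; first exact: (is_derive_cont (dE s)).
  by apply: cg; move: h => /andP[h1 h2]; apply/andP; split; lra.
have E := @FTC2_cc R (fun s => expR (- (p * s)) * g s - p * (expR (- (p * s)) * U s))
  (fun s => expR (- (p * s)) * U s) e Y eY.
have i1 := intg_oo cEg; have i2 := intg_oo cEU.
have mI : measurable (`]e, Y[%classic : set RR) by exact: measurable_itv.
have i3 := intgZl p mI i2.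
have := E
  ltac:(by move=> s h; apply: cont_sub; [exact: cEg|apply: cont_mul; [exact: cont_cst|exact: cEU]])
  ltac:(by move=> s h; apply: (is_derive_eq (dF s h)); ring).
rewrite (RintB mI i1 i3) (RintZl _ mI i2); lra.
Qed.

Lemma Rint_cut0 (Y : R) (f : RR -> R) : 0 < Y -> intg `]0, Y[ f ->
  \int[mu]_(s in `](Y / n.+2%:R), Y[) f s @[n --> \oo] --> \int[mu]_(s in `]0, Y[) f s.
Proof.
move=> Y0 fi.
have mI : measurable (`]0, Y[%classic : set RR) by exact: measurable_itv.
have n0 (n : nat) : 0 < Y / n.+2%:R by rewrite divr_gt0.
have E (n : nat) : \int[mu]_(s in `](Y / n.+2%:R), Y[) f s =
    \int[mu]_(s in `]0, Y[) (f \_ `](Y / n.+2%:R), +oo[) s.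
  rewrite -Rintegral_mkcondr; congr (Rintegral _ _ _); apply/seteqP; split => x /=; rewrite !in_itv/= ?andbT.
    by move=> /andP[h1 ->]; rewrite h1 (lt_trans (n0 n) h1).
  by move=> [/andP[_ ->] ->].
under eq_fun do rewrite E.
apply: (dominated_cvgR (g := fun s => `|f s|) mI _ _ _ _).2.
- by move=> n; apply: measurable_patch => //; exact: intg_measurable fi.
- move=> s; rewrite /= in_itv/= => /andP[s0 sY].
  have Hc : (fun=> f s) @ \oo --> (f s : R) by exact: cvg_cst.
  apply: cvg_trans Hc; apply: near_eq_cvg; near=> n; rewrite patch_itvE in_itv/= andbT.
  rewrite (_ : _ < s)//.
  have : Y / s < n.+2%:R.
    have h : Y / s < n%:R by near: n; exact: nbhs_infty_gtr.
    by rewrite (lt_trans h)// ltr_nat.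
  by rewrite ltr_pdivrMr// => h; rewrite ltr_pdivrMr// mulrC.
- exact: (integrable_norm fi).
- by move=> n s _; rewrite patch_itvE; case: ifP => // _; rewrite normr0.
Unshelve. all: by end_near. Qed.

Lemma intg_exp (Y p : R) (f : RR -> R) : 0 <= p -> intg `]0, Y[ f ->
  intg `]0, Y[ (fun s => expR (- (p * s)) * f s).
Proof.
move=> p0 fi; have mI : measurable (`]0, Y[%classic : set RR) by exact: measurable_itv.
have := @intgM_bounded R `]0, Y[%classic _ (fun z => expR (- p * z + 0)) 1 mI fi
    (measurable_expR_lin _ _ mI).
have h s : (`]0, Y[%classic : set RR) s -> `|expR (- p * s + 0)| <= 1.
  rewrite /= in_itv/= => /andP[s0 _]; rewrite ger0_norm ?expR_ge0// addr0 mulNr.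
  by rewrite expR_le1 oppr_le0 mulr_ge0// ltW.
by move=> /(_ h); apply: intg_eq => // s _; rewrite addr0 mulNr.
Qed.

End fractional.

Section fractional_transform_estimate.
Context {R : realType}.
Local Notation RR := (measurableTypeR R).
Local Notation mu := (@lebesgue_measure R).
Local Notation intg D f := (mu.-integrable D (EFin \o f)).
Implicit Types (g v : R -> R).

Lemma Rint_bound (c d M : R) (f : RR -> R) : c <= d -> intg `]c, d[ f ->
  (forall s : R, c < s < d -> `|f s| <= M) -> `|\int[mu]_(s in `]c, d[) f s| <= M * (d - c).
Proof.
move=> cd fi fM; have iM : intg `]c, d[ (cst M : RR -> R) by apply: intg_oo => s _; exact: cont_cst.
have -> : M * (d - c) = \int[mu]_(s in `]c, d[) (cst M : RR -> R) s.
  rewrite Rintegral_cst//= lebesgue_measure_itv/= lte_fin.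
  case: ltP => h; first by rewrite -EFinB.
  by rewrite (_ : d - c = 0)//; apply/eqP; rewrite subr_eq0 eq_le h cd.
by apply: norm_int_le => // s; rewrite /= in_itv/=; exact: fM.
Qed.

Lemma intg_oo_bounded (c d M : R) (f : RR -> R) : (forall s : R, c < s < d -> {for s, continuous (f : R -> R)}) ->
  (forall s : R, c < s < d -> `|f s| <= M) -> intg `]c, d[ f.
Proof.
move=> cf fM.
have iM : intg `]c, d[ (cst M : RR -> R) by apply: intg_oo => s _; exact: cont_cst.
apply: (intg_le (g := cst M)) => //; first exact: measurable_oo.
Qed.

(** To be applied to [g = u x] and [v = w n x]. Only the fractional integral [v] is bounded, but the
    primitive [U] of [g] is the fractional integral of [v] of order [1 - a], hence bounded, and
    integration by parts transfers this to the transform of [g]. The constant is chosen before [g],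
    which makes both estimates uniform in [x]; the second is the domination for [e -> 0] in Green's
    formula. *)
Lemma fractional_transform_estimate (a M T Y : R) : 0 <= a < 1 -> 0 <= M -> 0 < Y < T ->
  exists2 C : R, 0 <= C & forall g v,
   (forall s : R, 0 < s < T -> {for s, continuous g}) ->
   (forall Y : R, Y < T -> intg `]0, Y[ g) ->
   (forall s : R, 0 < s < T -> {for s, continuous v}) ->
   (forall s : R, 0 < s < T -> `|v s| <= M) ->
   (forall y : R, 0 < y < T -> v y = if a == 0 then g y else conv g (power_ker a) y) ->
   forall p : R, 1 <= p ->
   `|lap Y g p - p `^ a * lap Y v p| <= C * (p * expR (- ((p - 1) * Y))) /\
   forall e : R, 0 < e < Y -> `|\int[mu]_(s in `]e, Y[) (expR (- (p * s)) * g s)| <= C * p.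
Proof.
move=> /andP[a0 a1] M0 /andP[Y0 YT].
have [->|an0] := eqVneq a 0.
  exists (M * Y); first by rewrite mulr_ge0// ltW.
  move=> g v cg ig cv vM vE p p1.
  have p0 : 0 < p by rewrite (lt_le_trans ltr01).
  split.
    rewrite powRr0 mul1r (_ : lap Y g p = lap Y v p) ?subrr ?normr0; last first.
      by apply: eq_Rint => s; rewrite /= in_itv/= => /andP[s0 sY]; rewrite vE// s0 (lt_trans sY YT).
    by rewrite !mulr_ge0 ?expR_ge0// ltW.
  move=> e /andP[e0 eY].
  have mI : measurable (`]e, Y[%classic : set RR) by exact: measurable_itv.
  have i1 : intg `]e, Y[ (fun s => expR (- (p * s)) * g s).
    apply: (intgS _ mI _ (intg_exp (ltW p0) (ig _ YT))); first exact: measurable_itv.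
    by apply: subset_itvr; rewrite bnd_simp ltW.
  have h (s : R) : e < s < Y -> `|expR (- (p * s)) * g s| <= M.
    move=> /andP[es sY]; have s0 : 0 < s < T by apply/andP; split; lra.
    rewrite -vE// normrM ger0_norm ?expR_ge0// -[leRHS]mul1r ler_pM ?expR_ge0//; last exact: vM.
    by rewrite expR_le1 oppr_le0 mulr_ge0 ?ltW//; lra.
  rewrite (le_trans (Rint_bound (ltW eY) i1 h))// (@le_trans _ _ (M * Y))//.
    by rewrite ler_wpM2l//; lra.
  by rewrite ler_peMr// mulr_ge0// ltW.
have a01 : 0 < a < 1 by rewrite lt_neqAle eq_sym an0 a0.
have b01 : 0 < 1 - a < 1 by move: a01 => /andP[? ?]; apply/andP; split; lra.
have b0 : 0 < 1 - a by lra.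
have iP : intg `]0, T[ (fun s => `|power_ker (1 - a) s|) by exact: (integrable_norm (kernel_intg T (kernel_class_power_ker b0))).
pose P := \int[mu]_(s in `]0, T[) `|power_ker (1 - a) s|.
pose NK := \int[mu]_(z in `]0, +oo[) `|expR (- z) * power_ker (1 - a) z|.
have P0 : 0 <= P by apply: Rintegral_ge0.
have NK0 : 0 <= NK by apply: Rintegral_ge0.
have MP0 : 0 <= M * P by rewrite mulr_ge0.
have YNK0 : 0 <= M * Y * NK by rewrite !mulr_ge0// ltW.
(* [M * P] bounds [U], which enters through two end terms and an integral of length at most [Y];
   [M * Y * NK] bounds the truncation error of the convolution. *)
exists (M * P * (2 + Y) + M * Y * NK).
  by rewrite addr_ge0// mulr_ge0//; lra.
move=> g v cg ig cv vM vE p p1.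
have p0 : 0 < p by rewrite (lt_le_trans ltr01).
have iv (Z : R) : Z < T -> intg `]0, Z[ v.
  by move=> ZT; apply: (@intg_oo_bounded _ _ M) => s /andP[s0 sZ]; [apply: cv|apply: vM]; rewrite s0 (lt_trans sZ ZT).
have Hv : \int[mu]_(s in `]0, Y[) `|v s| <= M * Y.
  have := @Rint_bound 0 Y M (fun s => `|v s|) (ltW Y0) (integrable_norm (iv _ YT)).
  rewrite subr0 ger0_norm ?Rintegral_ge0//; apply => s /andP[s0 sY].
  by rewrite normr_id vM// s0 (lt_trans sY YT).
have EE : expR (- (p * Y)) <= p * expR (- ((p - 1) * Y)).
  rewrite (@le_trans _ _ (expR (- ((p - 1) * Y))))//; last by rewrite ler_peMl ?expR_ge0.
  by rewrite ler_expR; lra.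
have UE (t : R) : 0 < t < T -> \int[mu]_(s in `]0, t[) g s = conv v (power_ker (1 - a)) t.
  by move=> tT; apply: (@conv_power_ker_semigroup R a T t g v).
pose U (y : R) : R := \int[mu]_(s in `]0, y[) g s.
have Ule (t : R) : 0 < t < T -> `|U t| <= M * P.
  move=> tT; rewrite /U UE//; clear UE; have /andP[t0 tT'] := tT.
  have mI : measurable (`]0, t[%classic : set RR) by exact: measurable_itv.
  have ik := kernel_intg t (kernel_class_power_ker b0).
  have ir := (Rint_reflect (integrable_norm ik)).1.
  have ic : intg `]0, t[ (fun s => v s * power_ker (1 - a) (t - s)).
    apply: conv_integrand => //.
    - by move=> s /andP[s0 st]; apply: cv; rewrite s0 (le_lt_trans st tT').
    - by move=> s; exact: power_ker_continuous.
    - exact: iv.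
    - exact: kernel_class_power_ker.
  apply: (@le_trans _ _ (\int[mu]_(s in `]0, t[) (M * `|power_ker (1 - a) (t - s)|))).
    apply: norm_int_le => //; first exact: intgZl.
    by move=> s; rewrite /= in_itv/= => /andP[s0 st]; rewrite normrM ler_wpM2r// vM// s0 (lt_trans st tT').
  rewrite (RintZl _ mI ir); apply: (ler_wpM2l M0).
  have [_ eR] := Rint_reflect (integrable_norm ik).
  rewrite eR /P {eR}.
  rewrite (@Rint_cat _ _ 0 t T)//; [|exact: ltW|exact: ltW].
  by rewrite lerDl Rintegral_ge0.
have cU (y : R) : 0 < y < T -> {for y, continuous U}.
  move=> yT; rewrite /U -conv1; apply: (@conv_continuous _ _ _ T) => //; last exact: kernel_class_one.
  by move=> s _; exact: cont_cst.
have iU : intg `]0, Y[ U.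
  by apply: (@intg_oo_bounded _ _ (M * P)) => s /andP[s0 sZ]; [apply: cU|apply: Ule]; rewrite s0 (lt_trans sZ YT).
have ieU := intg_exp (ltW p0) iU.
have ieg := intg_exp (ltW p0) (ig _ YT).
have e1 (s : R) : 0 <= s -> `|expR (- (p * s))| <= 1.
  by move=> s0; rewrite ger0_norm ?expR_ge0// expR_le1 oppr_le0 mulr_ge0// ltW.
have UYle : `|U Y| <= M * P by apply: Ule; rewrite Y0.
split; last first.
  move=> e /andP[e0 eY]; rewrite (lap_by_parts p e0 eY YT cg ig) -/U.
  have mI : measurable (`]e, Y[%classic : set RR) by exact: measurable_itv.
  have i1 : intg `]e, Y[ (fun s => expR (- (p * s)) * U s).
    apply: (intgS _ mI _ ieU); first exact: measurable_itv.
    by apply: subset_itvr; rewrite bnd_simp ltW.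
  have h (s : R) : e < s < Y -> `|expR (- (p * s)) * U s| <= M * P.
    move=> /andP[es sY]; have s0 := lt_trans e0 es.
    rewrite normrM -[leRHS]mul1r ler_pM ?normr_ge0//; last by apply: Ule; rewrite s0 (lt_trans sY YT).
    by apply: e1; exact: ltW.
  have B1 := Rint_bound (ltW eY) i1 h.
  have B2 : `|expR (- (p * Y)) * U Y| <= M * P.
    rewrite normrM -[leRHS]mul1r ler_pM//; apply: e1; exact: ltW.
  have B3 : `|expR (- (p * e)) * U e| <= M * P.
    by rewrite normrM -[leRHS]mul1r ler_pM ?normr_ge0//; [apply: e1; exact: ltW|apply: Ule; rewrite e0 (lt_trans eY YT)].
  have B4 : `|p * \int[mu]_(s in `]e, Y[) (expR (- (p * s)) * U s)| <= p * (M * P * Y).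
    by rewrite normrM gtr0_norm// ler_wpM2l ?(ltW p0)// (le_trans B1)// ler_wpM2l// lerBlDr lerDl ltW.
  rewrite (le_trans (ler_normD _ _))// (le_trans (lerD (ler_normB _ _) B4))//.
  rewrite (le_trans (lerD (lerD B2 B3) (lexx _)))//.
  have h1 : M * P <= M * P * p by rewrite ler_peMr.
  have h2 : 0 <= M * Y * NK * p by rewrite mulr_ge0// ltW.
  by rewrite mulrDl; move: h1 h2; clear; clearbody P NK; lra.
(* The limit [e -> 0] of [lap_by_parts], whose lower end term vanishes with [U]. *)
have parts : lap Y g p = expR (- (p * Y)) * U Y + p * lap Y U p.
  have n0 (n : nat) : 0 < Y / n.+2%:R by rewrite divr_gt0.
  have n1 (n : nat) : Y / n.+2%:R < Y by rewrite ltr_pdivrMr// ltr_pMr// ltr1n.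
  have c1 := Rint_cut0 Y0 ieg; have c2 := Rint_cut0 Y0 ieU; have c3 := Rint_cut0 Y0 (ig _ YT).
  have cUe : U (Y / n.+2%:R) @[n --> \oo] --> (0 : R).
    apply: (@cvg_eq _ _ _ _ _ (U Y - U Y)); first by rewrite subrr.
    rewrite (_ : (fun n : nat => U (Y / n.+2%:R)) = fun n : nat => U Y - \int[mu]_(s in `](Y / n.+2%:R), Y[) g s); last first.
      apply/funext => n; rewrite {2}/U (@Rint_cat _ _ 0 (Y / n.+2%:R) Y) ?(ltW (n0 n)) ?(ltW (n1 n))//; last exact: ig.
      by rewrite addrK.
    by apply: cvgB c3; exact: cvg_cst.
  have cE : expR (- (p * (Y / n.+2%:R))) * U (Y / n.+2%:R) @[n --> \oo] --> (0 : R).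
    apply: norm_cvg0; apply: (@squeeze_cvgr _ _ _ _ (fun=> 0) (fun n : nat => `|U (Y / n.+2%:R)|)).
    - apply: nearW => n; rewrite normr_ge0/= normrM ler_piMl//; apply: e1; exact: ltW.
    - exact: cvg_cst.
    - by rewrite -(normr0 R); apply: cvg_norm.
  have c4 : expR (- (p * Y)) * U Y - expR (- (p * (Y / n.+2%:R))) * U (Y / n.+2%:R) +
    p * \int[mu]_(s in `](Y / n.+2%:R), Y[) (expR (- (p * s)) * U s) @[n --> \oo] -->
    expR (- (p * Y)) * U Y - 0 + p * lap Y U p.
    apply: cvgD; first by apply: cvgB => //; exact: cvg_cst.
    by apply: cvgM => //; exact: cvg_cst.
  have c5 : (fun n : nat => \int[mu]_(s in `](Y / n.+2%:R), Y[) (expR (- (p * s)) * g s)) =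
    (fun n : nat => expR (- (p * Y)) * U Y - expR (- (p * (Y / n.+2%:R))) * U (Y / n.+2%:R) +
    p * \int[mu]_(s in `](Y / n.+2%:R), Y[) (expR (- (p * s)) * U s)).
    by apply/funext => n; rewrite (lap_by_parts p (n0 n) (n1 n) YT cg ig).
  rewrite c5 in c1.
  rewrite subr0 in c4.
  by rewrite /lap -(cvg_lim _ c1)// (cvg_lim _ c4).
have ci (y : R) : 0 < y < Y -> intg `]0, y[ (fun s => v s * power_ker (1 - a) (y - s)).
  move=> /andP[y0 yY]; apply: conv_integrand => //.
  - by move=> s /andP[s0 sy]; apply: cv; rewrite s0 (le_lt_trans sy (lt_trans yY YT)).
  - by move=> s; exact: power_ker_continuous.
  - by apply: iv; exact: lt_trans yY YT.
  - exact: kernel_class_power_ker.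
have [_ H] := conv_laplace Y0 p1 (iv _ YT) (kernel_class_power_ker b0) ci.
have HU : lap Y (conv v (power_ker (1 - a))) p = lap Y U p.
  apply: eq_Rint => s; rewrite /= in_itv/= => /andP[s0 sY]; by rewrite /U UE// s0 (lt_trans sY YT).
rewrite HU (Lap_power_ker b01 p0) -/NK in H.
have -> : lap Y g p - p `^ a * lap Y v p =
   expR (- (p * Y)) * U Y + p * (lap Y U p - p `^ (- (1 - a)) * lap Y v p).
  rewrite parts; clear UE HU parts; rewrite mulrBr addrA; congr (_ - _); rewrite mulrA; congr (_ * _).
  by rewrite -{2}(powRr1 (ltW p0)) -powRD ?(gt_eqF p0) ?implybT//; congr (_ `^ _); ring.
clear UE HU parts.
rewrite (le_trans (ler_normD _ _))// !normrM (gtr0_norm p0) (ger0_norm (expR_ge0 _)).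
rewrite (le_trans (lerD (ler_pM (expR_ge0 _) (normr_ge0 _) EE UYle) (ler_wpM2l (ltW p0) H)))//.
set E := expR (- ((p - 1) * Y)).
have E0 : 0 <= p * E by rewrite mulr_ge0 ?expR_ge0// ltW.
have h1 : p * (E * (\int[mu]_(s in `]0, Y[) `|v s| * NK)) <= p * E * (M * Y * NK).
  by rewrite -mulrA ler_wpM2l ?(ltW p0)// ler_wpM2l ?expR_ge0// ler_wpM2r.
by rewrite (le_trans (lerD (lexx _) h1))// -mulrDr mulrC ler_wpM2r// lerD2r ler_peMr// ler_wpDr ?ler1n// ltW.
Qed.

End fractional_transform_estimate.

(** * Green's formula *)

Section within_tools.
Context {R : realType}.
Local Notation RR := (measurableTypeR R).
Local Notation mu := (@lebesgue_measure R).
Local Notation intg D f := (mu.-integrable D (EFin \o f)).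

Lemma within_seq (T U : topologicalType) (A : set T) (h : T -> U) (x : T) (x_ : nat -> T) :
  {within A, continuous h} -> A x -> (forall n, A (x_ n)) -> x_ @ \oo --> x ->
  h (x_ n) @[n --> \oo] --> h x.
Proof.
move=> ch Ax xA cx; apply: (cvg_comp x_ h _ (ch x)).
move=> P hP; have {hP} /cx : (within A (nbhs x)) P by rewrite (nbhs_subspace_in Ax); exact: hP.
move=> H; suff : \forall n \near \oo, P (x_ n) by [].
have H' : \forall n \near \oo, A (x_ n) -> P (x_ n) by exact: H.
by apply: filterS H' => n; apply; exact: xA.
Qed.

Lemma within_comp (T U V : topologicalType) (A : set U) (f : T -> U) (h : U -> V) (x : T) :
  {within A, continuous h} -> {for x, continuous f} -> A (f x) -> (\forall z \near x, A (f z)) ->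
  {for x, continuous (fun z => h (f z))}.
Proof.
move=> ch cf Ax nA.
suff : h (f z) @[z --> x] --> h (f x) by [].
apply: (cvg_comp f h _ (ch (f x))).
move=> P hP; have {hP} /cf H : (within A (nbhs (f x))) P by rewrite (nbhs_subspace_in Ax); exact: hP.
have H' : nbhs x (fun z => A (f z) -> P (f z)) by exact: H.
by move: nA H'; apply: filterS2 => z Az; apply.
Qed.

Lemma continuous_pairr (x s : R) : {for s, continuous (fun s : R => (x, s))}.
Proof.
apply: (@cvg_pair _ _ _ (nbhs s) (nbhs x) (nbhs s) _ _ _ (fun=> x) (fun s => s)).
  exact: cvg_cst.
exact: cvg_id.
Qed.

Lemma continuous_swap (q : R * R) : {for q, continuous (fun q : R * R => (q.2, q.1))}.
Proof.
apply: (@cvg_pair _ _ _ (nbhs q) (nbhs q.2) (nbhs q.1) _ _ _ (fun q : R * R => q.2) (fun q : R * R => q.1)).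
  exact: cvg_snd.
exact: cvg_fst.
Qed.

Lemma slice_x (h : R * R -> R) (x s : R) : {for (x, s), continuous h} ->
  {for x, continuous (fun x => h (x, s))}.
Proof.
move=> ch; suff : h (z, s) @[z --> x] --> h (x, s) by [].
exact: (cvg_comp _ _ (@continuous_pairl R s x) ch).
Qed.

Lemma slice_y (h : R * R -> R) (x s : R) : {for (x, s), continuous h} ->
  {for s, continuous (fun s => h (x, s))}.
Proof.
move=> ch; suff : h (x, z) @[z --> s] --> h (x, s) by [].
exact: (cvg_comp _ _ (@continuous_pairr x s) ch).
Qed.

Lemma swap_cont (h : R * R -> R) (x s : R) : {for (x, s), continuous h} ->
  {for (s, x), continuous (fun q : R * R => h (q.2, q.1))}.
Proof.
move=> ch; suff : h (q.2, q.1) @[q --> (s, x)] --> h (x, s) by [].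
exact: (cvg_comp _ _ (@continuous_swap (s, x)) ch).
Qed.

Lemma comp_fst (f : R -> R) (x s : R) : {for x, continuous f} ->
  {for (x, s), continuous (fun q : R * R => f q.1)}.
Proof.
move=> cf; suff : f q.1 @[q --> (x, s)] --> f x by [].
exact: (cvg_comp (fun q : R * R => q.1) f (@cont_fst R (x, s)) cf).
Qed.

Lemma comp_snd (f : R -> R) (x s : R) : {for s, continuous f} ->
  {for (x, s), continuous (fun q : R * R => f q.2)}.
Proof.
move=> cf; suff : f q.2 @[q --> (x, s)] --> f s by [].
exact: (cvg_comp (fun q : R * R => q.2) f (@cont_snd R (x, s)) cf).
Qed.

Lemma itv_near (a b x : R) : a < x < b -> \forall z \near x, a < z < b.
Proof.
move=> /andP[ax xb]; near=> z; apply/andP; split; near: z; [exact: lt_nbhsr|exact: lt_nbhsl].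
Unshelve. all: by end_near. Qed.

Lemma Rint_exhaust (l : R) (f : RR -> R) : 0 < l -> intg `]0, l[ f ->
  \int[mu]_(s in `](l / n.+3%:R), (l - l / n.+3%:R)[) f s @[n --> \oo] --> \int[mu]_(s in `]0, l[) f s.
Proof.
move=> l0 fi.
have mI : measurable (`]0, l[%classic : set RR) by exact: measurable_itv.
have n0 (n : nat) : 0 < l / n.+3%:R by rewrite divr_gt0.
have E (n : nat) : \int[mu]_(s in `](l / n.+3%:R), (l - l / n.+3%:R)[) f s =
    \int[mu]_(s in `]0, l[) (f \_ `](l / n.+3%:R), (l - l / n.+3%:R)[) s.
  rewrite -Rintegral_mkcondr; congr (Rintegral _ _ _); apply/seteqP; split => x /=; rewrite !in_itv/=; last by case.
  have h := n0 n; move=> /andP[h1 h2]; rewrite h1 h2 (lt_trans h h1) (lt_trans h2)//.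
  by rewrite ltrBlDr ltrDl.
under eq_fun do rewrite E.
apply: (dominated_cvgR (g := fun s => `|f s|) mI _ _ _ _).2.
- by move=> n; apply: measurable_patch => //; exact: intg_measurable fi.
- move=> s; rewrite /= in_itv/= => /andP[s0 sY].
  have ls : 0 < l - s by lra.
  have Hc : (fun=> f s) @ \oo --> (f s : R) by exact: cvg_cst.
  apply: cvg_trans Hc; apply: near_eq_cvg; near=> n; rewrite patch_itvE in_itv/=.
  have h1 : l / n.+3%:R < s.
    have : l / s < n.+3%:R.
      have h : l / s < n%:R by near: n; exact: nbhs_infty_gtr.
      by rewrite (lt_trans h)// ltr_nat ltnW// ltnW.
    by rewrite ltr_pdivrMr// => h; rewrite ltr_pdivrMr// mulrC.
  have h2 : l / n.+3%:R < l - s.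
    have : l / (l - s) < n.+3%:R.
      have h : l / (l - s) < n%:R by near: n; exact: nbhs_infty_gtr.
      by rewrite (lt_trans h)// ltr_nat ltnW// ltnW.
    by rewrite ltr_pdivrMr// => h; rewrite ltr_pdivrMr// mulrC.
  by rewrite h1/= ltrBrDr addrC -ltrBrDr h2.
- exact: (integrable_norm fi).
- by move=> n s _; rewrite patch_itvE; case: ifP => // _; rewrite normr0.
Unshelve. all: by end_near. Qed.

Lemma cvg_divn (l : R) (k : nat) : l / (n + k.+1)%:R @[n --> \oo] --> (0 : R).
Proof.
apply: (@cvg_eq _ _ _ _ _ (l * 0)); first by rewrite mulr0.
apply: cvgM; first exact: cvg_cst.
have := @cvg_invSn R; rewrite -(cvg_shiftn k).
by under eq_fun do rewrite -addnS.
Qed.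

End within_tools.

Lemma norm_lt_thirds (R : realType) (a b c e : R) :
  `|a| < e / 3 -> `|b| < e / 3 -> `|c| < e / 3 -> `|a + b - c| < e.
Proof.
move=> ha hb hc; apply: (le_lt_trans (ler_normB _ _)).
have := ler_normD a b; lra.
Qed.

Section green.
Context {R : realType}.
Local Notation RR := (measurableTypeR R).
Local Notation mu := (@lebesgue_measure R).
Local Notation intg D f := (mu.-integrable D (EFin \o f)).

Variables (l T : R) (u ux uxx w : R -> R -> R).
Hypotheses (l0 : 0 < l)
  (cu : forall x y : R, 0 < x < l -> 0 < y < T -> {for (x, y), continuous (fun q : R * R => u q.1 q.2)})
  (cuxx : forall x y : R, 0 < x < l -> 0 < y < T -> {for (x, y), continuous (fun q : R * R => uxx q.1 q.2)})
  (du : forall x y : R, 0 < x < l -> 0 < y < T -> is_derive x 1 (u^~ y) (ux x y))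
  (dux : forall x y : R, 0 < x < l -> 0 < y < T -> is_derive x 1 (ux^~ y) (uxx x y))
  (cux : {within `[0, l] `*` `]0, T[, continuous (fun q : R * R => ux q.1 q.2)})
  (cu0 : forall y : R, 0 < y < T -> {within `[0, l], continuous (u^~ y)})
  (dw : forall x y : R, 0 < x < l -> 0 < y < T -> is_derive y 1 (w x) (uxx x y))
  (cw : {within `[0, l] `*` `[0, T], continuous (fun q : R * R => w q.1 q.2)}).

Variables (sg c om p : R).
Hypothesis sg2 : sg * sg = 1.
(** Both weights at once: [sg = 1], [c = 0] gives [exp(-om x)], and [sg = -1], [c = l] gives
    [exp(-om (l - x))]. Either solves [E'' = om^2 E]. *)
Let E (x : R) : R := expR (- (om * (sg * x + c))).
(** The boundary expression of Green's formula: its [x]-derivative is [E (uxx - om^2 u)]. *)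
Let F (x s : R) : R := E x * (ux x s + sg * om * u x s).
Let uh (e Y x : R) : R := \int[mu]_(s in `]e, Y[) (expR (- (p * s)) * u x s).
(** The transform of [uxx] over []e, Y[] after integration by parts through its [y]-primitive [w];
    in this form it stays bounded as [e] tends to 0. *)
Let gf (e Y x : R) : R := expR (- (p * Y)) * w x Y - expR (- (p * e)) * w x e +
  p * \int[mu]_(s in `]e, Y[) (expR (- (p * s)) * w x s).

Let dE (x : R) : is_derive x 1 E (- (om * sg) * E x).
Proof.
apply: (is_derive_eq (deriv_expR (deriv_opp (deriv_scale om (deriv_add (deriv_scale sg (deriv_id x)) (deriv_cst x c)))))); rewrite /E; ring.
Qed.

Let dexpy (s : R) := deriv_expR (deriv_opp (deriv_scale p (deriv_id s))).

Let cexpy (s : R) : {for s, continuous (fun s : R => expR (- (p * s)))}.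
Proof. exact: (is_derive_cont (dexpy s)). Qed.

(** The [x]-derivative of [F] is integrated in [x], the integrals are exchanged, and [uxx = dw/dy]
    is integrated by parts in [y]. On a closed rectangle inside the domain all the integrands are
    continuous. *)
Lemma green_rect (a b e Y : R) : 0 < a -> a < b -> b < l -> 0 < e -> e < Y -> Y < T ->
  \int[mu]_(s in `]e, Y[) (expR (- (p * s)) * (F b s - F a s)) =
  \int[mu]_(x in `]a, b[) (E x * (gf e Y x - om ^+ 2 * uh e Y x)).
Proof.
move=> a0 ab bl e0 eY YT.
have inx x : a <= x <= b -> 0 < x < l by move=> /andP[? ?]; apply/andP; split; lra.
have iny s : e <= s <= Y -> 0 < s < T by move=> /andP[? ?]; apply/andP; split; lra.
pose h (q : R * R) : R := expR (- (p * q.1)) * (E q.2 * (uxx q.2 q.1 - om ^+ 2 * u q.2 q.1)).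
have ch s x : e <= s <= Y -> a <= x <= b -> {for (s, x), continuous h}.
  move=> hs hx; have cc1 := swap_cont (cuxx (inx _ hx) (iny _ hs)).
  have cc2 := swap_cont (cu (inx _ hx) (iny _ hs)).
  have k1 := @comp_fst R (fun s => expR (- (p * s))) s x (@cexpy s).
  have k2 := @comp_snd R E s x (is_derive_cont (dE x)).
  exact: (cont_mul k1 (cont_mul k2 (cont_sub cc1 (cont_mul (@cont_cst R _ (s, x) (om ^+ 2)) cc2)))).
have [M HM] := @bounded_rect R h e Y a b ltac:(apply: continuous_in_subspaceT => -[s x] /set_mem [] /=; rewrite !in_itv/=; exact: ch).
have mh : measurable_fun (`]e, Y[%classic `*` `]a, b[%classic : set (RR * RR)) (h : RR * RR -> R).
  apply: rect_measurable => s x /andP[s1 s2] /andP[x1 x2]; apply: ch; apply/andP; split; exact: ltW.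
have mI (i : interval R) : measurable ([set` i] : set RR) by exact: measurable_itv.
have ic (k c1 d1 : R) : intg `]c1, d1[ (cst k : RR -> R) by apply: intg_oo => s _; exact: cont_cst.
have cx x s : a <= x <= b -> e <= s <= Y -> {for x, continuous (fun x => E x * (uxx x s - om ^+ 2 * u x s))}.
  move=> hx hs; apply: cont_mul; first exact: (is_derive_cont (dE x)).
  have k1 := slice_x (cuxx (inx _ hx) (iny _ hs)).
  have k2 := slice_x (cu (inx _ hx) (iny _ hs)).
  by apply: cont_sub; [exact: k1|apply: cont_mul; [exact: cont_cst|exact: k2]].
transitivity (\int[mu]_(s in `]e, Y[) \int[mu]_(x in `]a, b[) h (s, x)).
  apply: eq_Rint => s; rewrite /= in_itv/= => /andP[s1 s2].
  have hs : e <= s <= Y by apply/andP; split; exact: ltW.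
  have ih : intg `]a, b[ (fun x => E x * (uxx x s - om ^+ 2 * u x s)) by apply: intg_oo => x hx; exact: cx.
  transitivity (expR (- (p * s)) * \int[mu]_(x in `]a, b[) (E x * (uxx x s - om ^+ 2 * u x s))); last first.
    by rewrite -(RintZl _ (mI _) ih).
  congr (_ * _); apply/esym.
  apply: (@FTC2_cc R _ (fun x => F x s) a b ab) => x hx; first exact: cx.
  have k1 := dux (inx _ hx) (iny _ hs); have k2 := du (inx _ hx) (iny _ hs).
  apply: (is_derive_eq (deriv_mul (dE x) (deriv_add k1 (deriv_scale (sg * om) k2)))).
  have -> : E x * (uxx x s - om ^+ 2 * u x s) = E x * (uxx x s - (sg * sg) * om ^+ 2 * u x s).
    by rewrite sg2 mul1r.
  by cbv beta; ring.
have := @FubiniR_dom R `]e, Y[%classic `]a, b[%classic h (cst M) (cst 1) (mI _) (mI _) mh (ic _ _ _) (ic _ _ _)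
  ltac:(move=> s x; rewrite /= !in_itv/= mulr1 => /andP[s1 s2] /andP[x1 x2]; apply: HM; apply/andP; split; exact: ltW).
move=> [_ _ _ fub].
rewrite fub; clear fub; apply: eq_Rint => x; rewrite /= in_itv/= => /andP[x1 x2].
have hx : a <= x <= b by apply/andP; split; exact: ltW.
have cu1 s : e <= s <= Y -> {for s, continuous (fun s => expR (- (p * s)) * u x s)}.
  move=> hs; apply: cont_mul; first exact: (is_derive_cont (dexpy s)).
  exact: (slice_y (cu (inx _ hx) (iny _ hs))).
have cu2 s : e <= s <= Y -> {for s, continuous (fun s => expR (- (p * s)) * uxx x s)}.
  move=> hs; apply: cont_mul; first exact: (is_derive_cont (dexpy s)).
  exact: (slice_y (cuxx (inx _ hx) (iny _ hs))).
have cu3 s : e <= s <= Y -> {for s, continuous (fun s => expR (- (p * s)) * w x s)}.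
  move=> hs; apply: cont_mul; first exact: (is_derive_cont (dexpy s)).
  exact: (is_derive_cont (dw (inx _ hx) (iny _ hs))).
have i1 := intg_oo cu1; have i2 := intg_oo cu2; have i3 := intg_oo cu3.
have i1' := intgZl (om ^+ 2) (mI _) i1; have i3' := intgZl p (mI _) i3.
transitivity (\int[mu]_(s in `]e, Y[) (E x * (expR (- (p * s)) * uxx x s - om ^+ 2 * (expR (- (p * s)) * u x s)))).
  by apply: eq_Rint => s _; rewrite /h/=; ring.
rewrite (RintZl _ (mI _) (intgB (mI _) i2 i1')) (RintB (mI _) i2 i1') (RintZl _ (mI _) i1) -/(uh e Y x).
congr (_ * (_ - _)).
have := @FTC2_cc R (fun s => expR (- (p * s)) * uxx x s - p * (expR (- (p * s)) * w x s)) (fun s => expR (- (p * s)) * w x s) e Y eY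
  ltac:(by move=> s hs; apply: cont_sub; [exact: cu2|apply: cont_mul; [exact: cont_cst|exact: cu3]])
  ltac:(by move=> s hs; apply: (is_derive_eq (deriv_mul (dexpy s) (dw (inx _ hx) (iny _ hs)))); ring).
rewrite (RintB (mI _) i2 i3') (RintZl _ (mI _) i3) /gf; lra.
Qed.

Lemma ux_bound (e Y : R) : 0 < e -> Y < T ->
  exists M : R, forall x s : R, 0 <= x <= l -> e <= s <= Y -> `|ux x s| <= M.
Proof.
move=> e0 YT; have [M HM] := @bounded_rect R (fun q : R * R => ux q.1 q.2) 0 l e Y ltac:(
  apply: continuous_subspaceW cux => -[x s] [] /=; rewrite !in_itv/= => -> /andP[s1 s2];
  split => //; apply/andP; split; lra).
by exists M => x s; exact: HM.
Qed.

(** Mean value theorem on a horizontal segment, where [u] is continuous up to the ends and [ux] is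
    bounded by compactness of [[0, l] x [e, Y]]. *)
Lemma u_lip (e Y : R) : 0 < e -> Y < T ->
  exists2 M : R, 0 <= M & forall x x' s : R, 0 <= x <= l -> 0 <= x' <= l -> e <= s <= Y -> `|u x s - u x' s| <= M * `|x - x'|.
Proof.
move=> e0 YT; have [M HM] := ux_bound e0 YT.
have K x x' s : 0 <= x -> x < x' -> x' <= l -> e <= s <= Y -> `|u x' s - u x s| <= `|M| * `|x' - x|.
  move=> x0 xx xl /andP[es sY].
  have hs : 0 < s < T by apply/andP; split; lra.
  have [z] := @MVT R (u^~ s) (ux^~ s) x x' xx
    ltac:(by move=> z; rewrite in_itv/= => /andP[z1 z2]; apply: du => //; apply/andP; split; lra)
    ltac:(apply: continuous_subspaceW (cu0 hs) => z /=; rewrite !in_itv/= => /andP[z1 z2]; apply/andP; split; lra).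
  rewrite in_itv/= => /andP[z1 z2] ->; rewrite normrM ler_wpM2r//.
  rewrite (le_trans (HM z s _ _)) ?ler_norm ?es//; apply/andP; split; lra.
exists `|M| => // x x' s /andP[x0 xl] /andP[x0' xl'] hs.
have [xx|xx|->] := ltgtP x x'; last by rewrite !subrr normr0 mulr0.
  by rewrite distrC (distrC x); exact: K.
exact: K.
Qed.

(** On the sides [x = 0] and [x = l], continuity in [y] is inherited from the interior: [u] is
    Lipschitz in [x] uniformly for [y] in a compact interval, so a nearby interior line [x']
    approximates it uniformly. *)
Lemma u_cont_y (x y : R) : 0 <= x <= l -> 0 < y < T -> {for y, continuous (u x)}.
Proof.
move=> xl yT; have /andP[y0 yT'] := yT.
have y20 : 0 < y / 2 by lra.
have yT2 : (y + T) / 2 < T by lra.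
have hy : y / 2 <= y <= (y + T) / 2 by apply/andP; split; lra.
have [M M0 HM] := u_lip y20 yT2.
suff : u x z @[z --> y] --> u x y by [].
apply/cvgrPdist_lt => ep ep0.
have [x' hx' hd] : exists2 x', 0 < x' < l & M * `|x - x'| < ep / 3.
  have M1 : 0 < M + 1 by lra.
  (* The cap [l / 2] keeps [x + d / 2] or [x - d / 2] inside []0, l[], according to the half in
     which [x] lies. *)
  pose d := Num.min (ep / 3 / (M + 1)) (l / 2).
  have d0 : 0 < d by rewrite lt_min !divr_gt0.
  have dl : d <= l / 2 by rewrite ge_min lexx orbT.
  have de : M * d < ep / 3.
    have h1 : d <= ep / 3 / (M + 1) by rewrite ge_min lexx.
    have h2 : d * (M + 1) <= ep / 3 by rewrite -ler_pdivlMr.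
    by nra.
  move: xl => /andP[x0 xl].
  have [h|h] := leP x (l / 2).
    exists (x + d / 2); first by apply/andP; split; lra.
    rewrite (_ : x - (x + d / 2) = - (d / 2)); last by ring.
    by rewrite normrN gtr0_norm ?divr_gt0//; nra.
  exists (x - d / 2); first by apply/andP; split; lra.
  rewrite (_ : x - (x - d / 2) = (d / 2)); last by ring.
  by rewrite gtr0_norm ?divr_gt0//; nra.
have xl' : 0 <= x' <= l by move: hx' => /andP[? ?]; apply/andP; split; exact: ltW.
have cx' := slice_y (cu hx' yT).
have /cvgrPdist_lt/(_ (ep / 3)) nx : u x' z @[z --> y] --> u x' y by exact: cx'.
have ep3 : 0 < ep / 3 by lra.
near=> z.
have hz : y / 2 <= z <= (y + T) / 2.
  have : y / 2 < z < (y + T) / 2 by near: z; apply: itv_near; apply/andP; split; lra.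
  by move=> /andP[? ?]; apply/andP; split; exact: ltW.
have A1 := HM x x' y xl xl' hy.
have A2 := HM x x' z xl xl' hz.
have A3 : `|u x' y - u x' z| < ep / 3 by near: z; exact: nx.
have -> : u x y - u x z = (u x y - u x' y) + (u x' y - u x' z) - (u x z - u x' z) by ring.
exact: norm_lt_thirds (le_lt_trans A1 hd) A3 (le_lt_trans A2 hd).
Unshelve. all: by end_near. Qed.

Lemma ux_cont_y (x y : R) : 0 <= x <= l -> 0 < y < T -> {for y, continuous (ux x)}.
Proof.
move=> xl yT.
apply: (@within_comp _ _ _ (`[0, l] `*` `]0, T[) (fun s : R => (x, s)) (fun q : R * R => ux q.1 q.2)).
- exact: cux.
- exact: continuous_pairr.
- by split; rewrite /= in_itv.
- by near=> z; split; rewrite /= in_itv//=; near: z; exact: itv_near.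
Unshelve. all: by end_near. Qed.

(** The Lipschitz bound in [x] propagates the bound on the middle line [x = l / 2]. *)
Lemma u_bound (e Y : R) : 0 < e -> Y < T ->
  exists M : R, forall x s : R, 0 <= x <= l -> e <= s <= Y -> `|u x s| <= M.
Proof.
move=> e0 YT; have l1 := l0; have [M M0 HM] := u_lip e0 YT.
have hl2 : 0 <= l / 2 <= l by apply/andP; split; lra.
have [N N0 HN] := @bounded_seg R (u (l / 2)) e Y ltac:(by move=> s /andP[s1 s2]; apply: u_cont_y => //; apply/andP; split; lra).
exists (M * l + N) => x s hx hs.
have -> : u x s = (u x s - u (l / 2) s) + u (l / 2) s by ring.
rewrite (le_trans (ler_normD _ _))// lerD ?HN//.
rewrite (le_trans (HM _ _ _ hx hl2 hs))// ler_wpM2l//.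
by move: hx => /andP[? ?]; rewrite ler_norml; apply/andP; split; lra.
Qed.

Lemma w_bound : exists2 M : R, 0 <= M & forall x s : R, 0 <= x <= l -> 0 <= s <= T -> `|w x s| <= M.
Proof.
have [M HM] := @bounded_rect R (fun q : R * R => w q.1 q.2) 0 l 0 T cw.
by exists `|M| => // x s hx hs; rewrite (le_trans (HM _ _ hx hs))// ler_norm.
Qed.

Lemma w_cont_x (x s : R) : 0 < x < l -> 0 <= s <= T -> {for x, continuous (w^~ s)}.
Proof.
move=> xl sT; have /andP[x0 xl'] := xl.
apply: (@within_comp _ _ _ (`[0, l] `*` `[0, T]) (fun x : R => (x, s)) (fun q : R * R => w q.1 q.2)).
- exact: cw.
- exact: continuous_pairl.
- by split; rewrite /= in_itv//=; apply/andP; split; exact: ltW.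
- near=> z; split; rewrite /= in_itv//=.
  have /andP[? ?] : 0 < z < l by near: z; exact: itv_near.
  by apply/andP; split; exact: ltW.
Unshelve. all: by end_near. Qed.

Let near_dom (x : R) : 0 < x < l -> \forall z \near x, 0 < z < l.
Proof. exact: itv_near. Qed.

Let ieu (e Y x : R) : 0 < e -> Y < T -> 0 <= x <= l -> intg `]e, Y[ (fun s => expR (- (p * s)) * u x s).
Proof.
move=> e0 YT hx; apply: intg_oo => s /andP[s1 s2]; apply: cont_mul; first exact: cexpy.
by apply: u_cont_y => //; apply/andP; split; lra.
Qed.

Let exp_bound (e Y : R) : exists2 N : R, 0 < N & forall s : R, e <= s <= Y -> `|expR (- (p * s))| <= N.
Proof. by apply: bounded_seg => s _; exact: cexpy. Qed.

Let E_bound : exists2 N : R, 0 < N & forall x : R, 0 <= x <= l -> `|E x| <= N.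
Proof. by apply: bounded_seg => x _; exact: (is_derive_cont (dE x)). Qed.

Lemma uh_cont (e Y x : R) : 0 < e -> Y < T -> 0 < x < l -> {for x, continuous (uh e Y)}.
Proof.
move=> e0 YT hx; have [M HM] := u_bound e0 YT; have [N N0 HN] := exp_bound e Y.
apply: (@continuous_Rint_param R _ _ _ _ (N * M)).
- move=> s /andP[s1 s2]; apply: cont_mul; first exact: cont_cst.
  by apply: (slice_x (h := fun q : R * R => u q.1 q.2)); apply: cu => //; apply/andP; split; lra.
- near=> z; have /andP[z1 z2] : 0 < z < l by near: z; exact: near_dom.
  by apply: (intg_measurable (ieu e0 YT _)); apply/andP; split; exact: ltW.
- near=> z; have /andP[z1 z2] : 0 < z < l by near: z; exact: near_dom.
  move=> s /andP[s1 s2]; rewrite normrM ler_pM// ?HN ?HM//; apply/andP; split; exact: ltW.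
Unshelve. all: by end_near. Qed.

Lemma w_cont_y (x s : R) : 0 < x < l -> 0 < s < T -> {for s, continuous (w x)}.
Proof. by move=> hx hs; exact: (is_derive_cont (dw hx hs)). Qed.

Let iew (e Y x : R) : 0 <= e -> Y < T -> 0 < x < l -> intg `]e, Y[ (fun s => expR (- (p * s)) * w x s).
Proof.
move=> e0 YT hx; have [M M0 HM] := w_bound; have [N N0 HN] := exp_bound e Y.
have hx' : 0 <= x <= l by move: hx => /andP[? ?]; apply/andP; split; exact: ltW.
apply: (@intg_oo_bounded R _ _ (N * M)) => s /andP[s1 s2].
  by apply: cont_mul; [exact: cexpy|apply: w_cont_y => //; apply/andP; split; lra].
rewrite normrM ler_pM// ?HN ?HM//; apply/andP; split; lra.
Qed.

Let wh (e Y x : R) : R := \int[mu]_(s in `]e, Y[) (expR (- (p * s)) * w x s).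

Lemma wh_cont (e Y x : R) : 0 <= e -> Y < T -> 0 < x < l -> {for x, continuous (wh e Y)}.
Proof.
move=> e0 YT hx; have [M M0 HM] := w_bound; have [N N0 HN] := exp_bound e Y.
apply: (@continuous_Rint_param R _ _ _ _ (N * M)).
- move=> s /andP[s1 s2]; apply: cont_mul; first exact: cont_cst.
  by apply: w_cont_x => //; apply/andP; split; lra.
- near=> z; have hz : 0 < z < l by near: z; exact: near_dom.
  exact: (intg_measurable (iew e0 YT hz)).
- near=> z; have /andP[z1 z2] : 0 < z < l by near: z; exact: near_dom.
  move=> s /andP[s1 s2]; rewrite normrM ler_pM// ?HN ?HM//; apply/andP; split; lra.
Unshelve. all: by end_near. Qed.

Lemma wh_bound (Y : R) : Y < T -> exists2 M : R, 0 <= M & forall e x : R, 0 <= e < Y -> 0 < x < l -> `|wh e Y x| <= M.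
Proof.
move=> YT; have [M M0 HM] := w_bound; have [N N0 HN] := exp_bound 0 Y.
exists (N * M * `|Y|); first by rewrite !mulr_ge0// ltW.
move=> e x /andP[e0 eY] hx.
have hx' : 0 <= x <= l by move: hx => /andP[? ?]; apply/andP; split; exact: ltW.
rewrite (le_trans (@Rint_bound R e Y (N * M) _ (ltW eY) (iew e0 YT hx) _))//.
  move=> s /andP[s1 s2]; rewrite normrM ler_pM// ?HN ?HM//; apply/andP; split; lra.
rewrite ler_wpM2l ?mulr_ge0 ?(ltW N0)//; have := ler_norm Y; lra.
Qed.

Lemma uh_bound (e Y : R) : 0 < e -> e < Y -> Y < T ->
  exists2 M : R, 0 <= M & forall x : R, 0 <= x <= l -> `|uh e Y x| <= M.
Proof.
move=> e0 eY YT; have [M HM] := u_bound e0 YT; have [N N0 HN] := exp_bound e Y.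
have M0 : 0 <= M by apply: le_trans (HM 0 e _ _) => //; rewrite ?lexx ?(ltW l0) ?(ltW eY).
exists (N * M * (Y - e)); first by rewrite !mulr_ge0 ?(ltW N0)//; lra.
move=> x hx; apply: (Rint_bound (ltW eY) (ieu e0 YT hx)) => s /andP[s1 s2].
by rewrite normrM ler_pM// ?HN ?HM//; apply/andP; split; exact: ltW.
Qed.

Let gf_cont (e Y x : R) : 0 <= e <= T -> 0 <= Y -> Y < T -> 0 < x < l -> {for x, continuous (gf e Y)}.
Proof.
move=> /andP[e0 eT] Y0 YT hx; apply: cont_add.
  apply: cont_sub; (apply: cont_mul; [exact: cont_cst|apply: w_cont_x => //; apply/andP; split => //; exact: ltW]).
by apply: cont_mul; [exact: cont_cst|exact: wh_cont].
Qed.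

Let gf_bound (Y : R) : 0 < Y -> Y < T ->
  exists2 M : R, 0 <= M & forall e x : R, 0 <= e < Y -> 0 < x < l -> `|gf e Y x| <= M.
Proof.
move=> Y0 YT; have [M M0 HM] := w_bound; have [N N0 HN] := exp_bound 0 Y.
have [W W0 HW] := wh_bound YT.
exists (N * M + N * M + `|p| * W); first by rewrite !addr_ge0// mulr_ge0// ltW.
move=> e x /andP[e0 eY] hx.
have hx' : 0 <= x <= l by move: hx => /andP[? ?]; apply/andP; split; exact: ltW.
rewrite /gf (le_trans (ler_normD _ _))// lerD//; last first.
  by rewrite normrM ler_wpM2l// HW// e0.
rewrite (le_trans (ler_normB _ _))// !normrM lerD// ler_pM// ?HN ?HM//; apply/andP; split; lra.
Qed.

Let phi (e Y x : R) : R := E x * (gf e Y x - om ^+ 2 * uh e Y x).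

Let phi_intg (e Y : R) : 0 < e -> e < Y -> Y < T -> intg `]0, l[ (phi e Y).
Proof.
move=> e0 eY YT; have Y0 : 0 < Y by lra.
have [M M0 HM] := uh_bound e0 eY YT; have [N N0 HN] := E_bound; have [G G0 HG] := gf_bound Y0 YT.
apply: (@intg_oo_bounded R _ _ (N * (G + om ^+ 2 * M))) => x hx.
  apply: cont_mul; first exact: (is_derive_cont (dE x)).
  apply: cont_sub; first by apply: gf_cont => //; [apply/andP; split; lra|lra].
  by apply: cont_mul; [exact: cont_cst|exact: uh_cont].
have hx' : 0 <= x <= l by move: hx => /andP[? ?]; apply/andP; split; exact: ltW.
rewrite normrM ler_pM// ?HN// (le_trans (ler_normB _ _))// lerD//.
  by rewrite HG//; apply/andP; split=> //; exact: ltW.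
by rewrite normrM ger0_norm ?sqr_ge0// ler_wpM2l ?sqr_ge0// HM.
Qed.

(** The rectangle formula is pushed to the sides: [ux] is continuous on the strip with its sides,
    [u] on each horizontal segment with its ends, and both are bounded for [s] in [[e, Y]]. *)
Lemma green_strip (e Y : R) : 0 < e -> e < Y -> Y < T ->
  \int[mu]_(s in `]e, Y[) (expR (- (p * s)) * (F l s - F 0 s)) =
  \int[mu]_(x in `]0, l[) phi e Y x.
Proof.
move=> e0 eY YT; have l1 := l0.
have c1 := Rint_exhaust l0 (phi_intg e0 eY YT).
(* The denominators start at 3, so that [a_ n <= l / 3] lies to the left of [l - a_ n]. *)
pose a_ (n : nat) : R := l / n.+3%:R.
have ca : a_ n @[n --> \oo] --> (0 : R).
  by rewrite /a_; under eq_fun do rewrite -addn3; exact: (@cvg_divn R l 2).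
have cb : l - a_ n @[n --> \oo] --> l.
  apply: (@cvg_eq _ _ _ _ _ (l - 0)); first by rewrite subr0.
  by apply: cvgB ca; exact: cvg_cst.
have a0 n : 0 < a_ n by rewrite divr_gt0.
have al n : a_ n <= l / 3 by rewrite ler_wpM2l ?(ltW l0)// lef_pV2 ?posrE// ler_nat.
have ain n : 0 <= a_ n <= l by have := al n; have := a0 n; move=> ? ?; apply/andP; split; lra.
have bin n : 0 <= l - a_ n <= l by have := al n; have := a0 n; move=> ? ?; apply/andP; split; lra.
have [Mx HMx] := ux_bound e0 YT; have [Mu HMu] := u_bound e0 YT.
have [N N0 HN] := exp_bound e Y; have [NE NE0 HNE] := E_bound.
have Fb x s : 0 <= x <= l -> e <= s <= Y -> `|F x s| <= NE * (Mx + `|sg * om| * Mu).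
  move=> hx hs; rewrite /F normrM ler_pM// ?HNE// (le_trans (ler_normD _ _))// lerD ?HMx//.
  by rewrite normrM ler_wpM2l// HMu.
have l0l : 0 <= l <= l by rewrite lexx ltW.
have l00 : (0 : R) <= 0 <= l by apply/andP; split; [exact: lexx|exact: ltW].
have cF (x : R) (x_ : nat -> R) s : 0 < s < T -> 0 <= x <= l -> (forall n, 0 <= x_ n <= l) ->
    x_ @ \oo --> x -> F (x_ n) s @[n --> \oo] --> F x s.
  move=> hs hx hx_ cx; apply: cvgM.
    exact: (cvg_comp _ _ cx (is_derive_cont (dE x))).
  apply: cvgD.
    have cx2 : (x_ n, s) @[n --> \oo] --> (x, s) by exact: (cvg_comp _ _ cx (@continuous_pairl R s x)).
    apply: (within_seq (x_ := fun n => (x_ n, s)) cux _ _ cx2).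
      by split; rewrite /= in_itv.
    by move=> n; split; rewrite /= in_itv/=.
  apply: cvgM; first exact: cvg_cst.
  apply: (within_seq (cu0 hs) _ _ cx); first by rewrite /= in_itv.
  by move=> n; rewrite /= in_itv/=.
have mF x : 0 <= x <= l -> measurable_fun (`]e, Y[%classic : set RR) (F x).
  move=> hx; apply: measurable_oo => s /andP[s1 s2]; have hs : 0 < s < T by apply/andP; split; lra.
  apply: cont_mul; first exact: cont_cst.
  apply: cont_add; first exact: ux_cont_y.
  by apply: cont_mul; [exact: cont_cst|exact: u_cont_y].
have mexp : measurable_fun (`]e, Y[%classic : set RR) (fun s => expR (- (p * s))).
  by apply: measurable_oo => s _; exact: cexpy.
have [_ c2] := @dominated_cvgR R `]e, Y[%classic (fun n s => expR (- (p * s)) * (F (l - a_ n) s - F (a_ n) s))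
  (fun s => expR (- (p * s)) * (F l s - F 0 s)) (cst (N * (NE * (Mx + `|sg * om| * Mu) + NE * (Mx + `|sg * om| * Mu))))
  (measurable_itv _)
  ltac:(by move=> n; apply: measurable_funM => //; apply: measurable_funB; apply: mF)
  ltac:(move=> s; rewrite /= in_itv/= => /andP[s1 s2]; have hs : 0 < s < T by [apply/andP; split; lra];
     by apply: cvgM; [exact: cvg_cst|apply: cvgB; apply: cF])
  ltac:(by apply: intg_oo => s _; exact: cont_cst)
  ltac:(move=> n s; rewrite /= in_itv/= => /andP[s1 s2]; have hs : e <= s <= Y by [apply/andP; split; lra];
     by rewrite normrM ler_pM// ?HN// (le_trans (ler_normB _ _))// lerD// Fb).
have E1 : (fun n : nat => \int[mu]_(s in `]e, Y[) (expR (- (p * s)) * (F (l - a_ n) s - F (a_ n) s))) =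
    fun n : nat => \int[mu]_(x in `](l / n.+3%:R), (l - l / n.+3%:R)[) phi e Y x.
  apply/funext => n; have h1 := al n; have h2 := a0 n.
  have h3 : a_ n < l - a_ n by lra.
  have h4 : l - a_ n < l by lra.
  exact: (green_rect h2 h3 h4 e0 eY YT).
rewrite E1 in c2.
by rewrite -(cvg_lim _ c2)// (cvg_lim _ c1).
Qed.

Hypotheses (iu : forall x Z : R, 0 <= x <= l -> Z < T -> intg `]0, Z[ (u x))
  (iux0 : intg `]0, T[ (ux 0)) (iuxl : intg `]0, T[ (ux l)) (p0 : 0 <= p).

(** The left side converges as [e -> 0] because [u] and [ux] are integrable down to [y = 0] on the
    two sides. On the right, [Cu] bounds the truncated transforms of [u] for all [e] and [x], and
    [w] is bounded on the closed rectangle. *)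
Lemma green_limit (Y Cu : R) : 0 < Y -> Y < T ->
  (forall e x : R, 0 < e < Y -> 0 < x < l -> `|uh e Y x| <= Cu) ->
  let psi := fun x : R => E x * (expR (- (p * Y)) * w x Y - w x 0 + p * lap Y (w x) p - om ^+ 2 * lap Y (u x) p) in
  intg `]0, l[ psi /\
  E l * (lap Y (ux l) p + sg * om * lap Y (u l) p) - E 0 * (lap Y (ux 0) p + sg * om * lap Y (u 0) p) =
  \int[mu]_(x in `]0, l[) psi x.
Proof.
move=> Y0 YT hCu psi; have T0 : 0 < T by lra.
have [N N0 HN] := E_bound; have [G G0 HG] := gf_bound Y0 YT.
have l0l : 0 <= l <= l by rewrite lexx ltW.
have l00 : (0 : R) <= 0 <= l by apply/andP; split; [exact: lexx|exact: ltW].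
pose e_ (n : nat) : R := Y / n.+2%:R.
have e0 n : 0 < e_ n by rewrite divr_gt0.
have eY n : e_ n < Y by rewrite ltr_pdivrMr// ltr_pMr// ltr1n.
have ce : e_ n @[n --> \oo] --> (0 : R).
  by rewrite /e_; under eq_fun do rewrite -addn2; exact: (@cvg_divn R Y 1).
have iS (f : RR -> R) : intg `]0, T[ f -> intg `]0, Y[ f.
  by move=> h; apply: intgS h => //; apply: subset_itvl; rewrite bnd_simp ltW.
have jx0 := intg_exp p0 (iS _ iux0); have jxl := intg_exp p0 (iS _ iuxl).
have ju0 := intg_exp p0 (iu l00 YT); have jul := intg_exp p0 (iu l0l YT).
have mI : measurable (`]0, Y[%classic : set RR) by exact: measurable_itv.
pose H (s : R) : R := E l * (expR (- (p * s)) * ux l s + sg * om * (expR (- (p * s)) * u l s)) -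
  E 0 * (expR (- (p * s)) * ux 0 s + sg * om * (expR (- (p * s)) * u 0 s)).
have k1 := intgD mI jxl (intgZl (sg * om) mI jul).
have k0 := intgD mI jx0 (intgZl (sg * om) mI ju0).
have k1' := intgZl (E l) mI k1; have k0' := intgZl (E 0) mI k0.
have iH : intg `]0, Y[ H by exact: (intgB mI k1' k0').
have -> : E l * (lap Y (ux l) p + sg * om * lap Y (u l) p) - E 0 * (lap Y (ux 0) p + sg * om * lap Y (u 0) p) =
   \int[mu]_(s in `]0, Y[) H s.
  rewrite /H (RintB mI k1' k0') (RintZl _ mI k1) (RintZl _ mI k0).
  by rewrite (RintD mI jxl (intgZl (sg * om) mI jul)) (RintD mI jx0 (intgZl (sg * om) mI ju0)) (RintZl _ mI jul) (RintZl _ mI ju0).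
have c1 := Rint_cut0 Y0 iH.
have E1 : (fun n : nat => \int[mu]_(s in `](Y / n.+2%:R), Y[) H s) =
    fun n : nat => \int[mu]_(x in `]0, l[) phi (e_ n) Y x.
  apply/funext => n; rewrite -(green_strip (e0 n) (eY n) YT); apply: eq_Rint => s _.
  rewrite /H /F; ring.
rewrite E1 in c1; clear E1.
have [i2 c2] : intg `]0, l[ psi /\ \int[mu]_(x in `]0, l[) phi (e_ n) Y x @[n --> \oo] --> \int[mu]_(x in `]0, l[) psi x.
  apply: (@dominated_cvgR R `]0, l[%classic (fun n => phi (e_ n) Y) psi (cst (N * (G + om ^+ 2 * Cu)))).
  - exact: measurable_itv.
  - by move=> n; exact: (intg_measurable (phi_intg (e0 n) (eY n) YT)).
  - move=> x; rewrite /= in_itv/= => hx.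
    have hx' : 0 <= x <= l by move: hx => /andP[? ?]; apply/andP; split; exact: ltW.
    apply: cvgM; first exact: cvg_cst.
    apply: cvgB; last first.
      apply: cvgM; first exact: cvg_cst.
      exact: (Rint_cut0 Y0 (intg_exp p0 (iu hx' YT))).
    apply: cvgD; last first.
      apply: cvgM; first exact: cvg_cst.
      exact: (Rint_cut0 Y0 (iew (lexx 0) YT hx)).
    apply: cvgB; first exact: cvg_cst.
    apply: (@cvg_eq _ _ _ _ _ (expR (- (p * 0)) * w x 0)); first by rewrite mulr0 oppr0 expR0 mul1r.
    apply: cvgM.
      exact: (cvg_comp _ _ ce (@cexpy 0)).
    have cx2 : (x, e_ n) @[n --> \oo] --> (x, 0 : R) by exact: (cvg_comp _ _ ce (@continuous_pairr R x 0)).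
    apply: (within_seq (x_ := fun n => (x, e_ n)) cw _ _ cx2).
      by split; rewrite /= in_itv//= lexx ltW.
    move=> n; split; rewrite /= in_itv//=; apply/andP; split; first exact: ltW.
    by rewrite ltW// (lt_trans (eY n)).
  - by apply: intg_oo => s _; exact: cont_cst.
  - move=> n x; rewrite /= in_itv/= => hx.
    have hx' : 0 <= x <= l by move: hx => /andP[? ?]; apply/andP; split; exact: ltW.
    rewrite normrM ler_pM// ?HN// (le_trans (ler_normB _ _))// lerD//.
      by rewrite HG//; apply/andP; split=> //; exact: ltW.
    by rewrite normrM ger0_norm ?sqr_ge0// ler_wpM2l ?sqr_ge0// hCu// e0 eY.
split; first exact: i2.
by rewrite -(cvg_lim _ c1)// (cvg_lim _ c2).
Qed.

End green.

(** * The boundary formula *)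

Section transform_tools.
Context {R : realType}.
Local Notation RR := (measurableTypeR R).
Local Notation mu := (@lebesgue_measure R).
Local Notation intg D f := (mu.-integrable D (EFin \o f)).

(** Beyond [Y] one has [exp(-p z) <= exp(-(p-1) Y) exp(-z)]. *)
Lemma lap_Lap (K : R -> R) (Y p : R) : 0 < Y -> 1 <= p -> kernel_class K ->
  `|lap Y K p - Lap K p| <= expR (- ((p - 1) * Y)) * \int[mu]_(z in `]0, +oo[) `|expR (- z) * K z|.
Proof.
move=> Y0 p1 iK; have ik := kernel_class_exp p1 iK.
have mI : measurable (`]0, +oo[%classic : set RR) by exact: measurable_itv.
have mY : measurable (`]0, Y[%classic : set RR) by exact: measurable_itv.
pose g (z : R) : R := expR (- (p * z)) * K z.
have ig : intg `]0, +oo[ (g \_ `]0, Y[).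
  apply: (intg_le (g := fun z => `|g z|)) => //.
  - by apply: measurable_patch => //; exact: (intg_measurable ik).
  - exact: (integrable_norm ik).
  - by move=> s _; rewrite patch_itvE; case: ifP => // _; rewrite normr0.
have -> : lap Y K p = \int[mu]_(z in `]0, +oo[) (g \_ `]0, Y[) z.
  rewrite -Rintegral_mkcondr; congr (Rintegral _ _ _); apply/seteqP; split => x /=; rewrite !in_itv/= ?andbT; last by case.
  by move=> /andP[-> ->].
have iKn := integrable_norm iK : intg `]0, +oo[ (fun z => `|expR (- z) * K z|).
rewrite /Lap -(RintB mI ig ik) -(RintZl _ mI iKn).
apply: norm_int_le => //; [exact: intgB|exact: intgZl|].
move=> z; rewrite /= in_itv/= andbT => z0; rewrite patch_itvE in_itv/= z0/=.
case: ltP => zY; first by rewrite /g subrr normr0 mulr_ge0 ?expR_ge0.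
rewrite sub0r normrN !normrM !(ger0_norm (expR_ge0 _)) mulrA ler_wpM2r// -expRD ler_expR.
have : (p - 1) * Y <= (p - 1) * z by rewrite ler_wpM2l// subr_ge0.
by lra.
Qed.

Lemma lapD (Y p : R) (f g : RR -> R) : 0 <= p -> intg `]0, Y[ f -> intg `]0, Y[ g ->
  lap Y (fun s => f s + g s) p = lap Y f p + lap Y g p.
Proof.
move=> p0 fi gi; rewrite /lap -(RintD (measurable_itv _) (intg_exp p0 fi) (intg_exp p0 gi)).
by apply: eq_Rint => s _; exact: mulrDr.
Qed.

Lemma lapZ (Y p k : R) (f : RR -> R) : 0 <= p -> intg `]0, Y[ f ->
  lap Y (fun s => k * f s) p = k * lap Y f p.
Proof.
move=> p0 fi; rewrite /lap -(RintZl _ (measurable_itv _) (intg_exp p0 fi)).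
by apply: eq_Rint => s _; exact: mulrCA.
Qed.

Lemma lapB (Y p : R) (f g : RR -> R) : 0 <= p -> intg `]0, Y[ f -> intg `]0, Y[ g ->
  lap Y (fun s => f s - g s) p = lap Y f p - lap Y g p.
Proof.
move=> p0 fi gi; rewrite /lap -(RintB (measurable_itv _) (intg_exp p0 fi) (intg_exp p0 gi)).
by apply: eq_Rint => s _; exact: mulrBr.
Qed.

End transform_tools.

(** * Terms carrying the initial data *)

Section initial_terms.
Context {R : realType}.
Local Notation RR := (measurableTypeR R).
Local Notation mu := (@lebesgue_measure R).
Local Notation intg D f := (mu.-integrable D (EFin \o f)).

Variables (b th : R).
Hypotheses (b0 : 0 < b) (b1 : b < 1) (pith : pi / 2 < th) (thpi : th < pi)
  (bth : b * th < pi / 2).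
Local Notation K := (ker b th).

Variables (l M d a sg c : R) (f : R -> R).
Hypotheses (d1 : d < 1) (a0 : 0 <= a) (e01 : 0 < 1 - d - b * a < 1)
  (M0 : 0 <= M) (mf : measurable_fun (`]0, l[%classic : set RR) f)
  (fM : forall t : R, 0 < t < l -> `|f t| <= M)
  (phi0 : forall t : R, 0 < t < l -> 0 < sg * t + c)
  (iphi : intg `]0, l[ (fun t => (sg * t + c) `^ (- a))).
Let phi (t : R) : R := sg * t + c.

(** Twice the operator [Nop] once the Wright function is replaced by [ker]; [sg * t + c] will be the
    distance from [t] to an end of the interval. *)
Definition initial_term (y : R) : R := \int[mu]_(t in `]0, l[) (f t * K d (phi t) y).

Let e := 1 - d - b * a.

Let mphi : measurable_fun setT (phi : RR -> RR).
Proof. by apply: measurable_funD => //; apply: measurable_funM. Qed.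

(** The exponent [a] divides the singularity of the kernel between [y = 0] and the end where [phi]
    vanishes: [e < 1] makes [y^(-e)] integrable at 0, and [phi^(-a)] is integrable by [iphi]. *)
Let bnd : exists2 C, 0 <= C & forall t y : R, 0 < t < l -> 0 < y ->
  `|f t * K d (phi t) y| <= C * phi t `^ (- a) * y `^ (- e).
Proof.
have /andP[e0 _] := e01.
have [C C0 HC] := ker_bound_xy b0 pith thpi bth a0 e0.
exists (M * C); first exact: mulr_ge0.
move=> t y ht y0; rewrite normrM -!mulrA ler_pM// ?fM//.
by apply: HC => //; exact: phi0.
Qed.

Let mKt (y : R) : measurable_fun (`]0, l[%classic : set RR) (fun t => f t * K d (phi t) y).
Proof.
apply: measurable_funM => //; apply: measurable_funTS.
have mp : measurable_fun setT (fun t : RR => (phi t : RR, y : RR)).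
  by apply/prod_measurable_funP; split => /=; [exact: mphi|exact: measurable_cst].
exact: (measurableT_comp (measurable_ker b th d) mp).
Qed.

Lemma initial_term_continuous (y : R) : 0 < y -> {for y, continuous initial_term}.
Proof.
move=> y0; have [C C0 HC] := bnd; have y20 : 0 < y / 2 by lra.
have e0 : 0 < e by have /andP[] := e01.
apply: (@dominated_cvg_filter R `]0, l[%classic y (fun y t => f t * K d (phi t) y) (fun t => f t * K d (phi t) y)
   (fun t => C * (y / 2) `^ (- e) * phi t `^ (- a))).
- exact: measurable_itv.
- by near=> z; exact: mKt.
- move=> t; rewrite /= in_itv/= => ht; apply: cvgM; first exact: cvg_cst.
  exact: (continuous_ker_y b0 pith thpi bth d1 (ltW (phi0 ht)) y0).
- by apply: intgZl => //; exact: measurable_itv.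
- near=> z => t; rewrite /= in_itv/= => ht.
  have zy : y / 2 < z by near: z; apply: lt_nbhsr; lra.
  have z0 : 0 < z by lra.
  rewrite (le_trans (HC _ _ ht z0))// -!mulrA ler_wpM2l// mulrC ler_wpM2r ?powR_ge0//.
  rewrite !powRN lef_pV2 ?posrE ?powR_gt0//.
  by rewrite ge0_ler_powR// ?nnegrE ltW.
Unshelve. all: by end_near. Qed.

Let fub (p : R) : 1 <= p ->
  intg `]0, +oo[ (fun y => expR (- (p * y)) * initial_term y) /\
  Lap initial_term p = \int[mu]_(t in `]0, l[) (f t * (p `^ (- d) * expR (- (phi t * p `^ b)))).
Proof.
move=> p1; have [C C0 HC] := bnd; have p0 : 0 < p by rewrite (lt_le_trans ltr01).
have /andP[e0 e1] := e01.
pose h (q : RR * RR) : R := expR (- (p * q.1)) * (f q.2 * K d (phi q.2) q.1).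
have mD1 : measurable (`]0, +oo[%classic : set RR) by exact: measurable_itv.
have mD2 : measurable (`]0, l[%classic : set RR) by exact: measurable_itv.
have mh : measurable_fun (`]0, +oo[%classic `*` `]0, l[%classic : set (RR * RR)) h.
  apply: measurable_funM.
    apply: measurable_funTS.
    have := measurable_expR_lin (- p) 0 (measurableT : measurable (setT : set RR)) => mE.
    rewrite (_ : (fun q : RR * RR => expR (- (p * q.1))) = (fun s : RR => expR (- p * s + 0)) \o fst).
      exact: (measurableT_comp mE measurable_fst).
    by apply/funext => q /=; rewrite addr0 mulNr.
  apply: measurable_funM.
    have mDD : measurable (`]0, +oo[%classic `*` `]0, l[%classic : set (RR * RR)) by exact: measurableX.
    apply: (@measurable_comp _ _ _ _ _ _ (`]0, l[%classic : set RR) f _ snd) => //.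
      by move=> t [] [y z] [/= _ zl] <-.
    exact: measurable_funTS measurable_snd.
  apply: measurable_funTS.
  have mp : measurable_fun setT (fun q : RR * RR => (phi q.2 : RR, q.1 : RR)).
    apply/prod_measurable_funP; split => /=; last exact: measurable_fst.
    exact: (measurableT_comp mphi measurable_snd).
  exact: (measurableT_comp (measurable_ker b th d) mp).
have i1 : intg `]0, +oo[ (fun y : RR => y `^ (- e) * expR (- (1 * y))).
  have := @intg_powR_expR1 R (1 - e) 1; rewrite subr_gt0 => /(_ e1 ltr01).
  by apply: intg_eq => // y _; congr (_ `^ _ * _); rewrite addrAC subrr add0r.
have i2 : intg `]0, l[ (fun t => C * phi t `^ (- a)) by apply: intgZl.
have hle (y t : R) : (`]0, +oo[%classic : set RR) y -> (`]0, l[%classic : set RR) t ->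
    `|h (y, t)| <= y `^ (- e) * expR (- (1 * y)) * (C * phi t `^ (- a)).
  rewrite /= !in_itv/= andbT => y0 ht.
  rewrite normrM (ger0_norm (expR_ge0 _)).
  have h1 : expR (- (p * y)) <= expR (- (1 * y)) by rewrite ler_expR lerN2 ler_wpM2r// ltW.
  rewrite (le_trans (ler_pM (expR_ge0 _) (normr_ge0 _) h1 (HC _ _ ht y0)))//.
  by rewrite le_eqVlt; apply/orP; left; apply/eqP; ring.
have hE (y : RR) : (`]0, +oo[%classic : set RR) y ->
    \int[mu]_(t in `]0, l[) h (y, t) = expR (- (p * y)) * initial_term y.
  rewrite /= in_itv/= andbT => y0.
  have ik : intg `]0, l[ (fun t => f t * K d (phi t) y).
    apply: (intg_le (g := fun t => y `^ (- e) * (C * phi t `^ (- a)))) => //.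
      exact: intgZl.
    by move=> t; rewrite /= in_itv/= => ht; rewrite (le_trans (HC _ _ ht y0))// mulrC.
  by rewrite /initial_term -(RintZl _ mD2 ik).
have [_ j1 _ sw] := FubiniR_dom mD1 mD2 mh i1 i2 hle.
split.
  by apply: intg_eq j1; [exact: hE|exact: mD1].
transitivity (\int[mu]_(y in `]0, +oo[) \int[mu]_(t in `]0, l[) h (y, t)).
  by apply: eq_Rint => y y0; rewrite (hE y y0).
rewrite sw; clear sw hE; apply: eq_Rint => t; rewrite /= in_itv/= => ht.
have [k1 k2] := ker_laplace b0 pith thpi bth d1 (phi0 ht) p0.
rewrite -k2 -(RintZl _ mD1 k1); apply: eq_Rint => y _; rewrite /h/=; ring.
Qed.

Lemma kernel_class_initial_term : kernel_class initial_term.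
Proof.
have [h _] := fub (lexx 1).
by apply: intg_eq h => // y _; rewrite mul1r.
Qed.

Lemma Lap_initial_term (p : R) : 1 <= p ->
  Lap initial_term p = \int[mu]_(t in `]0, l[) (f t * (p `^ (- d) * expR (- (phi t * p `^ b)))).
Proof. by move=> /fub[]. Qed.

End initial_terms.

Section boundary_value_formula.
Context {R : realType}.
Local Notation RR := (measurableTypeR R).
Local Notation mu := (@lebesgue_measure R).
Local Notation intg D f := (mu.-integrable D (EFin \o f)).

(** The polynomial factor is absorbed by lowering the rate from [Y] to [Z], which gives the form
    that the uniqueness lemma accepts. *)
Lemma poly_expR_absorb (Y Z : R) : Z < Y -> exists2 C : R, 0 <= C & forall p : R, 1 <= p ->
  p ^+ 3 * expR (- ((p - 1) * Y)) <= C * expR (- (p * Z)).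
Proof.
move=> ZY; have d0 : 0 < Y - Z by lra.
exists (expR Y * (3%:R / 1 / (Y - Z)) `^ (3%:R / 1)); first by rewrite mulr_ge0 ?expR_ge0 ?powR_ge0.
move=> p p1; have p0 : 0 < p by rewrite (lt_le_trans ltr01).
have := @powR_expR_le R 3%:R 1 (Y - Z) p ltac:(by []) ltr01 d0 p0.
rewrite powR_mulrn ?(ltW p0)// powRr1 ?(ltW p0)// => h.
have -> : p ^+ 3 * expR (- ((p - 1) * Y)) = (p ^+ 3 * expR (- ((Y - Z) * p))) * (expR Y * expR (- (p * Z))).
  rewrite -mulrA -!expRD; congr (_ * expR _); ring.
rewrite [leRHS](_ : _ = (3%:R / 1 / (Y - Z)) `^ (3%:R / 1) * (expR Y * expR (- (p * Z)))); last by ring.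
by rewrite ler_wpM2r ?mulr_ge0 ?expR_ge0.
Qed.

(** The algebra of dividing by [s = p^b]. Here [r = p^(-b)] and [ex = exp(-l p^b)]; [a0], [a1],
    [a2], [a3] are the transforms of [g0], [h0], [h1], [g1]; [a8] is the integral of the initial
    data; [a4] to [a7] are the transforms of the terms of the boundary formula. Division does not
    enlarge the error since [r <= 1]. *)
Lemma combine_errors (r s sg ex W V C1 C2 C3 C4 C5 a0 a1 a2 a3 a4 a5 a6 a7 a8 : R) :
  0 <= r -> r <= 1 -> r * s = 1 -> W <= V ->
  0 <= C1 -> 0 <= C2 -> 0 <= C3 -> 0 <= C4 -> 0 <= C5 ->
  `|s * a0 + sg * a1 - sg * ex * a2 - ex * (s * a3) - a8| <= C5 * V ->
  `|a7 - ex * a3| <= C4 * W ->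
  `|a6 - r * ex * a2| <= C3 * W ->
  `|a5 - r * a1| <= C2 * W ->
  `|a4 - r * a8| <= C1 * W ->
  `|a0 - (a4 - sg * a5 + sg * a6 + a7)| <= (C5 + C1 + `|sg| * C2 + `|sg| * C3 + C4) * V.
Proof.
move=> r0 r1 rs WV C10 C20 C30 C40 C50 H5 H4 H3 H2 H1.
have E5 : `|r * (s * a0 + sg * a1 - sg * ex * a2 - ex * (s * a3) - a8)| <= C5 * V.
  by rewrite normrM ger0_norm// (le_trans _ H5)// ler_piMl.
have -> : a0 - (a4 - sg * a5 + sg * a6 + a7) =
  r * (s * a0 + sg * a1 - sg * ex * a2 - ex * (s * a3) - a8)
  - (a4 - r * a8) + sg * (a5 - r * a1) - sg * (a6 - r * ex * a2) - (a7 - ex * a3).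
  have -> : r * (s * a0 + sg * a1 - sg * ex * a2 - ex * (s * a3) - a8) =
    (r * s) * a0 + r * sg * a1 - r * sg * ex * a2 - ex * ((r * s) * a3) - r * a8 by ring.
  rewrite rs; ring.
have F1 : `|a4 - r * a8| <= C1 * V by rewrite (le_trans H1)// ler_wpM2l.
have F2 : `|sg * (a5 - r * a1)| <= `|sg| * C2 * V.
  by rewrite normrM -(mulrA _ C2) ler_wpM2l// (le_trans H2)// ler_wpM2l.
have F3 : `|sg * (a6 - r * ex * a2)| <= `|sg| * C3 * V.
  by rewrite normrM -(mulrA _ C3) ler_wpM2l// (le_trans H3)// ler_wpM2l.
have F4 : `|a7 - ex * a3| <= C4 * V by rewrite (le_trans H4)// ler_wpM2l.
rewrite !mulrDl.
rewrite (le_trans (ler_normB _ _))// lerD// (le_trans (ler_normB _ _))// lerD//.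
by rewrite (le_trans (ler_normD _ _))// lerD// (le_trans (ler_normB _ _))// lerD.
Qed.

Variables (b th : R).
Hypotheses (b0 : 0 < b) (b1 : b < 1) (pith : pi / 2 < th) (thpi : th < pi)
  (bth : b * th < pi / 2).

Variables (l T sg c Mt : R) (n : nat) (tk : nat -> R -> R) (g0 g1 h0 h1 : R -> R).
Hypotheses (l0 : 0 < l) (Mt0 : 0 <= Mt)
  (phi0 : forall t : R, 0 < t < l -> 0 < sg * t + c)
  (iphi : forall a : R, a < 1 -> intg `]0, l[ (fun t => (sg * t + c) `^ (- a)))
  (ctk : forall (k : nat) (x : R), (1 <= k <= n)%N -> 0 < x < l -> {for x, continuous (tk k)})
  (btk : forall (k : nat) (x : R), (1 <= k <= n)%N -> 0 < x < l -> `|tk k x| <= Mt)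
  (exa : forall k : nat, (1 <= k <= n)%N -> exists a, [/\ 0 <= a, a < 1, b - k%:R + 1 < 1 & 0 < 1 - (b - k%:R + 1) - b * a < 1])
  (cg0 : forall s : R, 0 < s < T -> {for s, continuous g0})
  (cg1 : forall s : R, 0 < s < T -> {for s, continuous g1})
  (ch0 : forall s : R, 0 < s < T -> {for s, continuous h0})
  (ch1 : forall s : R, 0 < s < T -> {for s, continuous h1})
  (ig0 : forall Z : R, Z < T -> intg `]0, Z[ g0)
  (ig1 : forall Z : R, Z < T -> intg `]0, Z[ g1)
  (ih0 : forall Z : R, Z < T -> intg `]0, Z[ h0)
  (ih1 : forall Z : R, Z < T -> intg `]0, Z[ h1).
Let S (m : nat) (p x : R) : R := (\sum_(1 <= k < m.+1) tk k x * p `^ (k%:R - 1)) * expR (- (p `^ b * (sg * x + c))).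
Hypothesis identity : forall Y : R, 0 < Y < T -> exists2 C : R, 0 <= C & forall p : R, 1 <= p ->
  `|p `^ b * lap Y g0 p + sg * lap Y h0 p - sg * expR (- (l * p `^ b)) * lap Y h1 p
    - expR (- (l * p `^ b)) * (p `^ b * lap Y g1 p) - \int[mu]_(x in `]0, l[) S n p x|
  <= C * (p ^+ 3 * expR (- ((p - 1) * Y))).

Let I (k : nat) : R -> R := initial_term b th l (b - k%:R + 1) sg c (tk k).

Let mtk (k : nat) : (1 <= k <= n)%N -> measurable_fun (`]0, l[%classic : set RR) (tk k).
Proof. by move=> hk; apply: measurable_oo => x; exact: ctk. Qed.

Let I_class (k : nat) : (1 <= k <= n)%N -> kernel_class (I k).
Proof.
move=> hk; have [a [a0 a1 d1 e01]] := exa hk.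
exact: (kernel_class_initial_term b0 pith thpi bth d1 a0 e01 Mt0 (mtk hk) (fun x => btk hk) phi0 (iphi a1)).
Qed.

Let I_cont (k : nat) (y : R) : (1 <= k <= n)%N -> 0 < y -> {for y, continuous (I k)}.
Proof.
move=> hk; have [a [a0 a1 d1 e01]] := exa hk.
exact: (initial_term_continuous b0 pith thpi bth d1 a0 e01 Mt0 (mtk hk) (fun x => btk hk) phi0 (iphi a1)).
Qed.

Let iS1 (k : nat) (p : R) : (1 <= k <= n)%N -> 0 <= p ->
  intg `]0, l[ (fun x => tk k x * p `^ (k%:R - 1) * expR (- (p `^ b * (sg * x + c)))).
Proof.
move=> hk p0; apply: (@intg_oo_bounded R _ _ (Mt * p `^ (k%:R - 1))) => x hx.
  apply: cont_mul; first by apply: cont_mul; [exact: ctk|exact: cont_cst].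
  exact: (is_derive_cont (deriv_expR (deriv_opp (deriv_scale (p `^ b) (deriv_add (deriv_scale sg (deriv_id x)) (deriv_cst x c)))))).
rewrite !normrM (ger0_norm (powR_ge0 _ _)) (ger0_norm (expR_ge0 _)).
rewrite -[leRHS]mulr1 ler_pM ?mulr_ge0 ?powR_ge0 ?expR_ge0//.
  by rewrite ler_wpM2r ?powR_ge0// btk.
by rewrite expR_le1 oppr_le0 mulr_ge0 ?powR_ge0// ltW// phi0.
Qed.

Let Lap_I (k : nat) (p : R) : (1 <= k <= n)%N -> 1 <= p -> Lap (I k) p =
  p `^ (- b) * \int[mu]_(x in `]0, l[) (tk k x * p `^ (k%:R - 1) * expR (- (p `^ b * (sg * x + c)))).
Proof.
move=> hk p1; have p0 : 0 < p by rewrite (lt_le_trans ltr01).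
have [a [a0 a1 d1 e01]] := exa hk.
rewrite (Lap_initial_term b0 pith thpi bth d1 a0 e01 Mt0 (mtk hk) (fun x => btk hk) phi0 (iphi a1) p1).
rewrite -(RintZl _ (measurable_itv _) (iS1 hk (ltW p0))); apply: eq_Rint => x _ /=.
have -> : - (b - k%:R + 1) = - b + (k%:R - 1) by ring.
by rewrite powRD ?(gt_eqF p0) ?implybT// (mulrC (sg * x + c)); ring.
Qed.

(** Induction on the number of initial terms; [m <= n] because the data [tk k] are controlled for
    [1 <= k <= n] only. *)
Let sums (Y : R) (m : nat) : 0 < Y -> (m <= n)%N ->
  [/\ forall y : R, 0 < y -> {for y, continuous (fun y => \sum_(1 <= k < m.+1) I k y)},
      intg `]0, Y[ (fun y => \sum_(1 <= k < m.+1) I k y),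
      forall p : R, 1 <= p -> intg `]0, l[ (S m p) &
      exists2 C : R, 0 <= C & forall p : R, 1 <= p ->
       `|lap Y (fun y => \sum_(1 <= k < m.+1) I k y) p - p `^ (- b) * \int[mu]_(x in `]0, l[) S m p x| <= C * expR (- ((p - 1) * Y))].
Proof.
move=> Y0; elim: m => [_|m IH mn].
  have e0 : (fun y : RR => \sum_(1 <= k < 1) I k y) = fun=> 0 by apply/funext => y; rewrite big_geq.
  have e1 p : S 0 p = fun=> 0 by apply/funext => x; rewrite /S big_geq// mul0r.
  rewrite e0; split.
  - by move=> y _; exact: cont_cst.
  - exact: integrable0.
  - by move=> p _; rewrite e1; exact: integrable0.
  - exists 0 => // p _; rewrite e1 /lap Rintegral_cst// mul0r mulr0 subr0.
    rewrite (@eq_Rint R _ _ (fun=> 0)); first by rewrite Rintegral_cst// mul0r normr0 mul0r.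
    by move=> s _; rewrite mulr0.
have [c1 i1 j1 [C C0 HC]] := IH (ltnW mn).
have hm : (1 <= m.+1 <= n)%N by rewrite mn.
have e0 : (fun y : RR => \sum_(1 <= k < m.+2) I k y) = fun y => \sum_(1 <= k < m.+1) I k y + I m.+1 y.
  by apply/funext => y; rewrite big_nat_recr.
pose Q (p x : R) : R := tk m.+1 x * p `^ (m.+1%:R - 1) * expR (- (p `^ b * (sg * x + c))).
have e1 p : S m.+1 p = fun x => S m p x + Q p x.
  by apply/funext => x; rewrite /S big_nat_recr//= mulrDl.
have iI : intg `]0, Y[ (I m.+1) by apply: kernel_intg; exact: I_class.
rewrite e0; split.
- by move=> y y0; apply: cont_add; [exact: c1|exact: I_cont].
- by apply: intgD.
- move=> p p1; rewrite e1; apply: intgD => //; first exact: j1.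
  by apply: iS1 => //; rewrite (le_trans ler01).
have N0 : 0 <= \int[mu]_(z in `]0, +oo[) `|expR (- z) * I m.+1 z| by apply: Rintegral_ge0.
exists (C + \int[mu]_(z in `]0, +oo[) `|expR (- z) * I m.+1 z|); first exact: addr_ge0.
move=> p p1; have p0 : 0 <= p by rewrite (le_trans ler01).
have k1 := HC p p1; have k2 := lap_Lap Y0 p1 (I_class hm).
rewrite (lapD p0 i1 iI) e1 (RintD (measurable_itv _) (j1 p p1) (iS1 hm p0)).
rewrite (Lap_I hm p1) -/(Q p) in k2.
rewrite mulrDr mulrDl opprD addrACA.
rewrite (le_trans (ler_normD _ _))// lerD//.
by rewrite [leRHS]mulrC; exact: k2.
Qed.

Let K (d : R) : R -> R := ker b th d l.

Let K_class (d : R) : d < 1 -> kernel_class (K d).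
Proof.
move=> d1; have [h _] := ker_laplace b0 pith thpi bth d1 l0 (@ltr01 R).
by apply: intg_eq h => // y _; rewrite mul1r.
Qed.

Let Lap_K (d p : R) : d < 1 -> 0 < p -> Lap (K d) p = p `^ (- d) * expR (- (l * p `^ b)).
Proof. by move=> d1 p0; have [_] := ker_laplace b0 pith thpi bth d1 l0 p0. Qed.

Let K_cont (d s : R) : d < 1 -> 0 < s -> {for s, continuous (K d)}.
Proof. by move=> d1 s0; exact: (continuous_ker_y b0 pith thpi bth d1 (ltW l0) s0). Qed.

Let conv_facts (f H : R -> R) (Y : R) : 0 < Y < T ->
  (forall s : R, 0 < s < T -> {for s, continuous f}) -> (forall Z : R, Z < T -> intg `]0, Z[ f) ->
  (forall s : R, 0 < s -> {for s, continuous H}) -> kernel_class H ->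
  intg `]0, Y[ (conv f H) /\ exists2 C : R, 0 <= C & forall p : R, 1 <= p ->
    `|lap Y (conv f H) p - Lap H p * lap Y f p| <= C * expR (- ((p - 1) * Y)).
Proof.
move=> /andP[Y0 YT] cf fi cH iH.
have ci (y : R) : 0 < y < Y -> intg `]0, y[ (fun s => f s * H (y - s)).
  move=> /andP[y0 yY]; apply: conv_integrand => //; last by apply: fi; lra.
  by move=> s /andP[s0 sy]; apply: cf; rewrite s0/=; lra.
split; first exact: (conv_laplace Y0 (lexx 1) (fi _ YT) iH ci).1.
exists ((\int[mu]_(s in `]0, Y[) `|f s|) * (\int[mu]_(z in `]0, +oo[) `|expR (- z) * H z|)).
  by apply: mulr_ge0; apply: Rintegral_ge0.
by move=> p p1; rewrite [leRHS]mulrC; exact: (conv_laplace Y0 p1 (fi _ YT) iH ci).2.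
Qed.

(** The difference [J] of the two sides is continuous, and its transform over [(0, Y)] is
    [O(p^3 exp(-(p-1) Y))] by [identity] and the convolution estimates. With [y < Z < Y < T] this is
    [O(exp(-p Z))], so uniqueness gives [J y = 0]. *)
Lemma boundary_value_formula (y : R) : 0 < y < T ->
  g0 y = \sum_(1 <= k < n.+1) initial_term b th l (b - k%:R + 1) sg c (tk k) y
    - sg * conv h0 (power_ker b) y + sg * conv h1 (ker b th b l) y + conv g1 (ker b th 0 l) y.
Proof.
move=> yT; have /andP[y0 yT'] := yT.
pose Y := (y + T) / 2; pose Z := (y + Y) / 2.
have [yZ ZY YT] : [/\ y < Z, Z < Y & Y < T] by rewrite /Z /Y; split; lra.
have Y0 : 0 < Y by lra.
have YT0 : 0 < Y < T by rewrite Y0.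
have b01 : 0 < b < 1 by apply/andP.
have K0 : (0 : R) < 1 := ltr01.
have [cS iS _ [C1 C10 H1]] := sums Y0 (leqnn n).
have [i2 [C2 C20 H2]] := conv_facts YT0 ch0 ih0 (@power_ker_continuous R b) (kernel_class_power_ker b0).
have [i3 [C3 C30 H3]] := conv_facts YT0 ch1 ih1 (fun s => @K_cont b s b1) (K_class b1).
have [i4 [C4 C40 H4]] := conv_facts YT0 cg1 ig1 (fun s => @K_cont 0 s ltr01) (K_class ltr01).
have [C5 C50 H5] := identity YT0.
have [C6 C60 H6] := poly_expR_absorb ZY.
pose A (y : R) : R := \sum_(1 <= k < n.+1) I k y.
pose J (y : R) : R := g0 y - (A y - sg * conv h0 (power_ker b) y + sg * conv h1 (K b) y + conv g1 (K 0) y).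
suff : J y = 0 by rewrite /J => /eqP; rewrite subr_eq0 => /eqP.
have mY : measurable (`]0, Y[%classic : set RR) by exact: measurable_itv.
have i2' := intgZl sg mY i2; have i3' := intgZl sg mY i3.
have q1 := intgB mY iS i2'; have q2 := intgD mY q1 i3'; have q3 := intgD mY q2 i4.
have ig := ig0 YT; have iJ := intgB mY ig q3.
have cJ : {for y, continuous J}.
  have w2 : {for y, continuous (conv h0 (power_ker b))}.
    exact: (conv_continuous yT ch0 (@power_ker_continuous R b) ih0 (kernel_class_power_ker b0)).
  have w3 : {for y, continuous (conv h1 (K b))}.
    exact: (conv_continuous yT ch1 (fun s => @K_cont b s b1) ih1 (K_class b1)).
  have w4 : {for y, continuous (conv g1 (K 0))}.
    exact: (conv_continuous yT cg1 (fun s => @K_cont 0 s ltr01) ig1 (K_class ltr01)).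
  have w1 := cS y y0.
  exact: (cont_sub (@cg0 y yT) (cont_add (cont_add (cont_sub w1 (cont_mul (@cont_cst R _ y sg) w2)) (cont_mul (@cont_cst R _ y sg) w3)) w4)).
pose CC := C5 + C1 + `|sg| * C2 + `|sg| * C3 + C4.
have CC0 : 0 <= CC by rewrite /CC !addr_ge0// mulr_ge0.
apply: (@laplace_decay_eq0 R J Y Z (CC * C6) y) => //; [exact: ltW|exact: mulr_ge0|].
move=> m m0; set p : R := m%:R.
have p1 : 1 <= p by rewrite ler1n.
have p0 : 0 < p by rewrite (lt_le_trans ltr01).
have p0' := ltW p0.
suff LJ : `|lap Y J p| <= CC * (p ^+ 3 * expR (- ((p - 1) * Y))).
  apply: (le_trans LJ); rewrite -mulrA ler_wpM2l//; exact: H6.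
have -> : lap Y J p = lap Y g0 p - (lap Y A p - sg * lap Y (conv h0 (power_ker b)) p
    + sg * lap Y (conv h1 (K b)) p + lap Y (conv g1 (K 0)) p).
  rewrite /J (lapB p0' ig q3) (lapD p0' q2 i4) (lapD p0' q1 i3') (lapB p0' iS i2') (lapZ sg p0' i2) (lapZ sg p0' i3).
  by [].
have W0 := expR_ge0 (- ((p - 1) * Y)).
have WW : expR (- ((p - 1) * Y)) <= p ^+ 3 * expR (- ((p - 1) * Y)) by rewrite ler_peMl// exprn_ege1.
have pb : p `^ (- b) * p `^ b = 1 by rewrite powRN mulVf// gt_eqF// powR_gt0.
have pb1 : p `^ (- b) <= 1 by rewrite powRN invf_le1 ?powR_gt0// powR_ge1// ltW.
have k2 := H2 p p1; have k3 := H3 p p1; have k4 := H4 p p1.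
rewrite (Lap_power_ker b01 p0) in k2; rewrite (Lap_K b1 p0) in k3; rewrite (Lap_K ltr01 p0) oppr0 powRr0 mul1r in k4.
exact: (combine_errors (powR_ge0 _ _) pb1 pb WW C10 C20 C30 C40 C50 (H5 p p1) k4 k3 k2 (H1 p p1)).
Qed.

End boundary_value_formula.

Section boundary.
Context {R : realType}.
Local Notation RR := (measurableTypeR R).
Local Notation mu := (@lebesgue_measure R).
Local Notation intg D f := (mu.-integrable D (EFin \o f)).

Lemma intg_sum (D : set RR) (m : nat) (F : nat -> RR -> R) : measurable D ->
  (forall k : nat, (1 <= k < m)%N -> intg D (F k)) -> intg D (fun x => \sum_(1 <= k < m) F k x).
Proof.
move=> mD; elim: m => [|m IH] iF.
  rewrite (_ : (fun _ => _) = fun=> 0); first exact: integrable0.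
  by apply/funext => x; rewrite big_geq.
have [m0|m0] := posnP m.
  rewrite (_ : (fun _ => _) = fun=> 0); first exact: integrable0.
  by apply/funext => x; rewrite m0 big_geq.
rewrite (_ : (fun _ => _) = fun x => \sum_(1 <= k < m) F k x + F m x); last first.
  by apply/funext => x; rewrite big_nat_recr.
apply: intgD => //; last by apply: iF; rewrite m0 ltnSn.
by apply: IH => k /andP[k0 km]; apply: iF; rewrite k0 ltnW.
Qed.

Lemma intg_power (l a : R) : a < 1 -> intg `]0, l[ (fun t => t `^ (- a)).
Proof.
move=> a1; apply: kernel_intg.
have := @intg_powR_expR1 R (1 - a) 1; rewrite subr_gt0 => /(_ a1 ltr01).
by apply: intg_eq => // y _; rewrite addrAC subrr add0r mul1r mulrC.
Qed.

Variables (l T : R) (u ux uxx w : R -> R -> R).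
Hypotheses (l0 : 0 < l)
  (cu : forall x y : R, 0 < x < l -> 0 < y < T -> {for (x, y), continuous (fun q : R * R => u q.1 q.2)})
  (cuxx : forall x y : R, 0 < x < l -> 0 < y < T -> {for (x, y), continuous (fun q : R * R => uxx q.1 q.2)})
  (du : forall x y : R, 0 < x < l -> 0 < y < T -> is_derive x 1 (u^~ y) (ux x y))
  (dux : forall x y : R, 0 < x < l -> 0 < y < T -> is_derive x 1 (ux^~ y) (uxx x y))
  (cux : {within `[0, l] `*` `]0, T[, continuous (fun q : R * R => ux q.1 q.2)})
  (cu0 : forall y : R, 0 < y < T -> {within `[0, l], continuous (u^~ y)})
  (dw : forall x y : R, 0 < x < l -> 0 < y < T -> is_derive y 1 (w x) (uxx x y))
  (cw : {within `[0, l] `*` `[0, T], continuous (fun q : R * R => w q.1 q.2)})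
  (iu : forall x Z : R, 0 <= x <= l -> Z < T -> intg `]0, Z[ (u x))
  (iux0 : intg `]0, T[ (ux 0)) (iuxl : intg `]0, T[ (ux l)).

Variables (b Mt : R) (n : nat) (tk : nat -> R -> R).
Hypotheses (b0 : 0 < b) (b1 : b < 1) (Mt0 : 0 <= Mt)
  (ctk : forall (k : nat) (x : R), (1 <= k <= n)%N -> 0 < x < l -> {for x, continuous (tk k)})
  (btk : forall (k : nat) (x : R), (1 <= k <= n)%N -> 0 < x < l -> `|tk k x| <= Mt)
  (exa : forall k : nat, (1 <= k <= n)%N -> exists a, [/\ 0 <= a, a < 1, b - k%:R + 1 < 1 & 0 < 1 - (b - k%:R + 1) - b * a < 1])
  (asymp : forall Y : R, 0 < Y < T -> exists2 C : R, 0 <= C & forall p x : R, 1 <= p -> 0 < x < l ->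
    `|expR (- (p * Y)) * w x Y - w x 0 + p * lap Y (w x) p - (p `^ b) ^+ 2 * lap Y (u x) p
       + \sum_(1 <= k < n.+1) tk k x * p `^ (k%:R - 1)| <= C * (p ^+ 3 * expR (- ((p - 1) * Y))) /\
    forall e : R, 0 < e < Y -> `|\int[mu]_(s in `]e, Y[) (expR (- (p * s)) * u x s)| <= C * p).

Variables (sg c x0 x1 : R).
(** The first alternative represents [u] at the left end, with weight [exp(-p^b x)]; the second at
    the right end, with [exp(-p^b (l - x))]. In both, [sg * x + c] is the distance from [x] to
    [x0]. *)
Hypothesis ends : [/\ sg = 1, c = 0, x0 = 0 & x1 = l] \/ [/\ sg = -1, c = l, x0 = l & x1 = 0].

Let phi0 (t : R) : 0 < t < l -> 0 < sg * t + c.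
Proof. by move=> /andP[t0 tl]; case: ends => -[-> -> _ _]; lra. Qed.

Let iphi (a : R) : a < 1 -> intg `]0, l[ (fun t => (sg * t + c) `^ (- a)).
Proof.
move=> a1; have ip := intg_power l a1; case: ends => -[-> -> _ _].
  by apply: intg_eq ip => // t _; rewrite mul1r addr0.
by apply: intg_eq (Rint_reflect ip).1 => // t _; rewrite mulN1r addrC.
Qed.

Let sg2 : sg * sg = 1.
Proof. by case: ends => -[-> _ _ _]; rewrite ?mulrNN mulr1. Qed.

Let S (p x : R) : R := (\sum_(1 <= k < n.+1) tk k x * p `^ (k%:R - 1)) * expR (- (p `^ b * (sg * x + c))).

(** Green's formula with [om = p^b]. By [asymp] the bracket in [psi] is minus the sum of the initial
    terms, up to an error uniform in [x]; the weight is at most 1, so integrating over [(0, l)]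
    multiplies the error by [l]. *)
Let identity (Y : R) : 0 < Y < T -> exists2 C : R, 0 <= C & forall p : R, 1 <= p ->
  `|p `^ b * lap Y (u x0) p + sg * lap Y (ux x0) p - sg * expR (- (l * p `^ b)) * lap Y (ux x1) p
    - expR (- (l * p `^ b)) * (p `^ b * lap Y (u x1) p) - \int[mu]_(x in `]0, l[) S p x|
  <= C * (p ^+ 3 * expR (- ((p - 1) * Y))).
Proof.
move=> hY; have [C C0 HC] := asymp hY; have /andP[Y0 YT] := hY.
have l1 := l0; exists (C * l); first by rewrite mulr_ge0// ltW.
move=> p p1; have p0 : 0 < p by rewrite (lt_le_trans ltr01).
set W := p ^+ 3 * expR (- ((p - 1) * Y)).
have [ip e] := @green_limit R l T u ux uxx w l0 cu cuxx du dux cux cu0 dw cw sg c (p `^ b) p sg2 iu iux0 iuxl (ltW p0)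
  Y (C * p) Y0 YT (fun e x he hx => (HC p x p1 hx).2 e he).
pose psi (x : R) : R := expR (- (p `^ b * (sg * x + c))) *
  (expR (- (p * Y)) * w x Y - w x 0 + p * lap Y (w x) p - (p `^ b) ^+ 2 * lap Y (u x) p).
have iS : intg `]0, l[ (S p).
  rewrite (_ : S p = fun x => \sum_(1 <= k < n.+1) (tk k x * p `^ (k%:R - 1)) * expR (- (p `^ b * (sg * x + c)))); last first.
    by apply/funext => x; rewrite /S mulr_suml.
  apply: intg_sum => [|k hk]; first exact: measurable_itv.
  apply: (@intg_oo_bounded R _ _ (Mt * p `^ (k%:R - 1))) => x hx.
    apply: cont_mul; first by apply: cont_mul; [exact: ctk|exact: cont_cst].
    exact: (is_derive_cont (deriv_expR (deriv_opp (deriv_scale (p `^ b) (deriv_add (deriv_scale sg (deriv_id x)) (deriv_cst x c)))))).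
  rewrite !normrM (ger0_norm (powR_ge0 _ _)) (ger0_norm (expR_ge0 _)).
  rewrite -[leRHS]mulr1 ler_pM ?mulr_ge0 ?powR_ge0 ?expR_ge0//.
    by rewrite ler_wpM2r ?powR_ge0// btk.
  by rewrite expR_le1 oppr_le0 mulr_ge0 ?powR_ge0// ltW// phi0.
have mI : measurable (`]0, l[%classic : set RR) by exact: measurable_itv.
have bnd : `|\int[mu]_(x in `]0, l[) psi x + \int[mu]_(x in `]0, l[) S p x| <= C * l * W.
  rewrite -(RintD mI ip iS).
  have -> : C * l * W = C * W * (l - 0) by ring.
  apply: Rint_bound; [exact: ltW|exact: intgD|].
  move=> x hx; have [h _] := HC p x p1 hx.
  rewrite /S [X in psi x + X]mulrC -mulrDr normrM ger0_norm ?expR_ge0// -[leRHS]mul1r.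
  rewrite ler_pM ?expR_ge0//.
  by rewrite expR_le1 oppr_le0 mulr_ge0 ?powR_ge0// ltW// phi0.
rewrite -/psi in e.
(* The boundary terms of Green's formula have the sign opposite to the stated combination. *)
rewrite -normrN; rewrite -e in bnd; clear e ip iS.
rewrite [X in `|X|](_ : _ = expR (- (p `^ b * (sg * l + c))) * (lap Y (ux l) p + sg * (p `^ b) * lap Y (u l) p) -
   expR (- (p `^ b * (sg * 0 + c))) * (lap Y (ux 0) p + sg * (p `^ b) * lap Y (u 0) p) + \int[mu]_(x in `]0, l[) S p x); first exact: bnd.
clear bnd; move: (\int[mu]_(x in `]0, l[) S p x) => J.
case: ends => -[-> -> -> ->].
  have -> : 1 * l + 0 = l :> R by ring.
  have -> : 1 * 0 + 0 = 0 :> R by ring.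
  by rewrite mulr0 oppr0 expR0 (mulrC l); ring.
have -> : -1 * l + l = 0 :> R by ring.
have -> : -1 * 0 + l = l :> R by ring.
by rewrite mulr0 oppr0 expR0 (mulrC l); ring.
Qed.

Variable th : R.
Hypotheses (pith : pi / 2 < th) (thpi : th < pi) (bth : b * th < pi / 2).

Let x0l : 0 <= x0 <= l.
Proof. by have l1 := l0; case: ends => -[_ _ -> _]; apply/andP; split; lra. Qed.

Let x1l : 0 <= x1 <= l.
Proof. by have l1 := l0; case: ends => -[_ _ _ ->]; apply/andP; split; lra. Qed.

Let iux (x : R) : x = 0 \/ x = l -> forall Z : R, Z < T -> intg `]0, Z[ (ux x).
Proof.
have h (f : RR -> R) : intg `]0, T[ f -> forall Z : R, Z < T -> intg `]0, Z[ f.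
  by move=> jf Z ZT; apply: intgS jf => //; apply: subset_itvl; rewrite bnd_simp ltW.
by case=> ->; apply: h.
Qed.

Lemma boundary_representation (y : R) : 0 < y < T ->
  u x0 y = \sum_(1 <= k < n.+1) initial_term b th l (b - k%:R + 1) sg c (tk k) y
    - sg * conv (ux x0) (power_ker b) y + sg * conv (ux x1) (ker b th b l) y + conv (u x1) (ker b th 0 l) y.
Proof.
have cuy (x : R) (hx : 0 <= x <= l) (s : R) (hs : 0 < s < T) : {for s, continuous (u x)}.
  exact: (u_cont_y l0 cu du cux cu0 hx hs).
have cuxy (x : R) (hx : 0 <= x <= l) (s : R) (hs : 0 < s < T) : {for s, continuous (ux x)}.
  exact: (ux_cont_y cux hx hs).
apply: (boundary_value_formula b0 b1 pith thpi bth l0 Mt0 phi0 iphi ctk btk exa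
  (cuy _ x0l) (cuy _ x1l) (cuxy _ x0l) (cuxy _ x1l) (fun Z => iu x0l) (fun Z => iu x1l)).
- by apply: iux; case: ends => -[_ _ -> _]; [left|right].
- by apply: iux; case: ends => -[_ _ _ ->]; [right|left].
- exact: identity.
Qed.

End boundary.

(** * One-sided derivatives and continuity *)

Section one_sided.
Context {R : realType}.
Implicit Types (A : set R) (f : R -> R).

Lemma within_map (T U V : topologicalType) (A : set T) (B : set U) (f : T -> U) (h : U -> V) :
  {within B, continuous h} -> continuous f -> (forall x, A x -> B (f x)) ->
  {within A, continuous (fun x => h (f x))}.
Proof.
move=> ch cf AB; rewrite continuous_subspace_in => x /set_mem Ax.
suff H : f z @[z --> within A (nbhs x)] --> within B (nbhs (f x)).
  have := ch (f x); rewrite /continuous_at => cx.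
  have e1 : nbhs (x : subspace A) = within A (nbhs x) by rewrite (nbhs_subspace_in Ax).
  have e2 : nbhs (f x : subspace B) = within B (nbhs (f x)) by rewrite (nbhs_subspace_in (AB _ Ax)).
  move=> P /cx hP.
  have {}hP : (within B (nbhs (f x))) (h @^-1` P) by rewrite (nbhs_subspace_in (AB _ Ax)); exact: hP.
  have := H _ hP => hP'.
  suff : (within A (nbhs x)) (fun z => P (h (f z))) by rewrite (nbhs_subspace_in Ax).
  exact: hP'.
move=> P hP; have := cf x _ hP => hP'.
have {}hP' : nbhs x (fun z => B (f z) -> P (f z)) by exact: hP'.
have : nbhs x (fun z => A z -> P (f z)).
  by apply: filterS hP' => z Bz Az; apply: Bz; exact: AB.
by [].
Qed.

(** At an interior point the punctured neighbourhoods within [A] and on the line form the same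
    filter; what remains is the translation between [t] and [x + h]. *)
Lemma derive_in_interior A f x : A x -> nbhs x A -> derivable f x 1 ->
  derive_in A f x = derive1 f x.
Proof.
move=> Ax nA df; rewrite /derive_in.
have -> : within A x^' = x^'.
  apply/seteqP; split => P; last exact: cvg_within.
  rewrite /within /= => hP.
  have hP' : x^' (fun z => A z -> P z) by exact: hP.
  have nA' : x^' A by exact: nbhs_dnbhs.
  by apply: filterS2 nA' hP' => z Az; apply.
apply: (cvg_lim (@Rhausdorff R)).
have : h^-1 *: (f (h *: 1 + x) - f x) @[h --> 0^'] --> derive1 f x by rewrite derive1E; exact: df.
move=> /cvgrPdist_lt H; apply/cvgrPdist_lt => e e0.
have /nbhs_ballP[d /= d0 Hd] : nbhs (0 : R) (fun h => h != 0 -> `|derive1 f x - h^-1 *: (f (h *: 1 + x) - f x)| < e) by exact: H.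
suff : nbhs x (fun t => t != x -> `|derive1 f x - (f t - f x) / (t - x)| < e) by [].
apply/nbhs_ballP; exists d => //= t td tx.
have /= := Hd (t - x); rewrite subr_eq0 => /(_ _ tx).
rewrite {1}/GRing.scale/= /GRing.scale/= mulr1 subrK mulrC; apply.
by rewrite /ball/= sub0r opprB.
Qed.

Lemma derivable_in_continuous A f : (forall x, A x -> derivable_in A f x) ->
  {within A, continuous f}.
Proof.
move=> dA; rewrite continuous_subspace_in => x /set_mem Ax.
suff H : f t @[t --> within A (nbhs x)] --> f x.
  move=> P /H hP.
  suff : (within A (nbhs x)) (fun z => P (f z)) by rewrite (nbhs_subspace_in Ax).
  exact: hP.
have /cvg_ex[L /cvgrPdist_lt/(_ 1 ltr01) HL] := dA x Ax.
apply/cvgrPdist_lt => e e0.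
have M0 : 0 < `|L| + 1 by rewrite ltr_wpDl.
have /nbhs_ballP[d /= d0 Hd] : nbhs x (fun t => t != x -> A t -> `|L - (f t - f x) / (t - x)| < 1) by exact: HL.
suff : nbhs x (fun t => A t -> `|f x - f t| < e) by [].
(* Within [d] of [x] the difference quotient is below [|L| + 1] in absolute value, so [f] moves by
   less than [e] within the distance [e / (|L| + 1)]. *)
apply/nbhs_ballP; exists (Num.min d (e / (`|L| + 1))) => /=; first by rewrite lt_min d0 divr_gt0.
move=> t; rewrite /ball/= lt_min => /andP[td te] At.
have [->|tx] := eqVneq t x; first by rewrite subrr normr0.
have := Hd t td tx At => h.
have q : `|(f t - f x) / (t - x)| < `|L| + 1.
  have -> : (f t - f x) / (t - x) = L - (L - (f t - f x) / (t - x)) by ring.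
  by rewrite (le_lt_trans (ler_normB _ _))// ltrD2l.
rewrite distrC.
have tx0 : 0 < `|t - x| by rewrite normr_gt0 subr_eq0.
have -> : f t - f x = (f t - f x) / (t - x) * (t - x).
  by rewrite divfK// subr_eq0.
rewrite normrM (@lt_le_trans _ _ ((`|L| + 1) * `|t - x|))//.
  by rewrite ltr_pM2r.
by rewrite mulrC -ler_pdivlMr// distrC ltW.
Qed.

End one_sided.

(** * Riemann-Liouville operators as convolutions *)

Section fractional_def.
Context {R : realType}.
Local Notation RR := (measurableTypeR R).
Local Notation mu := (@lebesgue_measure R).
Local Notation intg D f := (mu.-integrable D (EFin \o f)).
Implicit Types (g : R -> R) (nu y : R).

Lemma RL_ex_derivable nu g y : 0 < nu -> RL_ex nu g y -> is_derive y 1 (RL (nu - 1) g) (RL nu g y).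
Proof.
move=> nu0; rewrite /RL_ex (RL_nder_gt0 nu0) /= => -[_ df].
by rewrite (RL_gt0 g nu0) derive1E; apply/derivableP.
Qed.

Lemma RL_ex_intg (a : R) g y : 0 < a -> RL_ex (- a) g y ->
  intg `]0, y[ (fun s => g s / (y - s) `^ (- a + 1)).
Proof.
move=> a0; rewrite /RL_ex RL_nder_le0 ?oppr_le0 ?(ltW a0)//= => -[|//].
by move=> /eqP; rewrite oppr_eq0 gt_eqF.
Qed.

Lemma RL_conv (a : R) g y : 0 < a -> intg `]0, y[ (fun s => g s / (y - s) `^ (- a + 1)) ->
  RL (- a) g y = conv g (power_ker a) y.
Proof.
move=> a0 ig; rewrite RL_lt0 ?oppr_lt0// opprK -(RintZl _ (measurable_itv _) ig).
apply: eq_Rint => s _; rewrite /power_ker (_ : a - 1 = - (- a + 1)); last by ring.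
rewrite powRN; ring.
Qed.

(** Existence of the fractional integral at one [y] beyond [Z] makes [g] times the weight
    [(y - s)^(a-1)] integrable; since [a < 1], the reciprocal of the weight is bounded on []0, y[]
    and can be multiplied back. *)
Lemma RL_ex_intg_fun (a Z T : R) g : 0 < a -> 0 < T -> Z < T ->
  (forall y, 0 < y < T -> RL_ex (- a) g y) -> a < 1 -> intg `]0, Z[ g.
Proof.
move=> a0 T0 ZT ex a1.
pose Z1 := Num.max Z (T / 2).
pose y := (Z1 + T) / 2.
have Z1T : Z1 < T by rewrite gt_max ZT/=; lra.
have Z10 : 0 < Z1 by rewrite lt_max; apply/orP; right; lra.
have [y0 yT] : 0 < y /\ y < T by rewrite /y; split; lra.
have Zy : Z <= y.
  by have : Z <= Z1 by [rewrite le_max lexx]; rewrite /y; lra.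
have i1 := RL_ex_intg a0 (ex y (introT andP (conj y0 yT))).
suff : intg `]0, y[ g.
  by move=> h; apply: intgS h => //; apply: subset_itvl; rewrite bnd_simp.
have mI : measurable (`]0, y[%classic : set RR) by exact: measurable_itv.
have mg : measurable_fun (`]0, y[%classic : set RR) (fun s : RR => (y - s) `^ (- a + 1)).
  by apply: measurable_oo => s /andP[s0 sy]; apply: (continuous_reflect (f := fun z => z `^ (- a + 1)));
    apply: continuous_powR; lra.
have := @intgM_bounded R `]0, y[%classic _ (fun s : RR => (y - s) `^ (- a + 1)) (y `^ (- a + 1)) mI i1 mg.
have h : forall s : RR, (`]0, y[%classic : set RR) s -> `|(y - s) `^ (- a + 1)| <= y `^ (- a + 1).
  move=> s; rewrite /= in_itv/= => /andP[s0 sy].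
  by rewrite ger0_norm ?powR_ge0// ge0_ler_powR// ?nnegrE; lra.
move=> /(_ h); apply: intg_eq => // s; rewrite /= in_itv/= => /andP[s0 sy].
by rewrite mulrC divfK// gt_eqF// powR_gt0// subr_gt0.
Qed.

Lemma cvg_right_within (h : R -> R) (T L : R) : 0 < T -> {within `[0, T], continuous h} ->
  h y @[y --> 0^'+] --> L -> L = h 0.
Proof.
move=> T0 ch cL.
pose y_ (n : nat) : R := T / n.+2%:R.
have y0 n : 0 < y_ n by rewrite divr_gt0.
have yT n : y_ n < T by rewrite ltr_pdivrMr// ltr_pMr// ltr1n.
have cy : y_ n @[n --> \oo] --> (0 : R).
  by rewrite /y_; under eq_fun do rewrite -addn2; exact: (@cvg_divn R T 1).
have c1 : h (y_ n) @[n --> \oo] --> h 0.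
  apply: (within_seq (x_ := y_) ch) => //.
    by rewrite /= in_itv/= lexx ltW.
  by move=> n; rewrite /= in_itv/= !ltW.
have c2 : h (y_ n) @[n --> \oo] --> L by move/cvg_at_rightP : cL; apply.
by rewrite -(cvg_lim _ c1)// (cvg_lim _ c2).
Qed.

End fractional_def.

(** * Expansion of the transformed equation *)

Section asymptotics.
Context {R : realType}.
Local Notation RR := (measurableTypeR R).
Local Notation mu := (@lebesgue_measure R).
Local Notation intg D f := (mu.-integrable D (EFin \o f)).

(** In the application [alpha = 2 b] and [g = n - alpha], so [p^n = p^(2 b) p^g] and the second term
    is [-p^(2 b)] times the error made on the transform of [u]. The factor [p^(2 b) <= p^2] and the
    factor [p] in that error give the cube. *)
Lemma remainder_bound (C M p b g Y E1 L V : R) (n : nat) : (1 <= n <= 2)%N -> 0 <= C -> 0 <= M -> 1 <= p -> 0 < Y ->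
  0 < b < 1 -> g = n%:R - b * 2 ->
  `|L - p `^ g * V| <= C * (p * expR (- ((p - 1) * Y))) -> `|E1| <= M * (1 + p) ->
  `|expR (- (p * Y)) * E1 + (p ^+ n * V - (p `^ b) ^+ 2 * L)| <= (M * 2 + C) * (p ^+ 3 * expR (- ((p - 1) * Y))).
Proof.
move=> hn C0 M0 p1 Y0 /andP[b0 b1] gE H HE.
have p0 : 0 < p by rewrite (lt_le_trans ltr01).
set W := expR (- ((p - 1) * Y)); have W0 : 0 <= W by exact: expR_ge0.
have pw : p ^+ n = (p `^ b) ^+ 2 * p `^ g.
  rewrite -(powR_mulrn 2 (powR_ge0 p b)) -powRrM -powRD ?(gt_eqF p0) ?implybT//.
  by rewrite gE addrC subrK powR_mulrn// ltW.
have pb2 : (p `^ b) ^+ 2 <= p ^+ 2.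
  rewrite -(powR_mulrn 2 (powR_ge0 p b)) -powRrM -(powR_mulrn 2 (ltW p0)) ler_powR//.
  by rewrite ler_piMl// ltW.
have eW : expR (- (p * Y)) <= W by rewrite ler_expR; lra.
have p2 : p <= p ^+ 3 by rewrite exprS ler_peMr ?(ltW p0)// exprn_ege1.
have p3 : 1 <= p ^+ 3 by rewrite exprn_ege1.
have e1 : p ^+ n * V - (p `^ b) ^+ 2 * L = - ((p `^ b) ^+ 2 * (L - p `^ g * V)) by rewrite pw; ring.
rewrite e1 (le_trans (ler_normB _ _))// mulrDl lerD//.
  rewrite normrM (ger0_norm (expR_ge0 _)).
  rewrite (le_trans (ler_pM (expR_ge0 _) (normr_ge0 _) eW HE))//.
  have -> : M * 2 * (p ^+ 3 * W) = W * (M * (p ^+ 3 + p ^+ 3)) by ring.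
  by rewrite ler_wpM2l// ler_wpM2l// lerD.
rewrite normrM (ger0_norm (sqr_ge0 _)) (le_trans (ler_pM (sqr_ge0 _) (normr_ge0 _) pb2 H))//.
rewrite -/W le_eqVlt; apply/orP; left; apply/eqP; ring.
Qed.

Lemma lap_derivative (f F : R -> R) (T Y p : R) : 0 < Y -> Y < T ->
  {within `[0, T], continuous f} -> {within `[0, T], continuous F} ->
  (forall y : R, 0 < y < T -> is_derive y 1 F (f y)) ->
  lap Y f p = expR (- (p * Y)) * F Y - F 0 + p * lap Y F p.
Proof.
move=> Y0 YT cf cF dF.
have sub : `[0, Y] `<=` `[0, T] by move=> y /=; rewrite !in_itv/= => /andP[-> yY]; rewrite (le_trans yY)// ltW.
have {}cf := continuous_subspaceW sub cf; have {}cF := continuous_subspaceW sub cF.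
have ce : {within `[0, Y], continuous (fun s : R => expR (- (p * s)))}.
  by apply: continuous_subspaceT => s; exact: (is_derive_cont (deriv_expR (deriv_opp (deriv_scale p (deriv_id s))))).
have cM' (g h : R -> R) : {within `[0, Y], continuous g} -> {within `[0, Y], continuous h} ->
    {within `[0, Y], continuous (fun s => g s * h s)}.
  by move=> cg ch x; apply: cvgM; [exact: cg|exact: ch].
have c1 := cM' _ _ ce cf; have c2 := cM' _ _ ce cF.
have c3 : {within `[0, Y], continuous (fun s => expR (- (p * s)) * f s - p * (expR (- (p * s)) * F s))}.
  by move=> x; apply: cvgB; [exact: c1|apply: cvgM; [exact: cvg_cst|exact: c2]].
have iI (g : R -> R) : {within `[0, Y], continuous g} -> intg `]0, Y[ g.
  by move=> cg; apply: intgS (intg_continuous cg) => //; exact: subset_itv_oo_cc.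
have mI : measurable (`]0, Y[%classic : set RR) by exact: measurable_itv.
have i1 := iI _ c1; have i2 := iI _ c2.
have := FTC2_oo Y0 c3 c2 ltac:(move=> s /andP[s0 sY];
  have hs : 0 < s < T by [apply/andP; split; lra];
  apply: (is_derive_eq (deriv_mul (deriv_expR (deriv_opp (deriv_scale p (deriv_id s)))) (dF s hs))); ring).
rewrite (RintB mI i1 (intgZl p mI i2)) (RintZl _ mI i2) mulr0 oppr0 expR0 mul1r /lap; lra.
Qed.

End asymptotics.

Section transform_expansion.
Context {R : realType}.
Local Notation RR := (measurableTypeR R).
Local Notation mu := (@lebesgue_measure R).
Local Notation intg D f := (mu.-integrable D (EFin \o f)).

(* [w m] is the trace D^(2b-m) u; for n = 2 it is the y-derivative of [w m.+1]. *)
Lemma transform_asymptotics (b l T : R) (n : nat) (u : R -> R -> R) (w : nat -> R -> R -> R)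
    (tk : nat -> R -> R) : n = 1%N \/ n = 2%N -> 0 < b < 1 -> 0 <= n%:R - b * 2 < 1 -> 0 < l ->
  (forall x y : R, 0 < x < l -> 0 < y < T -> {for y, continuous (u x)}) ->
  (forall x Z : R, 0 < x < l -> Z < T -> intg `]0, Z[ (u x)) ->
  (forall k : nat, (1 <= k <= n)%N -> {within `[0, l] `*` `[0, T], continuous (fun q : R * R => w k q.1 q.2)}) ->
  (forall k : nat, (1 <= k < n)%N -> forall x y : R, 0 < x < l -> 0 < y < T -> is_derive y 1 (w k.+1 x) (w k x y)) ->
  (forall x y : R, 0 < x < l -> 0 < y < T ->
     w n x y = if n%:R - b * 2 == 0 then u x y else conv (u x) (power_ker (n%:R - b * 2)) y) ->
  (forall (k : nat) (x : R), (1 <= k <= n)%N -> 0 < x < l -> tk k x = w k x 0) ->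
  forall Y : R, 0 < Y < T -> exists2 C : R, 0 <= C & forall p x : R, 1 <= p -> 0 < x < l ->
    `|expR (- (p * Y)) * w 1%N x Y - w 1%N x 0 + p * lap Y (w 1%N x) p - (p `^ b) ^+ 2 * lap Y (u x) p
       + \sum_(1 <= k < n.+1) tk k x * p `^ (k%:R - 1)| <= C * (p ^+ 3 * expR (- ((p - 1) * Y))) /\
    forall e : R, 0 < e < Y -> `|\int[mu]_(s in `]e, Y[) (expR (- (p * s)) * u x s)| <= C * p.
Proof.
move=> n12 b01 g01 l0 cu iu cw dw vE htk Y hY; have /andP[Y0 YT] := hY.
have T0 : 0 < T by lra.
have hn : (1 <= n <= 2)%N by case: n12 => ->.
have hnn : (1 <= n <= n)%N by case: n12 => ->.
have hn1 : (1 <= 1 <= n)%N by case: n12 => ->.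
have [M1 M10 HM1] := w_bound (cw 1%N hn1).
have [M2 M20 HM2] := w_bound (cw n hnn).
(* [w n x] is the fractional integral of [u x] of order [n - 2 b], and [M2] bounds it for every [x]:
   hence a single constant for all [x]. *)
have [C C0 HC] := fractional_transform_estimate g01 M20 hY.
exists ((M1 + M2) * 2 + C); first by rewrite addr_ge0// mulr_ge0// addr_ge0.
move=> p x p1 hx; have p0 : 0 < p by rewrite (lt_le_trans ltr01).
have hx' : 0 <= x <= l by move: hx => /andP[? ?]; apply/andP; split; exact: ltW.
have cy (k : nat) : (1 <= k <= n)%N -> {within `[0, T], continuous (w k x)}.
  move=> hk; apply: (within_map (f := fun s : R => (x, s)) (cw k hk)).
    by move=> s; exact: continuous_pairr.
  by move=> s /= hs; split; rewrite /= in_itv.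
have cvn (s : R) : 0 < s < T -> {for s, continuous (w n x)}.
  move=> hs; have /andP[s0 sT] := hs.
  apply: (within_interior (cy n hnn)); rewrite /interior/=; near=> z.
  have /andP[z0 zT] : 0 < z < T by near: z; exact: itv_near.
  by rewrite /= in_itv/= !ltW.
have bvn (s : R) : 0 < s < T -> `|w n x s| <= M2.
  by move=> /andP[s0 sT]; apply: HM2 => //; rewrite !ltW.
have [H1 H2] := HC (u x) (w n x) (fun s => cu x s hx) (fun Z => iu x Z hx) cvn bvn (fun y => vE x y hx) p p1.
split; last first.
  move=> e he; rewrite (le_trans (H2 e he))// ler_wpM2r ?(ltW p0)//.
  by rewrite lerDr mulr_ge0// addr_ge0.
have M12 : 0 <= M1 + M2 by exact: addr_ge0.
have Yin : 0 <= Y <= T by rewrite !ltW.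
have bY1 := HM1 x Y hx' Yin; have bY2 := HM2 x Y hx' Yin.
move: H1; case: n12 => nE; rewrite nE in vE htk dw cy b01 g01 bY2 hn *.
- move=> H1.
  have HE : `|w 1%N x Y| <= (M1 + M2) * (1 + p).
    rewrite (le_trans bY1)// (@le_trans _ _ (M1 + M2))//; first by rewrite lerDl.
    by rewrite ler_peMr// lerDl ltW.
  have := remainder_bound (isT : (1 <= 1 <= 2)%N) C0 M12 p1 Y0 b01 erefl H1 HE.
  rewrite expr1; set B := (X in _ <= X -> _); move=> R1.
  rewrite big_nat1 subrr powRr0 mulr1 htk//.
  rewrite [X in `|X|](_ : _ = expR (- (p * Y)) * w 1%N x Y + (p * lap Y (w 1%N x) p - p `^ b ^+ 2 * lap Y (u x) p)) //.
  by ring.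
- move=> H1.
  (* A second integration by parts in [y] replaces the transform of [w 1] by [p] times that of
     [w 2]; the value [w 2 x 0 = tk 2 x] at the lower end cancels the second initial term. *)
  have LD := lap_derivative p Y0 YT (cy 1%N isT) (cy 2%N isT) (fun y hy => dw 1%N isT x y hx hy).
  have HE : `|w 1%N x Y + p * w 2%N x Y| <= (M1 + M2) * (1 + p).
    rewrite (le_trans (ler_normD _ _))// normrM (gtr0_norm p0).
    have h1 : p * `|w 2%N x Y| <= p * M2 by rewrite ler_wpM2l// ltW.
    have h2 : 0 <= M1 * p by rewrite mulr_ge0// ltW.
    by move: h1 h2 bY1 M20; clear; lra.
  have := remainder_bound (isT : (1 <= 2 <= 2)%N) C0 M12 p1 Y0 b01 erefl H1 HE.
  set B := (X in _ <= X -> _); move=> R1.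
  rewrite big_nat_recl//= big_nat1 subrr powRr0 mulr1 !htk// LD.
  have -> : p `^ (2 - 1) = p by rewrite (_ : 2 - 1 = 1) ?powRr1 ?(ltW p0)//; ring.
  rewrite [X in `|X|](_ : _ = expR (- (p * Y)) * (w 1%N x Y + p * w 2%N x Y) + (p ^+ 2 * lap Y (w 2%N x) p - p `^ b ^+ 2 * lap Y (u x) p)) //.
  by ring.
Unshelve. all: by end_near. Qed.

End transform_expansion.

(** * From the operators of the statement to [ker] and [conv] *)

Section conversions.
Context {R : realType}.
Local Notation RR := (measurableTypeR R).
Local Notation mu := (@lebesgue_measure R).
Local Notation intg D f := (mu.-integrable D (EFin \o f)).
Variables (b th l : R).
Hypotheses (b0 : 0 < b) (b1 : b < 1) (pith : pi / 2 < th) (thpi : th < pi)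
  (bth : b * th < pi / 2) (l0 : 0 < l).

Lemma Rop_conv (d y : R) (f : R -> R) : d < 1 ->
  2 * Rop b d l y f = conv f (ker b th d l) y.
Proof.
move=> d1; rewrite /Rop mulrA divff// mul1r; apply: eq_Rint => s.
rewrite /= in_itv/= => /andP[s0 sy]; rewrite (gtr0_norm l0) -mulrA.
by rewrite (Wright_ker b0 b1 pith thpi bth d1 l0)// subr_gt0.
Qed.

Lemma Nop_initial_term (d y sg c x0 : R) (f : R -> R) : d < 1 -> 0 < y ->
  (forall t : R, 0 < t < l -> `|x0 - t| = sg * t + c /\ 0 < sg * t + c) ->
  2 * Nop b 0 l d x0 y f = initial_term b th l d sg c f y.
Proof.
move=> d1 y0 ht; rewrite /Nop mulrA divff// mul1r; apply: eq_Rint => t.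
rewrite /= in_itv/= => tl; have [-> t0] := ht _ tl; rewrite -mulrA.
by rewrite (Wright_ker b0 b1 pith thpi bth d1 t0 y0).
Qed.

Lemma RL_power_ker (T y : R) (f : R -> R) : 0 < y < T ->
  (forall s : R, 0 < s < T -> {for s, continuous f}) -> intg `]0, T[ f ->
  RL (- b) f y = conv f (power_ker b) y.
Proof.
move=> /andP[y0 yT] cf fi; apply: RL_conv => //.
have i1 : intg `]0, y[ (fun s => f s * power_ker b (y - s)).
  apply: conv_integrand => //.
  - by move=> s /andP[s0 sy]; apply: cf; rewrite s0/= (le_lt_trans sy).
  - by move=> s; exact: power_ker_continuous.
  - by apply: intgS fi => //; apply: subset_itvl; rewrite bnd_simp ltW.
  - exact: kernel_class_power_ker.
have b01 : 0 < b < 1 by apply/andP.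
apply: intg_eq (intgZl (Gamma b) (measurable_itv _) i1) => // s _.
rewrite /power_ker mulrCA mulVKf ?Gamma_neq0// (_ : b - 1 = - (- b + 1)) ?powRN//; ring.
Qed.

(** The angle is the midpoint of [pi / 2] and the smaller of [pi] and [pi / (2 b)]; the latter
    exceeds [pi / 2] because [b < 1]. *)
Lemma exists_angle : exists th : R, [/\ pi / 2 < th, th < pi & b * th < pi / 2].
Proof.
have p0 := pi_gt0 R; have b0' := b0; have b1' := b1.
have h : pi / 2 < pi / 2 / b by rewrite ltr_pdivlMr//; nra.
pose m := Num.min pi (pi / 2 / b).
have m1 : pi / 2 < m by rewrite lt_min h andbT; lra.
have m2 : m <= pi by rewrite ge_min lexx.
have m3 : m <= pi / 2 / b by rewrite ge_min lexx orbT.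
exists ((pi / 2 + m) / 2); split; [lra|lra|].
by rewrite mulrC -ltr_pdivlMr//; lra.
Qed.

End conversions.

(** For [k = 1], the choice [a = 0] leaves the exponent [1 - b]. For [k = 2], so that [n = 2] and
    [b > 1/2], the singularity [y^(-(2-b))] is not integrable at 0; [a = 1 / (2 b) < 1] lowers the
    exponent by [1/2] to [3/2 - b], which lies in []0, 1[]. *)
Lemma initial_decay_exponent (R : realType) (b : R) (n k : nat) : n = 1%N \/ n = 2%N -> 0 < b < 1 ->
  n%:R - b * 2 < 1 -> (1 <= k <= n)%N ->
  exists a, [/\ 0 <= a, a < 1, b - k%:R + 1 < 1 & 0 < 1 - (b - k%:R + 1) - b * a < 1].
Proof.
move=> hn /andP[b0 b1] nb hk.
have [->|[-> n2]] : k = 1%N \/ (k = 2%N /\ n = 2%N).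
  by case: hn hk => ->; case: k => [|[|[|k]]]//; auto.
  by exists 0; split=> //; [lra|apply/andP; split; lra].
rewrite n2 in nb.
exists (2 * b)^-1.
have -> : b * (2 * b)^-1 = 1 / 2 by field; rewrite gt_eqF.
split; [by rewrite invr_ge0 mulr_ge0// ltW| |lra|by apply/andP; split; lra].
by rewrite invf_lt1 ?mulr_gt0//; lra.
Qed.

Lemma left_end_formula (R : realType) (x S A B C S' A' B' C' : R) :
  x = S - 1 * B + 1 * A + C -> S' = S -> A' = A -> B' = B -> C' = C ->
  x = S' + A' - B' + C'.
Proof. by move=> -> -> -> -> ->; ring. Qed.

Lemma right_end_formula (R : realType) (x S A B C S' A' B' C' : R) :
  x = S - -1 * B + -1 * A + C -> S' = S -> A' = A -> B' = B -> C' = C ->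
  x = S' - A' + B' + C'.
Proof. by move=> -> -> -> -> ->; ring. Qed.

Theorem theorem1 (R : realType) (alpha beta : R) (n : nat) (l T : R)
    (u : R -> R -> R) (tau : nat -> R -> R)
    (halpha : 0 < alpha < 2)
    (hbeta : beta = alpha / 2)
    (hn : n = 1%N \/ n = 2%N)
    (halphan : n%:R - 1 < alpha <= n%:R)
    (hl : 0 < l) (hT : 0 < T)
    (hu : regular_solution alpha n l T u)
    (htau : forall (k : nat) (x : R), (1 <= k <= n)%N -> 0 < x < l ->
      RL (alpha - k%:R) (u x) y @[y --> 0^'+] --> tau k x)
    (hux : forall x y : R, 0 <= x <= l -> 0 < y < T ->
      derivable_in `[0, l]%classic (u^~ y) x)
    (huxC : {within `[0, l] `*` `]0, T[,
      continuous (fun p : R * R => partial_x l u p.1 p.2)})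
    (hux0 : lebesgue_measure.-integrable `]0, T[%classic
      (fun y => (partial_x l u 0 y)%:E))
    (huxl : lebesgue_measure.-integrable `]0, T[%classic
      (fun y => (partial_x l u l y)%:E)) :
  forall y : R, 0 < y < T ->
    u 0 y = 2 * (\sum_(1 <= k < n.+1) Nop beta 0 l (beta - k%:R + 1) 0 y (tau k))
            + 2 * Rop beta beta l y (partial_x l u l)
            - RL (- beta) (partial_x l u 0) y
            + 2 * Rop beta 0 l y (u l)
    /\
    u l y = 2 * (\sum_(1 <= k < n.+1) Nop beta 0 l (beta - k%:R + 1) l y (tau k))
            - 2 * Rop beta beta l y (partial_x l u 0)
            + RL (- beta) (partial_x l u l) y
            + 2 * Rop beta 0 l y (u 0).
Proof.
have [cuO Hk [dxx cxxO] [exA _] pde] := hu.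
have b01 : 0 < beta < 1 by rewrite hbeta; move: halpha => /andP[? ?]; apply/andP; split; lra.
have /andP[b0 b1] := b01.
have alE : alpha = beta * 2 by rewrite hbeta divfK.
have g01 : 0 <= n%:R - beta * 2 < 1.
  by move: halphan => /andP[h1 h2]; rewrite -alE; apply/andP; split; lra.
have [th [pith thpi bth]] := exists_angle b0 b1.
have inO (x y : R) : 0 < x < l -> 0 < y < T -> Omega l T (x, y).
  by move=> hx hy; split; rewrite /= in_itv.
have oO : open (Omega l T) by exact: open_rect.
have cu (x y : R) : 0 < x < l -> 0 < y < T -> {for (x, y), continuous (fun q : R * R => u q.1 q.2)}.
  move=> hx hy; apply: (within_interior cuO).
  by apply: open_nbhs_nbhs; split => //; exact: inO.
have cuxx (x y : R) : 0 < x < l -> 0 < y < T -> {for (x, y), continuous (fun q : R * R => partial_xx u q.1 q.2)}.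
  move=> hx hy; apply: (within_interior cxxO).
  by apply: open_nbhs_nbhs; split => //; exact: inO.
have pxE (x y : R) : 0 < x < l -> 0 < y < T -> partial_x l u x y = derive1 (u^~ y) x.
  move=> hx hy; apply: derive_in_interior.
  - by move: hx => /andP[x0 xl]; rewrite /= in_itv/= !ltW.
  - near=> z; have /andP[z0 zl] : 0 < z < l by near: z; exact: itv_near.
    by rewrite /= in_itv/= !ltW.
  - exact: (dxx x y (inO x y hx hy)).1.
have du (x y : R) : 0 < x < l -> 0 < y < T -> is_derive x 1 (u^~ y) (partial_x l u x y).
  move=> hx hy; rewrite pxE// derive1E; apply/derivableP; exact: (dxx x y (inO x y hx hy)).1.
have dux (x y : R) : 0 < x < l -> 0 < y < T -> is_derive x 1 ((partial_x l u)^~ y) (partial_xx u x y).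
  move=> hx hy; have h : is_derive x 1 (derive1 (u^~ y)) (partial_xx u x y).
    have -> : partial_xx u x y = derive1 (derive1 (u^~ y)) x by [].
    by rewrite derive1E; apply/derivableP; exact: (dxx x y (inO x y hx hy)).2.
  apply: near_eq_is_derive h; near=> z; rewrite pxE//.
  by near: z; exact: itv_near.
have cu0 (y : R) : 0 < y < T -> {within `[0, l], continuous (u^~ y)}.
  move=> hy; apply: derivable_in_continuous => x; rewrite /= in_itv/= => hx; exact: hux.
(* One function [w k] for each [k], continuous on the closed rectangle and extending the derivative
   of order [alpha - k]; outside [1 <= k <= n] the zero function fills in. *)
have /choice[w Hw] : forall k : nat, exists w : R * R -> R, (1 <= k <= n)%N ->
    {within `[0, l] `*` `[0, T], continuous w} /\
    forall x y : R, 0 <= x <= l -> 0 < y < T -> RL (alpha - k%:R) (u x) y = w (x, y).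
  move=> k; have [hk|hk] := boolP (1 <= k <= n)%N; last by exists (fun=> 0).
  by have [_ [v hv]] := Hk k hk; exists v.
pose W (k : nat) (x y : R) : R := w k (x, y).
have cW (k : nat) : (1 <= k <= n)%N -> {within `[0, l] `*` `[0, T], continuous (fun q : R * R => W k q.1 q.2)}.
  move=> hk; rewrite (_ : (fun q : R * R => _) = w k); first exact: (Hw k hk).1.
  by apply/funext => -[].
have WE (k : nat) (x y : R) : (1 <= k <= n)%N -> 0 <= x <= l -> 0 < y < T -> RL (alpha - k%:R) (u x) y = W k x y.
  by move=> hk; exact: (Hw k hk).2.
have ltwx (x : R) : 0 < x < l -> 0 <= x <= l by move=> /andP[? ?]; rewrite !ltW.
have hnn : (1 <= n <= n)%N by case: hn => ->.
have hn1 : (1 <= 1 <= n)%N by case: hn => ->.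
have /andP[al0 al2] := halpha.
(* By the equation [D^alpha u = u_xx], so [W 1] is a primitive of [u_xx] in [y], which is the role
   of [w] in Green's formula. *)
have dW1 (x y : R) : 0 < x < l -> 0 < y < T -> is_derive y 1 (W 1%N x) (partial_xx u x y).
  move=> hx hy; have h := RL_ex_derivable al0 (exA x y (inO x y hx hy)).
  have -> : partial_xx u x y = RL alpha (u x) y by apply/eqP; rewrite -subr_eq0 pde//; exact: inO.
  apply: near_eq_is_derive h; near=> z; apply: (WE 1%N) => //; first exact: ltwx.
  by near: z; exact: itv_near.
have dWk (k : nat) : (1 <= k < n)%N -> forall x y : R, 0 < x < l -> 0 < y < T -> is_derive y 1 (W k.+1 x) (W k x y).
  move=> /andP[k1 kn] x y hx hy.
  have hk : (1 <= k <= n)%N by rewrite k1 ltnW.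
  have hk' : (1 <= k.+1 <= n)%N by rewrite kn.
  have nu0 : 0 < alpha - k%:R.
    have /andP[h1 _] := halphan.
    by rewrite subr_gt0 (le_lt_trans _ h1)// lerBrDr natr1 ler_nat.
  have h := RL_ex_derivable nu0 ((Hk k hk).1 x y (ltwx x hx) hy).
  rewrite (WE k x y hk (ltwx x hx) hy) in h.
  apply: near_eq_is_derive h; near=> z.
  rewrite -(WE k.+1 x z hk' (ltwx x hx)); first by congr (RL _ _ _); rewrite -natr1; ring.
  by near: z; exact: itv_near.
have gE : alpha - n%:R = - (n%:R - beta * 2) by rewrite -alE; ring.
have W_cy (k : nat) (x : R) : (1 <= k <= n)%N -> 0 <= x <= l -> {within `[0, T], continuous (W k x)}.
  move=> hk hx; apply: (within_map (f := fun s : R => (x, s)) (cW k hk)).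
    by move=> s; exact: continuous_pairr.
  by move=> s /= hs; split; rewrite /= in_itv.
have W_cyy (k : nat) (x s : R) : (1 <= k <= n)%N -> 0 <= x <= l -> 0 < s < T -> {for s, continuous (W k x)}.
  move=> hk hx hs; apply: (within_interior (W_cy k x hk hx)); rewrite /interior/=; near=> z.
  have /andP[z0 zT] : 0 < z < T by near: z; exact: itv_near.
  by rewrite /= in_itv/= !ltW.
(* If [n = alpha], then [u] coincides with the bounded function [W n]; otherwise the existence of
   the fractional integral of order [n - alpha] gives integrability. *)
have iu (x Z : R) : 0 <= x <= l -> Z < T -> lebesgue_measure.-integrable `]0, Z[ (EFin \o (u x)).
  move=> hx ZT; have /andP[g0 g1] := g01.
  move: g0; rewrite le_eqVlt => /predU1P[g0|g0].
    have [M M0 HM] := w_bound (cW n hnn).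
    have h : lebesgue_measure.-integrable `]0, Z[ (EFin \o (W n x)).
      apply: (@intg_oo_bounded R _ _ M) => s /andP[s0 sZ].
        by apply: W_cyy => //; rewrite s0 (lt_trans sZ).
      by apply: HM => //; rewrite !ltW// (lt_trans sZ).
    apply: intg_eq h => // s; rewrite /= in_itv/= => /andP[s0 sZ].
    rewrite -WE//; last by rewrite s0 (lt_trans sZ).
    by rewrite gE -g0 oppr0 RL0.
  apply: (RL_ex_intg_fun g0 hT ZT _ g1) => y hy.
  by rewrite -gE; exact: (Hk n hnn).1.
have vE (x y : R) : 0 < x < l -> 0 < y < T ->
    W n x y = if n%:R - beta * 2 == 0 then u x y else conv (u x) (power_ker (n%:R - beta * 2)) y.
  move=> hx hy; rewrite -WE//; last exact: ltwx.
  rewrite gE; case: eqP => [->|/eqP g0]; first by rewrite oppr0 RL0.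
  have g00 : 0 < n%:R - beta * 2 by rewrite lt_neqAle eq_sym g0; case/andP: g01.
  apply: RL_conv => //; apply: RL_ex_intg => //.
  by rewrite -gE; apply: (Hk n hnn).1 => //; exact: ltwx.
(* The prescribed limits are the values at [y = 0] of the continuous extensions; boundedness and
   continuity of [tau k] follow from this. *)
have tauE (k : nat) (x : R) : (1 <= k <= n)%N -> 0 < x < l -> tau k x = W k x 0.
  move=> hk hx; apply: (cvg_right_within hT (W_cy k x hk (ltwx x hx))).
  apply: cvg_trans (htau k x hk hx); apply: near_eq_cvg; near=> y.
  rewrite WE//; first exact: ltwx.
  by apply/andP; split; near: y; [exact: nbhs_right_gt|exact: nbhs_right_lt].
have [Mt Mt0 btk] : exists2 Mt : R, 0 <= Mt & forall (k : nat) (x : R), (1 <= k <= n)%N -> 0 < x < l -> `|tau k x| <= Mt.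
  have [M1 M10 HM1] := w_bound (cW 1%N hn1); have [M2 M20 HM2] := w_bound (cW n hnn).
  exists (M1 + M2); first exact: addr_ge0.
  move=> k x hk hx; rewrite tauE//.
  have T0 : 0 <= (0 : R) <= T by rewrite lexx ltW.
  (* Since [n] is 1 or 2, the index [k] is 1 or [n], and two bounds suffice. *)
  have [k1|kn] : k = 1%N \/ k = n by case: hn hk => ->; case: k => [|[|[|k]]]//; auto.
    by rewrite k1 (le_trans (HM1 x 0 (ltwx x hx) T0))// lerDl.
  by rewrite kn (le_trans (HM2 x 0 (ltwx x hx) T0))// lerDr.
have ctk (k : nat) (x : R) : (1 <= k <= n)%N -> 0 < x < l -> {for x, continuous (tau k)}.
  move=> hk hx; have T0 : 0 <= (0 : R) <= T by rewrite lexx ltW.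
  have h := w_cont_x (cW k hk) hx T0.
  suff : tau k z @[z --> x] --> tau k x by [].
  rewrite tauE//; apply: cvg_trans h; apply: near_eq_cvg; near=> z; rewrite tauE//.
  by near: z; exact: itv_near.
have exa (k : nat) (hk : (1 <= k <= n)%N) := initial_decay_exponent hn b01 (andP g01).2 hk.
have asymp := transform_asymptotics hn b01 g01 hl
  (fun x y hx hy => u_cont_y hl cu du huxC cu0 (ltwx x hx) hy) (fun x Z hx => iu x Z (ltwx x hx))
  cW dWk vE tauE.
have d1 (k : nat) : (1 <= k <= n)%N -> beta - k%:R + 1 < 1 by move=> /exa[a []].
have l0l : 0 <= l <= l by rewrite lexx ltW.
have l00 : (0 : R) <= 0 <= l by rewrite lexx ltW.
move=> y hy; have /andP[y0 yT] := hy.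
have cx0 (s : R) (hs : 0 < s < T) : {for s, continuous (partial_x l u 0)} := ux_cont_y huxC l00 hs.
have cxl (s : R) (hs : 0 < s < T) : {for s, continuous (partial_x l u l)} := ux_cont_y huxC l0l hs.
have eA (f : R -> R) := Rop_conv b0 b1 pith thpi bth hl y f b1.
have eC (f : R -> R) := Rop_conv b0 b1 pith thpi bth hl y f (@ltr01 R).
have eB0 := RL_power_ker b0 b1 hy cx0 hux0.
have eBl := RL_power_ker b0 b1 hy cxl huxl.
have eS (sg c x0 : R) : (forall t : R, 0 < t < l -> `|x0 - t| = sg * t + c /\ 0 < sg * t + c) ->
    2 * (\sum_(1 <= k < n.+1) Nop beta 0 l (beta - k%:R + 1) x0 y (tau k)) =
    \sum_(1 <= k < n.+1) initial_term beta th l (beta - k%:R + 1) sg c (tau k) y.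
  move=> ht; rewrite mulr_sumr; apply: eq_big_nat => k; rewrite ltnS => hk.
  exact: (Nop_initial_term b0 b1 pith thpi bth (tau k) (d1 k hk) y0 ht).
have eS0 : forall t : R, 0 < t < l -> `|0 - t| = 1 * t + 0 /\ 0 < 1 * t + 0.
  by move=> t /andP[t0 tl]; rewrite sub0r normrN gtr0_norm// mul1r addr0.
have eSl : forall t : R, 0 < t < l -> `|l - t| = -1 * t + l /\ 0 < -1 * t + l.
  by move=> t /andP[t0 tl]; rewrite mulN1r (addrC (- t)) gtr0_norm subr_gt0.
have rep (sg c x0 x1 : R) ends := @boundary_representation R l T u (partial_x l u) (partial_xx u) (W 1%N) hl cu cuxx du dux huxC cu0 dW1
  (cW 1%N hn1) iu hux0 huxl beta Mt n tau b0 b1 Mt0 ctk btk exa asymp sg c x0 x1 ends th pith thpi bth.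
split.
  exact: (left_end_formula (rep 1 0 0 l (or_introl (And4 erefl erefl erefl erefl)) y hy) (eS _ _ _ eS0) (eA _) eB0 (eC _)).
exact: (right_end_formula (rep (-1) l l 0 (or_intror (And4 erefl erefl erefl erefl)) y hy) (eS _ _ _ eSl) (eA _) eBl (eC _)).
Unshelve. all: by end_near. Qed.
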